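(* Suppose that $$\varepsilon^{-1}\eta(\varepsilon)\to+\infty,\qquad\varepsilon\to+0,$$ that $a\ge0$, and that the function $b$ is not identically constant. Let $b_*:=\max_{[0,1]}b$. Assume also that for all sufficiently small $\delta>0$ the set $\{x: a(x)\le\delta,\ 0<x_2<(b_*+1)\eta\}$ is contained in an at most countable union of the rectangles $$\{x: |x_1-X_n|<\mu(\delta),\ 0<x_2<(b_*+1)\eta\},$$ where $\mu(\delta)$ is some non-negative function such that $\mu(\delta)\to+0$ as $\delta\to+0$, and the numbers $X_n$ (indexed by integers $n$) are independent of $\delta$, are taken in ascending order, and satisfy, with a constant $c$ independent of $n$ and $m$, $$|X_n-X_m|\ge c>0,\qquad n\ne m .$$ Let $\delta=\delta(\varepsilon)>0$ be any function tending to zero as $\varepsilon\to+0$. Then there exist constants $\varepsilon_0>0$ and $C>0$ such that for all $0<\varepsilon<\varepsilon_0$ and all $f\in L_2(\Omega_0)$, $$\big\|(\mathcal{H}^{\mathrm R}_{\varepsilon,\eta}-\mathrm{i})^{-1}f-(\mathcal{H}^{\mathrm D}_0-\mathrm{i})^{-1}f\big\|_{W_2^1(\Omega_\varepsilon)}\le C\big(\eta^{1/2}+\varepsilon^{1/2}\eta^{-1/2}\delta^{-1/2}+\mu^{1/2}(\delta)|\ln\mu(\delta)|^{1/2}\big)\|f\|_{L_2(\Omega_0)} ,$$ where $\eta=\eta(\varepsilon)$, $\delta=\delta(\varepsilon)$. In particular $C$ is independent of $\varepsilon$ and $f$.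
   Context: Coordinates are $x=(x_1,x_2)\in\mathbb{R}^2$; $\varepsilon>0$ is a small parameter; $\eta=\eta(\varepsilon)\ge 0$ is a function with $\eta(\varepsilon)\to0$ as $\varepsilon\to+0$; $b\in C^2(\mathbb{R})$ is real, non-negative and $1$-periodic; $d>0$ is a constant. Put $$\Omega_0=\{x:0<x_2<d\},\quad \Omega_\varepsilon=\{x:\eta(\varepsilon)b(x_1\varepsilon^{-1})<x_2<d\},$$ $$\Gamma=\{x_2=d\},\quad \Gamma_0=\{x_2=0\},\quad \Gamma_\varepsilon=\{x_2=\eta(\varepsilon)b(x_1\varepsilon^{-1})\}.$$ $W_2^j$ are the usual $L_2$-based Sobolev spaces (of complex-valued functions), $W_\infty^j$ the $L_\infty$-based ones, and $W_{2,0}^j(\Omega,S)$ is the space of functions in $W_2^j(\Omega)$ with zero trace on the curve $S$. Coefficients ($i,j=1,2$): $A_{ij}\in W_\infty^2(\Omega_0)$ and $A_j\in W_\infty^1(\Omega_0)$ are complex-valued, $A_0\in L_\infty(\Omega_0)$ is real-valued, and for some constant $c_0>0$ $$A_{ij}=\overline{A_{ji}},\qquad \sum_{i,j=1}^2A_{ij}(x)z_i\overline{z_j}\ge c_0(|z_1|^2+|z_2|^2),\quad x\in\Omega_0,\ z_1,z_2\in\mathbb{C}.$$ The function $a=a(x)$ is real and belongs to $W_\infty^1(\{x:0<x_2<\delta_0\})$ for some small fixed $\delta_0>0$ (it is identified with its Lipschitz continuous representative on the closed strip). For $\Omega\in\{\Omega_\varepsilon,\Omega_0\}$ consider the sesquilinear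 form $$\mathfrak{h}_\Omega(u,v)=\sum_{i,j=1}^2\Big(A_{ij}\tfrac{\partial u}{\partial x_j},\tfrac{\partial v}{\partial x_i}\Big)_{L_2(\Omega)}+\sum_{j=1}^2\Big(A_j\tfrac{\partial u}{\partial x_j},v\Big)_{L_2(\Omega)}+\sum_{j=1}^2\Big(u,A_j\tfrac{\partial v}{\partial x_j}\Big)_{L_2(\Omega)}+(A_0u,v)_{L_2(\Omega)} .$$ $\mathcal{H}^{\mathrm R}_{\varepsilon,\eta}$ is the self-adjoint lower-semibounded operator in $L_2(\Omega_\varepsilon)$ associated with the form $\mathfrak{h}_{\Omega_\varepsilon}(u,v)+(au,v)_{L_2(\Gamma_\varepsilon)}$ with domain $W_{2,0}^1(\Omega_\varepsilon,\Gamma)$ (Dirichlet condition on $\Gamma$, Robin condition with coefficient $a$ on $\Gamma_\varepsilon$; $L_2(\Gamma_\varepsilon)$ is taken with respect to arc length). $\mathcal{H}^{\mathrm D}_0$ is the self-adjoint operator in $L_2(\Omega_0)$ associated with $\mathfrak{h}_{\Omega_0}$ with domain $W_{2,0}^1(\Omega_0,\partial\Omega_0)$ (Dirichlet condition on $\partial\Omega_0=\Gamma\cup\Gamma_0$). For $f\in L_2(\Omega_0)$, $(\mathcal{H}^{\mathrm R}_{\varepsilon,\eta}-\mathrm i)^{-1}f$ means the resolvent applied to the restriction $f|_{\Omega_\varepsilon}$, and $(\mathcal{H}^{\mathrm D}_0-\mathrm i)^{-1}f$ is restricted to $\Omega_\varepsilon$ when the norm of $W_2^1(\Omega_\varepsilon)$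 is taken. The covering assumption is understood for all sufficiently small $\varepsilon$, with the numbers $X_n$, the constant $c$ and the function $\mu$ not depending on $\varepsilon$. The expression $\mu^{1/2}|\ln\mu|^{1/2}$ is understood as $0$ when $\mu=0$. *)

(* Defs.v *)
From HB Require Import structures.
From mathcomp Require Import all_boot all_order all_algebra.
From mathcomp Require Import all_classical all_reals all_analysis.
From mathcomp Require Export complex.
Set Implicit Arguments.
Unset Strict Implicit.
Unset Printing Implicit Defensive.
Import Order.TTheory GRing.Theory Num.Theory.
Import numFieldNormedType.Exports.
Local Open Scope classical_set_scope.
Local Open Scope ring_scope.

(* Elements of L_2, W_2^k, L_oo, W_oo^k over D are represented by functions
   R * R -> R[i]; their values outside D are irrelevant, and every notion
   below is invariant under measurable modification on a null set. *)

Section plane.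
Context {R : realType}.
Implicit Types (D : set (R * R)) (u v g f : R * R -> R[i]).
Implicit Types (phi : R * R -> R).

Definition area :
    {measure set (measurableTypeR R * measurableTypeR R) -> \bar R} :=
  (lebesgue_measure \x lebesgue_measure)%E.

Definition modulus (z : R[i]) : R := Normc.normc z.

Definition cmeasurable D u : Prop :=
  measurable_fun (D : set (measurableTypeR R * measurableTypeR R))
    (fun x => complex.Re (u x)) /\
  measurable_fun (D : set (measurableTypeR R * measurableTypeR R))
    (fun x => complex.Im (u x)).

Definition cint D u : R[i] :=
  Complex (Rintegral area D (fun x => complex.Re (u x)))
          (Rintegral area D (fun x => complex.Im (u x))).

Definition normL2 D u : \bar R :=
  ((\int[area]_(x in D) (modulus (u x) ^+ 2)%:E) `^ 2^-1)%E.

Definition L2 D u : Prop := cmeasurable D u /\ (normL2 D u < +oo)%E.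

Definition Linfty D u : Prop :=
  cmeasurable D u /\
  exists M : R, {ae area, forall x, D x -> modulus (u x) <= M}.

Definition ipL2 D u v : R[i] := cint D (fun x => u x * conjc (v x)).

Definition basis (j : 'I_2) : R * R := if j == ord0 then (1, 0) else (0, 1).

Fixpoint Ck (k : nat) phi : Prop :=
  match k with
  | 0 => continuous phi
  | k'.+1 => [/\ continuous phi,
      forall j x, derivable phi x (basis j) &
      forall j, Ck k' (fun x => 'D_(basis j) phi x)]
  end.

Definition Cinfty phi : Prop := forall k, Ck k phi.

Definition tsupport (T : zmodType) (h : R * R -> T) : set (R * R) :=
  closure [set x | h x != 0].

Definition testfun D phi : Prop :=
  [/\ Cinfty phi, compact (tsupport phi) & tsupport phi `<=` D].

Definition loc_integrable D u : Prop :=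
  cmeasurable D u /\
  forall K : set (R * R), compact K -> K `<=` D ->
    (\int[area]_(x in K) (modulus (u x))%:E < +oo)%E.

Definition is_weak_deriv D (j : 'I_2) u g : Prop :=
  [/\ loc_integrable D u, loc_integrable D g &
   forall phi, testfun D phi ->
     cint D (fun x => u x * ('D_(basis j) phi x)%:C%C) =
     - cint D (fun x => g x * (phi x)%:C%C)].

(* a representative of the weak derivative, which is unique almost everywhere
   on the open set D; junk value 0 when there is none *)
Definition wderiv D (j : 'I_2) u : R * R -> R[i] :=
  xget (fun=> 0) [set g | is_weak_deriv D j u g].

(* Sobolev spaces: W (L2 D) D k is W_2^k(D), W (Linfty D) D k is W_oo^k(D) *)

Fixpoint W (L : (R * R -> R[i]) -> Prop) D (k : nat) u : Prop :=
  match k with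
  | 0 => L u
  | k'.+1 => L u /\ forall j : 'I_2, exists g, is_weak_deriv D j u g /\ W L D k' g
  end.

Definition W2 (k : nat) D := W (L2 D) D k.
Definition Winfty (k : nat) D := W (Linfty D) D k.

Definition normW21 D u : \bar R :=
  ((normL2 D u `^ 2 + \sum_(j < 2) normL2 D (wderiv D j u) `^ 2) `^ 2^-1)%E.

(* Traces on the graph {x_2 = p(x_1)}. Functions on the graph are parametrised
   by s = x_1, and L_2 of the graph is taken with respect to arc length. The
   trace operator on W_2^1(D) is the closure of the restriction to the graph of
   smooth compactly supported functions on the whole plane. *)

Definition arclen (p : R -> R) (s : R) : R := Num.sqrt (1 + (derive1 p s) ^+ 2).

Definition csmooth_cpt (w : R * R -> R[i]) : Prop :=
  [/\ Cinfty (fun x => complex.Re (w x)), Cinfty (fun x => complex.Im (w x))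
    & compact (tsupport w)].

Definition is_trace D (p : R -> R) u (T : R -> R[i]) : Prop :=
  [/\ measurable_fun setT (fun s : measurableTypeR R => complex.Re (T s)),
      measurable_fun setT (fun s : measurableTypeR R => complex.Im (T s)) &
   exists w : nat -> R * R -> R[i],
     [/\ forall n, csmooth_cpt (w n),
         (fun n => normW21 D (w n \- u)) @ \oo --> 0%E &
         (fun n => \int[lebesgue_measure]_(s in setT)
            (modulus (w n (s, p s) - T s) ^+ 2 * arclen p s)%:E)%E
           @ \oo --> 0%E]].

(* the trace is unique almost everywhere; junk value 0 when there is none *)
Definition trace D (p : R -> R) u : R -> R[i] :=
  xget (fun=> 0) [set T | is_trace D p u T].

Definition zero_trace D (p : R -> R) u : Prop := is_trace D p u (fun=> 0).

(* (a u, v) in L_2 of the graph *)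
Definition ip_graph D (p : R -> R) (a : R * R -> R) u v : R[i] :=
  let F s := (a (s, p s) * arclen p s)%:C%C
             * trace D p u s * conjc (trace D p v s) in
  Complex (Rintegral lebesgue_measure setT (fun s => complex.Re (F s)))
          (Rintegral lebesgue_measure setT (fun s => complex.Im (F s))).

(* graph of the operator in L_2(D) associated with the form h of domain V *)
Definition form_operator D (V : (R * R -> R[i]) -> Prop)
    (h : (R * R -> R[i]) -> (R * R -> R[i]) -> R[i]) u g : Prop :=
  [/\ V u, L2 D g & forall v, V v -> h u v = ipL2 D g v].

(* u = (H - z)^-1 f for H given by its graph: u is in the domain of H and
   H u = f + z u *)
Definition is_resolvent (H : (R * R -> R[i]) -> (R * R -> R[i]) -> Prop)
    (z : R[i]) f u : Prop :=
  H u (fun x => f x + z * u x).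

End plane.

Section problem.
Context {R : realType}.
Variable d : R.

Definition upper (p : R -> R) : set (R * R) := [set x | p x.1 < x.2 < d].

Definition Omega0 : set (R * R) := upper (fun=> 0).

Definition lower_bdry (eta : R -> R) (b : R -> R) (eps : R) : R -> R :=
  fun s => eta eps * b (s / eps).

Definition Omega (eta : R -> R) (b : R -> R) (eps : R) : set (R * R) :=
  upper (lower_bdry eta b eps).

Variables (A : 'I_2 -> 'I_2 -> R * R -> R[i]) (A1 : 'I_2 -> R * R -> R[i])
  (A0 : R * R -> R) (a : R * R -> R).

Definition hform (D : set (R * R)) (u v : R * R -> R[i]) : R[i] :=
  \sum_(i < 2) \sum_(j < 2)
      ipL2 D (fun x => A i j x * wderiv D j u x) (wderiv D i v)
  + \sum_(j < 2) ipL2 D (fun x => A1 j x * wderiv D j u x) v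
  + \sum_(j < 2) ipL2 D u (fun x => A1 j x * wderiv D j v x)
  + ipL2 D (fun x => (A0 x)%:C%C * u x) v.

(* Dirichlet condition on {x_2 = d}, Robin condition on the graph of p *)
Definition HRobin (p : R -> R) :=
  let D := upper p in
  form_operator D (fun u => W2 1 D u /\ zero_trace D (fun=> d) u)
    (fun u v => hform D u v + ip_graph D p a u v).

(* Dirichlet condition on {x_2 = 0} and {x_2 = d} *)
Definition HDirichlet0 :=
  form_operator Omega0
    (fun u => [/\ W2 1 Omega0 u, zero_trace Omega0 (fun=> d) u
                & zero_trace Omega0 (fun=> 0) u])
    (hform Omega0).

Definition admissible_coefficients (c0 : R) : Prop :=
  [/\ forall i j, Winfty 2 Omega0 (A i j),
      forall j, Winfty 1 Omega0 (A1 j),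
      Linfty Omega0 (fun x => (A0 x)%:C%C),
      {ae area, forall x, Omega0 x -> forall i j, A i j x = conjc (A j i x)} &
      {ae area, forall x, Omega0 x -> forall z : 'I_2 -> R[i],
        (c0 * \sum_(i < 2) modulus (z i) ^+ 2)%:C%C
        <= \sum_(i < 2) \sum_(j < 2) A i j x * z i * conjc (z j)}].

Definition admissible_robin (delta0 : R) : Prop :=
  Winfty 1 [set x : R * R | 0 < x.2 < delta0] (fun x => (a x)%:C%C) /\
  [lipschitz a x | x in [set x : R * R | 0 <= x.2 <= delta0]].

End problem.

Section oscillation.
Context {R : realType}.

Definition C2_fun (b : R -> R) : Prop :=
  [/\ forall t, derivable b t 1, forall t, derivable (derive1 b) t 1
    & continuous (derive1 (derive1 b))].

Definition max01 (b : R -> R) : R := sup (b @` [set t | 0 <= t <= 1]).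

(* I indexes an at most countable family of points X_n, n in I *)
Definition well_separated (I : set int) (X : int -> R) : Prop :=
  [/\ {in I &, forall n m, (n < m)%R -> X n < X m} &
      exists2 c : R, 0 < c & forall n m, I n -> I m -> n != m ->
        c <= `|X n - X m|].

(* The thresholds for delta and eps, as well as X and mu, are uniform. *)
Definition covering (a : R * R -> R) (eta b : R -> R) (mu : R -> R)
    (I : set int) (X : int -> R) : Prop :=
  exists delta1 eps1 : R, [/\ 0 < delta1, 0 < eps1 &
    forall delta eps : R, 0 < delta < delta1 -> 0 < eps < eps1 ->
      [set x : R * R | a x <= delta /\ 0 < x.2 < (max01 b + 1) * eta eps]
      `<=` \bigcup_(n in I)
        [set x : R * R | `|x.1 - X n| < mu delta
                         /\ 0 < x.2 < (max01 b + 1) * eta eps]].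

End oscillation.

(* Main.v *)
(* Let u and u0 be the Robin and the Dirichlet solution, chi = chi(x_2) a cut-off that vanishes below
   the crests of the boundary and equals 1 above x_2 = (b_* + 1) eta, and v = u - chi u0. The Robin
   problem tested with v and the Dirichlet problem tested with chi v (extended by zero) give the
   coercive form of v plus the boundary energy of a |u|^2, up to terms supported in the layer
   x_2 < (b_* + 1) eta. These are absorbed by two estimates in the layer.
   - The gradient of u0 has L_2 norm O(eta^{1/2}) there: test the Dirichlet problem with the
     increment of u0 under a vertical translation, localised near the bottom (Savare's argument);
     the vanishing of u0 at the bottom then gives an extra factor eta for u0 itself.
   - Where |b'| > c1 the arc length is at least c1 eta / eps, and a > delta outside the bad
     intervals, so the boundary energy controls v on that part of the boundary; it has positive
     density in every period, and averaging horizontally over a period controls v in the layer.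
     On the bad intervals v is integrated along the rays (s + th t, y + t), 0 < th < 1, which spread
     an interval of length mu over length mu + t, whence the factor mu |ln mu|. *)
Require Import Defs.
From mathcomp Require Import all_boot all_order all_algebra.
From mathcomp Require Import all_classical all_reals all_analysis.
From mathcomp Require Import measurable_realfun.
From mathcomp Require Import ring lra.
Require Import Defs.
Set Implicit Arguments.
Unset Strict Implicit.
Unset Printing Implicit Defensive.
Import Order.TTheory GRing.Theory Num.Theory.
Import numFieldNormedType.Exports.
Local Open Scope classical_set_scope.
Local Open Scope ring_scope.

(** The solutions are known only in the form domain, so no second derivatives of the Dirichlet
    solution enter: its gradient near the bottom is controlled by comparing the form at the solution
    and at its translate. First-order terms spoil coercivity of the form; as the spectral parameter
    is i, the imaginary part of a tested equation contains -|v|^2, and the real part minus a large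
    multiple K of the imaginary part is coercive. The boundary term survives this: the cut-off
    vanishes on the graph, so u and v have the same trace there and the boundary pairing is real and
    non-negative. The cut-off has slope of order 1/eta, so the commutator terms are not small by
    themselves. They are absorbed because the squared norm of v in the layer is of order eta times
    the squared rate times (energy of v + boundary energy), and the weights in Young's inequality
    are tuned to that ([absorb]). Weak derivatives and traces are choices of representatives, so
    estimates are proved for smooth functions and carried over along approximating sequences
    ([jet]). *)

Section smooth.
Context {R : realType}.
Implicit Types (f g : R * R -> R) (x : R * R) (j : 'I_2).

(** * Smooth functions on the plane and a smooth step *)

Lemma basis_ind (P : 'I_2 -> Prop) : P ord0 -> P ord_max -> forall j, P j.
Proof.
move=> P0 P1 j; case: (unliftP ord_max j) => [i ->|->//].
by have -> : lift ord_max i = ord0 by apply/val_inj; rewrite /= ord1.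
Qed.

Lemma basis0 : basis ord0 = (1, 0) :> R * R. Proof. by []. Qed.
Lemma basis1 : basis ord_max = (0, 1) :> R * R. Proof. by []. Qed.

Lemma quot_basis0 f x :
  (fun h : R => h^-1 *: ((f \o shift x) (h *: basis ord0) - f x)) =
  (fun h : R => h^-1 *: (((fun s => f (s, x.2)) \o shift x.1) (h *: (1 : R))
                        - f (x.1, x.2))).
Proof.
apply/funext => h; rewrite /= /shift basis0; case: x => a b /=.
congr (_ *: (f _ - _)); congr pair => /=.
by rewrite scaler0 add0r.
Qed.

Lemma quot_basis1 f x :
  (fun h : R => h^-1 *: ((f \o shift x) (h *: basis ord_max) - f x)) =
  (fun h : R => h^-1 *: (((fun t => f (x.1, t)) \o shift x.2) (h *: (1 : R))
                        - f (x.1, x.2))).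
Proof.
apply/funext => h; rewrite /= /shift basis1; case: x => a b /=.
congr (_ *: (f _ - _)); congr pair => /=.
by rewrite scaler0 add0r.
Qed.

Lemma is_derive_basis0 f x l :
  is_derive x (basis ord0) f l <-> is_derive x.1 (1 : R) (fun s => f (s, x.2)) l.
Proof.
by split=> -[H1 H2]; split; move: H1 H2; rewrite /derivable /derive quot_basis0.
Qed.

Lemma is_derive_basis1 f x l :
  is_derive x (basis ord_max) f l <-> is_derive x.2 (1 : R) (fun t => f (x.1, t)) l.
Proof.
by split=> -[H1 H2]; split; move: H1 H2; rewrite /derivable /derive quot_basis1.
Qed.

Lemma CkSE k f : Ck k.+1 f -> [/\ continuous f,
  forall j x, derivable f x (basis j) & forall j, Ck k (fun x => 'D_(basis j) f x)].
Proof. by []. Qed.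

Lemma Ck_S k f : Ck k.+1 f -> Ck k f.
Proof.
elim: k f => [f /CkSE[]//|k IH f /CkSE[cf df Df]].
by split; [exact: cf|exact: df|move=> j; exact/IH/Df].
Qed.

Lemma CkS_intro k f (g : 'I_2 -> R * R -> R) : continuous f ->
  (forall j x, is_derive x (basis j) f (g j x)) ->
  (forall j, Ck k (g j)) -> Ck k.+1 f.
Proof.
move=> cf df Cg; split; [exact: cf|by move=> j x; apply: ex_derive|move=> j].
rewrite (_ : (fun x => _) = g j); first exact: Cg.
by apply/funext => x; apply: derive_val.
Qed.

Lemma Ck_cst k (c : R) : Ck k (fun=> c : R).
Proof.
elim: k c => [c|k IH c]; first exact: cst_continuous.
apply: (@CkS_intro _ _ (fun _ _ => 0)) => [|j]; last exact: IH.
exact: cst_continuous.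
Qed.

Lemma CkD k f g : Ck k f -> Ck k g -> Ck k (fun x => f x + g x).
Proof.
elim: k f g => [f g cf cg x|k IH f g /CkSE[cf df Df] /CkSE[cg dg Dg]].
  by apply: continuousD; [exact: cf|exact: cg].
apply: (@CkS_intro _ _ (fun j x => 'D_(basis j) f x + 'D_(basis j) g x)).
- by move=> x; apply: continuousD; [exact: cf|exact: cg].
- by move=> j x; apply: is_deriveD; apply: DeriveDef.
- by move=> j; apply: IH; [exact: Df|exact: Dg].
Qed.

Lemma CkM k f g : Ck k f -> Ck k g -> Ck k (fun x => f x * g x).
Proof.
elim: k f g => [f g cf cg x|k IH f g Cf Cg].
  by apply: continuousM; [exact: cf|exact: cg].
have [cf df Df] := CkSE Cf; have [cg dg Dg] := CkSE Cg.
apply: (@CkS_intro _ _ (fun j x => f x * 'D_(basis j) g x + g x * 'D_(basis j) f x)).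
- by move=> x; apply: continuousM; [exact: cf|exact: cg].
- by move=> j x; apply: is_deriveM; apply: DeriveDef.
- by move=> j; apply: CkD; apply: IH; [exact: Ck_S Cf|exact: Dg|exact: Ck_S Cg|exact: Df].
Qed.

Lemma CkV k f : (forall x, f x != 0) -> Ck k f -> Ck k (fun x => (f x)^-1).
Proof.
move=> f0; elim: k => [cf x|k IH Cf].
  by apply: continuousV; [exact: f0|exact: cf].
have [cf df Df] := CkSE Cf.
apply: (@CkS_intro _ _ (fun j x => - ((f x)^-1 * (f x)^-1) * 'D_(basis j) f x)).
- by move=> x; apply: continuousV; [exact: f0|exact: cf].
- move=> j x; split; first exact: derivableV.
  by rewrite deriveV// /GRing.scale /= expr2 invfM.
- move=> j; apply: CkM; last exact: Df.
  rewrite (_ : (fun x => _) = (fun x => (-1) * ((f x)^-1 * (f x)^-1))); last first.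
    by apply/funext => x; rewrite mulN1r.
  apply: CkM; first exact: Ck_cst.
  by apply: CkM; apply: IH; exact: Ck_S Cf.
Qed.

Lemma Ck_shift k f (c : R * R) : Ck k f -> Ck k (fun x => f (x + c)).
Proof.
elim: k f => [f cf x|k IH f /CkSE[cf df Df]].
  apply: continuous_comp; last exact: cf.
  by apply: (@continuousD R (R*R)%type (R*R)%type); [exact: cvg_id|exact: cst_continuous].
apply: (@CkS_intro _ _ (fun j x => 'D_(basis j) f (x + c))).
- move=> x; apply: continuous_comp; last exact: cf.
  by apply: (@continuousD R (R*R)%type (R*R)%type); [exact: cvg_id|exact: cst_continuous].
- move=> j x; have [H1 H2] : is_derive (x + c) (basis j) f ('D_(basis j) f (x + c)) by exact: DeriveDef.
  have E : (fun h : R => h^-1 *: (((fun y => f (y + c)) \o shift x) (h *: basis j) - f (x + c))) =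
     (fun h : R => h^-1 *: ((f \o shift (x + c)) (h *: basis j) - f (x + c))).
    by apply/funext => h; rewrite /= addrA.
  by split; rewrite /derivable /derive E.
- by move=> j; exact: (IH ('D_(basis j) f) (Df j)).
Qed.

Lemma Cinfty_D j f : Cinfty f -> Cinfty (fun x => 'D_(basis j) f x).
Proof. by move=> Cf k; have [_ _ D] := CkSE (Cf k.+1); exact: D. Qed.

Lemma Cinfty_continuous f : Cinfty f -> continuous f.
Proof. by move=> /(_ 0%N). Qed.

Lemma Cinfty_is_derive f j x : Cinfty f -> is_derive x (basis j) f ('D_(basis j) f x).
Proof. by move=> /(_ 1%N) /CkSE[_ df _]; apply: DeriveDef. Qed.

Lemma Cinfty_cst (c : R) : Cinfty (fun=> c). Proof. by move=> k; exact: Ck_cst. Qed.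
Lemma CinftyD f g : Cinfty f -> Cinfty g -> Cinfty (fun x => f x + g x).
Proof. by move=> Cf Cg k; exact: CkD. Qed.
Lemma CinftyM f g : Cinfty f -> Cinfty g -> Cinfty (fun x => f x * g x).
Proof. by move=> Cf Cg k; exact: CkM. Qed.
Lemma CinftyN f : Cinfty f -> Cinfty (fun x => - f x).
Proof.
move=> Cf; rewrite (_ : (fun x => _) = (fun x => -1 * f x)); last by apply/funext => x; rewrite mulN1r.
exact: CinftyM (Cinfty_cst _) Cf.
Qed.
Lemma CinftyB f g : Cinfty f -> Cinfty g -> Cinfty (fun x => f x - g x).
Proof. by move=> Cf /CinftyN; exact: CinftyD. Qed.
Lemma Cinfty_shift f (c : R * R) : Cinfty f -> Cinfty (fun x => f (x + c)).
Proof. by move=> Cf k; exact: Ck_shift. Qed.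

Lemma is_derive_affine (l c t : R) : is_derive t (1 : R) (fun s => l * s + c) l.
Proof.
by apply: is_derive_eq; rewrite ?scaler0 ?addr0 ?add0r /GRing.scale /= mulr1.
Qed.

(* The witness [F] lists the successive derivatives of [F 0]. *)
Lemma Cinfty_lift (F : nat -> R -> R) (l c : R) i :
  (forall k t, is_derive t (1 : R) (F k) (F k.+1 t)) ->
  Cinfty (fun x => F 0 (l * (if i == ord0 :> 'I_2 then x.1 else x.2) + c)).
Proof.
move=> dF k; set p := fun x : R * R => l * (if i == ord0 then x.1 else x.2) + c.
have cp : continuous p.
  have cq : continuous (fun y : R * R => if i == ord0 then y.1 else y.2).
    by case: eqP => _ y; [exact: cvg_fst|exact: cvg_snd].
  move=> x; apply: (@continuousD _ _ _
    (fun y : R * R => l * (if i == ord0 then y.1 else y.2)) (fun=> c) x).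
    by apply: (@continuousM _ _ (fun=> l) _ x); [exact: cst_continuous|exact: cq].
  exact: cst_continuous.
have cF m : continuous (F m).
  by move=> t; apply/differentiable_continuous/derivable1_diffP; apply: ex_derive.
have dp j (x : R * R) : is_derive x (basis j) p (if j == i then l else 0).
  elim/basis_ind: j.
    apply/is_derive_basis0; rewrite /p /=; elim/basis_ind: i {p cp} => /=.
      exact: is_derive_affine.
    exact: is_derive_cst.
  apply/is_derive_basis1; rewrite /p /=; elim/basis_ind: i {p cp} => /=.
    exact: is_derive_cst.
  exact: is_derive_affine.
suff: forall m, Ck k (fun x => F m (p x)) by exact.
elim: k => [m x|k IH m].
  by apply: continuous_comp; [exact: cp|exact: cF].
apply: (@CkS_intro _ _ (fun j x => F m.+1 (p x) * (if j == i then l else 0))).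
- by move=> x; apply: continuous_comp; [exact: cp|exact: cF].
- move=> j x; have [H1 H2] := dp j x.
  have E : (fun h : R => h^-1 *: (((fun y => F m (p y)) \o shift x) (h *: basis j) - F m (p x))) =
     (fun h : R => h^-1 *: ((F m \o shift (p x)) (h *: (if j == i then l else 0)) - F m (p x))).
    apply/funext => h /=; congr (_ *: (F m _ - _)).
    rewrite /p /shift; elim/basis_ind: j {H1 H2}; elim/basis_ind: i {p cp dp IH} => /=;
      rewrite /GRing.scale /= ?mulr1 ?mulr0; ring.
  have Hd : is_derive (p x) (if j == i then l else 0) (F m) (F m.+1 (p x) * (if j == i then l else 0)).
    have df := diff_locallyP.
    have dd : differentiable (F m) (p x) by apply/derivable1_diffP; apply: ex_derive.
    split; first exact: diff_derivable.
    rewrite deriveE//.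
    have -> : (if j == i then l else 0) = (if j == i then l else 0) *: (1 : R) by rewrite /GRing.scale /= mulr1.
    rewrite linearZ /= -deriveE// derive_val.
    by rewrite /GRing.scale /= mulr1 mulrC.
  by case: Hd => H3 H4; split; move: H3 H4; rewrite /derivable /derive E.
- by move=> j; apply: CkM; [exact: IH|exact: Ck_cst].
Qed.

(** The k-th derivative of exp(-1/t) on t > 0 is this polynomial at 1/t, times exp(-1/t). The
    recursion is the chain rule in y = 1/t, where dy/dt = -y^2. *)
Fixpoint flat_poly (k : nat) : {poly R} :=
  if k is k'.+1 then 'X^2 * (flat_poly k' - (flat_poly k')^`()) else 1.

Definition flat (k : nat) (t : R) : R :=
  if 0 < t then (flat_poly k).[t^-1] * expR (- t^-1) else 0.

(** The constant comes from y^i / i! <= exp y, applied to each monomial. *)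
Lemma expR_dominates (p : {poly R}) :
  exists2 C : R, 0 <= C & forall y, 0 <= y -> `|p.[y]| * expR (- y) <= C.
Proof.
exists (\sum_(i < size p) `|p`_i| * i`!%:R).
  by apply: sumr_ge0 => i _; rewrite mulr_ge0.
move=> y y0; rewrite horner_coef.
apply: (@le_trans _ _ ((\sum_(i < size p) `|p`_i * y ^+ i|) * expR (- y))).
  by rewrite ler_wpM2r ?expR_ge0//; exact: ler_norm_sum.
rewrite mulr_suml; apply: ler_sum => i _.
rewrite normrM -mulrA ler_wpM2l// ger0_norm ?exprn_ge0// expRN ler_pdivrMr ?expR_gt0//.
case: (nat_of_ord i) => [|n].
  rewrite expr0 fact0 mul1r; have := expR_ge1Dx y; lra.
have := expR_ge1Dxn n y0.
rewrite -ler_pdivrMl ?ltr0n ?fact_gt0// mulrC => h; apply: le_trans h; lra.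
Qed.

(** A quadratic bound makes the difference quotient at 0 tend to 0, whatever [k]. Multiplying the
    polynomial by ['X^2] turns it into boundedness in the variable 1/t. *)
Lemma flat_small k : exists2 C : R, 0 <= C & forall t, `|flat k t| <= C * t ^+ 2.
Proof.
have [C C0 HC] := expR_dominates ('X^2 * flat_poly k).
exists C => // t; rewrite /flat; case: ifPn => [t0|_]; last by rewrite normr0 mulr_ge0 ?sqr_ge0.
have := HC t^-1; rewrite invr_ge0 (ltW t0) => /(_ isT).
rewrite hornerM hornerXn (normrM (t^-1 ^+ 2)) (normrM (flat_poly k).[t^-1]) (ger0_norm (expR_ge0 _)) -mulrA.
rewrite ger0_norm ?exprn_ge0 ?invr_ge0 ?(ltW t0)// exprVn.
by rewrite ler_pdivrMl ?exprn_gt0// (mulrC C).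
Qed.

Lemma flat_derive k t : is_derive t (1 : R) (flat k) (flat k.+1 t).
Proof.
have [t0|t0|->] := ltgtP t 0.
- have -> : flat k.+1 t = 0 by rewrite /flat ltNge (ltW t0).
  have E : \forall y \near t, cst 0 y = flat k y.
    near=> y; rewrite /flat ifF//; apply/negbTE; rewrite -leNgt.
    by near: y; exact: lt_le_nbhsl.
  exact: near_eq_is_derive E (is_derive_cst _ _ _).
- have tN0 : t != 0 by rewrite gt_eqF.
  pose g (y : R) : R := (flat_poly k).[y^-1] * expR (- y^-1).
  have dg : is_derive t (1 : R) g (flat k.+1 t).
    have di : is_derive t (1 : R) (fun y => y^-1) (- t ^- 2).
      by apply: (is_derive_eq (@is_deriveV _ id t 1 1 tN0 (is_derive_id _ _))); rewrite /GRing.scale /= mulr1.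
    have dp := @is_derive1_comp _ (horner (flat_poly k)) (fun y => y^-1) t _ _
      (is_derive_poly _ _) di.
    have de : is_derive t (1 : R) (fun y : R => expR (- y^-1)) (expR (- t^-1) * t ^- 2).
      have dn : is_derive t (1 : R) (fun y : R => - y^-1) (t ^- 2).
        by apply: (is_derive_eq (is_deriveN di)); rewrite opprK.
      exact: (@is_derive1_comp _ expR (fun y => - y^-1) t _ _ (is_derive_expR _) dn).
    apply: (is_derive_eq (is_deriveM dp de)).
    rewrite /flat t0 /= /GRing.scale /= hornerM hornerD hornerN hornerXn -exprVn; ring.
  have E : \forall y \near t, g y = flat k y.
    near=> y; rewrite /flat ifT//; near: y; exact: lt_nbhsr.
  exact: near_eq_is_derive E dg.
- have -> : flat k.+1 0 = 0 by rewrite /flat ltxx.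
  have [C C0 HC] := flat_small k.
  have f0 : flat k 0 = 0 by rewrite /flat ltxx.
  have H : h^-1 *: ((flat k \o shift 0) (h *: (1 : R)) - flat k 0) @[h --> 0^'] --> (0 : R).
    apply: (@cvg_to_0_linear _ _ C 1) => // h /andP[h0 _].
    rewrite f0 subr0 /= /GRing.scale /= mulr1 addr0 normrM normfV.
    by rewrite ler_pdivrMl// mulrCA -expr2 real_normK ?num_real.
  by split; [apply/cvg_ex; exists 0|exact: cvg_lim H].
Unshelve. all: by end_near. Qed.

(** The usual transition f(t) / (f(t) + f(1 - t)) with f(t) = exp(-1/t) for t > 0. The denominator
    never vanishes, as t and 1 - t are not both non-positive. *)
Definition step_den (t : R) : R := flat 0 t + flat 0 (1 - t).
Definition step (t : R) : R := flat 0 t / step_den t.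
(** The quotient rule after cancellation: with g(t) = f(1 - t) the numerator f' (f + g) - f (f' +
    g') reduces to f' g - f g', and g'(t) = - f'(1 - t). *)
Definition step' (t : R) : R :=
  (flat 1 t * flat 0 (1 - t) + flat 0 t * flat 1 (1 - t)) / step_den t ^+ 2.

Lemma flat0_ge0 t : 0 <= flat 0 t.
Proof. by rewrite /flat; case: ifP => // _; rewrite /= hornerC mul1r expR_ge0. Qed.

Lemma flat0_gt0 t : 0 < t -> 0 < flat 0 t.
Proof. by move=> t0; rewrite /flat t0 /= hornerC mul1r expR_gt0. Qed.

Lemma flat_le0 k t : t <= 0 -> flat k t = 0.
Proof. by rewrite /flat ltNge => ->. Qed.

Lemma step_den_gt0 t : 0 < step_den t.
Proof.
rewrite /step_den; have [t0|t0] := ltP 0 t.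
  by rewrite ltr_pwDl ?flat0_gt0 ?flat0_ge0.
by rewrite ltr_wpDl ?flat0_ge0// flat0_gt0//; lra.
Qed.

Lemma step_le0 t : t <= 0 -> step t = 0.
Proof. by move=> t0; rewrite /step flat_le0// mul0r. Qed.

Lemma step_ge1 t : 1 <= t -> step t = 1.
Proof.
move=> t1; have := step_den_gt0 t; rewrite /step /step_den (@flat_le0 0 (1 - t)); last lra.
by rewrite addr0 => /gt_eqF/negbT/divff.
Qed.

Lemma step_ge0 t : 0 <= step t.
Proof. by rewrite divr_ge0 ?flat0_ge0// ltW// step_den_gt0. Qed.

Lemma step_le1 t : step t <= 1.
Proof. by rewrite ler_pdivrMr ?step_den_gt0// mul1r /step_den lerDl flat0_ge0. Qed.

Lemma Cinfty_step (l c : R) i :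
  Cinfty (fun x => step (l * (if i == ord0 :> 'I_2 then x.1 else x.2) + c)).
Proof.
have C1 := @Cinfty_lift flat l c i flat_derive.
have C2 := @Cinfty_lift flat (- l) (1 - c) i flat_derive.
have C2' : Cinfty (fun x => flat 0 (1 - (l * (if i == ord0 then x.1 else x.2) + c))).
  by move: C2; congr Cinfty; apply/funext => x; congr (flat 0 _); ring.
move=> k; apply: CkM; first exact: C1.
apply: CkV; first by move=> x; rewrite gt_eqF// step_den_gt0.
by apply: CkD; [exact: C1|exact: C2'].
Qed.

Lemma step_derive t : is_derive t (1 : R) step (step' t).
Proof.
have d1 := flat_derive 0 t.
have dc : is_derive t (1 : R) (fun s => 1 - s) (-1).
  by apply: (is_derive_eq (is_deriveB (is_derive_cst (1 : R) t 1) (is_derive_id t 1))); rewrite sub0r.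
have d2 := @is_derive1_comp _ _ _ t _ _ (flat_derive 0 (1 - t)) dc.
have dd : is_derive t (1 : R) step_den (flat 1 t - flat 1 (1 - t)).
  by apply: (is_derive_eq (is_deriveD d1 d2)); rewrite mulrN1.
have D0 : step_den t != 0 by rewrite gt_eqF// step_den_gt0.
apply: (is_derive_eq (is_deriveM d1 (is_deriveV D0 dd))).
rewrite /GRing.scale /= /step'; move: D0; rewrite /step_den => D0; field.
by [].
Qed.

Lemma step'_bounded : exists2 C : R, 0 < C & forall t, `|step' t| <= C.
Proof.
have cf k : continuous (flat k).
  move=> t; apply/differentiable_continuous/derivable1_diffP.
  by have [] := flat_derive k t.
have cf1 k : continuous (fun t : R => flat k (1 - t)).
  move=> t; apply: (@continuous_comp _ _ _ (fun t : R => 1 - t) (flat k)); last exact: cf.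
  by apply: continuousB; [exact: cst_continuous|exact: cvg_id].
have cs : {within `[0, 1], continuous (fun t => `|step' t|)}.
  apply: continuous_subspaceT => t; apply: continuous_comp; last exact: norm_continuous.
  apply: continuousM.
    by apply: continuousD; apply: continuousM; rewrite //; [exact: cf|exact: cf1|exact: cf|exact: cf1].
  have D0 : step_den t ^+ 2 != 0 by rewrite expf_eq0 /= gt_eqF// step_den_gt0.
  apply: continuousV => //.
  have cd : {for t, continuous step_den} by apply: continuousD; [exact: cf|exact: cf1].
  have -> : (fun s => step_den s ^+ 2) = step_den \* step_den.
    by apply/funext => s; rewrite expr2.
  exact: continuousM.
have [c _ Hc] := EVT_max ler01 cs.
exists (`|step' c| + 1) => [|t]; first by rewrite ltr_wpDl.
have [t01|] := boolP (t \in `[0, 1]); first by rewrite ler_wpDr// Hc.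
rewrite in_itv /= negb_and -!ltNge => /orP[t0|t1]; rewrite /step'.
  by rewrite !(flat_le0 _ (ltW t0)) !mul0r addr0 mul0r normr0.
have t1' : 1 - t <= 0 by lra.
by rewrite !(flat_le0 _ t1') !mulr0 addr0 mul0r normr0.
Qed.

End smooth.

(** * Area measure: measurability, translations, Tonelli *)

Section plane_measure.
Context {R : realType}.
Local Notation mR := (measurableTypeR R).
Local Notation mR2 := (measurableTypeR R * measurableTypeR R)%type.
Local Notation leb := (@lebesgue_measure R).

(** The plane carries the product sigma-algebra, so an open set is exhibited as a countable union of
    the rational rectangles that it contains. *)
Lemma open_measurable_plane (U : set (R * R)) : open U -> measurable (U : set mR2).
Proof.
move=> oU; pose Q (q1 q2 q3 q4 : rat) : set (R * R) :=
  `]ratr q1, ratr q2[%classic `*` `]ratr q3, ratr q4[%classic.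
have mQ q1 q2 q3 q4 : measurable (Q q1 q2 q3 q4 : set mR2).
  by apply: measurableX; exact: measurable_itv.
pose QU q1 q2 q3 q4 := if `[< Q q1 q2 q3 q4 `<=` U >] then Q q1 q2 q3 q4 else set0.
have mQU q1 q2 q3 q4 : measurable (QU q1 q2 q3 q4 : set mR2).
  by rewrite /QU; case: ifP => _; [exact: mQ|exact: measurable0].
have -> : U = \bigcup_q1 \bigcup_q2 \bigcup_q3 \bigcup_q4 QU q1 q2 q3 q4.
  apply/seteqP; split => [x Ux|x [q1 _ [q2 _ [q3 _ [q4 _]]]]]; last first.
    by rewrite /QU; case: ifP => // /asboolP; apply.
  have /nbhs_ballP[e /= e0 xe] := open_nbhs_nbhs (conj oU Ux).
  have [q1] := @rat_in_itvoo R (x.1 - e) x.1 ltac:(lra).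
  have [q2] := @rat_in_itvoo R x.1 (x.1 + e) ltac:(lra).
  have [q3] := @rat_in_itvoo R (x.2 - e) x.2 ltac:(lra).
  have [q4] := @rat_in_itvoo R x.2 (x.2 + e) ltac:(lra).
  rewrite !in_itv /= => /andP[h1 h2] /andP[h3 h4] /andP[h5 h6] /andP[h7 h8].
  exists q1 => //; exists q2 => //; exists q3 => //; exists q4 => //.
  rewrite /QU ifT; first by split; rewrite /= in_itv /=; lra.
  apply/asboolP => y [/=]; rewrite !in_itv /= => /andP[g1 g2] /andP[g3 g4].
  by apply: xe; split; rewrite /ball /= ltr_norml; lra.
do 4 (apply: bigcupT_measurable_rat => ?).
exact: mQU.
Qed.

Lemma continuous_measurable_plane (F : R * R -> R) : continuous F ->
  measurable_fun setT (F : mR2 -> R).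
Proof.
move=> /continuousP cF; apply: (measurability _ (RGenOInfty.measurableE R)).
move=> _ [_ [a ->] <-]; rewrite setTI; apply: open_measurable_plane.
by apply: cF; exact: interval_open.
Qed.

Lemma measurable_add (c : R) : measurable_fun setT ((fun s => s + c) : mR -> mR).
Proof.
apply: (@continuous_measurable_fun R (fun s => s + c)) => s.
by apply: continuousD; [exact: cvg_id|exact: cst_continuous].
Qed.

(** The translated measure agrees with Lebesgue measure on half-open intervals, and these determine
    it. *)
Lemma lebesgue_shift (c : R) (A : set mR) : measurable A ->
  leb A = leb ((fun s => s + c) @^-1` A).
Proof.
move=> mA; apply: (@lebesgue_measure_unique R (pushforward leb (fun s : mR => s + c : mR))) => //.
  exact: measurable_add.
move=> mc X [[a b] _ <-] /=; rewrite /pushforward /=.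
have -> : (fun s => s + c) @^-1` `]a, b]%classic = `]a - c, b - c]%classic.
  by apply/seteqP; split => s /=; rewrite !in_itv /= => /andP[? ?]; lra.
rewrite !lebesgue_measure_itv /= !lte_fin ltrD2r.
by case: ifP => // _; rewrite -!EFinB; congr EFin; ring.
Qed.

Lemma ge0_integral_shift (c : R) (f : mR -> \bar R) : measurable_fun setT f ->
  (forall s, 0 <= f s)%E ->
  (\int[leb]_s f s = \int[leb]_s f ((s : R) + c)%R)%E.
Proof.
move=> mf f0.
have := @ge0_integral_pushforward _ _ mR mR R (fun s => (s : R) + c) (measurable_add c) leb setT f measurableT mf.
rewrite preimage_setT => /(_ (fun y _ => f0 y)) <-.
apply: eq_measure_integral; first exact: measurable_add.
by move=> mc A mA _; exact: lebesgue_shift.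
Qed.

Lemma measurable_shift2 (c : R) :
  measurable_fun setT ((fun x => (x.1, x.2 + c)) : mR2 -> mR2).
Proof.
apply: measurable_fun_pair; first exact: measurable_fst.
by apply: (measurableT_comp (measurable_add c)); exact: measurable_snd.
Qed.

(** The same uniqueness argument, now tested on measurable rectangles. *)
Lemma area_shift2 (c : R) (A : set mR2) : measurable A ->
  area A = area ((fun x : R * R => (x.1, x.2 + c)) @^-1` A).
Proof.
move=> mA; apply: (@product_measure_unique _ _ mR mR R leb leb
  (pushforward area ((fun x => (x.1, x.2 + c)) : mR2 -> mR2))) => //.
  exact: measurable_shift2.
move=> mc X Y mX mY.
have mY' : measurable (((fun s => s + c) : mR -> mR) @^-1` Y).
  by rewrite -[_ @^-1` _]setTI; exact: measurable_add.
have E : (fun x : mR2 => (x.1, x.2 + c)) @^-1` (X `*` Y) =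
    X `*` (((fun s => s + c) : mR -> mR) @^-1` Y).
  by apply/seteqP; split => x [].
change (area ((fun x : mR2 => (x.1, x.2 + c)) @^-1` (X `*` Y)) = (leb X * leb Y)%E).
rewrite E (lebesgue_shift c mY); exact: product_measure1E.
Qed.

Lemma ge0_integral_shift2 (c : R) (f : mR2 -> \bar R) : measurable_fun setT f ->
  (forall x, 0 <= f x)%E ->
  (\int[area]_x f x = \int[area]_x f (x.1, (x.2 : R) + c)%R)%E.
Proof.
move=> mf f0.
have := @ge0_integral_pushforward _ _ mR2 mR2 R (fun x => (x.1, (x.2 : R) + c)) (measurable_shift2 c) area setT f measurableT mf.
rewrite preimage_setT => /(_ (fun y _ => f0 y)) <-.
apply: eq_measure_integral; first exact: measurable_shift2.
by move=> mc A mA _; exact: area_shift2.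
Qed.

Lemma area_tonelli (f : mR2 -> \bar R) : measurable_fun setT f ->
  (forall x, 0 <= f x)%E ->
  (\int[area]_x f x = \int[leb]_s \int[leb]_t f (s, t))%E.
Proof. by move=> mf f0; rewrite /area fubini_tonelli1. Qed.

Lemma area_tonelli2 (f : mR2 -> \bar R) : measurable_fun setT f ->
  (forall x, 0 <= f x)%E ->
  (\int[area]_x f x = \int[leb]_t \int[leb]_s f (s, t))%E.
Proof. by move=> mf f0; rewrite /area fubini_tonelli2. Qed.

End plane_measure.

(** * Continuity of algebraic combinations *)

Section continuity.
Context {R : realType} {T : topologicalType}.
Implicit Types f g : T -> R.

Lemma contM f g : continuous f -> continuous g -> continuous (fun x => f x * g x).
Proof. by move=> cf cg x; apply: continuousM; [exact: cf|exact: cg]. Qed.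

Lemma contD f g : continuous f -> continuous g -> continuous (fun x => f x + g x).
Proof. by move=> cf cg x; apply: continuousD; [exact: cf|exact: cg]. Qed.

Lemma contN f : continuous f -> continuous (fun x => - f x).
Proof. by move=> cf x; apply: continuousN; exact: cf. Qed.

Lemma contB f g : continuous f -> continuous g -> continuous (fun x => f x - g x).
Proof. by move=> cf /contN; exact: contD. Qed.

Lemma contX f : continuous f -> continuous (fun x => f x ^+ 2).
Proof. by move=> cf x; apply: (@cvgM _ _ _ _ _ _ (f x)); exact: cf. Qed.

Lemma contV f : (forall x, f x != 0) -> continuous f -> continuous (fun x => (f x)^-1).
Proof. by move=> f0 cf x; apply: continuousV; [exact: f0|exact: cf]. Qed.

Lemma cont_cst (c : R) : continuous (fun _ : T => c).
Proof. exact: cst_continuous. Qed.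

End continuity.

(** * One-variable inequalities with weights *)

Section one_dim.
Context {R : realType}.
Local Notation mR := (measurableTypeR R).
Local Notation leb := (@lebesgue_measure R).

Lemma measurable_itv_open (a b : R) (f : R -> R) : continuous f ->
  measurable_fun (`]a, b[%classic : set mR) (f : mR -> R).
Proof.
move=> cf; apply: (measurable_funS measurableT) => //.
exact: (@continuous_measurable_fun R f cf).
Qed.

Lemma itv_integrable (a b : R) (f : R -> R) : {within `[a, b], continuous f} ->
  leb.-integrable `[a, b] (EFin \o f).
Proof. by move=> cf; apply: continuous_compact_integrable => //; exact: segment_compact. Qed.

(** Cauchy-Schwarz without square roots: the integral of w (f' - c v)^2 is a non-negative quadratic
    polynomial in c, and its value at c = I / A is the claim. *)
Lemma weighted_cauchy (a b : R) (f f' v w : R -> R) : a < b ->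
  (forall t, is_derive t (1 : R) f (f' t)) -> continuous f' ->
  continuous v -> continuous w ->
  (forall t, a <= t <= b -> 0 <= w t /\ v t * w t = 1) ->
  ((f b - f a) ^+ 2 <= \int[leb]_(t in `[a, b]) v t * \int[leb]_(t in `[a, b]) (w t * f' t ^+ 2)).
Proof.
move=> ab df cf' cv cw vw.
have wcf' : {within `[a, b], continuous f'} by exact: continuous_subspaceT.
have wcv : {within `[a, b], continuous v} by exact: continuous_subspaceT.
have cwf : {within `[a, b], continuous (fun t => w t * f' t ^+ 2)}.
  by apply: continuous_subspaceT; apply: contM => //; exact: contX.
have ftc : \int[leb]_(t in `[a, b]) f' t = f b - f a.
  rewrite /Rintegral (@continuous_FTC2 _ f' f)//.
  - have cf : continuous f.
      move=> t; apply/differentiable_continuous/derivable1_diffP.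
      by have [] := df t.
    split; first by move=> t _; have [] := df t.
    + apply: cvg_at_right_filter; exact: cf.
    + apply: cvg_at_left_filter; exact: cf.
  - by move=> t _; rewrite derive1E; have [_] := df t.
set A := \int[leb]_(t in `[a, b]) v t; set B := \int[leb]_(t in `[a, b]) (w t * f' t ^+ 2).
set I := f b - f a.
have key c : 0 <= B - 2 * c * I + c ^+ 2 * A.
  rewrite /I -ftc /A /B.
  have iB := itv_integrable cwf; have iI := itv_integrable wcf'; have iA := itv_integrable wcv.
  have mab : measurable (`[a, b]%classic : set mR) by exact: measurable_itv.
  rewrite -(RintegralZl (2 * c) mab iI) -(RintegralZl (c ^+ 2) mab iA).
  have iI' := integrableZl mab (2 * c) iI; have iA' := integrableZl mab (c ^+ 2) iA.
  have iBI : leb.-integrable `[a, b] (EFin \o (fun t => w t * f' t ^+ 2 - 2 * c * f' t)).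
    exact: (integrableB mab iB iI').
  have -> := esym (@RintegralB _ mR R leb _ _ (fun t => 2 * c * f' t) mab iB iI').
  have -> := esym (@RintegralD _ mR R leb _ _ (fun t => c ^+ 2 * v t) mab iBI iA').
  apply: Rintegral_ge0 => t /=; rewrite in_itv /= => tab.
  have [w0 vw1] := vw t tab.
  have -> : w t * f' t ^+ 2 - 2 * c * f' t + c ^+ 2 * v t = w t * (f' t - c * v t) ^+ 2.
    have -> : w t * (f' t - c * v t) ^+ 2 = w t * f' t ^+ 2 - 2 * c * f' t * (v t * w t) + c ^+ 2 * v t * (v t * w t) by ring.
    by rewrite vw1; ring.
  by rewrite mulr_ge0// sqr_ge0.
(* Strict positivity is needed to divide by [A]; it follows from the positive minimum of [v] on the
   segment. *)
have A0 : 0 < A.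
  have A0' : 0 <= A.
    apply: Rintegral_ge0 => t /=; rewrite in_itv /= => /vw[w0 vw1].
    by rewrite leNgt; apply/negP => v0; have := ler_wpM2r w0 (ltW v0); rewrite vw1 mul0r; lra.
  rewrite lt_neqAle A0' andbT; apply/eqP => A00.
  have v1 t : t \in `[a, b] -> 0 < v t.
    rewrite in_itv /= => /vw[w0 vw1]; rewrite ltNge; apply/negP => v0.
    by have := ler_wpM2r w0 v0; rewrite vw1 mul0r; lra.
  have [c cab Hc] := EVT_min (ltW ab) wcv.
  have : \int[leb]_(t in `[a, b]) v c <= A.
    apply: le_Rintegral => //; last exact: itv_integrable.
    by apply: itv_integrable; apply: continuous_subspaceT; exact: cst_continuous.
  rewrite Rintegral_cst//= lebesgue_measure_itv /= lte_fin ab /= -A00.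
  by rewrite leNgt mulr_gt0 ?v1 ?subr_gt0.
have := key (I / A); rewrite (_ : B - _ + _ = (A * B - I ^+ 2) / A); last by field; rewrite gt_eqF.
by rewrite pmulr_lge0 ?invr_gt0// subr_ge0.
Qed.

(** This is the source of the logarithm in the final rate. The modulus keeps the weight positive and
    continuous on the whole line, so that continuity needs no restriction on t. *)
Lemma ln_weight (r c : R) : 0 < r -> 0 < c ->
  \int[leb]_(t in `[0, c]) (`|t| + r)^-1 = ln ((c + r) / r).
Proof.
move=> r0 c0.
have P (t : R) : 0 < `|t| + r by rewrite ltr_wpDl.
have cP : continuous (fun t : R => (`|t| + r)^-1).
  apply: contV => [t|]; first by rewrite gt_eqF.
  by apply: contD; [exact: norm_continuous|exact: cont_cst].
rewrite /Rintegral (@continuous_FTC2 _ _ (fun t => ln (t + r)))//.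
- by rewrite add0r -EFinB /= ln_div ?posrE// addr_gt0.
- exact: continuous_subspaceT.
- have D t : 0 < t + r -> is_derive t (1 : R) (fun t => ln (t + r)) (t + r)^-1.
    move=> tr; have d1 : is_derive t (1 : R) (fun s => s + r) 1.
      by apply: (is_derive_eq (is_deriveD (is_derive_id t 1) (is_derive_cst r t 1))); rewrite addr0.
    by apply: (is_derive_eq (@is_derive1_comp _ _ _ t _ _ (is_derive1_ln tr) d1)); rewrite mulr1.
  have C t : 0 < t + r -> {for t, continuous (fun t : R => ln (t + r))}.
    by move=> /D dt; apply/differentiable_continuous/derivable1_diffP; have [] := dt.
  split; first by move=> t; rewrite in_itv /= => /andP[t0 _]; have [] := D t (addr_gt0 t0 r0).
  + by apply: cvg_at_right_filter; apply: C; rewrite add0r.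
  + by apply: cvg_at_left_filter; apply: C; lra.
- move=> t; rewrite in_itv /= => /andP[t0 _]; rewrite derive1E ger0_norm ?ltW//.
  have tr : 0 < t + r by lra.
  have d1 : is_derive t (1 : R) (fun s => s + r) 1.
    by apply: (is_derive_eq (is_deriveD (is_derive_id t 1) (is_derive_cst r t 1))); rewrite addr0.
  by have [_ ->] := @is_derive1_comp _ _ _ t _ _ (is_derive1_ln tr) d1; rewrite mulr1.
Qed.

Lemma EFin_Rintegral (a b : R) (f : R -> R) : continuous f -> (forall t, 0 <= f t) ->
  ((\int[leb]_(t in `[a, b]) f t)%:E = \int[leb]_(t in `]a, b[) (f t)%:E)%E.
Proof.
move=> cf f0; rewrite -(integral_itv_bndoo true false).
  rewrite /Rintegral fineK//; apply: integrable_fin_num => //.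
  by apply: itv_integrable; exact: continuous_subspaceT.
by apply/measurable_EFinP; exact: measurable_itv_open.
Qed.

(** The fundamental theorem and Cauchy-Schwarz between x and y, in either order; the energy is taken
    over the whole of ]a, b[ so that the bound does not depend on the two points. *)
Lemma ftc_sqr (a b x y : R) (f f' : R -> R) :
  (forall t, is_derive t (1 : R) f (f' t)) -> continuous f' ->
  a <= x <= b -> a <= y <= b ->
  ((f y ^+ 2)%:E <= (2 * f x ^+ 2)%:E
    + (2 * (b - a))%:E * \int[leb]_(t in `]a, b[) (f' t ^+ 2)%:E)%E.
Proof.
move=> df cf'.
have base : forall x y, a <= x -> x < y -> y <= b ->
    (((f y - f x) ^+ 2)%:E <= (b - a)%:E * \int[leb]_(t in `]a, b[) (f' t ^+ 2)%:E)%E.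
  move=> {}x {}y ax xy yb.
  have := @weighted_cauchy x y f f' (fun=> 1) (fun=> 1) xy df cf' (@cont_cst R _ 1) (@cont_cst R _ 1).
  move=> /(_ (fun _ _ => conj ler01 (mulr1 1))).
  rewrite Rintegral_cst//= lebesgue_measure_itv /= lte_fin xy /= mul1r.
  under eq_Rintegral do rewrite mul1r.
  rewrite -lee_fin => /le_trans; apply; rewrite EFinM EFin_Rintegral; last 2 first.
    exact: contX.
    by move=> t; exact: sqr_ge0.
  apply: lee_pmul; rewrite ?lee_fin; [lra| |lra|].
    by apply: integral_ge0 => t _; rewrite lee_fin sqr_ge0.
  apply: ge0_subset_integral => //; [exact: measurable_itv..| | |].
  - by apply/measurable_EFinP; apply: measurable_itv_open; exact: contX.
  - by move=> t _; rewrite lee_fin sqr_ge0.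
  - by move=> t /=; rewrite !in_itv /= => /andP[? ?]; lra.
move=> /andP[ax xb] /andP[ay yb].
have I0 : (0 <= \int[leb]_(t in `]a, b[) (f' t ^+ 2)%:E)%E.
  by apply: integral_ge0 => t _; rewrite lee_fin sqr_ge0.
have : (((f y - f x) ^+ 2)%:E <= (b - a)%:E * \int[leb]_(t in `]a, b[) (f' t ^+ 2)%:E)%E.
  have [xy|xy|->] := ltgtP x y; first exact: base.
    by rewrite -sqrrN opprB; exact: base.
  by rewrite subrr expr0n /= mule_ge0// lee_fin; lra.
move=> H; apply: (@le_trans _ _ ((2 * f x ^+ 2)%:E + 2%:E * ((f y - f x) ^+ 2)%:E)%E).
  rewrite -EFinM -EFinD lee_fin; have : 0 <= (f y - 2 * f x) ^+ 2 by exact: sqr_ge0.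
  by rewrite !sqrrB; lra.
by rewrite leeD2l// (EFinM 2 (b - a)) -muleA lee_wpmul2l// lee_fin.
Qed.

(** [weighted_cauchy] with the weight t + r in the energy: its inverse integrates to a logarithm,
    and the weight itself is cancelled later by the spreading of the rays. *)
Lemma ray_sqr (r c : R) (f f' : R -> R) : 0 < r -> 0 < c ->
  (forall t, is_derive t (1 : R) f (f' t)) -> continuous f' -> f c = 0 ->
  ((f 0 ^+ 2)%:E <= (ln ((c + r) / r))%:E
     * \int[leb]_(t in `]0%R, c[) ((`|t| + r) * f' t ^+ 2)%:E)%E.
Proof.
move=> r0 c0 df cf' fc.
have P (t : R) : 0 < `|t| + r by rewrite ltr_wpDl.
have cP : continuous (fun t : R => `|t| + r).
  by apply: contD; [exact: norm_continuous|exact: cont_cst].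
have cV : continuous (fun t : R => (`|t| + r)^-1).
  by apply: contV => // t; rewrite gt_eqF.
have := @weighted_cauchy 0 c f f' _ _ c0 df cf' cV cP.
move=> /(_ _)/wrap[t _|]; first by split; [exact: ltW|rewrite mulVf ?gt_eqF].
rewrite ln_weight// fc sub0r sqrrN -lee_fin (EFinM (ln _)) EFin_Rintegral//.
  by apply: contM => //; exact: contX.
by move=> t; rewrite mulr_ge0 ?sqr_ge0// ltW.
Qed.

End one_dim.

(** * Integrals above a graph and over strips *)

Section tonelli.
Context {R : realType}.
Local Notation mR := (measurableTypeR R).
Local Notation mR2 := (measurableTypeR R * measurableTypeR R)%type.
Local Notation leb := (@lebesgue_measure R).

Lemma upper_open (d : R) (p : R -> R) : continuous p -> open (upper d p).
Proof.
move=> cp.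
have c1 : continuous (fun x : R * R => x.2 - p x.1).
  apply: contB; first by move=> x; exact: cvg_snd.
  by move=> x; apply: (@continuous_comp _ _ _ fst p); [exact: cvg_fst|exact: cp].
have c2 : continuous (fun x : R * R => d - x.2).
  by apply: contB; [exact: cont_cst|move=> x; exact: cvg_snd].
have -> : upper d p = (fun x => x.2 - p x.1) @^-1` [set r | 0 < r] `&`
                      (fun x => d - x.2) @^-1` [set r | 0 < r].
  by apply/seteqP; split => x; rewrite /upper /= !subr_gt0; [move=> /andP[]|move=> [-> ->]].
by apply: openI; apply: open_comp => //; exact: open_gt.
Qed.

Lemma upper_measurable (d : R) (p : R -> R) : continuous p ->
  measurable (upper d p : set mR2).
Proof. by move=> cp; apply: open_measurable_plane; exact: upper_open. Qed.

Lemma restrict_ge0 (T : Type) (D : set T) (f : T -> \bar R) :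
  (forall x, 0 <= f x)%E -> (forall x, 0 <= (f \_ D) x)%E.
Proof. by move=> f0 x; rewrite patchE; case: ifP. Qed.

Lemma measurable_restrictT d (T : measurableType d) (D : set T) (f : T -> \bar R) :
  measurable D -> measurable_fun setT f -> measurable_fun setT (f \_ D).
Proof.
move=> mD mf; apply/(measurable_restrict _ mD measurableT).
by apply: measurable_funS mf.
Qed.

Lemma upper_slice (p : R -> R) (d s : R) (f : mR2 -> \bar R) :
  (fun t => (f \_ (upper d p : set mR2)) (s, t)) = (fun t => f (s, t)) \_ (`]p s, d[ : set mR).
Proof.
apply/funext => t; rewrite !patchE.
suff -> : ((s, t) \in (upper d p : set mR2)) = (t \in (`]p s, d[%classic : set mR)) by [].
by apply/idP/idP; rewrite !inE /upper /= in_itv.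
Qed.

Section upper_integral.
Variables (p : R -> R) (d : R) (f : mR2 -> \bar R).
Hypotheses (cp : continuous p) (mf : measurable_fun setT f)
  (f0 : forall x, (0 <= f x)%E).

Let mfr : measurable_fun setT (f \_ (upper d p : set mR2)).
Proof. by apply: measurable_restrictT => //; exact: upper_measurable. Qed.

Lemma integral_upper :
  (\int[area]_(x in upper d p) f x = \int[leb]_s \int[leb]_(t in `]p s, d[) f (s, t))%E.
Proof.
rewrite integral_mkcond (area_tonelli mfr (restrict_ge0 _ f0)).
by apply: eq_integral => s _; rewrite upper_slice [RHS]integral_mkcond.
Qed.

Lemma measurable_vint :
  measurable_fun setT (fun s : mR => \int[leb]_(t in `]p s, d[) f (s, t))%E.
Proof.
rewrite (_ : (fun s => _) = fubini_F leb (f \_ (upper d p : set mR2))).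
  by apply: measurable_fun_fubini_tonelli_F => //; exact: restrict_ge0.
by apply/funext => s; rewrite /fubini_F upper_slice [LHS]integral_mkcond.
Qed.

End upper_integral.

Lemma integral_strip (B T : R) (f : mR2 -> \bar R) : measurable_fun setT f ->
  (forall x, 0 <= f x)%E ->
  (\int[area]_(x in upper T (fun=> B)) f x = \int[leb]_(t in `]B, T[) \int[leb]_s f (s, t))%E.
Proof.
move=> mf f0; have cB := @cont_cst R R B.
have mD := @upper_measurable T _ cB.
rewrite integral_mkcond area_tonelli2; last 2 first.
- exact: measurable_restrictT.
- exact: restrict_ge0.
rewrite [RHS]integral_mkcond; apply: eq_integral => t _; rewrite patchE.
case: ifPn => tBT.
  apply: eq_integral => s _; rewrite patchE ifT//.
apply: integral0_eq => s _; rewrite patchE ifF//; apply/negbTE; apply: contra tBT.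
by move=> /set_mem h; apply/mem_set; rewrite /= in_itv.
Qed.

Lemma measurable_hint (f : mR2 -> \bar R) : measurable_fun setT f ->
  (forall x, 0 <= f x)%E -> measurable_fun setT (fun t : mR => \int[leb]_s f (s, t))%E.
Proof. by move=> mf f0; exact: (@measurable_fun_fubini_tonelli_G _ _ _ _ _ leb f mf f0). Qed.

Lemma sqr_measurable_plane (F : R * R -> R) : continuous F ->
  measurable_fun setT (fun x : mR2 => (F x ^+ 2)%:E).
Proof.
by move=> cF; apply/measurable_EFinP; apply: continuous_measurable_plane; exact: contX.
Qed.

Lemma measurable_line (f : R -> R) : continuous f ->
  measurable_fun setT (fun x : mR => (f x)%:E).
Proof. by move=> cf; apply/measurable_EFinP; exact: (@continuous_measurable_fun R). Qed.

(** By Tonelli the translation is integrated last, and every translate of [g] has the same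
    integral. *)
Lemma shift_avg (e : R) (g : mR -> \bar R) : 0 < e -> measurable_fun setT g ->
  (forall s, 0 <= g s)%E ->
  (\int[leb]_s \int[leb]_(t in `]0%R, e[) g ((s : R) + (t : R))%R = e%:E * \int[leb]_s g s)%E.
Proof.
move=> e0 mg g0.
have madd : measurable_fun setT (fun x : mR2 => (x.1 : R) + (x.2 : R) : mR).
  by apply: continuous_measurable_plane; apply: contD => x; [exact: cvg_fst|exact: cvg_snd].
have mh : measurable_fun setT (fun x : mR2 => g ((x.1 : R) + (x.2 : R))%R).
  by apply: (measurableT_comp mg).
rewrite -(@integral_upper (fun=> 0) e (fun x => g ((x.1 : R) + (x.2 : R))%R))//; last exact: cont_cst.
rewrite integral_strip//.
under eq_integral do rewrite -(@ge0_integral_shift R _ g)//.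
rewrite integral_cst//= lebesgue_measure_itv /= lte_fin e0 sube0 muleC.
by [].
Qed.

End tonelli.

(** * Smooth functions: derivative along a ray, horizontal averaging *)

Section smooth_inequalities.
Context {R : realType}.
Local Notation mR := (measurableTypeR R).
Local Notation mR2 := (measurableTypeR R * measurableTypeR R)%type.
Local Notation leb := (@lebesgue_measure R).

(** The location of c is given by |c - a| <= |b - a| so that a and b need not be ordered:
    [ray_derive] takes increments of either sign. *)
Lemma mean_value (f f' : R -> R) (a b : R) : (forall t, is_derive t (1 : R) f (f' t)) ->
  exists2 c, `|c - a| <= `|b - a| & f b - f a = f' c * (b - a).
Proof.
move=> df.
have cf : continuous f.
  by move=> t; apply/differentiable_continuous/derivable1_diffP; have [] := df t.
have [ab|ba|->] := ltgtP a b; last by exists b; rewrite ?subrr ?mulr0 ?normr0.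
- have [c] := MVT ab (fun x _ => df x) (continuous_subspaceT cf).
  rewrite in_itv /= => /andP[ac cb] E; exists c => //.
  by rewrite (@ger0_norm _ (c - a)) ?(@ger0_norm _ (b - a)); lra.
- have [c] := MVT ba (fun x _ => df x) (continuous_subspaceT cf).
  rewrite in_itv /= => /andP[bc ca] E; exists c.
    by rewrite (@ler0_norm _ (c - a)) ?(@ler0_norm _ (b - a)); lra.
  by rewrite -opprB E -mulrN opprB.
Qed.

Lemma ereal_scale (e j k : R) (X Y Z : \bar R) : 0 < e -> 0 <= k ->
  (0 <= Y -> 0 <= Z -> (j * e)%:E * X <= 2%:E * (e%:E * Y) + k%:E * (e%:E * Z) ->
  j%:E * X <= 2%:E * Y + k%:E * Z)%E.
Proof.
move=> e0 k0 Y0 Z0 H; rewrite -(@lee_pmul2l _ e%:E)// ge0_muleDr ?mule_ge0 ?lee_fin//.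
by rewrite muleA -EFinM (mulrC e) (muleCA e%:E 2%:E) (muleCA e%:E k%:E).
Qed.

Section one_function.
Variables (F F1 F2 : R * R -> R).
Hypotheses (cF : continuous F) (cF1 : continuous F1) (cF2 : continuous F2).
Hypotheses (dF1 : forall x, is_derive x (basis ord0) F (F1 x))
  (dF2 : forall x, is_derive x (basis ord_max) F (F2 x)).

Lemma dline1 s t : is_derive s (1 : R) (fun s => F (s, t)) (F1 (s, t)).
Proof. by have /is_derive_basis0 := dF1 (s, t). Qed.

Lemma dline2 s t : is_derive t (1 : R) (fun t => F (s, t)) (F2 (s, t)).
Proof. by have /is_derive_basis1 := dF2 (s, t). Qed.

Lemma cont_hline (G : R * R -> R) (t : R) : continuous G -> continuous (fun s => G (s, t)).
Proof.
move=> cG s; apply: (@continuous_comp _ _ _ (fun s : R => (s, t)) G); last exact: cG.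
exact: (@cvg_pair R R R (nbhs s) (nbhs s) (nbhs t) _ _ _ (fun s => s) (fun=> t)
  cvg_id (@cvg_cst _ _ _ _ _)).
Qed.

Lemma cont_vline (G : R * R -> R) (s : R) : continuous G -> continuous (fun t => G (s, t)).
Proof.
move=> cG t; apply: (@continuous_comp _ _ _ (fun t : R => (s, t)) G); last exact: cG.
exact: (@cvg_pair R R R (nbhs t) (nbhs s) (nbhs t) _ _ _ (fun=> s) (fun t => t)
  (@cvg_cst _ _ _ _ _) cvg_id).
Qed.

(** The increment along the ray is split into a horizontal and a vertical one; the mean value
    theorem applies to each, and continuity of the partial derivatives does the rest. *)
Lemma ray_derive (s t th a : R) :
  is_derive a (1 : R) (fun a => F (s + th * a, t + a))
    (th * F1 (s + th * a, t + a) + F2 (s + th * a, t + a)).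
Proof.
set x0 := (s + th * a, t + a); set l := th * F1 x0 + F2 x0.
suff H : h^-1 *: (((fun a => F (s + th * a, t + a)) \o shift a) (h *: (1 : R)) - F x0)
    @[h --> 0^'] --> l.
  by split; [apply/cvg_ex; exists l|exact: cvg_lim H].
apply/cvgrPdist_le => e e0.
have th1 : 0 < `|th| + 1 by rewrite ltr_wpDl.
have e1 : 0 < e / 2 / (`|th| + 1) by rewrite !divr_gt0.
have /cvgrPdist_le /(_ _ e1) /nbhs_ballP[r1 /= r10 B1] := @cF1 x0.
have e2 : 0 < e / 2 by rewrite divr_gt0.
have /cvgrPdist_le /(_ _ e2) /nbhs_ballP[r2 /= r20 B2] := @cF2 x0.
near=> h.
have h0 : h != 0 by near: h; exact: nbhs_dnbhs_neq.
(* Both |h| and |th h| must stay below [r1], hence the division by |th| + 1. *)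
have hr1 : `|h| < r1 / (`|th| + 1).
  near: h; apply: dnbhs0_lt; exact: divr_gt0.
have hr2 : `|h| < r2 by near: h; exact: dnbhs0_lt.
rewrite /GRing.scale /= mulr1.
have [c Hc Ec] := @mean_value (fun s => F (s, t + (h + a))) (fun s => F1 (s, t + (h + a)))
  (s + th * a) (s + th * (h + a)) (fun u => dline1 u _).
have [c' Hc' Ec'] := @mean_value (fun t => F (s + th * a, t)) (fun t => F2 (s + th * a, t))
  (t + a) (t + (h + a)) (fun u => dline2 _ u).
have -> : F (s + th * (h + a), t + (h + a)) - F x0 =
  h * (th * F1 (c, t + (h + a)) + F2 (s + th * a, c')).
  have -> : F (s + th * (h + a), t + (h + a)) - F x0 =
   (F (s + th * (h + a), t + (h + a)) - F (s + th * a, t + (h + a)))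
   + (F (s + th * a, t + (h + a)) - F (s + th * a, t + a)) by rewrite /x0; ring.
  by rewrite Ec Ec'; ring.
rewrite mulKf//.
have E1 : `|F1 x0 - F1 (c, t + (h + a))| <= e / 2 / (`|th| + 1).
  apply: B1; split; rewrite /ball /= -normrN opprB.
    apply: le_lt_trans Hc _.
    rewrite (_ : _ - _ = th * h); last by ring.
    rewrite normrM; move: hr1; rewrite ltr_pdivlMr// => hr1.
    by apply: le_lt_trans hr1; rewrite mulrDr mulr1 mulrC lerDl.
  rewrite (_ : _ - _ = h); last by ring.
  move: hr1; rewrite ltr_pdivlMr// => hr1.
  by apply: le_lt_trans hr1; rewrite mulrDr mulr1 lerDr mulr_ge0.
have E2 : `|F2 x0 - F2 (s + th * a, c')| <= e / 2.
  apply: B2; split; rewrite /ball /= -normrN opprB.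
    by rewrite subrr normr0.
  apply: le_lt_trans Hc' _; rewrite (_ : _ - _ = h)//; by ring.
rewrite /l (_ : _ - _ = th * (F1 x0 - F1 (c, t + (h + a))) + (F2 x0 - F2 (s + th * a, c'))); last by ring.
apply: le_trans (ler_normD _ _) _; rewrite normrM.
have : `|th| * `|F1 x0 - F1 (c, t + (h + a))| <= e / 2.
  move: E1; rewrite ler_pdivlMr// => E1; apply: le_trans E1.
  by rewrite mulrC ler_wpM2l// lerDl.
lra.
Unshelve. all: by end_near. Qed.

Lemma int_sqr_ge0 d (T : measurableType d) (mu : {measure set T -> \bar R}) (D : set T) (f : T -> R) :
  (0 <= \int[mu]_(x in D) (f x ^+ 2)%:E)%E.
Proof. by apply: integral_ge0 => x _; rewrite lee_fin sqr_ge0. Qed.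

(** The window of length e to the right of s meets [J] in measure at least j e, so h(s) can be
    compared with h at points of [J]. Averaging over the window and then over s leaves an error of
    order e^2 |h'|^2. *)
Lemma horizontal_avg (h h' : R -> R) (J : set mR) (e j : R) : 0 < e ->
  (forall t, is_derive t (1 : R) h (h' t)) -> continuous h' -> measurable J ->
  (forall s : R, ((j * e)%:E <= \int[leb]_(t in `]0%R, e[) (\1_J (s + t)%R)%:E)%E) ->
  0 <= j ->
  (j%:E * \int[leb]_s (h s ^+ 2)%:E <=
   2%:E * \int[leb]_(s in J) (h s ^+ 2)%:E + (2 * e ^+ 2)%:E * \int[leb]_s (h' s ^+ 2)%:E)%E.
Proof.
move=> e0 dh ch' mJ HJ j0.
have ch : continuous h.
  by move=> t; apply/differentiable_continuous/derivable1_diffP; have [] := dh t.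
have mh := measurable_line (contX ch); have mh' := measurable_line (contX ch').
have mI : measurable_fun setT (fun x : mR => (\1_J x)%:E : \bar R).
  by apply/measurable_EFinP; exact: measurable_indic.
have P1 s : 0 <= h s ^+ 2 by exact: sqr_ge0.
have P2 s : 0 <= h' s ^+ 2 by exact: sqr_ge0.
pose g s := ((\1_J s)%:E * (h s ^+ 2)%:E : \bar R)%E.
have mg : measurable_fun setT (g : mR -> \bar R).
  by rewrite /g; exact: emeasurable_funM.
have g0 s : (0 <= g s)%E by rewrite mule_ge0 ?lee_fin.
have gE : (\int[leb]_(s in J) (h s ^+ 2)%:E = \int[leb]_s g s)%E.
  rewrite integral_mkcond; apply: eq_integral => s _; rewrite /g patchE indicE.
  by case: ifP => _; rewrite ?mul1e ?mul0e.
have mS f : measurable_fun setT (f : mR -> \bar R) ->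
    forall s, measurable_fun setT (fun t : mR => f ((s : R) + (t : R))%R).
  move=> mf s; apply: (measurableT_comp mf).
  apply: (@continuous_measurable_fun R (fun t : R => s + t)).
  by apply: contD; [exact: cont_cst|move=> ?; exact: cvg_id].
pose V s := (\int[leb]_(t in `]0%R, e[) (h' (s + t)%R ^+ 2)%:E)%E.
pose U s := (\int[leb]_(t in `]0%R, e[) g ((s : R) + (t : R))%R)%E.
have V0 s : (0 <= V s)%E by exact: int_sqr_ge0.
have U0 s : (0 <= U s)%E by apply: integral_ge0.
(* Integrate, over the t with s + t in [J], the bound of h(s)^2 by 2 h(s + t)^2 plus the energy of
   the window. *)
have ptw s : ((j * e)%:E * (h s ^+ 2)%:E <= 2%:E * U s + (2 * e ^+ 2)%:E * V s)%E.
  have Vs t : 0 < t < e -> ((h s ^+ 2)%:E <= 2%:E * (h (s + t)%R ^+ 2)%:E + (2 * e)%:E * V s)%E.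
    move=> /andP[t0 te].
    have dS u : is_derive u (1 : R) (fun u => h (s + u)) (h' (s + u)).
      have d1 : is_derive u (1 : R) (fun u => s + u) 1.
        by apply: (is_derive_eq (is_deriveD (is_derive_cst s u 1) (is_derive_id u 1))); rewrite add0r.
      by apply: (is_derive_eq (@is_derive1_comp _ _ _ u _ _ (dh (s + u)) d1)); rewrite mulr1.
    have cS : continuous (fun u => h' (s + u)).
      move=> u; apply: (@continuous_comp _ _ _ (fun u => s + u) h'); last exact: ch'.
      by apply: continuousD; [exact: cst_continuous|exact: cvg_id].
    have := @ftc_sqr R 0 e t 0 _ _ dS cS.
    rewrite addr0 subr0 EFinM; apply; lra.
  have E1 : ((h s ^+ 2)%:E * \int[leb]_(t in `]0%R, e[) (\1_J (s + t)%R)%:E <=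
     \int[leb]_(t in `]0%R, e[) (2%:E * g ((s:R) + (t:R))%R + (2 * e)%:E * V s))%E.
    rewrite -ge0_integralZl//; last 2 first.
    - by apply: measurable_funTS; exact: (mS _ mI).
    - by rewrite lee_fin.
    apply: ge0_le_integral => //.
    - by move=> t _; rewrite mule_ge0 ?lee_fin.
    - by apply: emeasurable_funM => //; apply: measurable_funTS; exact: (mS _ mI).
    - apply: emeasurable_funD => //; apply: emeasurable_funM => //.
      by apply: measurable_funTS; exact: (mS _ mg).
    move=> t /=; rewrite in_itv /= => te; rewrite /g indicE.
    case: (_ \in J) => /=; first by rewrite mule1 mul1e; exact: Vs.
    by rewrite mule0 mul0e mule0 add0e mule_ge0// lee_fin; lra.
  rewrite (@le_trans _ _ ((h s ^+ 2)%:E * \int[leb]_(t in `]0%R, e[) (\1_J (s + t)%R)%:E))%E//.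
    by rewrite muleC lee_wpmul2l ?lee_fin.
  apply: (le_trans E1); rewrite ge0_integralD//; last 3 first.
  - by move=> t _; rewrite mule_ge0.
  - by apply: emeasurable_funM => //; apply: measurable_funTS; exact: (mS _ mg).
  - by move=> t _; rewrite mule_ge0// lee_fin; lra.
  rewrite ge0_integralZl//; last by apply: measurable_funTS; exact: (mS _ mg).
  rewrite integral_cst//= lebesgue_measure_itv /= lte_fin e0 sube0.
  rewrite leeD2l// muleC muleA -EFinM (_ : e * _ = 2 * e ^+ 2)%R//; by ring.
have mV : measurable_fun setT (V : mR -> \bar R).
  apply: (@measurable_vint R (fun=> 0) e (fun x => (h' (x.1 + x.2) ^+ 2)%:E)).
  - exact: cont_cst.
  - apply/measurable_EFinP; apply: continuous_measurable_plane; apply: contX => x.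
    apply: (@continuous_comp _ _ _ (fun x : R * R => x.1 + x.2) h'); last exact: ch'.
    by apply: continuousD; [exact: cvg_fst|exact: cvg_snd].
  - by move=> x; rewrite lee_fin.
have mU : measurable_fun setT (U : mR -> \bar R).
  apply: (@measurable_vint R (fun=> 0) e (fun x => g ((x.1 : R) + (x.2 : R))%R)).
  - exact: cont_cst.
  - apply: (measurableT_comp mg); apply: continuous_measurable_plane.
    by apply: contD => x; [exact: cvg_fst|exact: cvg_snd].
  - by move=> x; exact: g0.
have : (\int[leb]_s ((j * e)%:E * (h s ^+ 2)%:E) <= \int[leb]_s (2%:E * U s + (2 * e ^+ 2)%:E * V s))%E.
  apply: ge0_le_integral => //.
  - by move=> s _; rewrite mule_ge0// lee_fin// mulr_ge0// ltW.
  - by apply: emeasurable_funM.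
  - by apply: emeasurable_funD => //; apply: emeasurable_funM.
rewrite ge0_integralZl//; last 2 first.
- by move=> s _; rewrite lee_fin.
- by rewrite lee_fin mulr_ge0// ltW.
rewrite ge0_integralD//; last 4 first.
- by move=> s _; rewrite mule_ge0.
- by apply: emeasurable_funM.
- by move=> s _; rewrite mule_ge0// lee_fin mulr_ge0// sqr_ge0.
- by apply: emeasurable_funM.
rewrite !ge0_integralZl//; last by rewrite lee_fin mulr_ge0// sqr_ge0.
rewrite /U /V shift_avg//.
rewrite (@shift_avg R e (fun s => (h' s ^+ 2)%:E))//.
rewrite -gE => H.
apply: (ereal_scale e0 _ _ _ H); rewrite ?int_sqr_ge0//.
by rewrite mulr_ge0// sqr_ge0.
Qed.

End one_function.
End smooth_inequalities.

Lemma contP (R : realType) (T : topologicalType) (f g : T -> R) :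
  continuous f -> continuous g -> continuous (fun x => (f x, g x) : R * R).
Proof.
move=> cf cg x.
exact: (@cvg_pair T R R (nbhs x) (nbhs (f x)) (nbhs (g x)) _ _ _ f g (@cf x) (@cg x)).
Qed.

(** * Integration over the bad intervals along slanted rays *)

Section bad_set.
Context {R : realType}.
Local Notation mR := (measurableTypeR R).
Local Notation mR2 := (measurableTypeR R * measurableTypeR R)%type.
Local Notation leb := (@lebesgue_measure R).

Lemma strip_swap (A : set mR) (B T : R) (f : mR2 -> \bar R) : measurable A ->
  measurable_fun setT f -> (forall x, 0 <= f x)%E ->
  (\int[leb]_(a in A) \int[leb]_(b in `]B, T[) f (a, b) =
   \int[leb]_(b in `]B, T[) \int[leb]_(a in A) f (a, b))%E.
Proof.
move=> mA mf f0; pose g := f \_ (A `*` (setT : set mR) : set mR2).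
have mg : measurable_fun setT g by apply: measurable_restrictT => //; exact: measurableX.
have g0 x : (0 <= g x)%E by exact: restrict_ge0.
have gE a b : g (a, b) = if a \in A then f (a, b) else 0%E.
  rewrite /g patchE; suff -> : ((a, b) \in A `*` (setT : set mR)) = (a \in A) by [].
  by apply/idP/idP => /set_mem; [move=> [/= Aa _]; exact/mem_set|move=> Aa; apply/mem_set].
rewrite integral_mkcond.
under [RHS]eq_integral do rewrite integral_mkcond.
transitivity (\int[leb]_a \int[leb]_(b in `]B, T[) g (a, b))%E.
  apply: eq_integral => a _; rewrite patchE; case: ifPn => aA.
    by apply: eq_integral => b _; rewrite gE aA.
  by rewrite integral0_eq// => b _; rewrite gE (negbTE aA).
rewrite -(@integral_upper R (fun=> B) T g (@cont_cst R R B) mg g0) (integral_strip B T mg g0).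
by apply: eq_integral => b _; apply: eq_integral => a _; rewrite gE patchE.
Qed.

Variables (F F1 F2 : R * R -> R).
Hypotheses (cF : continuous F) (cF1 : continuous F1) (cF2 : continuous F2).
Hypotheses (dF1 : forall x, is_derive x (basis ord0) F (F1 x))
  (dF2 : forall x, is_derive x (basis ord_max) F (F2 x)).

Variables (c m t : R) (Bad : set mR).
Hypotheses (c0 : 0 < c) (m0 : 0 < m) (mBad : measurable Bad).
(** Seen from the point y reached at parameter a, this is the share of slopes th whose ray started
    in [Bad]: an interval of width of order m is smeared over a width of order a + m. *)
Hypothesis thin : forall y a : R, 0 < a < c ->
  (\int[leb]_(th in `]0%R, 1%R[) (\1_Bad (y - th * a)%R)%:E <= (3 * m / (a + m))%:E)%E.

(** Two partial derivatives come from the derivative along the ray, the function itself from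
    differentiating the cut-off 1 - a / c; the factor 3 is that of the square of a sum of three
    terms. *)
Let G (x : R * R) : R := 3 * (F1 x ^+ 2 + F2 x ^+ 2 + c^-1 ^+ 2 * F x ^+ 2).

Let cG : continuous G.
Proof.
apply: contM; first exact: cont_cst.
by apply: contD; [apply: contD|apply: contM]; do ?[exact: contX|exact: cont_cst].
Qed.

Let G0 x : 0 <= G x.
Proof.
apply: mulr_ge0 => //; apply: addr_ge0; last by apply: mulr_ge0; exact: sqr_ge0.
by apply: addr_ge0; exact: sqr_ge0.
Qed.

Let L := ln ((c + m) / m).

Let L0 : 0 <= L.
Proof. by rewrite ln_ge0// ler_pdivlMr// mul1r lerDr ltW. Qed.

Let cmap (th : R) : continuous (fun x : R * R => (x.1 + th * x.2, t + x.2) : R * R).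
Proof.
apply: contP.
  apply: contD; first by move=> ?; exact: cvg_fst.
  by apply: contM; [exact: cont_cst|move=> ?; exact: cvg_snd].
by apply: contD; [exact: cont_cst|move=> ?; exact: cvg_snd].
Qed.

Let H (th : R) (x : mR2) : \bar R :=
  ((\1_Bad x.1)%:E * ((`|x.2| + m) * G (x.1 + th * x.2, t + x.2)%R)%:E)%E.

Let mH th : measurable_fun setT (H th).
Proof.
apply: emeasurable_funM.
  apply/measurable_EFinP; apply: (measurableT_comp (measurable_indic mBad)).
  exact: measurable_fst.
apply/measurable_EFinP; apply: continuous_measurable_plane; apply: contM.
  apply: contD; last exact: cont_cst.
  by move=> x; apply: (@continuous_comp _ _ _ snd (fun r : R => `|r|)); [exact: cvg_snd|exact: norm_continuous].
by move=> x; apply: (@continuous_comp _ _ _ _ G); [exact: cmap|exact: cG].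
Qed.

Let P (a : R) : 0 <= `|a| + m. Proof. by rewrite addr_ge0// ltW. Qed.

Let H0 th x : (0 <= H th x)%E.
Proof.
by apply: mule_ge0; rewrite lee_fin; [rewrite indicE ler0n|apply: mulr_ge0; [exact: P|exact: G0]].
Qed.

(** Multiplication by 1 - a / c makes the function vanish at the end of the ray, so that [ray_sqr]
    applies with r = m; the slope and the cut-off are at most 1. *)
Let ray s th : 0 < th < 1 ->
  ((F (s, t) ^+ 2)%:E <=
   L%:E * \int[leb]_(a in `]0%R, c[) ((`|a| + m) * G (s + th * a, t + a)%R)%:E)%E.
Proof.
move=> /andP[th0 th1].
pose f a := (1 - c^-1 * a) * F (s + th * a, t + a).
pose f' a := (1 - c^-1 * a) * (th * F1 (s + th * a, t + a) + F2 (s + th * a, t + a))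
  - c^-1 * F (s + th * a, t + a).
have df a : is_derive a (1 : R) f (f' a).
  have d1 := ray_derive cF1 cF2 dF1 dF2 s t th a.
  have d2 : is_derive a (1 : R) (fun a => 1 - c^-1 * a) (- c^-1).
    have := @is_derive_affine R (- c^-1) 1 a.
    by rewrite (_ : (fun s => _) = (fun a => 1 - c^-1 * a))//; apply/funext => u; ring.
  by apply: (is_derive_eq (is_deriveM d2 d1)); rewrite /f' /GRing.scale /=; ring.
have cl : continuous (fun a : R => (s + th * a, t + a) : R * R).
  apply: contP; last by apply: contD; [exact: cont_cst|move=> ?; exact: cvg_id].
  by apply: contD; [exact: cont_cst|apply: contM; [exact: cont_cst|move=> ?; exact: cvg_id]].
have ccl (K : R * R -> R) : continuous K -> continuous (fun a => K (s + th * a, t + a)).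
  by move=> cK a; apply: (@continuous_comp _ _ _ _ K); [exact: cl|exact: cK].
have cw : continuous (fun a : R => 1 - c^-1 * a).
  by apply: contB; [exact: cont_cst|apply: contM; [exact: cont_cst|move=> ?; exact: cvg_id]].
have cf' : continuous f'.
  apply: contB; last by apply: contM; [exact: cont_cst|exact: ccl].
  apply: contM => //; apply: contD; last exact: ccl.
  by apply: contM; [exact: cont_cst|exact: ccl].
have fc : f c = 0 by rewrite /f mulVf ?gt_eqF// subrr mul0r.
have := ray_sqr m0 c0 df cf' fc.
rewrite {1}/f !mulr0 subr0 mul1r !addr0 => /le_trans; apply.
have cP : continuous (fun a : R => `|a| + m).
  by apply: contD; [exact: norm_continuous|exact: cont_cst].
apply: lee_wpmul2l; first by rewrite lee_fin.
apply: ge0_le_integral => //.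
- by move=> a _; rewrite lee_fin mulr_ge0 ?P ?sqr_ge0.
- by apply: measurable_funTS; apply: measurable_line; apply: contM => //; exact: contX.
- by apply: measurable_funTS; apply: measurable_line; apply: contM => //; exact: ccl.
move=> a /=; rewrite in_itv /= => /andP[a0 ac]; rewrite lee_fin ler_wpM2l//.
rewrite /f' /G; set u := F1 _; set v := F2 _; set w := F _.
have k0 : 0 <= 1 - c^-1 * a by rewrite subr_ge0 mulrC ler_pdivrMr// mul1r ltW.
have k1 : 1 - c^-1 * a <= 1 by rewrite lerBlDr lerDl mulr_ge0 ?invr_ge0 ?ltW.
move: k0 k1; set k := 1 - _ => k0 k1.
have h3 (x y z : R) : (x + y - z) ^+ 2 <= 3 * (x ^+ 2 + y ^+ 2 + z ^+ 2).
  by have := sqr_ge0 (x - y); have := sqr_ge0 (x + z); have := sqr_ge0 (y + z); rewrite !expr2; lra.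
rewrite mulrDr; apply: le_trans (h3 _ _ _) _; rewrite ler_wpM2l// exprMn.
have kk : k ^+ 2 <= 1 by rewrite expr_le1.
have thh : th ^+ 2 <= 1 by rewrite expr_le1// ltW.
rewrite lerD// ?exprMn// lerD//.
  rewrite mulrA -[leRHS]mul1r ler_wpM2r ?sqr_ge0// -[leRHS]mulr1.
  by rewrite ler_pM ?sqr_ge0.
by rewrite -[leRHS]mul1r ler_wpM2r ?sqr_ge0.
Qed.

(** The integrand [H] written in the endpoint y = s + th * a of the ray. The slope now occurs only
    inside the indicator, where [thin] can act. *)
Let M (z : mR2 * mR) : \bar R :=
  ((\1_Bad ((z.2 : R) - (z.1.1 : R) * (z.1.2 : R)))%:E *
   ((`|z.1.2 : R| + m) * G ((z.2 : R), t + (z.1.2 : R)))%:E)%E.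

Let mM : measurable_fun setT M.
Proof.
have m1 : measurable_fun setT (fun z : mR2 * mR => z.1.1 : mR).
  by apply: (measurableT_comp measurable_fst); exact: measurable_fst.
have m2 : measurable_fun setT (fun z : mR2 * mR => z.1.2 : mR).
  by apply: (measurableT_comp measurable_snd); exact: measurable_fst.
have m3 : measurable_fun setT (fun z : mR2 * mR => z.2 : mR) by exact: measurable_snd.
apply: emeasurable_funM.
  apply/measurable_EFinP; apply: (measurableT_comp (measurable_indic mBad)).
  by apply: measurable_funB => //; exact: measurable_funM.
apply/measurable_EFinP.
have cK : continuous (fun x : R * R => (`|x.2| + m) * G (x.1, t + x.2)).
  apply: contM.
    apply: contD; last exact: cont_cst.
    by move=> x; apply: (@continuous_comp _ _ _ snd (fun r : R => `|r|)); [exact: cvg_snd|exact: norm_continuous].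
  move=> x; apply: (@continuous_comp _ _ _ (fun x : R * R => (x.1, t + x.2)) G); last exact: cG.
  apply: contP; first by move=> ?; exact: cvg_fst.
  by apply: contD; [exact: cont_cst|move=> ?; exact: cvg_snd].
apply: (measurableT_comp (continuous_measurable_plane cK) (measurable_fun_pair m3 m2)).
Qed.

Let M0 z : (0 <= M z)%E.
Proof.
by apply: mule_ge0; rewrite lee_fin; [rewrite indicE ler0n|apply: mulr_ge0; [exact: P|exact: G0]].
Qed.

(** For a fixed slope and a fixed a, passing from s to y = s + th * a is a translation of the
    line. *)
Let slice th : 0 < th < 1 ->
  (\int[leb]_(s in Bad) (F (s, t) ^+ 2)%:E <=
   L%:E * \int[leb]_(a in `]0%R, c[) \int[leb]_y M ((th, a), y))%E.
Proof.
move=> th01.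
apply: (@le_trans _ _ (\int[leb]_s (L%:E * \int[leb]_(a in `]0%R, c[) H th (s, a))))%E.
  rewrite integral_mkcond; apply: ge0_le_integral => //.
  - by move=> s _; apply: restrict_ge0 => {}s; rewrite lee_fin sqr_ge0.
  - apply: measurable_restrictT => //; apply: (@measurable_line R (fun s => F (s, t) ^+ 2)).
    by apply: contX; exact: cont_hline.
  - apply: emeasurable_funM => //.
    exact: (@measurable_vint R (fun=> 0) c (H th) (@cont_cst R R 0) (mH th) (H0 th)).
  - move=> s _; rewrite patchE; case: ifPn => sB; last first.
      by rewrite mule_ge0 ?lee_fin//; apply: integral_ge0.
    apply: (le_trans (ray s th01)); rewrite le_eqVlt; apply/orP; left; apply/eqP; congr (_ * _)%E.
    by apply: eq_integral => a _; rewrite /H /= indicE sB mul1e.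
rewrite (ge0_integralZl leb measurableT); last 3 first.
- exact: (@measurable_vint R (fun=> 0) c (H th) (@cont_cst R R 0) (mH th) (H0 th)).
- by move=> s _; apply: integral_ge0.
- by rewrite lee_fin.
apply: lee_wpmul2l; first by rewrite lee_fin.
rewrite -(@integral_upper R (fun=> 0) c (H th) (@cont_cst R R 0) (mH th) (H0 th)) (integral_strip 0 c (mH th) (H0 th)).
rewrite le_eqVlt; apply/orP; left; apply/eqP; apply: eq_integral => a _.
have mHa : measurable_fun setT (fun s : mR => H th (s, a)).
  exact: (measurable_fun_pair1 _ (mH th)).
rewrite (ge0_integral_shift (- (th * a)) mHa)//.
by apply: eq_integral => y _; rewrite /H /M /= subrK.
Qed.

Lemma bad_set_estimate :
  (\int[leb]_(s in Bad) (F (s, t) ^+ 2)%:E <=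
   (3 * m * L)%:E * \int[leb]_(a in `]0%R, c[) \int[leb]_s (G (s, t + a)%R)%:E)%E.
Proof.
pose Phi (x : mR2) := (\int[leb]_y M (x, y))%E.
have mPhi : measurable_fun setT Phi by exact: (@measurable_fun_fubini_tonelli_F _ _ _ _ _ leb M mM M0).
have Phi0 x : (0 <= Phi x)%E by apply: integral_ge0.
(* The left-hand side does not depend on the slope, so it equals its average over 0 < th < 1. *)
have LE : (\int[leb]_(s in Bad) (F (s, t) ^+ 2)%:E =
    \int[leb]_(th in `]0%R, 1%R[) \int[leb]_(s in Bad) (F (s, t) ^+ 2)%:E)%E.
  by rewrite integral_cst//= lebesgue_measure_itv /= lte_fin ltr01 sube0 mule1.
rewrite LE.
have mI := @measurable_vint R (fun=> 0) c Phi (@cont_cst R R 0) mPhi Phi0.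
apply: (@le_trans _ _ (\int[leb]_(th in `]0%R, 1%R[) (L%:E * \int[leb]_(a in `]0%R, c[) Phi (th, a))))%E.
  apply: ge0_le_integral => //.
  - by move=> th _; apply: int_sqr_ge0.
  - by apply: measurable_funTS; apply: emeasurable_funM.
rewrite ge0_integralZl//; last 2 first.
- exact: measurable_funTS.
- by move=> th _; apply: integral_ge0.
rewrite (mulrC (3 * m)) EFinM -muleA; apply: lee_wpmul2l; first by rewrite lee_fin.
rewrite strip_swap//.
have cGa a : continuous (fun s => G (s, t + a)) by exact: cont_hline.
have mGa : measurable_fun setT (fun a : mR => \int[leb]_s (G (s, t + (a : R))%R)%:E)%E.
  apply: (@measurable_hint R (fun x : mR2 => (G (x.1, t + (x.2 : R))%R)%:E)); last by move=> x; rewrite lee_fin.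
  apply/measurable_EFinP; apply: continuous_measurable_plane => x.
  apply: (@continuous_comp _ _ _ (fun x : R * R => (x.1, t + x.2)) G); last exact: cG.
  apply: contP; first by move=> ?; exact: cvg_fst.
  by apply: contD; [exact: cont_cst|move=> ?; exact: cvg_snd].
rewrite -ge0_integralZl//; last 3 first.
- exact: measurable_funTS.
- by move=> a _; apply: integral_ge0 => s _; rewrite lee_fin.
- by rewrite lee_fin mulr_ge0// ltW.
apply: ge0_le_integral; first exact: measurable_itv.
- by move=> a _; apply: integral_ge0.
- apply: measurable_funTS.
  have mPhi' : measurable_fun setT (fun x : mR2 => Phi (x.2, x.1)).
    by apply: (measurableT_comp mPhi); apply: measurable_fun_pair;
      [exact: measurable_snd|exact: measurable_fst].
  exact: (@measurable_vint R (fun=> 0) 1 (fun x => Phi (x.2, x.1)) (@cont_cst R R 0) mPhi' (fun x => Phi0 _)).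
- by apply: measurable_funTS; apply: emeasurable_funM.
move=> a /=; rewrite in_itv /= => a0c.
have mMa : measurable_fun setT (fun x : mR2 => M ((x.2, a), x.1)).
  apply: (measurableT_comp mM); apply: measurable_fun_pair; last exact: measurable_fst.
  by apply: measurable_fun_pair => //; exact: measurable_snd.
rewrite /Phi -(@strip_swap setT 0 1 (fun x : mR2 => M ((x.2, a), x.1)))//.
rewrite -ge0_integralZl//; last 3 first.
- exact: measurable_line.
- by move=> s _; rewrite lee_fin.
- by rewrite lee_fin mulr_ge0// ltW.
apply: ge0_le_integral => //.
- by move=> y _; apply: integral_ge0.
- exact: (@measurable_vint R (fun=> 0) 1 (fun x : mR2 => M ((x.2, a), x.1)) (@cont_cst R R 0) mMa (fun x => M0 _)).
- by apply: emeasurable_funM => //; exact: measurable_line.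
move=> y _; rewrite /M /=.
have P1 : 0 < a + m by case/andP: a0c => a0 _; rewrite addr_gt0.
have aE : `|a| = a by case/andP: a0c => a0 _; rewrite ger0_norm// ltW.
rewrite ge0_integralZr//; last 2 first.
- apply/measurable_EFinP; apply: measurable_funTS.
  apply: (measurableT_comp (measurable_indic mBad)).
  apply: (@continuous_measurable_fun R (fun th => y - th * a)).
  by apply: contB; [exact: cont_cst|apply: contM; [move=> ?; exact: cvg_id|exact: cont_cst]].
- by rewrite lee_fin; apply: mulr_ge0; [exact: P|exact: G0].
(* [thin] supplies 3 m / (a + m), and the weight a + m cancels the denominator; only the constant 3
   m is left. *)
apply: (@le_trans _ _ ((3 * m / (a + m))%:E * ((`|a| + m) * G (y, t + a))%:E)%E).
  by apply: lee_wpmul2r; [rewrite lee_fin; apply: mulr_ge0; [exact: P|exact: G0]|exact: thin].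
by rewrite -!EFinM lee_fin aE mulrA divfK ?gt_eqF.
Qed.

End bad_set.

(** * The layer estimate for smooth functions *)

Section layer.
Context {R : realType}.
Local Notation mR := (measurableTypeR R).
Local Notation mR2 := (measurableTypeR R * measurableTypeR R)%type.
Local Notation leb := (@lebesgue_measure R).

Lemma integral_itv_shift (t c : R) (g : mR -> \bar R) : measurable_fun setT g ->
  (forall s, 0 <= g s)%E ->
  (\int[leb]_(a in `]0%R, c[) g (t + a)%R = \int[leb]_(a in `]t, (t + c)%R[) g a)%E.
Proof.
move=> mg g0; rewrite [RHS]integral_mkcond (ge0_integral_shift t); last 2 first.
- by apply: measurable_restrictT => //; exact: measurable_itv.
- exact: restrict_ge0.
rewrite integral_mkcond; apply: eq_integral => a _; rewrite !patchE addrC.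
suff -> : ((a : R) + t \in (`]t, t + c[%classic : set mR)) = (a \in (`]0%R, c[%classic : set mR)) by [].
by apply/idP/idP => /set_mem /=; rewrite in_itv /= => h; apply/mem_set; rewrite /= in_itv /=; lra.
Qed.

(** Above the crest level [B] whole horizontal lines lie in the domain, so Tonelli can be used with
    the height as the outer variable. *)
Lemma strip_le_upper (p : R -> R) (B T d : R) (f : mR2 -> \bar R) : continuous p ->
  (forall s, p s <= B) -> T <= d -> measurable_fun setT f -> (forall x, 0 <= f x)%E ->
  (\int[leb]_(t in `]B, T[) \int[leb]_s f (s, t) <= \int[area]_(x in upper d p) f x)%E.
Proof.
move=> cp pB Td mf f0; rewrite -(integral_strip B T mf f0).
apply: ge0_subset_integral.
- exact: (@upper_measurable R T (fun=> B) (@cont_cst R R B)).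
- exact: upper_measurable.
- exact: measurable_funTS.
- by move=> x _; exact: f0.
- by move=> x; rewrite /upper /= => /andP[h1 h2]; have := pB x.1; lra.
Qed.

(** The smooth functions of this part may have infinite energy, so the bookkeeping is done in the
    extended reals, with non-negative constants only. *)
Lemma ereal_combine (H j T k l q : R) (X Y Q N : \bar R) :
  0 <= H -> 0 <= j -> 0 <= T -> 0 <= k -> 0 <= l -> 0 <= q ->
  (0 <= Y -> 0 <= Q -> 0 <= N ->
  H%:E * X <= T%:E * Y + k%:E * N -> j%:E * Y <= q%:E * Q + l%:E * N ->
  (j * H)%:E * X <= (T * q)%:E * Q + (T * l + k * j)%:E * N)%E.
Proof.
move=> H0 j0 T0 k0 l0 q0 Y0 Q0 N0 h1 h2.
rewrite EFinM -muleA; apply: (le_trans (lee_wpmul2l _ h1)); first by rewrite lee_fin.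
rewrite ge0_muleDr ?mule_ge0 ?lee_fin// muleCA.
rewrite EFinD ge0_muleDl ?lee_fin ?mulr_ge0// addeA leeD//; last first.
  by rewrite muleA -EFinM mulrC.
apply: (le_trans (lee_wpmul2l _ h2)); first by rewrite lee_fin.
by rewrite ge0_muleDr ?mule_ge0 ?lee_fin// !muleA -!EFinM.
Qed.

Lemma ereal_regroup1 (T k : R) (Q N : \bar R) : 0 <= T -> 0 <= k ->
  (0 <= Q -> 0 <= N ->
   4%:E * Q + (4 * T + 2 * k)%:E * N = 2%:E * ((2%:E * Q + (2 * T)%:E * N) + k%:E * N))%E.
Proof.
move=> T0 k0 Q0 N0; have T20 : 0 <= 2 * T by rewrite mulr_ge0.
have a0 : (0 <= 2%:E * Q)%E by rewrite mule_ge0 ?lee_fin.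
have b0 : (0 <= (2 * T)%:E * N)%E by rewrite mule_ge0 ?lee_fin.
have c0 : (0 <= k%:E * N)%E by rewrite mule_ge0 ?lee_fin.
rewrite (ge0_muleDr _ (adde_ge0 a0 b0) c0) (ge0_muleDr _ a0 b0) !muleA -!EFinM -addeA.
rewrite -ge0_muleDl ?lee_fin ?mulr_ge0// -EFinD.
by congr (_%:E * _ + _%:E * _)%E; ring.
Qed.

Lemma ereal_regroup2 (H l k : R) (Q N : \bar R) : 0 <= H -> 0 <= l -> 0 <= k ->
  (0 <= Q -> 0 <= N ->
   (4 * H)%:E * Q + (H * l + k)%:E * N = (4%:E * Q + l%:E * N) * H%:E + k%:E * N)%E.
Proof.
move=> H0 l0 k0 Q0 N0.
have a0 : (0 <= 4%:E * Q)%E by rewrite mule_ge0 ?lee_fin.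
have b0 : (0 <= l%:E * N)%E by rewrite mule_ge0 ?lee_fin.
rewrite EFinD ge0_muleDl ?lee_fin ?mulr_ge0// addeA; congr (_ + _)%E.
by rewrite [RHS]muleC (ge0_muleDr _ a0 b0) !muleA -!EFinM (mulrC 4).
Qed.

Lemma ereal_regroup3 (T x : R) (v : \bar R) : 0 <= T -> 0 <= x -> (0 <= v ->
   T%:E * ((2 * x)%:E + (2 * T)%:E * v) = (2 * T)%:E * x%:E + (2 * T ^+ 2)%:E * v)%E.
Proof.
move=> T0 x0 v0; rewrite ge0_muleDr; last 2 first.
- by rewrite lee_fin mulr_ge0.
- by rewrite mule_ge0// lee_fin mulr_ge0.
by rewrite muleA -!EFinM; congr (_%:E + _%:E * _)%E; ring.
Qed.

Variables (F F1 F2 : R * R -> R).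
Hypotheses (cF : continuous F) (cF1 : continuous F1) (cF2 : continuous F2).
Hypotheses (dF1 : forall x, is_derive x (basis ord0) F (F1 x))
  (dF2 : forall x, is_derive x (basis ord_max) F (F2 x)).

Let E (x : R * R) : R := F1 x ^+ 2 + F2 x ^+ 2 + F x ^+ 2.

Let cE : continuous E. Proof. by apply: contD; [apply: contD|]; exact: contX. Qed.

Let E0 x : 0 <= E x. Proof. by apply: addr_ge0; [apply: addr_ge0|]; exact: sqr_ge0. Qed.

Let mE : measurable_fun setT (fun x : mR2 => (E x)%:E).
Proof. by apply/measurable_EFinP; exact: continuous_measurable_plane. Qed.

Variables (p : R -> R) (B T d : R).
Hypotheses (cp : continuous p) (p0 : forall s, 0 <= p s) (pB : forall s, p s <= B)
  (BT : B < T) (Td : T <= d).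

Let N : \bar R := (\int[area]_(x in upper d p) (E x)%:E)%E.

Let N0 : (0 <= N)%E.
Proof. by apply: integral_ge0 => x _; rewrite lee_fin. Qed.

Let B0 : 0 <= B. Proof. exact: le_trans (p0 0) (pB 0). Qed.
Let T0 : 0 < T. Proof. exact: le_lt_trans B0 BT. Qed.

(** The rays start above the crests and climb by c, hence stay in the domain because T + c <= d. The
    9 is 3 from the spreading times 3 from the definition of the energy along the ray. *)
Lemma bad_set_upper (c m : R) (Bad : set mR) : 0 < c -> 0 < m -> measurable Bad ->
  (forall y a : R, 0 < a < c ->
    (\int[leb]_(th in `]0%R, 1%R[) (\1_Bad (y - th * a)%R)%:E <= (3 * m / (a + m))%:E)%E) ->
  T + c <= d -> forall t, B < t < T ->
  (\int[leb]_(s in Bad) (F (s, t) ^+ 2)%:E <=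
    (9 * (1 + c^-1 ^+ 2) * (m * ln ((c + m) / m)))%:E * N)%E.
Proof.
move=> c0 m0 mBad thin Tc t /andP[Bt tT].
apply: (le_trans (bad_set_estimate cF cF1 cF2 dF1 dF2 t c0 m0 mBad thin)).
have L0 : 0 <= ln ((c + m) / m) by rewrite ln_ge0// ler_pdivlMr// mul1r lerDr ltW.
rewrite (_ : 9 * _ * _ = (3 * m * ln ((c + m) / m)) * (3 * (1 + c^-1 ^+ 2))); last by ring.
set q := 3 * m * _; rewrite (EFinM q) -muleA; apply: lee_wpmul2l.
  by rewrite lee_fin /q mulr_ge0// mulr_ge0// ltW.
pose k := 3 * (1 + c^-1 ^+ 2).
have k0 : 0 <= k by rewrite mulr_ge0// addr_ge0// sqr_ge0.
have mkE : measurable_fun setT (fun x : mR2 => (k * E x)%:E).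
  by apply/measurable_EFinP; apply: continuous_measurable_plane; apply: contM => //; exact: cont_cst.
have kE0 x : (0 <= (k * E x)%:E)%E by rewrite lee_fin mulr_ge0.
have -> : (k%:E * N = \int[area]_(x in upper d p) (k * E x)%:E)%E.
  rewrite /N -ge0_integralZl//; first exact: upper_measurable.
    exact: measurable_funTS.
  by move=> x _; rewrite lee_fin.
apply: (@le_trans _ _ (\int[leb]_(a in `]0%R, c[) \int[leb]_s (k * E (s, t + a)%R)%:E)%E).
  have cta : continuous (fun x : R * R => (x.1, t + x.2) : R * R).
    apply: contP; first by move=> ?; exact: cvg_fst.
    by apply: contD; [exact: cont_cst|move=> ?; exact: cvg_snd].
  have mh (K : R * R -> R) : continuous K -> (forall x, 0 <= K x) ->
      measurable_fun setT (fun a : mR => \int[leb]_s (K (s, t + (a : R))%R)%:E)%E.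
    move=> cK K0; apply: (@measurable_hint R (fun x : mR2 => (K (x.1, t + (x.2 : R))%R)%:E)).
      apply/measurable_EFinP; apply: continuous_measurable_plane => x.
      by apply: (@continuous_comp _ _ _ _ K); [exact: cta|exact: cK].
    by move=> x; rewrite lee_fin.
  apply: ge0_le_integral; first exact: measurable_itv.
  - move=> a _; apply: integral_ge0 => s _; rewrite lee_fin mulr_ge0//.
    by apply: addr_ge0; [apply: addr_ge0|apply: mulr_ge0]; exact: sqr_ge0.
  - apply: measurable_funTS; apply: (mh (fun x => 3 * (F1 x ^+ 2 + F2 x ^+ 2 + c^-1 ^+ 2 * F x ^+ 2))).
      apply: contM; first exact: cont_cst.
      by apply: contD; [apply: contD|apply: contM]; do ?[exact: contX|exact: cont_cst].
    move=> x; apply: mulr_ge0 => //.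
    by apply: addr_ge0; [apply: addr_ge0|apply: mulr_ge0]; exact: sqr_ge0.
  - apply: measurable_funTS; apply: (mh (fun x => k * E x)); last by move=> x; exact: mulr_ge0.
    by apply: contM => //; exact: cont_cst.
  move=> a _; apply: ge0_le_integral => //.
  - move=> s _; rewrite lee_fin mulr_ge0//.
    by apply: addr_ge0; [apply: addr_ge0|apply: mulr_ge0]; exact: sqr_ge0.
  - apply: measurable_line; apply: contM; first exact: cont_cst.
    apply: contD; first by apply: contD; apply: contX; exact: cont_hline.
    by apply: contM; [exact: cont_cst|apply: contX; exact: cont_hline].
  - by apply: measurable_line; apply: contM; [exact: cont_cst|exact: cont_hline].
  move=> s _; rewrite lee_fin /k /E -mulrA ler_wpM2l//.
  have := sqr_ge0 (F1 (s, t + a)); have := sqr_ge0 (F2 (s, t + a)); have := sqr_ge0 (F (s, t + a)).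
  move: (F1 _ ^+ 2) (F2 _ ^+ 2) (F _ ^+ 2) (sqr_ge0 c^-1) => x y z; move: (c^-1 ^+ 2) => w w0 z0 y0 x0.
  have := mulr_ge0 w0 x0; have := mulr_ge0 w0 y0; lra.
have mg : measurable_fun setT (fun a : mR => \int[leb]_s (k * E (s, a))%:E)%E.
  exact: (@measurable_hint R (fun x : mR2 => (k * E x)%:E)).
rewrite (@integral_itv_shift t c (fun a => \int[leb]_s (k * E (s, a))%:E)%E)//; last first.
  by move=> a; apply: integral_ge0.
apply: (@strip_le_upper p t (t + c) d (fun x => (k * E x)%:E)) => //; last by lra.
by move=> s; apply: le_trans (pB s) (ltW Bt).
Qed.

Variables (e j kap : R) (J Bad : set mR).
Hypotheses (e0 : 0 < e) (j0 : 0 < j) (kap0 : 0 <= kap)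
  (mJ : measurable J) (mBad : measurable Bad).
Hypothesis HJ : forall s : R,
  ((j * e)%:E <= \int[leb]_(t in `]0%R, e[) (\1_J (s + t)%R)%:E)%E.
Hypothesis Hbad : forall t, B < t < T ->
  (\int[leb]_(s in Bad) (F (s, t) ^+ 2)%:E <= kap%:E * N)%E.

Let Q : \bar R := (\int[leb]_(s in J `\` Bad) (F (s, p s) ^+ 2)%:E)%E.

Let V (s : mR) : \bar R := (\int[leb]_(y in `]p s, T[) (F2 (s, y) ^+ 2)%:E)%E.

Let V0 s : (0 <= V s)%E. Proof. exact: int_sqr_ge0. Qed.

Let mV : measurable_fun setT V.
Proof.
apply: (@measurable_vint R p T (fun x => (F2 x ^+ 2)%:E) cp (sqr_measurable_plane cF2)).
by move=> x; rewrite lee_fin sqr_ge0.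
Qed.

Let VN : (\int[leb]_s V s <= N)%E.
Proof.
rewrite -(@integral_upper R p T (fun x => (F2 x ^+ 2)%:E) cp (sqr_measurable_plane cF2)); last first.
  by move=> x; rewrite lee_fin sqr_ge0.
apply: (@le_trans _ _ (\int[area]_(x in upper T p) (E x)%:E)%E).
  apply: ge0_le_integral.
  - exact: upper_measurable.
  - by move=> x _; rewrite lee_fin sqr_ge0.
  - by apply: measurable_funTS; exact: sqr_measurable_plane.
  - exact: measurable_funTS.
  - by move=> x _; rewrite lee_fin /E; have := sqr_ge0 (F1 x); have := sqr_ge0 (F x); lra.
apply: ge0_subset_integral.
- exact: upper_measurable.
- exact: upper_measurable.
- exact: measurable_funTS.
- by move=> x _; rewrite lee_fin.
- by move=> x; rewrite /upper /= => /andP[-> h2] /=; exact: lt_le_trans h2 Td.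
Qed.

Let vert s x y : p s <= x <= T -> p s <= y <= T ->
  ((F (s, y) ^+ 2)%:E <= (2 * F (s, x) ^+ 2)%:E + (2 * T)%:E * V s)%E.
Proof.
move=> hx hy.
have := @ftc_sqr R (p s) T x y _ _ (dline2 dF2 s) (@cont_vline R F2 s cF2) hx hy.
move=> /le_trans; apply; apply: leeD2l; apply: lee_wpmul2r; first exact: V0.
by rewrite lee_fin; have := p0 s; lra.
Qed.

Let mFh t : measurable_fun setT (fun s : mR => (F (s, t) ^+ 2)%:E).
Proof. by apply: (@measurable_line R (fun s => F (s, t) ^+ 2)); apply: contX; exact: cont_hline. Qed.

Let mFp : measurable_fun setT (fun s : mR => (F (s, p s) ^+ 2)%:E).
Proof.
apply: (@measurable_line R (fun s => F (s, p s) ^+ 2)); apply: contX => s.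
apply: (@continuous_comp _ _ _ (fun s => (s, p s)) F); last exact: cF.
by apply: (@contP R R id p) => // ?; exact: cvg_id.
Qed.

(** On the good part of [J] the value at height t is compared with the value on the graph, down the
    same column. *)
Let good t : B < t < T ->
  (\int[leb]_(s in J `\` Bad) (F (s, t) ^+ 2)%:E <= 2%:E * Q + (2 * T)%:E * N)%E.
Proof.
move=> /andP[Bt tT]; have mD : measurable (J `\` Bad) by exact: measurableD.
apply: (@le_trans _ _ (\int[leb]_(s in J `\` Bad) (2%:E * (F (s, p s) ^+ 2)%:E + (2 * T)%:E * V s))%E).
  apply: ge0_le_integral => //.
  - by move=> s _; rewrite lee_fin sqr_ge0.
  - exact: measurable_funTS.
  - by apply: measurable_funTS; apply: emeasurable_funD; apply: emeasurable_funM.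
  - move=> s _; rewrite -EFinM; apply: vert; have := pB s; lra.
rewrite ge0_integralD//; last 4 first.
- by move=> s _; rewrite mule_ge0// lee_fin sqr_ge0.
- by apply: measurable_funTS; apply: emeasurable_funM.
- by move=> s _; rewrite mule_ge0// lee_fin mulr_ge0// ltW.
- by apply: measurable_funTS; apply: emeasurable_funM.
rewrite (ge0_integralZl leb mD); last 3 first.
- exact: measurable_funTS.
- by move=> s _; rewrite lee_fin sqr_ge0.
- by rewrite lee_fin.
rewrite (ge0_integralZl leb mD); last 3 first.
- exact: measurable_funTS.
- by move=> s _.
- by rewrite lee_fin mulr_ge0// ltW.
apply: leeD2l; apply: lee_wpmul2l; first by rewrite lee_fin mulr_ge0// ltW.
apply: le_trans VN; apply: ge0_subset_integral => //.
Qed.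

(** Heights are restricted to B < t < T because lower horizontal lines may leave the domain. The
    values on [J] are split into a good part, controlled from the graph, and a bad part, controlled
    by [Hbad]. *)
Let line t : B < t < T ->
  (j%:E * \int[leb]_s (F (s, t) ^+ 2)%:E <=
   4%:E * Q + (4 * T + 2 * kap)%:E * N + (2 * e ^+ 2)%:E * \int[leb]_s (F1 (s, t) ^+ 2)%:E)%E.
Proof.
move=> Bt.
have := @horizontal_avg R (fun s => F (s, t)) (fun s => F1 (s, t)) J e j e0
  (fun s => dline1 dF1 s t) (@cont_hline R F1 t cF1) mJ HJ (ltW j0).
move=> /le_trans; apply; apply: leeD2r.
have Q0 : (0 <= Q)%E by exact: int_sqr_ge0.
rewrite (ereal_regroup1 (ltW T0) kap0 Q0 N0).
apply: lee_wpmul2l; first by rewrite lee_fin.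
apply: le_trans (leeD (good Bt) (Hbad Bt)).
apply: (@le_trans _ _ (\int[leb]_(s in (J `\` Bad) `|` Bad) (F (s, t) ^+ 2)%:E)%E).
  apply: ge0_subset_integral => //.
  - by apply: measurableU => //; exact: measurableD.
  - exact: measurable_funTS.
  - by move=> s _; rewrite lee_fin sqr_ge0.
  - by move=> s Js; case: (pselect (Bad s)) => Bs; [right|left].
rewrite ge0_integral_setU//; first exact: measurableD.
- exact: measurable_funTS.
- by move=> s _; rewrite lee_fin sqr_ge0.
- by apply/disj_setPS => s [[_ nB] B'].
Qed.

Let X (s : mR) : \bar R := (\int[leb]_(y in `]p s, T[) (F (s, y) ^+ 2)%:E)%E.

Let X0 s : (0 <= X s)%E. Proof. exact: int_sqr_ge0. Qed.

Let mX : measurable_fun setT X.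
Proof.
apply: (@measurable_vint R p T (fun x => (F x ^+ 2)%:E) cp (sqr_measurable_plane cF)).
by move=> x; rewrite lee_fin sqr_ge0.
Qed.

Let Y (s : mR) : \bar R := (\int[leb]_(t in `]B, T[) (F (s, t) ^+ 2)%:E)%E.

(** Below the crests the function is reached vertically, from its values at the heights B < t < T of
    the same column, over which the bound is averaged. *)
Let column s : ((T - B)%:E * X s <= (2 * T)%:E * Y s + (2 * T ^+ 2 * (T - B))%:E * V s)%E.
Proof.
have XI t : B < t < T -> (X s <= T%:E * ((2 * F (s, t) ^+ 2)%:E + (2 * T)%:E * V s))%E.
  move=> /andP[Bt tT]; set k := ((2 * _)%:E + _)%E.
  have k0 : (0 <= k)%E.
    by rewrite adde_ge0// ?mule_ge0// lee_fin mulr_ge0// ?sqr_ge0// ltW.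
  apply: (@le_trans _ _ (\int[leb]_(y in `]p s, T[) k)%E).
    apply: ge0_le_integral => //.
    - by move=> y _; rewrite lee_fin sqr_ge0.
    - apply: measurable_funTS; apply: (@measurable_line R (fun y => F (s, y) ^+ 2)).
      by apply: contX; exact: cont_vline.
    - move=> y /=; rewrite in_itv /= => /andP[y1 y2]; apply: vert; have := pB s; lra.
  rewrite integral_cst//= lebesgue_measure_itv /= lte_fin muleC.
  case: ifP => _; last by rewrite mul0e mule_ge0// lee_fin ltW.
  by apply: lee_wpmul2r => //; rewrite -EFinB lee_fin; have := p0 s; lra.
have mFv : measurable_fun setT (fun t : mR => (F (s, t) ^+ 2)%:E).
  by apply: (@measurable_line R (fun y => F (s, y) ^+ 2)); apply: contX; exact: cont_vline.
have : (\int[leb]_(t in `]B, T[) X s <=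
    \int[leb]_(t in `]B, T[) ((2 * T)%:E * (F (s, t) ^+ 2)%:E + (2 * T ^+ 2)%:E * V s))%E.
  apply: ge0_le_integral => //.
  - by apply: measurable_funTS; apply: emeasurable_funD; apply: emeasurable_funM.
  - move=> t /=; rewrite in_itv /= => /XI /le_trans; apply.
    by rewrite (ereal_regroup3 (ltW T0) (sqr_ge0 _) (V0 s)).
rewrite integral_cst//= lebesgue_measure_itv /= lte_fin BT -EFinB muleC => /le_trans; apply.
rewrite ge0_integralD//; last 3 first.
- by move=> t _; rewrite mule_ge0// lee_fin ?sqr_ge0// mulr_ge0// ltW.
- by apply: measurable_funTS; apply: emeasurable_funM.
- by move=> t _; rewrite mule_ge0// lee_fin mulr_ge0// sqr_ge0.
rewrite (ge0_integralZl leb (measurable_itv _)); last 3 first.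
- exact: measurable_funTS.
- by move=> t _; rewrite lee_fin sqr_ge0.
- by rewrite lee_fin mulr_ge0// ltW.
rewrite integral_cst//= lebesgue_measure_itv /= lte_fin BT -EFinB.
by rewrite leeD2l// muleC muleA -EFinM (mulrC (T - B)).
Qed.

(** [column] reduces the layer to the band B < t < T, and [line] treats the band. The factor j (T -
    B) stays on the left to avoid divisions in the extended reals. *)
Lemma layer_smooth :
  ((j * (T - B))%:E * \int[area]_(x in upper T p) (F x ^+ 2)%:E <=
   (2 * T * (4 * (T - B)))%:E * Q +
   (2 * T * ((T - B) * (4 * T + 2 * kap) + 2 * e ^+ 2) + 2 * T ^+ 2 * (T - B) * j)%:E * N)%E.
Proof.
have H0 : 0 < T - B by rewrite subr_gt0.
have Q0 : (0 <= Q)%E by exact: int_sqr_ge0.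
have Fs0 x : (0 <= (F x ^+ 2)%:E)%E by rewrite lee_fin sqr_ge0.
have F1s0 x : (0 <= (F1 x ^+ 2)%:E)%E by rewrite lee_fin sqr_ge0.
have mF := sqr_measurable_plane cF; have mF1 := sqr_measurable_plane cF1.
have mY : measurable_fun setT Y.
  exact: (@measurable_vint R (fun=> B) T (fun x => (F x ^+ 2)%:E) (@cont_cst R R B) mF).
have Y0 s : (0 <= Y s)%E by exact: int_sqr_ge0.
have T20 : 0 <= 2 * T ^+ 2 * (T - B) by rewrite mulr_ge0 ?mulr_ge0 ?sqr_ge0// ltW.
have h1 : 0 <= T - B by exact: ltW.
have h3 : 0 <= 2 * T by rewrite mulr_ge0// ltW.
have e20 : 0 <= 2 * e ^+ 2 by rewrite mulr_ge0// sqr_ge0.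
have h5 : 0 <= (T - B) * (4 * T + 2 * kap) + 2 * e ^+ 2.
  by rewrite addr_ge0// mulr_ge0// addr_ge0// mulr_ge0// ltW.
have h6 : 0 <= 4 * (T - B) by rewrite mulr_ge0.
have Y1 : (0 <= \int[leb]_s Y s)%E by apply: integral_ge0.
apply: (@ereal_combine (T - B) j (2 * T) _ _ _ _ (\int[leb]_s Y s)%E Q N h1 (ltW j0) h3 T20 h5 h6 Y1 Q0 N0).
- rewrite (@integral_upper R p T (fun x => (F x ^+ 2)%:E) cp mF Fs0).
  have : (\int[leb]_s ((T - B)%:E * X s) <=
      \int[leb]_s ((2 * T)%:E * Y s + (2 * T ^+ 2 * (T - B))%:E * V s))%E.
    apply: ge0_le_integral => //.
    + by move=> s _; rewrite mule_ge0// lee_fin ltW.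
    + exact: emeasurable_funM.
    + by apply: emeasurable_funD; exact: emeasurable_funM.
  rewrite ge0_integralD//; last 4 first.
  + by move=> s _; rewrite mule_ge0// lee_fin mulr_ge0// ltW.
  + exact: emeasurable_funM.
  + by move=> s _; rewrite mule_ge0// lee_fin.
  + exact: emeasurable_funM.
  rewrite !(ge0_integralZl leb measurableT)//; do ?[by rewrite lee_fin ?mulr_ge0// ltW].
  move=> /le_trans; apply; apply: leeD2l; apply: lee_wpmul2l => //.
rewrite -(@integral_upper R (fun=> B) T (fun x => (F x ^+ 2)%:E) (@cont_cst R R B) mF Fs0).
rewrite (integral_strip B T mF Fs0).
have mI1 : measurable_fun setT (fun t : mR => \int[leb]_s (F (s, t) ^+ 2)%:E)%E.
  exact: (measurable_hint mF Fs0).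
have mI2 : measurable_fun setT (fun t : mR => \int[leb]_s (F1 (s, t) ^+ 2)%:E)%E.
  exact: (measurable_hint mF1 F1s0).
have I0 (K : R * R -> R) t : (0 <= \int[leb]_s (K (s, t) ^+ 2)%:E)%E by exact: int_sqr_ge0.
set W := (4%:E * Q + (4 * T + 2 * kap)%:E * N)%E.
have W0 : (0 <= W)%E.
  apply: adde_ge0; apply: mule_ge0 => //; rewrite lee_fin//.
  by rewrite addr_ge0// mulr_ge0// ltW.
rewrite -(ge0_integralZl leb); last 4 first.
- exact: measurable_itv.
- exact: measurable_funTS.
- by move=> t _.
- by rewrite lee_fin ltW.
apply: (@le_trans _ _ (\int[leb]_(t in `]B, T[) (W + (2 * e ^+ 2)%:E * \int[leb]_s (F1 (s, t) ^+ 2)%:E))%E).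
  apply: ge0_le_integral => //.
  - by move=> t _; rewrite mule_ge0// lee_fin ltW.
  - by apply: measurable_funTS; exact: emeasurable_funM.
  - by apply: measurable_funTS; apply: emeasurable_funD => //; exact: emeasurable_funM.
rewrite ge0_integralD//; last 2 first.
- by move=> t _; rewrite mule_ge0// lee_fin.
- by apply: measurable_funTS; exact: emeasurable_funM.
rewrite integral_cst//= lebesgue_measure_itv /= lte_fin BT -EFinB.
rewrite (ge0_integralZl leb); last 4 first.
- exact: measurable_itv.
- exact: measurable_funTS.
- by move=> t _.
- by rewrite lee_fin.
rewrite (ereal_regroup2 (ltW H0) _ e20 Q0 N0); last by rewrite addr_ge0// mulr_ge0// ltW.
apply: leeD2l; apply: lee_wpmul2l; first by rewrite lee_fin.
apply: (le_trans (@strip_le_upper p B T d (fun x => (F1 x ^+ 2)%:E) cp pB Td mF1 F1s0)).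
apply: ge0_le_integral.
- exact: upper_measurable.
- by move=> x _.
- exact: measurable_funTS.
- exact: measurable_funTS.
- by move=> x _; rewrite lee_fin /E; have := sqr_ge0 (F2 x); have := sqr_ge0 (F x); lra.
Qed.

End layer.

(** * The fundamental lemma of the calculus of variations *)

Section rectangles.
Context {R : realType}.
Local Notation mR := (measurableTypeR R).
Local Notation mR2 := (measurableTypeR R * measurableTypeR R)%type.

Definition rect (a b c d : R) : set (R * R) := `]a, b[%classic `*` `]c, d[%classic.
Definition rects : set (set (R * R)) := [set A | exists a b c d, A = rect a b c d].

Lemma measurable_rect a b c d : measurable (rect a b c d : set mR2).
Proof. by apply: measurableX; exact: measurable_itv. Qed.

Lemma rectI a b c d a' b' c' d' : rect a b c d `&` rect a' b' c' d' =
  rect (Num.max a a') (Num.min b b') (Num.max c c') (Num.min d d').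
Proof.
apply/seteqP; split => x; rewrite /rect /= !in_itv /= !gt_max !lt_min.
  by move=> [[/andP[-> ->] /andP[-> ->]] [/andP[-> ->] /andP[-> ->]]].
by move=> [/andP[/andP[-> ->] /andP[-> ->]] /andP[/andP[-> ->] /andP[-> ->]]].
Qed.

Lemma rects_setI_closed : setI_closed rects.
Proof.
move=> _ _ [a [b [c [d ->]]]] [a' [b' [c' [d' ->]]]]; rewrite rectI.
by do 4 eexists.
Qed.

Lemma rects_bigcup (A : set (R * R)) (F : nat -> set (R * R)) :
  (forall n, <<s rects >> (F n)) -> A = \bigcup_n F n -> <<s rects >> A.
Proof.
by move=> HF ->; have [_ _] := smallest_sigma_algebra setT rects; apply.
Qed.

Lemma setT_bigcup_itv : [set: R] = \bigcup_n `]- n%:R, n%:R[%classic.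
Proof.
apply/seteqP; split => // x _; exists (Num.trunc `|x|).+1 => //=.
by rewrite in_itv /= -ltr_norml; exact: truncnS_gt.
Qed.

(** Preimages of intervals under the coordinates are countable unions of bounded rectangles; the
    Borel sets of the line, and then the product sigma-algebra, follow. *)
Lemma measurable_rects (A : set mR2) : measurable A -> <<s rects >> A.
Proof.
have sG := smallest_sigma_algebra setT rects.
have [S0 SD SU] := sG.
have base (f : R * R -> R) : (forall a b, <<s rects >> (f @^-1` `]a, b[%classic)) ->
    forall B : set mR, measurable B -> <<s rects >> (f @^-1` B).
  move=> Hf; rewrite RGenOpens.measurableE; apply: smallest_sub; last first.
    by move=> _ [a [b ->]]; exact: Hf.
  split.
  - by rewrite preimage_set0.
  - move=> B HB; rewrite setTD preimage_setC.
    by have := SD _ HB; rewrite setTD.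
  - by move=> B HB; rewrite preimage_bigcup; exact: SU.
have H1 : forall B : set mR, measurable B -> <<s rects >> (fst @^-1` B).
  apply: base => a b.
  apply: (@rects_bigcup _ (fun n => rect a b (- n%:R) n%:R)).
    by move=> n; apply: sub_gen_smallest; do 4 eexists.
  apply/seteqP; split => x /=; last by move=> [n _ [? ?]].
  move=> x1; have : [set: R] x.2 by []; rewrite setT_bigcup_itv => -[n _ x2].
  by exists n.
have H2 : forall B : set mR, measurable B -> <<s rects >> (snd @^-1` B).
  apply: base => a b.
  apply: (@rects_bigcup _ (fun n => rect (- n%:R) n%:R a b)).
    by move=> n; apply: sub_gen_smallest; do 4 eexists.
  apply/seteqP; split => x /=; last by move=> [n _ [? ?]].
  move=> x2; have : [set: R] x.1 by []; rewrite setT_bigcup_itv => -[n _ x1].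
  by exists n.
apply: smallest_sub => //.
by move=> _ [[B mB <-]|[B mB <-]]; rewrite setTI; [exact: H1|exact: H2].
Qed.

(** The sets E for which the integral over E and [Q] together vanishes form a Dynkin system.
    Rectangles are stable under intersection, so every measurable set is reached, and a function
    with all integrals zero is zero almost everywhere. *)
Lemma ae_zero_rect (a b c d : R) (F : mR2 -> R) :
  area.-integrable (rect a b c d) (EFin \o F) ->
  (forall A, rects A -> (\int[area]_(x in A `&` rect a b c d) (F x)%:E = 0)%E) ->
  {ae area, forall x, rect a b c d x -> F x = 0}.
Proof.
set Q := rect a b c d => iF HF.
have mQ : measurable (Q : set mR2) by exact: measurable_rect.
pose S : set (set (R * R)) := [set E | measurable (E : set mR2) /\
  (\int[area]_(x in E `&` Q) (F x)%:E = 0)%E].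
have iS (E : set mR2) : measurable E -> area.-integrable (E `&` Q) (EFin \o F).
  by move=> mE; apply: (integrableS mQ) => //; exact: measurableI.
have dS : dynkin S.
  split.
  - split; first exact: measurableT.
    by rewrite setTI -[X in (\int[_]_(x in X) _)%E](setIid Q); apply: HF; do 4 eexists.
  - move=> E [mE E0]; split; first exact: measurableC.
    have : (\int[area]_(x in Q) (F x)%:E = 0)%E.
      by rewrite -[X in (\int[_]_(x in X) _)%E](setIid Q); apply: HF; do 4 eexists.
    have QE : Q = (E `&` Q) `|` (~` E `&` Q) by rewrite -setIUl setUv setTI.
    rewrite {1}QE integral_setU.
    + by rewrite E0 add0e.
    + exact: measurableI.
    + by apply: measurableI => //; exact: measurableC.
    + by rewrite -QE; have /integrableP[] := iF.
    + by apply/disj_setPS => x [[Ex _] [nEx _]].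
  - move=> E tE HE; split; first by apply: bigcup_measurable => n _; case: (HE n).
    rewrite setI_bigcupl integral_bigcup.
    + by apply: eseries0 => n _ _; case: (HE n).
    + exact: trivIset_setIr.
    + by move=> n; apply: measurableI => //; case: (HE n).
    + by rewrite -setI_bigcupl; apply: iS; apply: bigcup_measurable => n _; case: (HE n).
have SG : <<s rects >> `<=` S.
  rewrite -(setI_closed_g_dynkin_g_sigma_algebra rects_setI_closed); apply: smallest_sub => //.
  by move=> A rA; split; [case: rA => [? [? [? [? ->]]]]; exact: measurable_rect|exact: HF].
have := @integral_ae_eq _ mR2 R area Q mQ (cst 0%E) (EFin \o F) iF.
move=> /(_ _ _)/wrap[|E EQ mE|]; first exact: measurable_cst.
  have [_] := SG _ (measurable_rects mE); rewrite setIidl// => ->.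
  by rewrite integral0.
by apply: filterS => x H /H [].
Qed.

(** A smooth approximation from inside of the indicator of the open interval: zero within 1/n of the
    endpoints, one at distance at least 2/n from both. *)
Definition bump1 (n : nat) (a b t : R) : R :=
  step (n%:R * (t - a) - 1) * step (n%:R * (b - t) - 1).

Definition bump2 (n : nat) (a b c d : R) (x : R * R) : R :=
  bump1 n a b x.1 * bump1 n c d x.2.

Lemma bump1_ge0 n a b t : 0 <= bump1 n a b t.
Proof. by rewrite mulr_ge0// step_ge0. Qed.

Lemma bump1_le1 n a b t : bump1 n a b t <= 1.
Proof. by rewrite -[leRHS]mulr1 ler_pM ?step_ge0 ?step_le1. Qed.

Lemma bump2_ge0 n a b c d x : 0 <= bump2 n a b c d x.
Proof. by apply: mulr_ge0; exact: bump1_ge0. Qed.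

Lemma bump2_le1 n a b c d x : bump2 n a b c d x <= 1.
Proof. by rewrite -[leRHS]mulr1; apply: ler_pM; rewrite ?bump1_ge0 ?bump1_le1. Qed.

Lemma bump1_support n a b t : bump1 n a b t != 0 -> a < t < b.
Proof.
have st (u : R) : step (n%:R * u - 1) != 0 -> 0 < u.
  move=> h; rewrite ltNge; apply/negP => u0; move: h; rewrite step_le0 ?eqxx//.
  by rewrite lerBlDr add0r (le_trans _ ler01)// mulr_ge0_le0.
by rewrite mulf_eq0 negb_or => /andP[/st + /st]; rewrite !subr_gt0 => -> ->.
Qed.

Lemma bump1_cvg a b t : a < t < b -> exists N, forall n, (N <= n)%N -> bump1 n a b t = 1.
Proof.
move=> /andP[h1 h2].
have st (u : R) : 0 < u -> exists N, forall n, (N <= n)%N -> step (n%:R * u - 1) = 1.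
  move=> u0; exists (Num.trunc (2 / u)).+1 => n Nn.
  apply: step_ge1; rewrite lerBrDr -ler_pdivrMr//; apply: ltW.
  have := truncnS_gt (2 / u); rewrite (_ : 1 + 1 = 2 :> R)// => /lt_le_trans; apply.
  by rewrite ler_nat.
have [N1 H1] := st (t - a) ltac:(lra); have [N2 H2] := st (b - t) ltac:(lra).
exists (maxn N1 N2) => n; rewrite geq_max => /andP[n1 n2].
by rewrite /bump1 H1// H2// mulr1.
Qed.

Lemma Cinfty_bump2 n a b c d : Cinfty (bump2 n a b c d).
Proof.
have S1 (l k : R) : Cinfty (fun x : R * R => step (l * x.1 + k)) by exact: (@Cinfty_step R l k ord0).
have S2 (l k : R) : Cinfty (fun x : R * R => step (l * x.2 + k)) by exact: (@Cinfty_step R l k ord_max).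
apply: CinftyM; apply: CinftyM.
- by have := S1 n%:R (- (n%:R * a) - 1); congr Cinfty; apply/funext => x; congr step; ring.
- by have := S1 (- n%:R) (n%:R * b - 1); congr Cinfty; apply/funext => x; congr step; ring.
- by have := S2 n%:R (- (n%:R * c) - 1); congr Cinfty; apply/funext => x; congr step; ring.
- by have := S2 (- n%:R) (n%:R * d - 1); congr Cinfty; apply/funext => x; congr step; ring.
Qed.

Definition crect (a b c d : R) : set (R * R) := `[a, b]%classic `*` `[c, d]%classic.

Lemma crect_compact a b c d : compact (crect a b c d).
Proof. by apply: compact_setX; exact: segment_compact. Qed.

Lemma crect_closed a b c d : closed (crect a b c d).
Proof.
apply: compact_closed (@crect_compact a b c d).
exact: norm_hausdorff.
Qed.

Lemma tsupport_crect (T : zmodType) (h : R * R -> T) a b c d :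
  (forall x, h x != 0 -> crect a b c d x) -> tsupport h `<=` crect a b c d.
Proof.
by move=> H x hx; apply: crect_closed; apply: closure_subset hx => y; exact: H.
Qed.

Lemma tsupport_compact (T : zmodType) (h : R * R -> T) a b c d :
  (forall x, h x != 0 -> crect a b c d x) -> compact (tsupport h).
Proof.
move=> H; apply: subclosed_compact (@crect_compact a b c d) (tsupport_crect H).
exact: closed_closure.
Qed.

Lemma bump2_testfun (D : set (R * R)) n a b c d : crect a b c d `<=` D ->
  testfun D (bump2 n a b c d).
Proof.
move=> QD; have H x : bump2 n a b c d x != 0 -> crect a b c d x.
  rewrite mulf_eq0 negb_or => /andP[/bump1_support /andP[? ?] /bump1_support /andP[? ?]].
  by split; rewrite /= in_itv /= !ltW.
by split; [exact: Cinfty_bump2|exact: tsupport_compact H|exact: subset_trans (tsupport_crect H) QD].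
Qed.

Lemma rect_crect a b c d : rect a b c d `<=` crect a b c d.
Proof. by move=> x [/=]; rewrite !in_itv /= => /andP[? ?] /andP[? ?]; split; rewrite /= in_itv /= !ltW. Qed.

Lemma rat_itv_cover (x e : R) : 0 < e -> exists q1 q2 : rat,
  [/\ x - e < ratr q1, ratr q1 < x, x < ratr q2 & ratr q2 < x + e].
Proof.
move=> e0.
have [q1] := @rat_in_itvoo R (x - e) x ltac:(lra).
have [q2] := @rat_in_itvoo R x (x + e) ltac:(lra).
by rewrite !in_itv /= => /andP[? ?] /andP[? ?]; exists q1, q2.
Qed.

(** The Lindelof property: the rational rectangles whose closure lies in [D] cover [D], and they are
    countably many. *)
Lemma negligible_cover (D N : set (R * R)) : open D ->
  (forall a b c d, crect a b c d `<=` D -> area.-negligible (N `&` rect a b c d)) ->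
  area.-negligible (D `&` N).
Proof.
move=> oD HN.
pose Q (q : rat * rat * (rat * rat)) := rect (ratr q.1.1) (ratr q.1.2) (ratr q.2.1) (ratr q.2.2) : set (R * R).
pose K (q : rat * rat * (rat * rat)) := crect (ratr q.1.1) (ratr q.1.2) (ratr q.2.1) (ratr q.2.2) : set (R * R).
pose G (k : nat) : set mR2 := if unpickle k is Some q then
   (if `[< K q `<=` D >] then N `&` Q q else set0) else set0.
have negG : area.-negligible (\bigcup_k G k).
  apply: negligible_bigcup => k; rewrite /G; case: unpickle => [q|]; last exact: negligible_set0.
  by case: ifPn => [/asboolP KD|_]; [exact: HN|exact: negligible_set0].
apply: negligibleS negG => x [Dx Nx].
have /nbhs_ballP[e /= e0 xe] := open_nbhs_nbhs (conj oD Dx).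
have [q1 [q2 [h1 h2 h3 h4]]] := rat_itv_cover x.1 e0.
have [q3 [q4 [h5 h6 h7 h8]]] := rat_itv_cover x.2 e0.
have Gp q : K q `<=` D -> G (pickle q) = N `&` Q q.
  by move=> KD; rewrite /G pickleK ifT//; exact/asboolP.
exists (pickle ((q1, q2), (q3, q4))); first exact: I.
rewrite Gp.
  by split; [exact: Nx|split; rewrite /Q /= in_itv /=; apply/andP].
move=> y [/=]; rewrite !in_itv /= => /andP[g1 g2] /andP[g3 g4].
by apply: xe; split; rewrite /ball /= ltr_norml; lra.
Qed.

(** Bumps converge to the indicator of a rectangle, so dominated convergence gives zero integrals
    over all rectangles; [ae_zero_rect] and a countable cover conclude. *)
Lemma fundamental (D : set (R * R)) (F : mR2 -> R) : open D ->
  (forall a b c d, crect a b c d `<=` D -> area.-integrable (rect a b c d) (EFin \o F)) ->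
  (forall phi, testfun D phi -> (\int[area]_(x in D) (F x * phi x)%:E = 0)%E) ->
  {ae area, forall x, D x -> F x = 0}.
Proof.
move=> oD iF HF.
suff : area.-negligible (D `&` [set x | F x <> 0]).
  by apply: negligibleS => x /= /not_implyP.
apply: negligible_cover => // a b c d QD.
have : {ae area, forall x, rect a b c d x -> F x = 0}.
  apply: ae_zero_rect; first exact: iF.
  move=> _ [a' [b' [c' [d' ->]]]]; rewrite rectI.
  set a1 := Num.max _ _; set b1 := Num.min _ _; set c1 := Num.max _ _; set d1 := Num.min _ _.
  have QD1 : crect a1 b1 c1 d1 `<=` D.
    apply: subset_trans QD => x [/=]; rewrite !in_itv /= => /andP[+ +] /andP[+ +].
    rewrite !ge_max !le_min => /andP[_ ?] /andP[_ ?] /andP[_ ?] /andP[_ ?].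
    by split; rewrite /= in_itv /=; apply/andP.
  have mQ1 := @measurable_rect a1 b1 c1 d1.
  have iF1 := iF _ _ _ _ QD1; have /integrableP[mF1 _] := iF1.
  have E n : (\int[area]_(x in rect a1 b1 c1 d1) (F x * bump2 n a1 b1 c1 d1 x)%:E = 0)%E.
    rewrite -(HF _ (bump2_testfun n QD1)) [RHS]integral_mkcond [LHS]integral_mkcond.
    apply: eq_integral => x _; rewrite !patchE.
    have [Qx|nQx] := pselect (rect a1 b1 c1 d1 x).
      by rewrite !ifT//; apply/mem_set => //; apply: QD1; exact: rect_crect.
    rewrite ifF; last by apply/negbTE/negP => /set_mem.
    case: ifP => // _; rewrite /bump2.
    suff -> : bump1 n a1 b1 x.1 * bump1 n c1 d1 x.2 = 0 by rewrite mulr0.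
    apply/eqP/negPn/negP; rewrite mulf_eq0 negb_or.
    by move=> /andP[/bump1_support ? /bump1_support ?]; apply: nQx; split; rewrite /= in_itv.
  have mb n : measurable_fun setT (fun x : mR2 => bump2 n a1 b1 c1 d1 x).
    by apply: continuous_measurable_plane; apply: Cinfty_continuous; exact: Cinfty_bump2.
  have p1 n : measurable_fun (rect a1 b1 c1 d1) (fun x : mR2 => (F x * bump2 n a1 b1 c1 d1 x)%:E).
    apply/measurable_EFinP; apply: measurable_funM; first exact/measurable_EFinP.
    exact: (measurable_funTS (mb n)).
  have p2 : {ae area, forall x, rect a1 b1 c1 d1 x ->
      (F x * bump2 n a1 b1 c1 d1 x)%:E @[n --> \oo] --> (F x)%:E}.
    apply: aeW => x [/=]; rewrite !in_itv /= => x1 x2.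
    have [N1 H1] := bump1_cvg x1; have [N2 H2] := bump1_cvg x2.
    apply: cvg_near_cst; near=> n.
    rewrite /bump2 H1 ?H2 ?mulr1//; near: n; exact: nbhs_infty_ge.
  have p3 : {ae area, forall x, forall n, rect a1 b1 c1 d1 x ->
      (`|(F x * bump2 n a1 b1 c1 d1 x)%:E| <= `|(F x)%:E|)%E}.
    apply: aeW => x n _; rewrite /= lee_fin normrM -[leRHS]mulr1 ler_wpM2l//.
    by rewrite ger0_norm ?bump2_ge0 ?bump2_le1.
  have [_ _ h] := dominated_convergence mQ1 p1 mF1 p2 (integrable_abse iF1) p3.
  have h2 : (cst 0%E : nat -> \bar R) @ \oo --> (0 : \bar R)%E by exact: cvg_cst.
  apply: (cvg_unique (@ereal_hausdorff R) h).
  by rewrite (_ : [sequence _]_n = cst 0%E)//; apply/funext => n /=; exact: E.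
by apply: negligibleS => x /= [Fx Qx] /(_ Qx).
Unshelve. all: by end_near. Qed.

End rectangles.

(** * Modulus, real and imaginary parts *)

Section modulus.
Context {R : realType}.
Implicit Types z w : R[i].

Lemma modulus_ge0 z : 0 <= modulus z.
Proof. by case: z => a b; rewrite /modulus /=; exact: sqrtr_ge0. Qed.

Lemma modulus_sqr z : modulus z ^+ 2 = complex.Re z ^+ 2 + complex.Im z ^+ 2.
Proof. by case: z => a b; rewrite /modulus /= sqr_sqrtr// addr_ge0// sqr_ge0. Qed.

Lemma modulusM z w : modulus (z * w) = modulus z * modulus w.
Proof. exact: Normc.normcM. Qed.

Lemma modulusN z : modulus (- z) = modulus z.
Proof. by case: z => a b; rewrite /modulus /= !sqrrN. Qed.

Lemma modulus_conj z : modulus (conjc z) = modulus z.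
Proof. by case: z => a b; rewrite /modulus /= sqrrN. Qed.

Lemma modulus_real (r : R) : modulus (r%:C)%C = `|r|.
Proof. by rewrite /modulus /= expr0n /= addr0 sqrtr_sqr. Qed.

Lemma modulus0 : modulus (0 : R[i]) = 0.
Proof. by rewrite (modulus_real 0) normr0. Qed.

Lemma Re_le_modulus z : `|complex.Re z| <= modulus z.
Proof.
case: z => a b; rewrite /modulus /= -sqrtr_sqr ler_wsqrtr// lerDl; exact: sqr_ge0.
Qed.

Lemma Im_le_modulus z : `|complex.Im z| <= modulus z.
Proof.
case: z => a b; rewrite /modulus /= -sqrtr_sqr ler_wsqrtr// lerDr; exact: sqr_ge0.
Qed.

Lemma modulus_le z : modulus z <= `|complex.Re z| + `|complex.Im z|.
Proof.
rewrite -(ler_pXn2r (n := 2)) ?nnegrE ?modulus_ge0 ?addr_ge0//.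
have m0 : 0 <= `|complex.Re z| * `|complex.Im z| by exact: mulr_ge0.
by rewrite modulus_sqr sqrrD !real_normK ?num_real//; lra.
Qed.

Lemma modulusD_sqr z w : modulus (z + w) ^+ 2 <= 2 * modulus z ^+ 2 + 2 * modulus w ^+ 2.
Proof.
rewrite !modulus_sqr; case: z w => a b [c d] /=.
have := sqr_ge0 (a - c); have := sqr_ge0 (b - d); rewrite !expr2; lra.
Qed.

Lemma Re_real (r : R) z : complex.Re (z * (r%:C)%C) = complex.Re z * r.
Proof. by case: z => a b /=; rewrite mulr0 subr0. Qed.

Lemma Im_real (r : R) z : complex.Im (z * (r%:C)%C) = complex.Im z * r.
Proof. by case: z => a b /=; rewrite mulr0 add0r. Qed.

Lemma ReM z w : complex.Re (z * w) = complex.Re z * complex.Re w - complex.Im z * complex.Im w.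
Proof. by case: z w => a b [c d]. Qed.

Lemma ImM z w : complex.Im (z * w) = complex.Re z * complex.Im w + complex.Im z * complex.Re w.
Proof. by case: z w => a b [c d]. Qed.

Lemma ReD z w : complex.Re (z + w) = complex.Re z + complex.Re w.
Proof. by case: z w => a b [c d]. Qed.

Lemma ImD z w : complex.Im (z + w) = complex.Im z + complex.Im w.
Proof. by case: z w => a b [c d]. Qed.

Lemma ReN z : complex.Re (- z) = - complex.Re z. Proof. by case: z. Qed.
Lemma ImN z : complex.Im (- z) = - complex.Im z. Proof. by case: z. Qed.
Lemma Re_conj z : complex.Re (conjc z) = complex.Re z. Proof. by case: z. Qed.
Lemma Im_conj z : complex.Im (conjc z) = - complex.Im z. Proof. by case: z. Qed.

Lemma complex_eq z w : complex.Re z = complex.Re w -> complex.Im z = complex.Im w -> z = w.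
Proof. by case: z w => a b [c d] /= -> ->. Qed.

End modulus.

(** * Square-integrable complex functions over an arbitrary measure *)

Section L2tools.
Context {R : realType} {d : measure_display} {T : measurableType d}.
Variables (mu : {measure set T -> \bar R}) (D : set T).
Hypothesis mD : measurable D.
Implicit Types u v p q : T -> R[i].

Definition cmeas (u : T -> R[i]) : Prop :=
  measurable_fun D (fun x => complex.Re (u x)) /\ measurable_fun D (fun x => complex.Im (u x)).

(** The squared norm, as an extended real. The measure is a parameter because both the area and the
    length of the line are used. *)
Definition sqn (u : T -> R[i]) : \bar R := (\int[mu]_(x in D) (modulus (u x) ^+ 2)%:E)%E.

Definition cL2 (u : T -> R[i]) : Prop := cmeas u /\ (sqn u < +oo)%E.

Lemma sqn_ge0 u : (0 <= sqn u)%E. Proof. exact: int_sqr_ge0. Qed.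

Lemma cmeasD u v : cmeas u -> cmeas v -> cmeas (fun x => u x + v x).
Proof.
move=> [u1 u2] [v1 v2]; split.
  by under eq_fun do rewrite ReD; exact: measurable_funD.
by under eq_fun do rewrite ImD; exact: measurable_funD.
Qed.

Lemma cmeasM u v : cmeas u -> cmeas v -> cmeas (fun x => u x * v x).
Proof.
move=> [u1 u2] [v1 v2]; split.
  by under eq_fun do rewrite ReM; apply: measurable_funB; exact: measurable_funM.
by under eq_fun do rewrite ImM; apply: measurable_funD; exact: measurable_funM.
Qed.

Lemma cmeasN u : cmeas u -> cmeas (fun x => - u x).
Proof.
move=> [u1 u2]; split.
  by under eq_fun do rewrite ReN; exact: measurableT_comp.
by under eq_fun do rewrite ImN; exact: measurableT_comp.
Qed.

Lemma cmeasB u v : cmeas u -> cmeas v -> cmeas (fun x => u x - v x).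
Proof. by move=> mu1 /cmeasN; exact: cmeasD. Qed.

Lemma cmeas_conj u : cmeas u -> cmeas (fun x => conjc (u x)).
Proof.
move=> [u1 u2]; split; first by under eq_fun do rewrite Re_conj.
by under eq_fun do rewrite Im_conj; exact: measurableT_comp.
Qed.

Lemma cmeas_real (r : T -> R) : measurable_fun D r -> cmeas (fun x => (r x)%:C%C).
Proof. by move=> mr; split => //=; exact: measurable_cst. Qed.

Lemma cmeas_cst (c : R[i]) : cmeas (fun=> c).
Proof. by split; exact: measurable_cst. Qed.

Lemma msqr u : cmeas u -> measurable_fun D (fun x => modulus (u x) ^+ 2).
Proof.
move=> [u1 u2]; under eq_fun do rewrite modulus_sqr.
by apply: measurable_funD; exact: measurable_funX.
Qed.

Lemma msqrE u : cmeas u -> measurable_fun D (fun x => (modulus (u x) ^+ 2)%:E).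
Proof. by move=> /msqr ?; apply/measurable_EFinP. Qed.

Lemma mmod u : cmeas u -> measurable_fun D (fun x => modulus (u x)).
Proof.
move=> mu'; rewrite (_ : (fun x => _) = Num.sqrt \o (fun x => modulus (u x) ^+ 2)).
  apply: measurableT_comp; last exact: msqr.
  by apply: (@continuous_measurable_fun R); exact: sqrt_continuous.
by apply/funext => x /=; rewrite sqrtr_sqr ger0_norm// modulus_ge0.
Qed.

Lemma sqnD u v : cmeas u -> cmeas v ->
  (sqn (fun x => u x + v x)%R <= 2%:E * sqn u + 2%:E * sqn v)%E.
Proof.
move=> mu1 mv1; rewrite /sqn -!ge0_integralZl//; do ?[exact: msqrE|by move=> x _; rewrite lee_fin sqr_ge0].
rewrite -ge0_integralD//; do ?[by move=> x _; rewrite mule_ge0// lee_fin sqr_ge0|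
  by apply: emeasurable_funM => //; exact: msqrE].
apply: ge0_le_integral => //.
- by move=> x _; rewrite lee_fin sqr_ge0.
- by apply: msqrE; exact: cmeasD.
- by apply: emeasurable_funD; apply: emeasurable_funM => //; exact: msqrE.
- by move=> x _; rewrite -!EFinM -EFinD lee_fin modulusD_sqr.
Qed.

Lemma sqn_sym u v : sqn (fun x => u x - v x) = sqn (fun x => v x - u x).
Proof. by apply: eq_integral => x _; rewrite -modulusN opprB. Qed.

Lemma sqn_triangle u v w : cmeas u -> cmeas v -> cmeas w ->
  (sqn (fun x => u x - w x)%R <= 2%:E * sqn (fun x => u x - v x)%R + 2%:E * sqn (fun x => v x - w x)%R)%E.
Proof.
move=> mu1 mv1 mw1.
rewrite (_ : (fun x => u x - w x) = (fun x => (u x - v x) + (v x - w x))).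
  by apply: sqnD; exact: cmeasB.
by apply/funext => x; rewrite addrA subrK.
Qed.

Lemma le_sqn (K : R) u v : 0 <= K -> cmeas u -> cmeas v ->
  {ae mu, forall x, D x -> modulus (u x) <= K * modulus (v x)} ->
  (sqn u <= (K ^+ 2)%:E * sqn v)%E.
Proof.
move=> K0 mu1 mv1 uv; rewrite /sqn -ge0_integralZl//; last 3 first.
- exact: msqrE.
- by move=> x _; rewrite lee_fin sqr_ge0.
- by rewrite lee_fin sqr_ge0.
apply: ae_ge0_le_integral => //.
- by move=> x _; rewrite lee_fin sqr_ge0.
- exact: msqrE.
- by move=> x _; rewrite mule_ge0// lee_fin sqr_ge0.
- by apply: emeasurable_funM => //; exact: msqrE.
apply: filterS uv => x h Dx; rewrite -EFinM lee_fin -exprMn.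
by rewrite ler_pXn2r ?nnegrE ?mulr_ge0 ?modulus_ge0// h.
Qed.

Lemma cL2D u v : cL2 u -> cL2 v -> cL2 (fun x => u x + v x).
Proof.
move=> [mu1 u2] [mv1 v2]; split; first exact: cmeasD.
by apply: (le_lt_trans (sqnD mu1 mv1)); rewrite lte_add_pinfty// lte_mul_pinfty ?lee_fin.
Qed.

Lemma cL2_le (K : R) u v : 0 <= K -> cmeas u -> cL2 v ->
  {ae mu, forall x, D x -> modulus (u x) <= K * modulus (v x)} -> cL2 u.
Proof.
move=> K0 mu1 [mv1 v2] uv; split => //; apply: (le_lt_trans (le_sqn K0 mu1 mv1 uv)).
by rewrite lte_mul_pinfty ?lee_fin ?sqr_ge0.
Qed.

Lemma cL2N u : cL2 u -> cL2 (fun x => - u x).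
Proof.
move=> hu; apply: (@cL2_le 1 _ u) => //; first by apply: cmeasN; case: hu.
by apply: aeW => x _; rewrite modulusN mul1r.
Qed.

Lemma cL2B u v : cL2 u -> cL2 v -> cL2 (fun x => u x - v x).
Proof. by move=> hu /cL2N; exact: cL2D. Qed.

Lemma sqr_integrable u : cL2 u -> mu.-integrable D (EFin \o (fun x => modulus (u x) ^+ 2)).
Proof.
move=> [mu1 u2]; apply/integrableP; split; first exact: msqrE.
apply: le_lt_trans u2; rewrite le_eqVlt; apply/orP; left; apply/eqP.
by apply: eq_integral => x _; rewrite gee0_abs// lee_fin sqr_ge0.
Qed.

Lemma sqn_fin u : cL2 u -> sqn u = (\int[mu]_(x in D) (modulus (u x) ^+ 2))%:E.
Proof.
by move=> hu; rewrite /Rintegral fineK//; exact: (integrable_fin_num mD (sqr_integrable hu)).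
Qed.

Lemma dom_integrable (K : R) u v (F : T -> R) : cL2 u -> cL2 v -> measurable_fun D F ->
  {ae mu, forall x, D x -> `|F x| <= K * (modulus (u x) ^+ 2 + modulus (v x) ^+ 2)} ->
  mu.-integrable D (EFin \o F).
Proof.
move=> hu hv mF HF; apply/integrableP; split; first exact/measurable_EFinP.
pose G x := K * (modulus (u x) ^+ 2 + modulus (v x) ^+ 2).
have iG : mu.-integrable D (EFin \o G).
  apply: (integrableZl mD K (f := EFin \o (fun x => modulus (u x) ^+ 2 + modulus (v x) ^+ 2))).
  exact: (integrableD mD (sqr_integrable hu) (sqr_integrable hv)).
have /integrableP[mG] := iG; apply: le_lt_trans.
apply: ae_ge0_le_integral => //.
- by apply: measurableT_comp => //; exact/measurable_EFinP.
- exact: measurableT_comp.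
apply: filterS HF => x h /h {}h; rewrite /= lee_fin.
exact: le_trans h (ler_norm _).
Qed.

Lemma ae_le_Rintegral (F G : T -> R) :
  mu.-integrable D (EFin \o F) -> mu.-integrable D (EFin \o G) ->
  {ae mu, forall x, D x -> F x <= G x} ->
  \int[mu]_(x in D) F x <= \int[mu]_(x in D) G x.
Proof.
move=> iF iG FG; rewrite -subr_ge0 -(RintegralB mD iG iF).
have iGF : mu.-integrable D (EFin \o (fun x => G x - F x)) by exact: (integrableB mD iG iF).
rewrite -lee_fin /Rintegral fineK; last exact: (integrable_fin_num mD iGF).
have /integrableP[mGF _] := iGF.
have E : ae_eq mu D (fun x => (G x - F x)%:E) (fun x => (`|G x - F x|)%:E).
  by apply: filterS FG => x h Dx; rewrite ger0_norm// subr_ge0 h.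
have mA : measurable_fun D (fun x => (`|G x - F x|)%:E).
  by apply/measurable_EFinP; apply: measurableT_comp => //; exact/measurable_EFinP.
rewrite (ae_eq_integral _ _ mD mGF mA E).
by apply: integral_ge0 => x _; rewrite lee_fin.
Qed.

(** Domination by the product of moduli covers real and imaginary parts and bounded coefficients at
    once. The bound 2 |I| <= K (t A + B / t) holds for every t > 0 and is optimal at t = (B /
    A)^(1/2). *)
Lemma cauchy_schwarz (u v : T -> R[i]) (K : R) (F : T -> R) : 0 <= K -> cL2 u -> cL2 v ->
  measurable_fun D F ->
  {ae mu, forall x, D x -> `|F x| <= K * (modulus (u x) * modulus (v x))} ->
  ((((\int[mu]_(x in D) F x) ^+ 2)%:E <= (K ^+ 2)%:E * (sqn u * sqn v)))%E.
Proof.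
move=> K0 hu hv mF HF.
have iF : mu.-integrable D (EFin \o F).
  apply: (dom_integrable (K := K) hu hv mF); apply: filterS HF => x h /h {}h.
  apply: le_trans h _; rewrite ler_wpM2l//.
  have := sqr_ge0 (modulus (u x) - modulus (v x)); have := sqr_ge0 (modulus (u x) + modulus (v x)).
  by rewrite !expr2; lra.
rewrite (sqn_fin hu) (sqn_fin hv) -!EFinM lee_fin.
set A := \int[mu]_(x in D) (modulus (u x) ^+ 2); set B := \int[mu]_(x in D) (modulus (v x) ^+ 2).
set I := \int[mu]_(x in D) F x.
have A0 : 0 <= A by apply: Rintegral_ge0 => x _; exact: sqr_ge0.
have B0 : 0 <= B by apply: Rintegral_ge0 => x _; exact: sqr_ge0.
have iA := sqr_integrable hu; have iB := sqr_integrable hv.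
have key (t : R) : 0 < t -> 2 * `|I| <= K * (t * A + t^-1 * B).
  move=> t0.
  have iAt := integrableZl mD t iA; have iBt := integrableZl mD t^-1 iB.
  have iS : mu.-integrable D (EFin \o (fun x => t * modulus (u x) ^+ 2 + t^-1 * modulus (v x) ^+ 2)).
    exact: (integrableD mD iAt iBt).
  have iKS := integrableZl mD K iS.
  have -> : K * (t * A + t^-1 * B) =
      \int[mu]_(x in D) (K * (t * modulus (u x) ^+ 2 + t^-1 * modulus (v x) ^+ 2)).
    rewrite (RintegralZl K mD iS) (RintegralD mD iAt iBt).
    by rewrite (RintegralZl t mD iA) (RintegralZl t^-1 mD iB).
  have h x (y : R) : y <= K * (modulus (u x) * modulus (v x)) ->
     2 * y <= K * (t * modulus (u x) ^+ 2 + t^-1 * modulus (v x) ^+ 2).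
    move=> hy; apply: (@le_trans _ _ (K * (2 * (modulus (u x) * modulus (v x))))).
      by rewrite mulrCA ler_wpM2l.
    rewrite ler_wpM2l//.
    have : 0 <= t^-1 * (t * modulus (u x) - modulus (v x)) ^+ 2.
      by rewrite mulr_ge0 ?invr_ge0 ?sqr_ge0// ltW.
    rewrite (_ : t^-1 * _ = t * modulus (u x) ^+ 2 + t^-1 * modulus (v x) ^+ 2 - 2 * (modulus (u x) * modulus (v x))).
      by rewrite subr_ge0.
    by field; rewrite gt_eqF.
  have i2F := integrableZl mD 2 iF.
  have iNF := integrableZl mD (- 2) iF.
  have up : 2 * I <= \int[mu]_(x in D) (K * (t * modulus (u x) ^+ 2 + t^-1 * modulus (v x) ^+ 2)).
    rewrite -(RintegralZl 2 mD iF); apply: ae_le_Rintegral => //.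
    by apply: filterS HF => x hx /hx {}hx; apply: h; apply: le_trans hx; exact: ler_norm.
  have dn : - 2 * I <= \int[mu]_(x in D) (K * (t * modulus (u x) ^+ 2 + t^-1 * modulus (v x) ^+ 2)).
    rewrite -(RintegralZl (- 2) mD iF); apply: ae_le_Rintegral => //.
    apply: filterS HF => x hx /hx {}hx; rewrite mulNr -mulrN; apply: h.
    by apply: le_trans hx; rewrite -normrN; exact: ler_norm.
  by case: (lerP 0 I) => I0; [rewrite ger0_norm|rewrite ltr0_norm//; lra].
(* If [A] or [B] vanishes, the optimal t degenerates to infinity or 0; I = 0 is then obtained with t
   arbitrarily large or small. *)
have [B00|B00] := eqVneq B 0.
  have KA : 0 <= K * A by rewrite mulr_ge0.
  have : `|I| <= 0.
    apply/ler_addgt0Pr => e e0; rewrite add0r.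
    have KA1 : 0 < K * A + 1 by rewrite ltr_wpDl.
    have := key (e / (K * A + 1)) (divr_gt0 e0 KA1).
    rewrite B00 mulr0 addr0 mulrCA => h.
    have : e / (K * A + 1) * (K * A) <= e.
      by rewrite mulrAC ler_pdivrMr// ler_wpM2l ?ltW// ltrDl.
    by have := normr_ge0 I; lra.
  by rewrite normr_le0 => /eqP ->; rewrite expr0n /= !mulr_ge0 ?sqr_ge0.
have Bp : 0 < B by rewrite lt_neqAle eq_sym B00.
have [A00|A00] := eqVneq A 0.
  have KB : 0 <= K * B by rewrite mulr_ge0.
  have : `|I| <= 0.
    apply/ler_addgt0Pr => e e0; rewrite add0r.
    have KB1 : 0 < K * B + 1 by rewrite ltr_wpDl.
    have := key ((e / (K * B + 1))^-1); rewrite invr_gt0 => /(_ (divr_gt0 e0 KB1)).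
    rewrite A00 mulr0 add0r invrK mulrCA => h.
    have : e / (K * B + 1) * (K * B) <= e.
      by rewrite mulrAC ler_pdivrMr// ler_wpM2l ?ltW// ltrDl.
    by have := normr_ge0 I; lra.
  by rewrite normr_le0 => /eqP ->; rewrite expr0n /= !mulr_ge0 ?sqr_ge0.
have Ap : 0 < A by rewrite lt_neqAle eq_sym A00.
have ABp : 0 < B / A by rewrite divr_gt0.
have := key (Num.sqrt (B / A)); rewrite sqrtr_gt0 => /(_ ABp).
have E : Num.sqrt (B / A) * A + (Num.sqrt (B / A))^-1 * B = 2 * (Num.sqrt (B / A) * A).
  have s0 : 0 < Num.sqrt (B / A) by rewrite sqrtr_gt0.
  have s2 := sqr_sqrtr (ltW ABp).
  have -> : B = Num.sqrt (B / A) ^+ 2 * A by rewrite s2 divfK.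
  have -> : Num.sqrt (B / A) ^+ 2 * A / A = Num.sqrt (B / A) ^+ 2 by rewrite mulfK.
  rewrite sqrtr_sqr (ger0_norm (ltW s0)) expr2 -mulrA mulKf ?gt_eqF//; ring.
rewrite E mulrCA ler_pM2l// => h.
rewrite -real_normK ?num_real//.
apply: (@le_trans _ _ ((K * (Num.sqrt (B / A) * A)) ^+ 2)).
  by rewrite ler_pXn2r ?nnegrE ?mulr_ge0 ?sqrtr_ge0.
rewrite !exprMn (sqr_sqrtr (ltW ABp)) ler_wpM2l ?sqr_ge0//.
by rewrite expr2 mulrA divfK// mulrC.
Qed.

End L2tools.

(** * Sequences of extended reals tending to zero *)

Section vanishing.
Context {R : realType}.
Implicit Type a b : nat -> \bar R.

(** A one-sided form of convergence to 0, equivalent to it for non-negative sequences, in which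
    finiteness of the terms need not be carried along. *)
Definition vanishes (a : nat -> \bar R) : Prop :=
  forall e : R, 0 < e -> \forall n \near \oo, (a n <= e%:E)%E.

Lemma vanishesP a : (forall n, 0 <= a n)%E -> (a n @[n --> \oo] --> 0%E) <-> vanishes a.
Proof.
move=> a0; split => [/fine_cvgP[fa /cvgrPdist_le ca] e e0|va].
  near=> n; have fn : a n \is a fin_num by near: n.
  rewrite -(fineK fn) lee_fin; have : `|0 - fine (a n)| <= e by near: n; exact: ca.
  by rewrite sub0r normrN; apply: le_trans; exact: ler_norm.
have fin_le e n : (a n <= e%:E)%E -> a n \is a fin_num.
  by move=> h; rewrite ge0_fin_numE// (le_lt_trans h)// ltry.
apply/fine_cvgP; split; first by near=> n; apply: (fin_le 1); near: n; exact: va.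
apply/cvgrPdist_le => e e0; near=> n.
have h : (a n <= e%:E)%E by near: n; exact: va.
by rewrite sub0r normrN ger0_norm ?fine_ge0//= -lee_fin fineK// (fin_le e).
Unshelve. all: by end_near. Qed.

Lemma vanishes_le (K : R) a b : vanishes b -> 0 <= K ->
  (forall n, a n <= K%:E * b n)%E -> vanishes a.
Proof.
move=> vb K0 ab e e0; have K1 : 0 < K + 1 by rewrite ltr_wpDl.
near=> n; apply: (le_trans (ab n)).
have h : (b n <= (e / (K + 1))%:E)%E by near: n; apply: vb; exact: divr_gt0.
apply: (le_trans (lee_wpmul2l _ h)); first by rewrite lee_fin.
rewrite -EFinM lee_fin mulrCA -[leRHS]mulr1 (ler_wpM2l (ltW e0))//.
by rewrite ler_pdivrMr// mul1r lerDl.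
Unshelve. all: by end_near. Qed.

Lemma vanishesD a b : vanishes a -> vanishes b -> vanishes (fun n => a n + b n)%E.
Proof.
move=> va vb e e0; near=> n.
have h1 : (a n <= (e / 2)%:E)%E by near: n; apply: va; exact: divr_gt0.
have h2 : (b n <= (e / 2)%:E)%E by near: n; apply: vb; exact: divr_gt0.
by apply: (le_trans (leeD h1 h2)); rewrite -EFinD -splitr.
Unshelve. all: by end_near. Qed.

Lemma vanishes_le2 (K : R) a b c : vanishes b -> vanishes c -> 0 <= K ->
  (forall n, a n <= K%:E * (b n + c n))%E -> vanishes a.
Proof. by move=> vb vc; apply: vanishes_le; exact: vanishesD. Qed.

Lemma vanishes_le0 (c : R) a : vanishes a -> (forall n, (c%:E <= a n)%E) -> c <= 0.
Proof.
move=> va ca; apply/ler_addgt0Pr => e e0; rewrite add0r -lee_fin.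
have [n _ /(_ n (leqnn n))] := va e e0; exact: le_trans.
Qed.

(** This is how limits are taken in inequalities between fixed quantities: only the error term
    depends on n. *)
Lemma vanishes_le_const (x : \bar R) (y : \bar R) a : vanishes a -> (0 <= y)%E ->
  (forall n, x <= y + a n)%E -> (x <= y)%E.
Proof.
move=> va y0 H; apply/lee_addgt0Pr => e e0.
have [n _ /(_ n (leqnn n)) h] := va e e0.
by apply: (le_trans (H n)); exact: leeD2l.
Qed.

Lemma sqrt_poweR (a : \bar R) : (0 <= a)%E -> ((a `^ 2^-1) `^ 2 = a)%E.
Proof. by move=> a0; rewrite -poweRrM mulVf// poweRe1. Qed.

Lemma poweR_half_le (x y : \bar R) : (0 <= x)%E -> (0 <= y)%E -> (x <= y `^ 2)%E -> (x `^ 2^-1 <= y)%E.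
Proof.
move=> x0 y0 xy; have -> : y = ((y `^ 2) `^ 2^-1)%E by rewrite -poweRrM mulfV// poweRe1.
apply: gt0_ler_poweR => //; rewrite ?invr_ge0// in_itv /= leey ?andbT//; exact: poweR_ge0.
Qed.

Lemma poweR_half_ge (x y : \bar R) : (0 <= x)%E -> (0 <= y)%E -> (x `^ 2^-1 <= y)%E -> (x <= y `^ 2)%E.
Proof.
move=> x0 y0 xy; rewrite -(sqrt_poweR x0); apply: gt0_ler_poweR => //.
- by rewrite in_itv /= leey poweR_ge0.
- by rewrite in_itv /= leey y0.
Qed.

Lemma EFin_sqr (e : R) : 0 <= e -> ((e%:E `^ 2) = (e ^+ 2)%:E)%E.
Proof. by move=> e0; rewrite poweR_EFin powR_mulrn. Qed.

Lemma vanishes_half a : (forall n, 0 <= a n)%E -> vanishes (fun n => a n `^ 2^-1)%E <-> vanishes a.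
Proof.
move=> a0; split => va e e0; near=> n.
  have h : (a n `^ 2^-1 <= (Num.sqrt e)%:E)%E by near: n; apply: va; rewrite sqrtr_gt0.
  have := poweR_half_ge (a0 n) _ h; rewrite lee_fin sqrtr_ge0 => /(_ isT).
  by rewrite EFin_sqr ?sqrtr_ge0// sqr_sqrtr// ltW.
apply: poweR_half_le => //; first by rewrite lee_fin ltW.
by rewrite (EFin_sqr (ltW e0)); near: n; apply: va; rewrite exprn_gt0.
Unshelve. all: by end_near. Qed.

End vanishing.

(** * Compactly supported functions *)

Section compactness.
Context {R : realType}.
Local Notation mR := (measurableTypeR R).
Local Notation mR2 := (measurableTypeR R * measurableTypeR R)%type.

Lemma compact_in_crect (K : set (R * R)) : compact K ->
  exists2 M : R, 0 < M & K `<=` crect (- M) M (- M) M.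
Proof.
move=> /compact_bounded[M [_ HM]]; exists (Num.max M 0 + 1).
  by rewrite ltr_wpDl// le_max lexx orbT.
move=> x Kx; have : `|x| <= Num.max M 0 + 1.
  by apply: HM => //; rewrite (le_lt_trans (_ : M <= Num.max M 0))// ?le_max ?lexx// ltrDl.
rewrite /Num.norm /= /Num.Def.normr /= ge_max => /andP[h1 h2].
by split; rewrite /= in_itv /= -ler_norml.
Qed.

Lemma measurable_crect a b c d : measurable (crect a b c d : set mR2).
Proof. by apply: measurableX; exact: measurable_itv. Qed.

Lemma area_crect_fin (a b c d : R) : (area (crect a b c d : set mR2) < +oo)%E.
Proof.
have h (x y : R) : (0 <= (@lebesgue_measure R) `[x, y]%classic < +oo)%E.
  by rewrite measure_ge0 /= lebesgue_measure_itv; case: ifP => _; rewrite ?ltry// -EFinB ltry.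
have -> : area (crect a b c d : set mR2) =
    ((@lebesgue_measure R) `[a, b]%classic * (@lebesgue_measure R) `[c, d]%classic)%E.
  by apply: product_measure1E; exact: measurable_itv.
have /andP[h1 h2] := h a b; have /andP[h3 h4] := h c d.
have f1 : (@lebesgue_measure R) `[a, b]%classic \is a fin_num by rewrite ge0_fin_numE.
have f2 : (@lebesgue_measure R) `[c, d]%classic \is a fin_num by rewrite ge0_fin_numE.
by rewrite -(fineK f1) -(fineK f2) -EFinM ltry.
Qed.

Lemma cont_crect_bounded (f : R * R -> R) a b c d : continuous f ->
  exists2 M, 0 <= M & forall x, crect a b c d x -> `|f x| <= M.
Proof.
move=> cf; have cc : compact (f @` crect a b c d).
  apply: continuous_compact; first exact: continuous_subspaceT.
  exact: crect_compact.
have [M [_ HM]] := compact_bounded cc.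
exists (Num.max M 0 + 1); first by rewrite addr_ge0// le_max lexx orbT.
move=> x Kx; apply: HM; last by exists x.
by rewrite (le_lt_trans (_ : M <= Num.max M 0))// ?le_max ?lexx// ltrDl.
Qed.

Lemma cpt_integrable (f : R * R -> R) a b c d : continuous f ->
  (forall x, f x != 0 -> crect a b c d x) ->
  area.-integrable setT (EFin \o (f : mR2 -> R)).
Proof.
move=> cf Hf; have [M M0 HM] := cont_crect_bounded a b c d cf.
have mC := measurable_crect a b c d.
have -> : EFin \o (f : mR2 -> R) = (EFin \o f) \_ (crect a b c d : set mR2).
  apply/funext => x; rewrite patchE; case: ifPn => // /negP nx /=.
  by congr EFin; apply/eqP/negPn/negP => /Hf Cx; apply: nx; exact/mem_set.
apply/(integrable_mkcond _ mC).1; apply: measurable_bounded_integrable => //.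
- exact: area_crect_fin.
- by apply: measurable_funTS; exact: continuous_measurable_plane.
- exists M; split; first exact: num_real.
  by move=> y My x Cx; apply: le_trans (HM _ Cx) (ltW My).
Qed.

(** The complement of a closed set is open, so off [C] the function is zero in a neighbourhood. *)
Lemma derive_off_closed (C : set (R * R)) (f : R * R -> R) j : closed C ->
  (forall x, f x != 0 -> C x) -> forall x, 'D_(basis j) f x != 0 -> C x.
Proof.
move=> cC Hf x; apply: contra_neqP => nCx.
have oC : open (~` C) by rewrite openC.
have E : \forall y \near x, cst 0 y = f y.
  have := open_nbhs_nbhs (conj oC nCx); apply: filterS => y nCy.
  by apply/esym/eqP/negPn/negP => /Hf.
by have [_ ->] := near_eq_is_derive E (is_derive_cst (0 : R) x (basis j)).
Qed.

End compactness.

Lemma ae_imp (R : realType) d (T : measurableType d) (mu : {measure set T -> \bar R}) (P Q : T -> Prop) :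
  (forall x, P x -> Q x) -> {ae mu, forall x, P x} -> {ae mu, forall x, Q x}.
Proof. by move=> PQ; apply: filterS => x; exact: PQ. Qed.

Lemma ae_imp2 (R : realType) d (T : measurableType d) (mu : {measure set T -> \bar R}) (P Q S : T -> Prop) :
  (forall x, P x -> Q x -> S x) -> {ae mu, forall x, P x} -> {ae mu, forall x, Q x} ->
  {ae mu, forall x, S x}.
Proof. by move=> PQS; apply: filterS2 => x; exact: PQS. Qed.

(** * Weak derivatives: smooth functions, uniqueness *)

Section weak_derivatives.
Context {R : realType}.
Local Notation mR := (measurableTypeR R).
Local Notation mR2 := (measurableTypeR R * measurableTypeR R)%type.
Local Notation leb := (@lebesgue_measure R).
Implicit Types (D : set (R * R)) (u g : R * R -> R[i]) (phi : R * R -> R).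

Lemma closed_measurable_plane D : closed D -> measurable (D : set mR2).
Proof.
by move=> cD; rewrite -(setCK D); apply: measurableC; apply: open_measurable_plane; rewrite openC.
Qed.

Lemma plane_compact_closed (K : set (R * R)) : compact K -> closed K.
Proof. by apply: compact_closed; exact: norm_hausdorff. Qed.

Lemma tsupport_sub (T : zmodType) (h : R * R -> T) x : h x != 0 -> tsupport h x.
Proof. by move=> hx; apply: subset_closure. Qed.

Lemma testfun_D D phi j : testfun D phi -> testfun D (fun x => 'D_(basis j) phi x).
Proof.
move=> [Cphi Kphi Dphi]; have cl : closed (tsupport phi) by exact: closed_closure.
have sub : tsupport (fun x => 'D_(basis j) phi x) `<=` tsupport phi.
  move=> x hx; apply: (cl); apply: closure_subset hx => y /=.
  by apply: (derive_off_closed cl); exact: tsupport_sub.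
split; first exact: Cinfty_D.
  by apply: subclosed_compact Kphi sub; exact: closed_closure.
exact: subset_trans sub Dphi.
Qed.

Lemma testfun_bounded D phi : testfun D phi -> exists2 M, 0 <= M & forall x, `|phi x| <= M.
Proof.
move=> [Cphi /compact_in_crect[N N0 KN] _].
have [M M0 HM] := cont_crect_bounded (- N) N (- N) N (Cinfty_continuous Cphi).
exists M => // x; have [p0|p0] := eqVneq (phi x) 0; first by rewrite p0 normr0.
by apply: HM; apply: KN; exact: tsupport_sub.
Qed.

Lemma test_measurable D phi : testfun D phi -> measurable_fun setT (phi : mR2 -> R).
Proof. by move=> [C _ _]; apply: continuous_measurable_plane; exact: Cinfty_continuous. Qed.

Lemma test_integrable D (f phi : mR2 -> R) : open D -> testfun D phi ->
  measurable_fun (D : set mR2) f ->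
  (forall K : set (R * R), compact K -> K `<=` D -> (\int[area]_(x in K) `|f x|%:E < +oo)%E) ->
  area.-integrable D (EFin \o (fun x => f x * phi x)).
Proof.
move=> oD tphi mf lf; have mD := open_measurable_plane oD.
have [Cphi Kphi Dphi] := tphi; have [M M0 HM] := testfun_bounded tphi.
have mphi := test_measurable tphi.
have mK := closed_measurable_plane (plane_compact_closed Kphi).
have mfp : measurable_fun (D : set mR2) (fun x => f x * phi x).
  by apply: measurable_funM => //; exact: measurable_funTS.
apply/integrableP; split; first exact/measurable_EFinP.
have mfK : measurable_fun (tsupport phi : set mR2) (fun x => `|f x|%:E).
  by apply/measurable_EFinP; apply: measurableT_comp => //; exact: (measurable_funS mD Dphi).
apply: (@le_lt_trans _ _ (M%:E * \int[area]_(x in tsupport phi) `|f x|%:E)%E); last first.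
  by rewrite lte_mul_pinfty ?lee_fin//; exact: lf.
rewrite -ge0_integralZl//.
rewrite [leLHS]integral_mkcond [leRHS]integral_mkcond; apply: ge0_le_integral => //.
- by move=> x _; apply: restrict_ge0 => y; exact: abse_ge0.
- apply/(measurable_restrict _ mD measurableT); rewrite setTI; apply: measurableT_comp => //; exact/measurable_EFinP.
- by apply/(measurable_restrict _ mK measurableT); rewrite setTI; exact: emeasurable_funM.
- move=> x _; rewrite !patchE; have [p0|p0] := eqVneq (phi x) 0.
    apply: (@le_trans _ _ 0%E); last by case: ifP => // _; rewrite mule_ge0 ?lee_fin.
    by case: ifP => // _; rewrite /= p0 mulr0 normr0.
  have Kx : tsupport phi x by exact: tsupport_sub.
  rewrite !ifT; last 2 first.
  + exact/mem_set.
  + exact/mem_set/Dphi.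
  by rewrite /= lee_fin normrM mulrC ler_wpM2r.
Qed.

(** The fundamental theorem on each line parallel to [basis j], between two points beyond the
    support. *)
Lemma integral_derive0 (H : R * R -> R) (j : 'I_2) : Ck 1 H -> compact (tsupport H) ->
  (\int[area]_x ('D_(basis j) H x)%:E = 0)%E.
Proof.
move=> CH /compact_in_crect[M M0 KM]; have [cH dH DH] := CkSE CH.
have HM x : H x != 0 -> crect (- M) M (- M) M x by move=> h; apply: KM; exact: tsupport_sub.
have cD : continuous (fun x => 'D_(basis j) H x) by exact: DH.
have DM x : 'D_(basis j) H x != 0 -> crect (- M) M (- M) M x.
  exact: (derive_off_closed (@crect_closed _ _ _ _ _) HM).
have iD := cpt_integrable cD DM.
have N0 : - (M + 1) < M + 1 by lra.
have line (h h' : R -> R) : (forall t, is_derive t (1 : R) h (h' t)) -> continuous h' ->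
    (forall t, h' t != 0 -> - M <= t <= M) -> h (M + 1) = 0 -> h (- (M + 1)) = 0 ->
    (\int[leb]_t (h' t)%:E = 0)%E.
  move=> dh ch' h'M h1 h2.
  transitivity (\int[leb]_(t in `[(- (M + 1))%R, (M + 1)%R]) (h' t)%:E)%E.
    rewrite [RHS]integral_mkcond; apply: eq_integral => t _; rewrite patchE.
    case: ifPn => // /negP nt; congr EFin; apply/eqP/negPn/negP => /h'M tM.
    by apply: nt; apply/mem_set; rewrite /= in_itv /=; lra.
  have ch : continuous h.
    by move=> t; apply/differentiable_continuous/derivable1_diffP; have [] := dh t.
  rewrite (@continuous_FTC2 _ h' h)//.
  - by rewrite h1 h2 subee.
  - exact: continuous_subspaceT.
  - split; first by move=> t _; have [] := dh t.
    + apply: cvg_at_right_filter; exact: ch.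
    + apply: cvg_at_left_filter; exact: ch.
  - by move=> t _; rewrite derive1E; have [_] := dh t.
have off x : ~ crect (- M) M (- M) M x -> H x = 0 by move=> nx; apply/eqP/negPn/negP => /HM.
have d x : is_derive x (basis j) H ('D_(basis j) H x) by exact: DeriveDef.
elim/basis_ind: j cD DM iD d => cD DM iD d.
- rewrite -integral21_prod_meas1//; apply: integral0_eq => t _.
  apply: (line (fun s => H (s, t)) (fun s => 'D_(basis ord0) H (s, t))).
  + by move=> s; exact: (dline1 d s t).
  + exact: (@cont_hline R (fun x => 'D_(basis ord0) H x) t cD).
  + by move=> s /DM [/=]; rewrite in_itv.
  + by apply: off => -[/=]; rewrite in_itv /=; lra.
  + by apply: off => -[/=]; rewrite in_itv /=; lra.
- rewrite -integral12_prod_meas1//; apply: integral0_eq => s _.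
  apply: (line (fun t => H (s, t)) (fun t => 'D_(basis ord_max) H (s, t))).
  + by move=> t; exact: (dline2 d s t).
  + exact: (@cont_vline R (fun x => 'D_(basis ord_max) H x) s cD).
  + by move=> t /DM [/=] _; rewrite in_itv.
  + by apply: off => -[/=] _; rewrite in_itv /=; lra.
  + by apply: off => -[/=] _; rewrite in_itv /=; lra.
Qed.

(** [integral_derive0] for the product F phi, which is supported in [D], so that no boundary term
    arises. *)
Lemma ibp_real D (F phi : R * R -> R) j : open D -> Cinfty F -> testfun D phi ->
  \int[area]_(x in D) (F x * 'D_(basis j) phi x) =
  - \int[area]_(x in D) ('D_(basis j) F x * phi x).
Proof.
move=> oD CF tphi; have [Cphi Kphi Dphi] := tphi; have tDphi := testfun_D j tphi.
have mD := open_measurable_plane oD.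
have loc (f : R * R -> R) (K : set (R * R)) : continuous f -> compact K -> (\int[area]_(x in K) `|f x|%:E < +oo)%E.
  move=> cf cK; have [N N0 KN] := compact_in_crect cK.
  have [M M0 HM] := cont_crect_bounded (- N) N (- N) N cf.
  have mK := closed_measurable_plane (plane_compact_closed cK).
  have mC := measurable_crect (- N) N (- N) N.
  have mf := continuous_measurable_plane cf.
  apply: (@le_lt_trans _ _ (\int[area]_(x in crect (- N) N (- N) N) M%:E)%E).
    apply: (@le_trans _ _ (\int[area]_(x in K) M%:E)%E).
      apply: ge0_le_integral => //.
      - by apply/measurable_EFinP; apply: measurableT_comp => //; exact: measurable_funTS.
      - by move=> x Kx; rewrite lee_fin HM//; exact: KN.
    by apply: ge0_subset_integral => // x _; rewrite lee_fin.
  by rewrite integral_cst//= lte_mul_pinfty ?lee_fin//; exact: area_crect_fin.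
have i1 : area.-integrable D (EFin \o (fun x => F x * 'D_(basis j) phi x)).
  apply: (test_integrable oD tDphi); first exact: (measurable_funTS (continuous_measurable_plane (Cinfty_continuous CF))).
  by move=> K cK _; apply: loc => //; exact: Cinfty_continuous.
have i2 : area.-integrable D (EFin \o (fun x => 'D_(basis j) F x * phi x)).
  apply: (test_integrable oD tphi); first exact: (measurable_funTS (continuous_measurable_plane (Cinfty_continuous (Cinfty_D j CF)))).
  by move=> K cK _; apply: loc => //; exact: Cinfty_continuous (Cinfty_D j CF).
apply/eqP; rewrite -subr_eq0 opprK; apply/eqP; rewrite -(RintegralD mD i1 i2).
have sub : tsupport (fun x => F x * phi x) `<=` tsupport phi.
  move=> x hx; apply: (closure_subset _ hx) => y /=.
  by apply: contraNneq => ->; rewrite mulr0.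
have CH : Ck 1 (fun x => F x * phi x) by apply: CkM; [exact: CF|exact: Cphi].
have KH : compact (tsupport (fun x => F x * phi x)).
  by apply: subclosed_compact Kphi sub; exact: closed_closure.
have := integral_derive0 j CH KH; rewrite /Rintegral => I0.
suff -> : (\int[area]_(x in D) (F x * 'D_(basis j) phi x + 'D_(basis j) F x * phi x)%:E =
    \int[area]_x ('D_(basis j) (fun x => F x * phi x) x)%:E)%E by rewrite I0.
rewrite integral_mkcond; apply: eq_integral => x _; rewrite patchE.
have E y : 'D_(basis j) (fun x => F x * phi x) y = F y * 'D_(basis j) phi y + 'D_(basis j) F y * phi y.
  have d1 := Cinfty_is_derive j y CF; have d2 := Cinfty_is_derive j y Cphi.
  by have [_ ->] := is_deriveM d1 d2; rewrite /GRing.scale /= (mulrC (phi y)).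
case: ifPn => [_|/negP nD]; first by rewrite E.
apply/esym; congr EFin; apply/eqP/negPn/negP => h; apply: nD; apply/mem_set/Dphi.
apply: sub; apply: (derive_off_closed _ (fun x => @tsupport_sub _ _ x) h).
exact: closed_closure.
Qed.

Definition cderiv (j : 'I_2) (w : R * R -> R[i]) (x : R * R) : R[i] :=
  Complex ('D_(basis j) (fun x => complex.Re (w x)) x) ('D_(basis j) (fun x => complex.Im (w x)) x).

Lemma area_compact_fin (K : set (R * R)) : compact K -> (area (K : set mR2) < +oo)%E.
Proof.
move=> cK; have [N N0 KN] := compact_in_crect cK.
apply: le_lt_trans (area_crect_fin (- N) N (- N) N); apply: le_measure => //; rewrite inE.
- exact: closed_measurable_plane (plane_compact_closed cK).
- exact: measurable_crect.
Qed.

Lemma cL2_loc D u : open D -> cL2 area (D : set mR2) u -> loc_integrable D u.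
Proof.
move=> oD [mu u2]; split => // K cK KD.
have mK := closed_measurable_plane (plane_compact_closed cK); have mD := open_measurable_plane oD.
have mK' := measurable_funS mD KD (msqr (mu : cmeas D u)).
apply: (@le_lt_trans _ _ (\int[area]_(x in K) (1 + modulus (u x) ^+ 2)%:E)%E).
  apply: ge0_le_integral => //.
  - by move=> x _; rewrite lee_fin modulus_ge0.
  - by apply/measurable_EFinP; apply: (measurable_funS mD KD); exact: mmod.
  - by apply/measurable_EFinP; exact: measurable_funD.
  - move=> x _; rewrite lee_fin; have := sqr_ge0 (1 - modulus (u x)); rewrite !expr2.
    have := modulus_ge0 (u x); nra.
under eq_integral do rewrite EFinD.
rewrite ge0_integralD//; last 2 first.
- by move=> x _; rewrite lee_fin sqr_ge0.
- exact/measurable_EFinP.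
rewrite integral_cst//= mul1e lte_add_pinfty//; first exact: area_compact_fin.
apply: le_lt_trans u2; apply: ge0_subset_integral => //.
- exact: msqrE.
- by move=> x _; rewrite lee_fin sqr_ge0.
Qed.

Lemma smooth_loc D w : open D -> Cinfty (fun x => complex.Re (w x)) ->
  Cinfty (fun x => complex.Im (w x)) -> loc_integrable D w.
Proof.
move=> oD C1 C2.
have m1 := continuous_measurable_plane (Cinfty_continuous C1).
have m2 := continuous_measurable_plane (Cinfty_continuous C2).
split; first by split; exact: measurable_funTS.
move=> K cK KD; have mK := closed_measurable_plane (plane_compact_closed cK).
have cw : cmeas (K : set mR2) w by split; exact: measurable_funTS.
have [N N0 KN] := compact_in_crect cK.
have [M1 M10 HM1] := cont_crect_bounded (- N) N (- N) N (Cinfty_continuous C1).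
have [M2 M20 HM2] := cont_crect_bounded (- N) N (- N) N (Cinfty_continuous C2).
apply: (@le_lt_trans _ _ (\int[area]_(x in K) (M1 + M2)%:E)%E).
  apply: ge0_le_integral => //.
  - by move=> x _; rewrite lee_fin modulus_ge0.
  - by apply/measurable_EFinP; exact: mmod.
  - move=> x Kx; rewrite lee_fin; apply: (le_trans (modulus_le _)); apply: lerD.
      by apply: HM1; exact: KN.
    by apply: HM2; exact: KN.
by rewrite integral_cst//= lte_mul_pinfty ?lee_fin ?addr_ge0//; exact: area_compact_fin.
Qed.

Lemma cint_real D u phi : cint D (fun x => u x * (phi x)%:C%C) =
  Complex (\int[area]_(x in D) (complex.Re (u x) * phi x)) (\int[area]_(x in D) (complex.Im (u x) * phi x)).
Proof.
by rewrite /cint; congr Complex; apply: eq_Rintegral => x _; rewrite ?Re_real ?Im_real.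
Qed.

Lemma smooth_weak_deriv D w j : open D -> Cinfty (fun x => complex.Re (w x)) ->
  Cinfty (fun x => complex.Im (w x)) -> is_weak_deriv D j w (cderiv j w).
Proof.
move=> oD C1 C2; split; first exact: smooth_loc.
  by apply: smooth_loc => //; exact: Cinfty_D.
move=> phi tphi; rewrite !cint_real /cderiv /= (ibp_real j oD C1 tphi) (ibp_real j oD C2 tphi).
by [].
Qed.

Lemma loc_parts D u : open D -> loc_integrable D u -> forall K : set (R * R), compact K -> K `<=` D ->
  (\int[area]_(x in K) `|complex.Re (u x)|%:E < +oo)%E /\ (\int[area]_(x in K) `|complex.Im (u x)|%:E < +oo)%E.
Proof.
move=> oD [[m1 m2] Hu] K cK KD; have mD := open_measurable_plane oD.
have mK := closed_measurable_plane (plane_compact_closed cK).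
have cw : cmeas (K : set mR2) u by split; exact: (measurable_funS mD KD).
split; apply: le_lt_trans (Hu K cK KD); apply: ge0_le_integral => //;
  do ?[by move=> x _; rewrite lee_fin ?modulus_ge0|by apply/measurable_EFinP; exact: mmod].
- by apply/measurable_EFinP; apply: measurableT_comp => //; case: cw.
- by move=> x _; rewrite lee_fin Re_le_modulus.
- by apply/measurable_EFinP; apply: measurableT_comp => //; case: cw.
- by move=> x _; rewrite lee_fin Im_le_modulus.
Qed.

(** [fundamental] concerns real functions, so the real and the imaginary part of the difference are
    treated separately. *)
Lemma weak_deriv_unique D j u g g' : open D -> is_weak_deriv D j u g ->
  is_weak_deriv D j u g' -> {ae area, forall x, D x -> g x = g' x}.
Proof.
move=> oD [_ lg Hg] [_ lg' Hg']; have mD := open_measurable_plane oD.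
have core (f f' : mR2 -> R) : measurable_fun (D : set mR2) f -> measurable_fun (D : set mR2) f' ->
    (forall K : set (R * R), compact K -> K `<=` D -> (\int[area]_(x in K) `|f x|%:E < +oo)%E) ->
    (forall K : set (R * R), compact K -> K `<=` D -> (\int[area]_(x in K) `|f' x|%:E < +oo)%E) ->
    (forall phi, testfun D phi -> \int[area]_(x in D) (f x * phi x) = \int[area]_(x in D) (f' x * phi x)) ->
    {ae area, forall x, D x -> f x = f' x}.
  move=> mf mf' lf lf' H.
  have : {ae area, forall x, D x -> (fun x => f x - f' x) x = 0}.
    apply: fundamental => //.
    - move=> a b c d QD; have mQ := @measurable_rect R a b c d.
      have QC := @rect_crect R a b c d; have mC := measurable_crect a b c d.
      have one (h : mR2 -> R) : measurable_fun (D : set mR2) h ->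
          (forall K : set (R * R), compact K -> K `<=` D -> (\int[area]_(x in K) `|h x|%:E < +oo)%E) ->
          area.-integrable (rect a b c d) (EFin \o h).
        move=> mh lh; apply: (integrableS mC mQ QC); apply/integrableP; split.
          by apply/measurable_EFinP; exact: (measurable_funS mD QD).
        exact: (lh _ (@crect_compact R a b c d) QD).
      exact: (integrableB mQ (one f mf lf) (one f' mf' lf')).
    - move=> phi tphi; have i1 := test_integrable oD tphi mf lf; have i2 := test_integrable oD tphi mf' lf'.
      have iB : area.-integrable D (EFin \o (fun x => f x * phi x - f' x * phi x)) by exact: (integrableB mD i1 i2).
      have : \int[area]_(x in D) (f x * phi x - f' x * phi x) = 0.
        by rewrite (RintegralB mD i1 i2) H// subrr.
      rewrite /Rintegral => h; under eq_integral do rewrite mulrBl.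
      by rewrite -(fineK (integrable_fin_num mD iB)) h.
  by apply: ae_imp => x h /h /eqP; rewrite subr_eq0 => /eqP.
have [[m1 m2] _] := lg; have [[m1' m2'] _] := lg'.
have pl := loc_parts oD lg; have pl' := loc_parts oD lg'.
have E phi : testfun D phi -> cint D (fun x => g x * (phi x)%:C%C) = cint D (fun x => g' x * (phi x)%:C%C).
  by move=> tphi; apply: oppr_inj; rewrite -Hg// -Hg'.
have h1 : {ae area, forall x, D x -> complex.Re (g x) = complex.Re (g' x)}.
  apply: core => //; do ?[by move=> K cK KD; have [] := pl K cK KD|by move=> K cK KD; have [] := pl' K cK KD].
  by move=> phi /E; rewrite !cint_real => -[].
have h2 : {ae area, forall x, D x -> complex.Im (g x) = complex.Im (g' x)}.
  apply: core => //; do ?[by move=> K cK KD; have [] := pl K cK KD|by move=> K cK KD; have [] := pl' K cK KD].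
  by move=> phi /E; rewrite !cint_real => -[].
by apply: ae_imp2 h1 h2 => x e1 e2 Dx; apply: complex_eq; [exact: e1|exact: e2].
Qed.

End weak_derivatives.

(** The real part for [true], the imaginary part for [false]: one statement then gives both scalar
    identities contained in a complex one. *)
Definition part {R : realType} (b : bool) (z : R[i]) : R :=
  if b then complex.Re z else complex.Im z.

(** * Pairings with a bounded coefficient *)

Section pairing.
Context {R : realType} {d : measure_display} {T : measurableType d}.
Variables (mu : {measure set T -> \bar R}) (D : set T).
Hypothesis mD : measurable D.
Implicit Types u v p q a : T -> R[i].

Lemma part_le b (z : R[i]) : `|part b z| <= modulus z.
Proof. by case: b; [exact: Re_le_modulus|exact: Im_le_modulus]. Qed.

Lemma partD b (z z' : R[i]) : part b (z + z') = part b z + part b z'.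
Proof. by case: b; rewrite /= ?ReD ?ImD. Qed.

Lemma partN b (z : R[i]) : part b (- z) = - part b z.
Proof. by case: b; rewrite /= ?ReN ?ImN. Qed.

Lemma partB b (z z' : R[i]) : part b (z - z') = part b z - part b z'.
Proof. by rewrite partD partN. Qed.

Lemma part_measurable b u : cmeas D u -> measurable_fun D (fun x => part b (u x)).
Proof. by case: b => -[]. Qed.

Definition rsqn u : R := fine (sqn mu D u).

Lemma rsqn_ge0 u : 0 <= rsqn u. Proof. exact/fine_ge0/sqn_ge0. Qed.

Lemma rsqnE u : cL2 mu D u -> sqn mu D u = (rsqn u)%:E.
Proof. by move=> [_ h]; rewrite /rsqn fineK// ge0_fin_numE ?sqn_ge0. Qed.

Definition bounded_coef (M : R) a : Prop :=
  cmeas D a /\ {ae mu, forall x, D x -> modulus (a x) <= M}.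

(** Every term of a tested equation has this shape for a suitable measure and coefficient, including
    the right-hand side (a = 1) and the boundary term (Lebesgue measure on the line). *)
Definition pint b a p q : R := \int[mu]_(x in D) part b (a x * p x * conjc (q x)).

Lemma pint_measurable b a p q : cmeas D a -> cmeas D p -> cmeas D q ->
  measurable_fun D (fun x => part b (a x * p x * conjc (q x))).
Proof.
by move=> ma mp mq; apply: part_measurable; apply: cmeasM; [exact: cmeasM|exact: cmeas_conj].
Qed.

Lemma pint_bound b M a p q : bounded_coef M a ->
  {ae mu, forall x, D x -> `|part b (a x * p x * conjc (q x))| <= M * (modulus (p x) * modulus (q x))}.
Proof.
move=> [_]; apply: ae_imp => x aM Dx; apply: (le_trans (part_le _ _)).
rewrite !modulusM modulus_conj -mulrA; apply: ler_wpM2r; last exact: aM.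
by apply: mulr_ge0; exact: modulus_ge0.
Qed.

Lemma pint_integrable b M a p q : 0 <= M -> bounded_coef M a -> cL2 mu D p -> cL2 mu D q ->
  mu.-integrable D (EFin \o (fun x => part b (a x * p x * conjc (q x)))).
Proof.
move=> M0 ba hp hq; apply: (@dom_integrable _ _ _ mu D mD M p q) => //.
  by case: ba hp hq => ma _ [mp _] [mq _]; exact: pint_measurable.
apply: ae_imp (pint_bound b p q ba) => x h Dx; apply: (le_trans (h Dx)); apply: (ler_wpM2l M0).
have := sqr_ge0 (modulus (p x) - modulus (q x)).
have := sqr_ge0 (modulus (p x)); have := sqr_ge0 (modulus (q x)); rewrite !expr2; lra.
Qed.

Lemma pint_cs b M a p q : 0 <= M -> bounded_coef M a -> cL2 mu D p -> cL2 mu D q ->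
  pint b a p q ^+ 2 <= M ^+ 2 * (rsqn p * rsqn q).
Proof.
move=> M0 ba hp hq; rewrite -lee_fin (EFinM (M ^+ 2)) (EFinM (rsqn p)) -!rsqnE//.
apply: cauchy_schwarz => //; last exact: pint_bound.
by case: ba hp hq => ma _ [mp _] [mq _]; exact: pint_measurable.
Qed.

Lemma pint_Bl b M a p p' q : 0 <= M -> bounded_coef M a -> cL2 mu D p -> cL2 mu D p' -> cL2 mu D q ->
  pint b a (fun x => p x - p' x) q = pint b a p q - pint b a p' q.
Proof.
move=> M0 ba hp hp' hq; rewrite /pint -(RintegralB mD); last 2 first.
- exact: (pint_integrable _ M0 ba).
- exact: (pint_integrable _ M0 ba).
by apply: eq_Rintegral => x _; rewrite -partB mulrBr mulrBl.
Qed.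

Lemma pint_Br b M a p q q' : 0 <= M -> bounded_coef M a -> cL2 mu D p -> cL2 mu D q -> cL2 mu D q' ->
  pint b a p (fun x => q x - q' x) = pint b a p q - pint b a p q'.
Proof.
move=> M0 ba hp hq hq'; rewrite /pint -(RintegralB mD); last 2 first.
- exact: (pint_integrable _ M0 ba).
- exact: (pint_integrable _ M0 ba).
by apply: eq_Rintegral => x _; rewrite -partB rmorphB/= mulrBr.
Qed.

Lemma vanishes_sqn_fin (p_ : nat -> T -> R[i]) p : (forall n, cL2 mu D (p_ n)) -> cL2 mu D p ->
  vanishes (fun n => sqn mu D (fun x => p_ n x - p x)) ->
  vanishes (fun n => (rsqn (fun x => p_ n x - p x))%:E).
Proof.
move=> h_ h va e e0; have := va e e0; apply: filterS => n.
by rewrite rsqnE//; exact: cL2B.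
Qed.

(** The square of the difference is used because Cauchy-Schwarz controls it without square roots. *)
Lemma pint_cvg b M a p q (p_ q_ : nat -> T -> R[i]) : 0 <= M -> bounded_coef M a ->
  cL2 mu D p -> cL2 mu D q -> (forall n, cL2 mu D (p_ n)) -> (forall n, cL2 mu D (q_ n)) ->
  vanishes (fun n => sqn mu D (fun x => p_ n x - p x)) ->
  vanishes (fun n => sqn mu D (fun x => q_ n x - q x)) ->
  vanishes (fun n => ((pint b a (p_ n) (q_ n) - pint b a p q) ^+ 2)%:E).
Proof.
move=> M0 ba hp hq hp_ hq_ vp vq e e0.
have vp' := vanishes_sqn_fin hp_ hp vp; have vq' := vanishes_sqn_fin hq_ hq vq.
(* Sum of the factors in front of the two errors; [2 * rsqn q + 2] bounds the squared norm of [q_ n]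
   once its error is at most 1. *)
pose k := 2 * M ^+ 2 * (2 * rsqn q + 2 + rsqn p) + 1.
have P0 := rsqn_ge0 p; have Q0 := rsqn_ge0 q.
have k0 : 0 < k by rewrite ltr_wpDl// mulr_ge0// ?mulr_ge0// ?sqr_ge0//; lra.
near=> n; rewrite lee_fin.
have h1 : rsqn (fun x => p_ n x - p x) <= e / 2 / k.
  by rewrite -lee_fin; near: n; apply: vp'; rewrite !divr_gt0.
have h2 : rsqn (fun x => q_ n x - q x) <= e / 2 / k.
  by rewrite -lee_fin; near: n; apply: vq'; rewrite !divr_gt0.
have h3 : rsqn (fun x => q_ n x - q x) <= 1 by rewrite -lee_fin; near: n; exact: vq'.
have hpn : cL2 mu D (fun x => p_ n x - p x) by exact: cL2B.
have hqn : cL2 mu D (fun x => q_ n x - q x) by exact: cL2B.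
have EY := pint_Bl b M0 ba (hp_ n) hp (hq_ n); have EX := pint_Br b M0 ba hp (hq_ n) hq.
set Y := pint b a (fun x => p_ n x - p x) (q_ n) in EY.
set X := pint b a p (fun x => q_ n x - q x) in EX.
have -> : pint b a (p_ n) (q_ n) - pint b a p q = Y + X by rewrite EX EY; ring.
have cX : X ^+ 2 <= M ^+ 2 * (rsqn p * rsqn (fun x => q_ n x - q x)) by exact: pint_cs.
have cY : Y ^+ 2 <= M ^+ 2 * (rsqn (fun x => p_ n x - p x) * rsqn (q_ n)) by exact: pint_cs.
have hQ : rsqn (q_ n) <= 2 * rsqn q + 2.
  have := sqnD mu mD (proj1 hqn) (proj1 hq).
  rewrite (_ : (fun x => _ + _) = q_ n); last by apply/funext => x; rewrite subrK.
  by rewrite !rsqnE// -!EFinM -EFinD lee_fin; lra.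
have p0 := rsqn_ge0 (fun x => p_ n x - p x); have q0 := rsqn_ge0 (fun x => q_ n x - q x).
move: cX cY h1 h2 h3 hQ p0 q0; set a1 := rsqn (fun x => p_ n x - p x); set b1 := rsqn (fun x => q_ n x - q x).
move=> cX cY h1 h2 h3 hQ p0 q0.
have M2 : 0 <= M ^+ 2 by exact: sqr_ge0.
apply: (@le_trans _ _ (2 * X ^+ 2 + 2 * Y ^+ 2)); first by have := sqr_ge0 (X - Y); rewrite !expr2; lra.
set t := e / 2 / k.
have t0 : 0 <= t by rewrite !divr_ge0// ltW.
have l1 : a1 * rsqn (q_ n) <= t * (2 * rsqn q + 2).
  by apply: ler_pM => //; exact: rsqn_ge0.
have l2 : rsqn p * b1 <= rsqn p * t by apply: ler_wpM2l.
have l3 := ler_wpM2l M2 l1; have l4 := ler_wpM2l M2 l2.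
have -> : e = 2 * (k * t) by rewrite /t; field; rewrite gt_eqF.
have : 0 <= t * (2 * (M ^+ 2 * rsqn q) + 2 * M ^+ 2 + M ^+ 2 * rsqn p).
  apply: mulr_ge0 => //; have := mulr_ge0 M2 Q0; have := mulr_ge0 M2 P0; lra.
by rewrite /k; move: cX cY l3 l4; nra.
Unshelve. all: by end_near. Qed.

End pairing.

Lemma sum2E {V : nmodType} (f : 'I_2 -> V) : \sum_(j < 2) f j = f ord0 + f ord_max.
Proof. by rewrite big_ord_recl big_ord1; congr (_ + f _); exact: val_inj. Qed.

(** * Functions with approximated weak derivatives *)

Section jets.
Context {R : realType}.
Local Notation mR := (measurableTypeR R).
Local Notation mR2 := (measurableTypeR R * measurableTypeR R)%type.
Implicit Types (D : set (R * R)) (u v : R * R -> R[i]).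

Definition sqa (D : set (R * R)) (u : R * R -> R[i]) : \bar R := sqn area (D : set mR2) u.
Definition cL2a (D : set (R * R)) (u : R * R -> R[i]) : Prop := cL2 area (D : set mR2) u.

(* [w] is a sequence of smooth approximants of [u] in W_2^1(D); [g] are the weak derivatives. *)
Record jet (D : set (R * R)) (u : R * R -> R[i]) (g : 'I_2 -> R * R -> R[i])
    (w : nat -> R * R -> R[i]) : Prop := Jet {
  jet_smooth : forall n, csmooth_cpt (w n);
  jet_u : cL2a D u;
  jet_g : forall j, cL2a D (g j);
  jet_cvg : vanishes (fun n => sqa D (fun x => w n x - u x));
  jet_cvgD : forall j, vanishes (fun n => sqa D (fun x => cderiv j (w n) x - g j x)) }.

Lemma sqa_ge0 D u : (0 <= sqa D u)%E. Proof. exact: sqn_ge0. Qed.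

Lemma normL2E D u : normL2 D u = (sqa D u `^ 2^-1)%E. Proof. by []. Qed.

Lemma normL2_sqr D u : (normL2 D u `^ 2 = sqa D u)%E.
Proof. by rewrite normL2E sqrt_poweR// sqn_ge0. Qed.

Lemma L2P D u : L2 D u <-> cL2a D u.
Proof.
rewrite /L2 normL2E; split => -[h1 h2]; split => //; last exact: poweR_lty.
by apply: lty_poweRy h2; rewrite invr_neq0.
Qed.

Lemma part_smooth b (w : R * R -> R[i]) : csmooth_cpt w -> Cinfty (fun x => part b (w x)).
Proof. by case: b => -[]. Qed.

Lemma part_cderiv b j (w : R * R -> R[i]) x : part b (cderiv j w x) = 'D_(basis j) (fun x => part b (w x)) x.
Proof. by case: b. Qed.

Lemma csmooth_cmeas D (w : R * R -> R[i]) : open D -> csmooth_cpt w -> cmeasurable D w.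
Proof. by move=> oD [C1 C2 _]; have [] := smooth_loc oD C1 C2. Qed.

Lemma cderiv_cmeas D (w : R * R -> R[i]) j : open D -> csmooth_cpt w -> cmeasurable D (cderiv j w).
Proof. by move=> oD [C1 C2 _]; have [_ []] := smooth_weak_deriv j oD C1 C2. Qed.

Lemma cL2_cpt D (phi : R * R -> R) : open D -> continuous phi -> compact (tsupport phi) ->
  cL2a D (fun x => (phi x)%:C%C).
Proof.
move=> oD cphi /compact_in_crect[M _ KM]; have mD := open_measurable_plane oD.
have mphi := continuous_measurable_plane cphi.
have i2 : area.-integrable setT (EFin \o (fun x => phi x ^+ 2)).
  apply: (@cpt_integrable R (fun x => phi x ^+ 2) (- M) M (- M) M); first exact: contX.
  by move=> x; rewrite expf_eq0 /= => h; apply: KM; exact: tsupport_sub.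
split; first by apply: cmeas_real; exact: measurable_funTS.
have := integrableS measurableT mD (@subsetT _ D) i2 => /integrableP[_].
apply: le_lt_trans; rewrite le_eqVlt; apply/orP; left; apply/eqP.
by apply: eq_integral => x _; rewrite modulus_real real_normK ?num_real//= ger0_norm// sqr_ge0.
Qed.

Lemma loc_part b D u (K : set (R * R)) : open D -> loc_integrable D u -> compact K -> K `<=` D ->
  (\int[area]_(x in K) `|part b (u x)|%:E < +oo)%E.
Proof. by move=> oD lu cK KD; have [h1 h2] := loc_parts oD lu cK KD; case: b. Qed.

Lemma loc_test_integrable b D u phi : open D -> loc_integrable D u -> testfun D phi ->
  area.-integrable D (EFin \o (fun x => part b (u x) * phi x)).
Proof.
move=> oD lu tphi; apply: test_integrable => //.
  by apply: part_measurable; case: lu.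
by move=> K cK KD; exact: (loc_part b oD lu cK KD).
Qed.

Lemma cint_parts D u (phi : R * R -> R) (F : R * R -> R[i]) (psi : R * R -> R) :
  (forall b, \int[area]_(x in D) (part b (u x) * psi x) = - \int[area]_(x in D) (part b (F x) * phi x)) ->
  cint D (fun x => u x * (psi x)%:C%C) = - cint D (fun x => F x * (phi x)%:C%C).
Proof. by move=> H; rewrite !cint_real (H true) (H false). Qed.

Lemma cint_part D (F : R * R -> R[i]) b : part b (cint D F) = \int[area]_(x in D) part b (F x).
Proof. by case: b. Qed.

Lemma cL2_smooth D (w : R * R -> R[i]) : open D -> csmooth_cpt w -> cL2a D w.
Proof.
move=> oD sw; have mw := csmooth_cmeas oD sw; have [C1 C2 Kw] := sw; have mD := open_measurable_plane oD.
have h1 : cL2a D (fun x => (complex.Re (w x))%:C%C).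
  apply: cL2_cpt => //; first exact: Cinfty_continuous.
  apply: subclosed_compact Kw _; first exact: closed_closure.
  apply: closure_subset => x /=; apply: contra_neq => ->; by rewrite /= .
have h2 : cL2a D (fun x => (complex.Im (w x))%:C%C).
  apply: cL2_cpt => //; first exact: Cinfty_continuous.
  apply: subclosed_compact Kw _; first exact: closed_closure.
  apply: closure_subset => x /=; apply: contra_neq => ->; by rewrite /= .
split => //; have := sqnD area mD (proj1 h1) (proj1 h2).
have := proj2 h1; have := proj2 h2; rewrite /cL2a /sqa => f2 f1 _.
apply: (@le_lt_trans _ _ (sqn area (D : set mR2) (fun x => (complex.Re (w x))%:C%C) + sqn area (D : set mR2) (fun x => (complex.Im (w x))%:C%C))%E); last exact: lte_add_pinfty.
rewrite /sqn -ge0_integralD//; do ?[by move=> x _; rewrite lee_fin sqr_ge0|by apply: msqrE; exact: cmeas_real; case: mw].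
- rewrite le_eqVlt; apply/orP; left; apply/eqP; apply: eq_integral => x _.
  by rewrite -EFinD !modulus_real !real_normK ?num_real// modulus_sqr.
- by apply: msqrE; case: h1.
- by apply: msqrE; case: h2.
Qed.

Lemma cderiv_smooth j (w : R * R -> R[i]) : csmooth_cpt w -> csmooth_cpt (cderiv j w).
Proof.
move=> [C1 C2 Kw]; split; [exact: Cinfty_D|exact: Cinfty_D|].
have cl : closed (tsupport w) by exact: closed_closure.
apply: subclosed_compact Kw _; first exact: closed_closure.
move=> x hx; apply: (cl); apply: closure_subset hx => y /= hy.
have [E1|n1] := eqVneq ('D_(basis j) (fun x => complex.Re (w x)) y) 0; last first.
  apply: (derive_off_closed cl _ n1) => z nz; apply: tsupport_sub; by apply: contra_neq nz => ->.
have [E2|n2] := eqVneq ('D_(basis j) (fun x => complex.Im (w x)) y) 0; last first.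
  apply: (derive_off_closed cl _ n2) => z nz; apply: tsupport_sub; by apply: contra_neq nz => ->.
by move: hy; rewrite /cderiv E1 E2 eqxx.
Qed.

Lemma testfun_csmooth D phi : testfun D phi -> csmooth_cpt (fun x => (phi x)%:C%C : R[i]).
Proof.
move=> [C K _]; split => //=; first exact: Cinfty_cst.
apply: subclosed_compact K _; first exact: closed_closure.
by apply: closure_subset => x /=; apply: contra_neq => ->.
Qed.

Lemma bounded_coef1 D : bounded_coef area (D : set mR2) 1 (fun=> 1 : R[i]).
Proof.
split; first exact: cmeas_cst.
by apply: aeW => x _; rewrite (modulus_real (1 : R)) normr1.
Qed.

Lemma pint_test b D u phi :
  pint area (D : set mR2) b (fun=> 1) u (fun x => (phi x)%:C%C) = \int[area]_(x in D) (part b (u x) * phi x).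
Proof.
apply: eq_Rintegral => x _; rewrite mul1r.
have -> : conjc (phi x)%:C%C = (phi x)%:C%C :> R[i] by rewrite /= oppr0.
by case: b; rewrite /= ?Re_real ?Im_real.
Qed.

(** The defining identity consists of pairings with fixed test functions, so it passes to the limit
    along the approximants, for which it is integration by parts. *)
Lemma jet_weak D u g w j : open D -> jet D u g w -> is_weak_deriv D j u (g j).
Proof.
move=> oD [sw hu hg cu cg]; have mD := open_measurable_plane oD.
split; [exact: (cL2_loc oD hu)|exact: (cL2_loc oD (hg j))|move=> phi tphi].
have tD := testfun_D j tphi; apply: cint_parts => b.
have hp := cL2_smooth oD (testfun_csmooth tphi); have hDp := cL2_smooth oD (testfun_csmooth tD).
have v0 p : vanishes (fun n : nat => sqn area (D : set mR2) (fun x => p x - p x)).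
  move=> e e0; apply: nearW => n; rewrite /sqn; under eq_integral do rewrite subrr modulus0 expr0n.
  by rewrite integral0 lee_fin ltW.
have c1 := pint_cvg mD b ler01 (bounded_coef1 D) hu hDp (fun n => cL2_smooth oD (sw n)) (fun=> hDp) cu (v0 _).
have c2 := pint_cvg mD b ler01 (bounded_coef1 D) (hg j) hp (fun n => cL2_smooth oD (cderiv_smooth j (sw n))) (fun=> hp) (cg j) (v0 _).
rewrite -!pint_test; apply/eqP; rewrite -subr_eq0 opprK.
set X := pint _ _ _ _ _ _ in c1 *; set Y := pint _ _ _ _ _ _ in c2 *.
suff : (X + Y) ^+ 2 <= 0 by rewrite le_eqVlt ltNge sqr_ge0 orbF sqrf_eq0.
apply: (vanishes_le0 (vanishes_le2 (K := 2) c1 c2 _ (a := fun=> ((X + Y) ^+ 2)%:E) _)) => // n.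
rewrite -EFinD -EFinM lee_fin !pint_test.
have := ibp_real j oD (part_smooth b (sw n)) tphi.
under [X in _ = - X]eq_Rintegral do rewrite -part_cderiv.
move=> ->; set Z := (\int[_]_(x in _) _).
by have := sqr_ge0 (- Z - X - (Z - Y)); rewrite !expr2; lra.
Qed.

Lemma cmeas_ae D u v : measurable (D : set mR2) -> {ae area, forall x, D x -> u x = v x} ->
  cmeasurable D u -> cmeasurable D v -> sqa D u = sqa D v.
Proof.
move=> mD uv cu cv; apply: ae_eq_integral => //; [exact: msqrE|exact: msqrE|].
by apply: ae_imp uv => x h Dx; rewrite (h Dx).
Qed.

Lemma wderiv_ae D j u g : open D -> is_weak_deriv D j u g ->
  is_weak_deriv D j u (wderiv D j u) /\ {ae area, forall x, D x -> wderiv D j u x = g x}.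
Proof.
move=> oD wg.
have H : is_weak_deriv D j u (wderiv D j u) by apply: xgetPex; exists g.
by split => //; exact: weak_deriv_unique wg.
Qed.

Lemma W2_wderiv D u : open D -> W2 1 D u ->
  cL2a D u /\ forall j, is_weak_deriv D j u (wderiv D j u) /\ cL2a D (wderiv D j u).
Proof.
move=> oD [/L2P hu H]; split => // j; have [g [wg /L2P hg]] := H j.
have [ww ae] := wderiv_ae oD wg; split => //; have mD := open_measurable_plane oD.
have mw : cmeasurable D (wderiv D j u) by case: ww => _ [].
by split => //; rewrite -/(sqa D _) (cmeas_ae mD ae) //; case: hg.
Qed.

Lemma weak_derivB D j u v g g' : open D -> is_weak_deriv D j u g -> is_weak_deriv D j v g' ->
  cL2a D u -> cL2a D v -> cL2a D g -> cL2a D g' ->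
  is_weak_deriv D j (fun x => u x - v x) (fun x => g x - g' x).
Proof.
move=> oD [l1 l2 H] [l3 l4 H'] hu hv hg hg'; have mD := open_measurable_plane oD.
split; [exact/(cL2_loc oD)/cL2B|exact/(cL2_loc oD)/cL2B|move=> phi tphi].
have tD := testfun_D j tphi; apply: cint_parts => b.
have := congr1 (part b) (H _ tphi); have := congr1 (part b) (H' _ tphi).
rewrite !partN !cint_part.
have E (f : R * R -> R[i]) (p : R * R -> R) : \int[area]_(x in D) part b (f x * (p x)%:C%C) =
    \int[area]_(x in D) (part b (f x) * p x).
  by apply: eq_Rintegral => x _; case: b {H H'}; rewrite /= ?Re_real ?Im_real.
rewrite !E => e1 e2.
under eq_Rintegral do rewrite partB mulrBl.
under [X in _ = - X]eq_Rintegral do rewrite partB mulrBl.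
rewrite !(RintegralB mD); do ?exact: loc_test_integrable.
by rewrite e1 e2; ring.
Qed.

Lemma normW21E D u g : open D -> (forall j, is_weak_deriv D j u (g j)) ->
  normW21 D u = ((sqa D u + \sum_(j < 2) sqa D (g j)) `^ 2^-1)%E.
Proof.
move=> oD wg; rewrite /normW21 normL2_sqr; congr (_ `^ _)%E; congr (_ + _)%E.
apply: eq_bigr => j _; have [w1 ae] := wderiv_ae oD (wg j).
rewrite normL2_sqr; apply: cmeas_ae ae _ _; [exact: open_measurable_plane|by case: w1 => _ []|].
by case: (wg j) => _ [].
Qed.

Lemma smooth_W D (w : R * R -> R[i]) j : open D -> csmooth_cpt w -> is_weak_deriv D j w (cderiv j w).
Proof. by move=> oD [C1 C2 _]; exact: smooth_weak_deriv. Qed.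

(** Replaces the norm of W_2^1, which involves the chosen derivatives of the difference, by separate
    L_2 errors against a derivative [g] known in advance. *)
Lemma sqaD_cvg D u g w : open D -> (forall n, csmooth_cpt (w n)) -> cL2a D u -> (forall j, cL2a D (g j)) ->
  (forall j, is_weak_deriv D j u (g j)) ->
  (fun n => normW21 D (w n \- u)) @ \oo --> 0%E <->
  vanishes (fun n => sqa D (fun x => w n x - u x)) /\
  forall j, vanishes (fun n => sqa D (fun x => cderiv j (w n) x - g j x)).
Proof.
move=> oD sw hu hg wg.
have E n : normW21 D (w n \- u) = ((sqa D (fun x => w n x - u x)%R +
    (sqa D (fun x => cderiv ord0 (w n) x - g ord0 x)%R +
     sqa D (fun x => cderiv ord_max (w n) x - g ord_max x)%R)) `^ 2^-1)%E.
  rewrite (@normW21E _ _ (fun j x => cderiv j (w n) x - g j x))//; last first.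
    move=> j; apply: weak_derivB => //; [exact: smooth_W|exact: cL2_smooth|exact/cL2_smooth/cderiv_smooth].
  by rewrite sum2E.
under eq_fun do rewrite E.
rewrite vanishesP; last by move=> n; exact: poweR_ge0.
rewrite vanishes_half; last by move=> n; do 2 (apply: adde_ge0; first exact: sqn_ge0); exact: sqn_ge0.
split => [va|[v1 v2]]; last by apply: vanishesD => //; exact: vanishesD.
have le n : (0 <= sqa D (fun x => w n x - u x)%R)%E by exact: sqn_ge0.
have le' n j : (0 <= sqa D (fun x => cderiv j (w n) x - g j x)%R)%E by exact: sqn_ge0.
split => [|j]; apply: (vanishes_le va ler01) => n; rewrite mul1e.
  by apply: leeDl; apply: adde_ge0.
move: j; apply: basis_ind; first by rewrite addeCA; apply: leeDl; apply: adde_ge0.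
by rewrite addeA; apply: leeDr; apply: adde_ge0.
Qed.

Lemma jetP D u w : open D -> W2 1 D u -> (forall n, csmooth_cpt (w n)) ->
  (fun n => normW21 D (w n \- u)) @ \oo --> 0%E -> jet D u (fun j => wderiv D j u) w.
Proof.
move=> oD Wu sw cw; have [hu hg] := W2_wderiv oD Wu.
have [c1 c2] := (sqaD_cvg oD sw hu (fun j => (hg j).2) (fun j => (hg j).1)).1 cw.
by split => // j; have [] := hg j.
Qed.

Lemma jet_W2 D u g w : open D -> jet D u g w -> W2 1 D u.
Proof.
move=> oD J; split; first by apply/L2P; exact: (jet_u J).
by move=> j; exists (g j); split; [exact: (jet_weak j oD J)|apply/L2P; exact: (jet_g J j)].
Qed.

Lemma jet_normW21 D u g w : open D -> jet D u g w -> (fun n => normW21 D (w n \- u)) @ \oo --> 0%E.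
Proof.
move=> oD J; have [sw hu hg c1 c2] := J.
by apply: (sqaD_cvg oD sw hu hg (fun j => jet_weak j oD J)).2.
Qed.

Lemma jet_wderiv D u g w j : open D -> jet D u g w -> {ae area, forall x, D x -> wderiv D j u x = g j x}.
Proof. by move=> oD J; have [] := wderiv_ae oD (jet_weak j oD J). Qed.

Lemma sqa_le D (K : R) u v : measurable (D : set mR2) -> 0 <= K -> cmeasurable D u -> cmeasurable D v ->
  (forall x, D x -> modulus (u x) <= K * modulus (v x)) -> (sqa D u <= (K ^+ 2)%:E * sqa D v)%E.
Proof. by move=> mD K0 mu1 mv1 H; apply: le_sqn => //; apply: aeW. Qed.

Lemma sqa_sub D E u : measurable (D : set mR2) -> measurable (E : set mR2) -> E `<=` D -> cmeasurable D u ->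
  (sqa E u <= sqa D u)%E.
Proof.
move=> mD mE ED cu; apply: ge0_subset_integral => //; first exact: msqrE.
by move=> x _; rewrite lee_fin sqr_ge0.
Qed.

Lemma cmeas_sub D E u : measurable (D : set mR2) -> E `<=` D -> cmeasurable D u -> cmeasurable E u.
Proof. by move=> mD ED [m1 m2]; split; exact: (measurable_funS mD ED). Qed.

Lemma jet_sub D E u g w : open D -> open E -> E `<=` D -> jet D u g w -> jet E u g w.
Proof.
move=> oD oE ED [sw hu hg c1 c2].
have mD := open_measurable_plane oD; have mE := open_measurable_plane oE.
have h v : cL2a D v -> cL2a E v.
  move=> [mv fv]; split; first exact: cmeas_sub mv.
  by apply: le_lt_trans fv; exact: sqa_sub.
split => //; [exact: h|by move=> j; exact: h| |move=> j].
  apply: (vanishes_le c1 ler01) => n; rewrite mul1e; apply: sqa_sub => //.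
  by apply: cmeasB; [exact: csmooth_cmeas|case: hu].
apply: (vanishes_le (c2 j) ler01) => n; rewrite mul1e; apply: sqa_sub => //.
by apply: cmeasB; [exact: cderiv_cmeas|case: (hg j)].
Qed.

Lemma csmoothB (w w' : R * R -> R[i]) : csmooth_cpt w -> csmooth_cpt w' -> csmooth_cpt (fun x => w x - w' x).
Proof.
move=> [C1 C2 K] [C1' C2' K']; split.
- by under eq_fun do rewrite ReD ReN; exact: CinftyB.
- by under eq_fun do rewrite ImD ImN; exact: CinftyB.
- apply: (@subclosed_compact _ _ (tsupport w `|` tsupport w')); first exact: closed_closure.
    exact: compactU.
  rewrite /tsupport -closureU; apply: closure_subset => x /=.
  have [->|w0] := eqVneq (w x) 0; last by left.
  by rewrite sub0r oppr_eq0; right.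
Qed.

Lemma cderivB j (w w' : R * R -> R[i]) x : csmooth_cpt w -> csmooth_cpt w' ->
  cderiv j (fun x => w x - w' x) x = cderiv j w x - cderiv j w' x.
Proof.
move=> [C1 C2 K] [C1' C2' K']; apply: complex_eq; rewrite ?ReD ?ImD ?ReN ?ImN /=.
  under eq_fun do rewrite ReD ReN; apply: derive_val; exact: is_deriveB (Cinfty_is_derive _ _ C1) (Cinfty_is_derive _ _ C1').
by under eq_fun do rewrite ImD ImN; apply: derive_val; exact: is_deriveB (Cinfty_is_derive _ _ C2) (Cinfty_is_derive _ _ C2').
Qed.

Lemma csmoothM (c : R * R -> R) (w : R * R -> R[i]) : Cinfty c -> csmooth_cpt w ->
  csmooth_cpt (fun x => (c x)%:C%C * w x).
Proof.
move=> Cc [C1 C2 K]; split.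
- by under eq_fun do rewrite mulrC Re_real; exact: CinftyM.
- by under eq_fun do rewrite mulrC Im_real; exact: CinftyM.
- apply: subclosed_compact K _; first exact: closed_closure.
  by apply: closure_subset => x /=; apply: contra_neq => ->; rewrite mulr0.
Qed.

Lemma cderivM j (c : R * R -> R) (w : R * R -> R[i]) x : Cinfty c -> csmooth_cpt w ->
  cderiv j (fun x => (c x)%:C%C * w x) x = (c x)%:C%C * cderiv j w x + ('D_(basis j) c x)%:C%C * w x.
Proof.
move=> Cc [C1 C2 K]; apply: complex_eq; rewrite ?ReD ?ImD !(mulrC (_%:C)%C) ?Re_real ?Im_real /=.
  under eq_fun do rewrite mulrC Re_real; apply: derive_val.
  apply: (is_derive_eq (is_deriveM (Cinfty_is_derive _ _ C1) (Cinfty_is_derive _ _ Cc))).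
  by rewrite /GRing.scale /=; ring.
under eq_fun do rewrite mulrC Im_real; apply: derive_val.
apply: (is_derive_eq (is_deriveM (Cinfty_is_derive _ _ C2) (Cinfty_is_derive _ _ Cc))).
by rewrite /GRing.scale /=; ring.
Qed.

Lemma jetB D u g w u' g' w' : open D -> jet D u g w -> jet D u' g' w' ->
  jet D (fun x => u x - u' x) (fun j x => g j x - g' j x) (fun n x => w n x - w' n x).
Proof.
move=> oD [sw hu hg c1 c2] [sw' hu' hg' c1' c2']; have mD := open_measurable_plane oD.
have key (p q p' q' : R * R -> R[i]) : cmeasurable D p -> cmeasurable D q -> cmeasurable D p' -> cmeasurable D q' ->
    (sqa D (fun x => (p x - p' x) - (q x - q' x))%R <= 2%:E * (sqa D (fun x => p x - q x)%R + sqa D (fun x => p' x - q' x)%R))%E.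
  move=> h1 h2 h3 h4; rewrite muleDr//; last by rewrite ge0_adde_def// inE; exact: sqn_ge0.
  have -> : sqa D (fun x => p' x - q' x) = sqa D (fun x => q' x - p' x) by exact: sqn_sym.
  have -> : sqa D (fun x => (p x - p' x) - (q x - q' x)) = sqa D (fun x => (p x - q x) + (q' x - p' x)).
    by congr sqa; apply/funext => x; ring.
  by apply: sqnD => //; exact: cmeasB.
split.
- by move=> n; exact: csmoothB.
- exact: (cL2B mD hu hu').
- by move=> j; exact: (cL2B mD (hg j) (hg' j)).
- by apply: (vanishes_le2 c1 c1' (ler0n _ 2)) => n; apply: key; do ?exact: csmooth_cmeas; by [case: hu|case: hu'].
- move=> j; apply: (vanishes_le2 (c2 j) (c2' j) (ler0n _ 2)) => n.
  under [X in sqa D X]eq_fun do rewrite cderivB//.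
  by apply: key; do ?exact: cderiv_cmeas; by [case: (hg j)|case: (hg' j)].
Qed.

Lemma cmeas_smooth D (c : R * R -> R) : Cinfty c -> cmeasurable D (fun x => (c x)%:C%C).
Proof.
move=> Cc; apply: cmeas_real; apply: measurable_funTS; apply: continuous_measurable_plane.
exact: Cinfty_continuous.
Qed.

Lemma jetM D (c : R * R -> R) u g w (K : R) : open D -> Cinfty c -> 0 <= K ->
  (forall x, D x -> `|c x| <= K) -> (forall j x, D x -> `|'D_(basis j) c x| <= K) ->
  jet D u g w ->
  jet D (fun x => (c x)%:C%C * u x)
    (fun j x => (c x)%:C%C * g j x + ('D_(basis j) c x)%:C%C * u x) (fun n x => (c x)%:C%C * w n x).
Proof.
move=> oD Cc K0 cK dK [sw hu hg c1 c2]; have mD := open_measurable_plane oD.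
have mc := cmeas_smooth D Cc; have mdc j := cmeas_smooth D (Cinfty_D j Cc).
have mulK (a : R * R -> R) v : (forall x, D x -> `|a x| <= K) -> cmeasurable D (fun x => (a x)%:C%C) ->
    cmeasurable D v -> (sqa D (fun x => (a x)%:C%C * v x)%R <= (K ^+ 2)%:E * sqa D v)%E.
  move=> aK ma mv; apply: sqa_le => //; first exact: cmeasM.
  by move=> x Dx; rewrite modulusM modulus_real ler_wpM2r ?modulus_ge0// aK.
have LK (a : R * R -> R) v : (forall x, D x -> `|a x| <= K) -> cmeasurable D (fun x => (a x)%:C%C) ->
    cL2a D v -> cL2a D (fun x => (a x)%:C%C * v x).
  move=> aK ma [mv fv]; split; first exact: cmeasM.
  by apply: (le_lt_trans (mulK _ _ aK ma mv)); rewrite lte_mul_pinfty// ?lee_fin ?sqr_ge0.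
have mu1 : cmeasurable D u by case: hu.
have mg j : cmeasurable D (g j) by case: (hg j).
have mw n := csmooth_cmeas oD (sw n).
have mdw n j := cderiv_cmeas j oD (sw n).
split.
- by move=> n; exact: csmoothM.
- exact: LK.
- by move=> j; apply: cL2D => //; apply: LK => //; exact: dK.
- apply: (vanishes_le c1 (sqr_ge0 K)) => n.
  under [X in sqa D X]eq_fun do rewrite -mulrBr.
  exact: (mulK _ _ cK mc (cmeasB (mw n) mu1)).
- move=> j; apply: (vanishes_le2 (c2 j) c1 (K := 2 * K ^+ 2)) => [|n].
    by rewrite mulr_ge0// sqr_ge0.
  have -> : (fun x => cderiv j (fun x => (c x)%:C%C * w n x) x - ((c x)%:C%C * g j x + ('D_(basis j) c x)%:C%C * u x)) =
     (fun x => (c x)%:C%C * (cderiv j (w n) x - g j x) + ('D_(basis j) c x)%:C%C * (w n x - u x)).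
    by apply/funext => x; rewrite cderivM//; ring.
  have m1 := cmeasB (mdw n j) (mg j); have m2 := cmeasB (mw n) mu1.
  apply: (le_trans (sqnD area mD (cmeasM mc m1) (cmeasM (mdc j) m2))).
  rewrite [leRHS]ge0_muleDr ?sqa_ge0//.
  rewrite (EFinM 2) -!muleA; apply: leeD; apply: lee_wpmul2l; rewrite ?lee_fin//; apply: mulK => //; exact: (dK j).
Qed.

End jets.

(** * Traces on the lower boundary *)

Section traces.
Context {R : realType}.
Local Notation mR := (measurableTypeR R).
Local Notation mR2 := (measurableTypeR R * measurableTypeR R)%type.
Local Notation leb := (@lebesgue_measure R).
Variables (d B : R) (p : R -> R).
Hypotheses (Bd : B < d) (pB : forall s, 0 <= p s <= B) (cp : continuous p).

Lemma derive_continuous_line (f : R -> R) (f' : R -> R) : (forall t, is_derive t (1 : R) f (f' t)) -> continuous f.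
Proof. by move=> df t; apply/differentiable_continuous/derivable1_diffP; have [] := df t. Qed.

Lemma step'_continuous : continuous (@step' R).
Proof.
have cf k : continuous (@flat R k) by exact: derive_continuous_line (flat_derive k).
have cr : continuous (fun t : R => 1 - t).
  by apply: contB; [exact: (@cont_cst R _ 1)|move=> t; exact: cvg_id].
have cfr k : continuous (fun t : R => flat k (1 - t)).
  by move=> t; apply: (@continuous_comp _ _ _ (fun t : R => 1 - t) (flat k)); [exact: cr|exact: cf].
apply: contM; first by apply: contD; apply: contM => //; exact: cf.
apply: contV; first by move=> t; rewrite expf_neq0// gt_eqF// step_den_gt0.
by apply: contX; apply: contD => //; exact: cf.
Qed.

Let l := (d - B)^-1.
Let arg t := l * t + (- (B * l)).

(** A vertical cut-off equal to 1 below the crests, in particular on the graph, and to 0 at the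
    upper boundary. *)
Definition tcut t : R := 1 - step (arg t).
Definition tcut' t : R := - (l * step' (arg t)).

Let l_gt0 : 0 < l. Proof. by rewrite invr_gt0 subr_gt0. Qed.

Let carg : continuous arg.
Proof. exact: (derive_continuous_line (is_derive_affine l (- (B * l)))). Qed.

Lemma tcut_derive t : is_derive t (1 : R) tcut (tcut' t).
Proof.
have h := is_derive1_comp (f := step) (step_derive (arg t)) (is_derive_affine l (- (B * l)) t).
apply: (is_derive_eq (is_deriveB (is_derive_cst (1 : R) t 1) h)).
by rewrite sub0r /tcut' mulrC.
Qed.

Lemma tcut'_continuous : continuous tcut'.
Proof.
apply: contN; apply: contM; first exact: (@cont_cst R _ l).
by move=> t; apply: (@continuous_comp _ _ _ arg (@step' R)); [exact: carg|exact: step'_continuous].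
Qed.

Lemma tcut_continuous : continuous tcut.
Proof. exact: derive_continuous_line tcut_derive. Qed.

Lemma tcut_graph s : tcut (p s) = 1.
Proof.
rewrite /tcut step_le0 ?subr0// /arg mulrC -mulrBl pmulr_lle0// subr_le0.
by case/andP: (pB s).
Qed.

Lemma tcut_top : tcut d = 0.
Proof.
rewrite /tcut step_ge1 ?subrr// /arg mulrC -mulrBl /l divff// gt_eqF// subr_gt0//.
Qed.

Lemma tcut_bounded : exists2 M, 1 <= M & forall t, `|tcut t| <= M /\ `|tcut' t| <= M.
Proof.
have [C C0 HC] := @step'_bounded R; exists (1 + l * C); first by rewrite lerDl mulr_ge0// ltW.
move=> t; split.
  apply: (@le_trans _ _ 1); last by rewrite lerDl mulr_ge0// ltW.
  have := step_ge0 (arg t); have := step_le1 (arg t); rewrite /tcut.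
  by move: (step _) => y y1 y0; rewrite ger0_norm; lra.
rewrite normrN normrM gtr0_norm//; apply: (@le_trans _ _ (l * C)); last by rewrite lerDr.
by apply: ler_wpM2l; [exact: ltW|exact: HC].
Qed.

(** The fundamental theorem for tcut F between the graph and the top. The formula returns the
    boundary value of a smooth function ([vtrace_smooth]) and still makes sense for L_2 functions,
    so it provides an explicit representative of the trace. *)
Definition vtrace (q q2 : mR2 -> R) (s : R) : R :=
  - \int[leb]_(t in `]p s, d[) (tcut' t * q (s, t) + tcut t * q2 (s, t)).

Lemma pd s : p s < d. Proof. by have /andP[_ h] := pB s; exact: le_lt_trans Bd. Qed.

Lemma slice_measurable (f : mR2 -> R) (s : R) : measurable_fun setT f -> measurable_fun setT (fun t : mR => f (s, t)).
Proof. by move=> mf; apply: measurableT_comp => //; exact: measurable_pair1. Qed.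

Lemma vtrace_smooth F F2 : continuous F -> continuous F2 ->
  (forall x, is_derive x (basis ord_max) F (F2 x)) ->
  forall s, vtrace F F2 s = F (s, p s).
Proof.
move=> cF cF2 dF s; have := pd s => psd.
pose f t := tcut t * F (s, t); pose f' t := tcut' t * F (s, t) + tcut t * F2 (s, t).
have df t : is_derive t (1 : R) f (f' t).
  have h := (is_derive_basis1 F (s, t) (F2 (s, t))).1 (dF _).
  apply: (is_derive_eq (is_deriveM (tcut_derive t) h)).
  by rewrite /f' /GRing.scale /=; ring.
have cf' : continuous f'.
  apply: contD; apply: contM; do ?exact: cont_vline.
    exact: tcut'_continuous.
  exact: tcut_continuous.
rewrite /vtrace -/f'; rewrite /Rintegral -(@integral_itv_bndoo _ _ _ (EFin \o f') true false); last first.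
  by apply/measurable_EFinP; exact: measurable_itv_open.
rewrite (@continuous_FTC2 _ f' f)//.
- by rewrite /= /f tcut_top tcut_graph mul0r mul1r sub0r opprK.
- exact: continuous_subspaceT.
- have cf := derive_continuous_line df.
  split; first by move=> t _; have [] := df t.
  + by apply: cvg_at_right_filter; exact: cf.
  + by apply: cvg_at_left_filter; exact: cf.
- by move=> t _; rewrite derive1E; have [_] := df t.
Qed.

Lemma vtrace_measurable q q2 : measurable_fun setT q -> measurable_fun setT q2 ->
  measurable_fun setT (vtrace q q2).
Proof.
move=> mq mq2; pose f (x : mR2) := tcut' x.2 * q x + tcut x.2 * q2 x.
have mf : measurable_fun setT f.
  have m2 (h : R -> R) : continuous h -> measurable_fun setT (fun x : mR2 => h x.2).
    by move=> ch; apply: (@measurableT_comp _ _ _ _ _ _ (h : mR -> R)); [exact: continuous_measurable_fun|exact: measurable_snd].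
  apply: measurable_funD; apply: measurable_funM => //; apply: m2.
    exact: tcut'_continuous.
  exact: tcut_continuous.
have H (g : mR2 -> \bar R) : measurable_fun setT g -> (forall x, (0 <= g x)%E) ->
    measurable_fun setT (fun s : mR => \int[leb]_(t in `]p s, d[) g (s, t))%E.
  by move=> mg g0; exact: measurable_vint.
rewrite (_ : vtrace q q2 = fun s => - fine (\int[leb]_(t in `]p s, d[) ((EFin \o f)^\+ (s, t)) -
   \int[leb]_(t in `]p s, d[) ((EFin \o f)^\- (s, t)))%E); last first.
  apply/funext => s; rewrite /vtrace /Rintegral integralE; congr (- fine (_ - _)%E);
  by apply: eq_integral => t _; rewrite ?funeposE ?funenegE.
apply: measurableT_comp => //; apply: measurableT_comp => //; apply: emeasurable_funB; apply: H => //.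
- by apply: measurable_funepos; exact/measurable_EFinP.
- by apply: measurable_funeneg; exact/measurable_EFinP.
Qed.

(** Cauchy-Schwarz on each column, then integration in s. With [q] and [q2] a function and its
    vertical derivative this is continuity of the trace. *)
Lemma vtrace_close : exists2 K, 0 <= K & forall F F2 q q2, continuous F -> continuous F2 ->
  (forall x, is_derive x (basis ord_max) F (F2 x)) -> measurable_fun setT q -> measurable_fun setT q2 ->
  (\int[leb]_s ((F (s, p s) - vtrace q q2 s) ^+ 2)%:E <=
   K%:E * (\int[area]_(x in upper d p) ((F x - q x) ^+ 2 + (F2 x - q2 x) ^+ 2)%:E))%E.
Proof.
have [M M1 HM] := tcut_bounded; have d0 : 0 < d by have := pd 0; have /andP[] := pB 0; lra.
have M2 : 0 <= 2 * M ^+ 2 by rewrite mulr_ge0 ?sqr_ge0.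
exists (d * (2 * M ^+ 2)); first exact: mulr_ge0 (ltW d0) M2.
move=> F F2 q q2 cF cF2 dF mq mq2.
have mF := continuous_measurable_plane cF; have mF2 := continuous_measurable_plane cF2.
pose r (x : mR2) := (F x - q x) ^+ 2 + (F2 x - q2 x) ^+ 2.
have r0 x : 0 <= r x by apply: addr_ge0; exact: sqr_ge0.
have mr : measurable_fun setT r.
  by apply: measurable_funD; apply: measurable_funX; exact: measurable_funB.
have mr' : measurable_fun setT (EFin \o r) by exact/measurable_EFinP.
have r0' x : (0 <= (EFin \o r) x)%E by rewrite lee_fin.
rewrite (integral_upper d cp mr' r0') -ge0_integralZl//; last 3 first.
- exact: (measurable_vint d cp mr' r0').
- by move=> s _; apply: integral_ge0 => t _; exact: r0'.
- by rewrite lee_fin mulr_ge0// ltW.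
apply: ge0_le_integral => //.
- by move=> s _; rewrite lee_fin sqr_ge0.
- apply/measurable_EFinP; apply: measurable_funX; apply: measurable_funB; last exact: vtrace_measurable.
  rewrite (_ : (fun s => _) = F \o (fun s => (s, p s)))//.
  apply: (@measurableT_comp _ _ _ _ _ _ (F : mR2 -> R)) => //.
  by apply: measurable_fun_pair => //; exact: continuous_measurable_fun.
- by apply: emeasurable_funM => //; exact: (measurable_vint d cp mr' r0').
move=> s _; have psd := pd s; have mI : measurable (`]p s, d[%classic : set mR) by exact: measurable_itv.
set Y := (\int[leb]_(t in _) _)%E.
have Y0 : (0 <= Y)%E by apply: integral_ge0 => t _; exact: r0'.
(* On a column of infinite energy the bound is trivial; on the others the differences are integrable
   and the two integrals can be subtracted. *)
have [Yoo|] := eqVneq Y +oo%E; first by rewrite Yoo gt0_muley ?leey// lte_fin !mulr_gt0// ?exprn_gt0//; lra.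
rewrite -ltey => Yfin; rewrite -(vtrace_smooth cF cF2 dF).
pose G t := tcut' t * F (s, t) + tcut t * F2 (s, t); pose g t := tcut' t * q (s, t) + tcut t * q2 (s, t).
have mc := @continuous_measurable_fun R tcut tcut_continuous.
have mc' := @continuous_measurable_fun R tcut' tcut'_continuous.
have mG : measurable_fun setT (G : mR -> R).
  by apply: measurable_funD; apply: measurable_funM => //; exact: slice_measurable.
have mg : measurable_fun setT (g : mR -> R).
  by apply: measurable_funD; apply: measurable_funM => //; exact: slice_measurable.
have bd t : (G t - g t) ^+ 2 <= 2 * M ^+ 2 * r (s, t).
  have [h1 h2] := HM t.
  have E : G t - g t = tcut' t * (F (s, t) - q (s, t)) + tcut t * (F2 (s, t) - q2 (s, t)) by rewrite /G /g; ring.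
  have s1 : tcut' t ^+ 2 <= M ^+ 2 by rewrite -(real_normK (num_real (tcut' t))) lerXn2r// nnegrE; lra.
  have s2 : tcut t ^+ 2 <= M ^+ 2 by rewrite -(real_normK (num_real (tcut t))) lerXn2r// nnegrE; lra.
  rewrite E; set a := F _ - _; set b := F2 _ - _.
  apply: (@le_trans _ _ (2 * (tcut' t ^+ 2 * a ^+ 2) + 2 * (tcut t ^+ 2 * b ^+ 2))).
    by have := sqr_ge0 (tcut' t * a - tcut t * b); rewrite -!exprMn !expr2; lra.
  have := ler_wpM2r (sqr_ge0 a) s1; have := ler_wpM2r (sqr_ge0 b) s2; rewrite /r -/a -/b mulrDr; lra.
have lI : leb (`]p s, d[%classic : set mR) = (d - p s)%:E by rewrite /= lebesgue_measure_itv /= lte_fin psd -EFinB.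
have sq1 : sqn leb (`]p s, d[%classic : set mR) (fun=> 1 : R[i]) = (d - p s)%:E.
  rewrite /sqn; under eq_integral do rewrite (modulus_real (1 : R)) normr1 expr1n.
  by have h := integral_cst leb mI 1%E; apply: (etrans h); apply: (etrans (mul1e _)); exact: lI.
have hu : cL2 leb (`]p s, d[%classic : set mR) (fun=> 1 : R[i]).
  by split; [exact: cmeas_cst|rewrite sq1 ltry].
have le1 : (sqn leb (`]p s, d[%classic : set mR) (fun t => (G t - g t)%:C%C) <= (2 * M ^+ 2)%:E * Y)%E.
  have mrs : measurable_fun (`]p s, d[%classic : set mR) (fun t => (EFin \o r) (s, t)).
    by apply: measurable_funTS; apply/measurable_EFinP; exact: slice_measurable.
  have k0 : (0 <= (2 * M ^+ 2)%:E)%E by rewrite lee_fin.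
  rewrite /Y -(ge0_integralZl leb mI mrs (fun t _ => r0' (s, t)) k0).
  apply: ge0_le_integral => //.
  - by move=> t _; rewrite lee_fin sqr_ge0.
  - by apply: msqrE; apply: cmeas_real; apply: measurable_funTS; exact: measurable_funB.
  - by apply: emeasurable_funM.
  - by move=> t _; rewrite modulus_real real_normK ?num_real// -EFinM lee_fin.
have hv : cL2 leb (`]p s, d[%classic : set mR) (fun t => (G t - g t)%:C%C).
  split; first by apply: cmeas_real; apply: measurable_funTS; exact: measurable_funB.
  by apply: (le_lt_trans le1); rewrite lte_mul_pinfty// lee_fin.
have iGg : leb.-integrable `]p s, d[ (EFin \o (fun t => G t - g t)).
  apply: (@dom_integrable _ _ _ leb _ mI 1 _ _ _ hu hv).
    by apply: measurable_funTS; exact: measurable_funB.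
  apply: aeW => t _; rewrite (modulus_real (1 : R)) modulus_real normr1 mul1r expr1n.
  have := sqr_ge0 (`|G t - g t| - 2^-1); rewrite !expr2; lra.
have iG : leb.-integrable `]p s, d[ (EFin \o G).
  apply: (integrableS _ mI (@subset_itv_oo_cc _ _ _ _)); first exact: measurable_itv.
  apply: itv_integrable; apply: continuous_subspaceT.
  apply: contD; apply: contM; do ?exact: cont_vline; [exact: tcut'_continuous|exact: tcut_continuous].
have ig : leb.-integrable `]p s, d[ (EFin \o g).
  have -> : EFin \o g = (fun t => (EFin \o G) t - (EFin \o (fun t => (G t - g t)%R)) t)%E.
    by apply/funext => t /=; rewrite -EFinB opprB addrC subrK.
  exact: integrableB.
have -> : vtrace F F2 s - vtrace q q2 s = - \int[leb]_(t in `]p s, d[) (G t - g t).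
  by rewrite (RintegralB mI iG ig) /vtrace; ring.
rewrite sqrrN.
have := cauchy_schwarz mI ler01 hu hv (F := fun t => G t - g t) _ _.
rewrite expr1n mul1e sq1 => h.
apply: (le_trans (h _ _)).
- by apply: measurable_funTS; exact: measurable_funB.
- by apply: aeW => t _; rewrite (modulus_real (1 : R)) modulus_real normr1 !mul1r.
rewrite (EFinM d) -muleA; apply: lee_pmul; [by rewrite lee_fin subr_ge0 ltW|exact: sqn_ge0| |exact: le1].
by rewrite lee_fin; have /andP[h0 _] := pB s; lra.
Qed.

Local Notation D := (upper d p).

(** Both functions are cut to the domain, which makes them measurable on the whole plane and
    independent of irrelevant values outside. *)
Definition ctrace (u g2 : R * R -> R[i]) (s : R) : R[i] :=
  Complex (vtrace ((fun x => part true (u x)) \_ D) ((fun x => part true (g2 x)) \_ D) s)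
          (vtrace ((fun x => part false (u x)) \_ D) ((fun x => part false (g2 x)) \_ D) s).

Let oD : open D := upper_open cp.
Let mD : measurable (D : set mR2) := upper_measurable d cp.

Lemma restr_part_measurable b u : cmeasurable D u ->
  measurable_fun setT ((fun x => part b (u x)) \_ D : mR2 -> R).
Proof.
by move=> mu; apply/(measurable_restrict _ mD measurableT); rewrite setTI; exact: part_measurable.
Qed.

Lemma ctrace_cmeas u g2 : cmeasurable D u -> cmeasurable D g2 -> cmeas (setT : set mR) (ctrace u g2).
Proof.
by move=> mu mg; split; apply: vtrace_measurable; exact: restr_part_measurable.
Qed.

Lemma graph_measurable (f : R * R -> R) : continuous f -> measurable_fun setT (fun s : mR => f (s, p s)).
Proof.
move=> cf; apply: (@measurableT_comp _ _ _ _ _ _ (f : mR2 -> R)).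
  exact: continuous_measurable_plane.
by apply: measurable_fun_pair => //; exact: continuous_measurable_fun.
Qed.

Lemma graph_cmeas w : csmooth_cpt w -> cmeas (setT : set mR) (fun s => w (s, p s)).
Proof. by move=> [/Cinfty_continuous C1 /Cinfty_continuous C2 _]; split; [exact: (graph_measurable C1)|exact: (graph_measurable C2)]. Qed.

Lemma sqn_parts (dd : measure_display) (T : measurableType dd) (mu : {measure set T -> \bar R}) (E : set T) (u : T -> R[i]) :
  measurable E -> cmeas E u ->
  (sqn mu E u = \int[mu]_(x in E) (part true (u x) ^+ 2)%:E + \int[mu]_(x in E) (part false (u x) ^+ 2)%:E)%E.
Proof.
move=> mE mu'; rewrite -(ge0_integralD mu mE); last 4 first.
- by move=> x _; rewrite lee_fin sqr_ge0.
- by apply/measurable_EFinP; apply: measurable_funX; exact: part_measurable.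
- by move=> x _; rewrite lee_fin sqr_ge0.
- by apply/measurable_EFinP; apply: measurable_funX; exact: part_measurable.
by apply: eq_integral => x _; rewrite modulus_sqr.
Qed.

Lemma ctrace_close : exists2 K : R, 0 <= K & forall u g2 w, cmeasurable D u -> cmeasurable D g2 -> csmooth_cpt w ->
  (sqn leb (setT : set mR) (fun s => w (s, p s) - ctrace u g2 s)%R <=
   K%:E * (sqa D (fun x => w x - u x)%R + sqa D (fun x => cderiv ord_max w x - g2 x)%R))%E.
Proof.
have [K K0 HK] := vtrace_close; exists K => // u g2 w mu mg sw.
have mw := csmooth_cmeas oD sw; have mdw := cderiv_cmeas ord_max oD sw.
have m1 := cmeasB mw mu; have m2 := cmeasB mdw mg.
rewrite (sqn_parts leb measurableT (cmeasB (graph_cmeas sw) (ctrace_cmeas mu mg))).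
have key b : (\int[leb]_s (part b (w (s, p s) - ctrace u g2 s) ^+ 2)%:E <= K%:E *
    (\int[area]_(x in D) (part b (w x - u x) ^+ 2)%:E + \int[area]_(x in D) (part b (cderiv ord_max w x - g2 x) ^+ 2)%:E))%E.
  have Cw := part_smooth b sw.
  have := HK (fun x => part b (w x)) (fun x => part b (cderiv ord_max w x)) _ _ _ _ _
    (restr_part_measurable b mu) (restr_part_measurable b mg).
  move=> /(_ (Cinfty_continuous Cw)) h.
  have E : (fun x => part b (cderiv ord_max w x)) = (fun x => 'D_(basis ord_max) (fun x => part b (w x)) x).
    by apply/funext => x; rewrite part_cderiv.
  have h1 : continuous (fun x => part b (cderiv ord_max w x)).
    by rewrite E; exact/Cinfty_continuous/Cinfty_D.
  have h2 x : is_derive x (basis ord_max) (fun x => part b (w x)) (part b (cderiv ord_max w x)).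
    by rewrite part_cderiv; exact: Cinfty_is_derive.
  have := h h1 h2; rewrite -(ge0_integralD area mD); last 4 first.
  - by move=> x _; rewrite lee_fin sqr_ge0.
  - by apply/measurable_EFinP; apply: measurable_funX; exact: part_measurable.
  - by move=> x _; rewrite lee_fin sqr_ge0.
  - by apply/measurable_EFinP; apply: measurable_funX; exact: part_measurable.
  congr (_ <= _)%E.
    by apply: eq_integral => s _; rewrite partB; case: (b).
  by congr (_ * _)%E; apply: eq_integral => x Dx; rewrite !partB !patchE Dx.
apply: (le_trans (leeD (key true) (key false))).
rewrite /sqa (sqn_parts area mD m1) (sqn_parts area mD m2) [X in (_ <= _ * X)%E]addeACA.
by rewrite [leRHS]ge0_muleDr//; apply: adde_ge0; exact: int_sqr_ge0.
Qed.

Hypotheses (L : R) (L0 : 0 <= L) (cp' : continuous (derive1 p)) (pL : forall s, arclen p s <= L).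

Lemma arclen_ge1 s : 1 <= arclen p s.
Proof.
rewrite /arclen -{1}(@sqrtr1 R) ler_wsqrtr// lerDl; exact: sqr_ge0.
Qed.

Lemma arclen_measurable : measurable_fun setT (arclen p : mR -> R).
Proof.
apply: (@measurableT_comp _ _ _ _ _ _ (Num.sqrt : mR -> R)).
  by apply: (@continuous_measurable_fun R); exact: sqrt_continuous.
apply: continuous_measurable_fun; apply: contD; first exact: (@cont_cst R _ 1).
exact: contX.
Qed.

(** The squared norm with respect to arc length. As the arc length density lies between 1 and [L],
    it is equivalent to the plain norm in the parameter s. *)
Definition gsqn (v : R -> R[i]) : \bar R := (\int[leb]_s (modulus (v s) ^+ 2 * arclen p s)%:E)%E.

Lemma gsqn_ge (v : R -> R[i]) : cmeas (setT : set mR) v -> (sqn leb (setT : set mR) v <= gsqn v)%E.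
Proof.
move=> mv; apply: ge0_le_integral => //.
- by move=> s _; rewrite lee_fin sqr_ge0.
- exact: msqrE.
- by apply/measurable_EFinP; apply: measurable_funM; [exact: msqr|exact: arclen_measurable].
- by move=> s _; rewrite lee_fin ler_peMr ?sqr_ge0// arclen_ge1.
Qed.

Lemma gsqn_le (v : R -> R[i]) : cmeas (setT : set mR) v -> (gsqn v <= L%:E * sqn leb (setT : set mR) v)%E.
Proof.
move=> mv; rewrite /sqn -(ge0_integralZl leb measurableT); last 3 first.
- exact: msqrE.
- by move=> s _; rewrite lee_fin sqr_ge0.
- by rewrite lee_fin.
have a0 s : 0 <= arclen p s by exact: le_trans (arclen_ge1 s).
apply: ge0_le_integral => //.
- by move=> s _; rewrite lee_fin mulr_ge0// sqr_ge0.
- by apply/measurable_EFinP; apply: measurable_funM; [exact: msqr|exact: arclen_measurable].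
- by apply: emeasurable_funM => //; exact: msqrE.
- by move=> s _; rewrite -EFinM lee_fin mulrC ler_wpM2r ?sqr_ge0.
Qed.

Lemma gsqn_ge0 v : (0 <= gsqn v)%E.
Proof.
by apply: integral_ge0 => s _; rewrite lee_fin mulr_ge0 ?sqr_ge0// (le_trans _ (arclen_ge1 s)).
Qed.

(** The approximants of the jet serve for the trace as well: by [ctrace_close] their boundary values
    converge to [ctrace]. *)
Lemma jet_is_trace u g w : jet D u g w -> is_trace D p u (ctrace u (g ord_max)).
Proof.
move=> J; have [sw [mu _] hg c1 c2] := J; have [mg _] := hg ord_max.
have [m1 m2] := ctrace_cmeas mu mg; split => //; exists w; split => //; first exact: jet_normW21 J.
apply/vanishesP; first by move=> n; exact: gsqn_ge0.
have [K K0 HK] := ctrace_close.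
apply: (vanishes_le2 (K := L * K) c1 (c2 ord_max)) => [|n]; first exact: mulr_ge0.
have mv := cmeasB (graph_cmeas (sw n)) (ctrace_cmeas mu mg).
apply: (le_trans (gsqn_le mv)); rewrite EFinM -muleA; apply: lee_wpmul2l; rewrite ?lee_fin//.
exact: HK.
Qed.

(** The boundary values of the approximants that define [T] converge to [T], and by [ctrace_close]
    also to [ctrace]; hence traces are unique almost everywhere. *)
Lemma is_trace_ae u T : W2 1 D u -> is_trace D p u T ->
  {ae leb, forall s, T s = ctrace u (wderiv D ord_max u) s}.
Proof.
move=> Wu [mT1 mT2 [w [sw cw /vanishesP ct]]].
have [_ [mu _] hg c1 c2] := jetP oD Wu sw cw; have [mg _] := hg ord_max.
have mT : cmeas (setT : set mR) T by split.
have mC := ctrace_cmeas mu mg; have [K K0 HK] := ctrace_close.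
have ct' : vanishes (fun n => gsqn (fun s => w n (s, p s) - T s)) by apply: ct => n; exact: gsqn_ge0.
have z : sqn leb (setT : set mR) (fun s => T s - ctrace u (wderiv D ord_max u) s) = 0%E.
  apply/eqP; rewrite eq_le sqn_ge0 andbT.
  apply: (vanishes_le_const (a := fun n => (2%:E * gsqn (fun s => w n (s, p s) - T s)%R +
     (2 * K)%:E * (sqa D (fun x => w n x - u x)%R + sqa D (fun x => cderiv ord_max (w n) x - wderiv D ord_max u x)%R))%E)) => //.
    apply: vanishesD; first by apply: (vanishes_le ct' (ler0n _ 2)).
    by apply: (vanishes_le2 c1 (c2 ord_max) (K := 2 * K)) => //; exact: mulr_ge0.
  move=> n; rewrite add0e; have mw := graph_cmeas (sw n).
  apply: (le_trans (sqn_triangle leb measurableT mT mw mC)).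
  apply: leeD; last by rewrite EFinM -muleA; apply: lee_wpmul2l; [rewrite lee_fin|exact: HK].
  by apply: lee_wpmul2l; [rewrite lee_fin|rewrite sqn_sym; apply: gsqn_ge; exact: cmeasB].
have := (ae_eq_integral_abs leb measurableT (msqrE (cmeasB mT mC))).1.
move=> h; have {h} : {ae leb, forall s, setT s -> (modulus (T s - ctrace u (wderiv D ord_max u) s) ^+ 2)%:E = 0%E}.
  apply: h; rewrite -[RHS]z; apply: eq_integral => s _; by rewrite gee0_abs// lee_fin sqr_ge0.
apply: ae_imp => s /(_ I) [/eqP]; rewrite expf_eq0 /= => /eqP m0.
have := modulus_sqr (T s - ctrace u (wderiv D ord_max u) s); rewrite m0 expr0n /= => /esym/eqP.
rewrite paddr_eq0 ?sqr_ge0// !sqrf_eq0 => /andP[/eqP h1 /eqP h2].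
by apply/eqP; rewrite -subr_eq0; apply/eqP; exact: complex_eq.
Qed.

Lemma trace_ae u T : W2 1 D u -> is_trace D p u T -> is_trace D p u (trace D p u) /\
  {ae leb, forall s, trace D p u s = T s}.
Proof.
move=> Wu hT; have h : is_trace D p u (trace D p u) by apply: xgetPex; exists T.
by split => //; apply: ae_imp2 (is_trace_ae Wu h) (is_trace_ae Wu hT) => s -> ->.
Qed.

End traces.

(** * Strips along the boundary *)

Section strips.
Context {R : realType}.
Local Notation mR := (measurableTypeR R).
Local Notation mR2 := (measurableTypeR R * measurableTypeR R)%type.
Local Notation leb := (@lebesgue_measure R).
Implicit Types (u v w : R * R -> R[i]).

Lemma le_integral_cst (a b : R) (c : \bar R) (f : mR -> \bar R) : a <= b -> (0 <= c)%E ->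
  (forall t, 0 <= f t)%E -> measurable_fun setT f ->
  (forall t, a < t < b -> (f t <= c)%E) ->
  (\int[leb]_(t in `]a, b[) f t <= c * (b - a)%:E)%E.
Proof.
move=> ab c0 f0 mf fc; have mI : measurable (`]a, b[%classic : set mR) by exact: measurable_itv.
apply: (@le_trans _ _ (\int[leb]_(t in `]a, b[) c)%E).
  by apply: ge0_le_integral => //; exact: measurable_funTS.
have lI : leb (`]a, b[%classic : set mR) = (b - a)%:E.
  by rewrite /= lebesgue_measure_itv /= lte_fin; case: ltP => [_|h]; rewrite -?EFinB// (_ : b = a) ?subrr//; apply/eqP; rewrite eq_le h ab.
have h : (\int[leb]_(t in `]a, b[) c = c * (b - a)%:E)%E.
  by apply: (etrans (integral_cst leb mI c)); congr (_ * _)%E.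
by rewrite h.
Qed.

(** The trace term is kept because for approximants of a function with zero trace it is small
    without being zero. *)
Lemma layer_zero (h : R) (F F2 : R * R -> R) : 0 < h -> continuous F -> continuous F2 ->
  (forall x, is_derive x (basis ord_max) F (F2 x)) ->
  (\int[area]_(x in upper h (fun=> 0%R)) (F x ^+ 2)%:E <=
   (2 * h)%:E * \int[leb]_s (F (s, 0%R) ^+ 2)%:E +
   (2 * h ^+ 2)%:E * \int[area]_(x in upper h (fun=> 0%R)) (F2 x ^+ 2)%:E)%E.
Proof.
move=> h0 cF cF2 dF; have c0 : continuous (fun _ : R => 0 : R) by exact: (@cont_cst R _ 0).
have mF := sqr_measurable_plane cF; have mF2 := sqr_measurable_plane cF2.
have f0 (f : R * R -> R) (x : mR2) : (0 <= (f x ^+ 2)%:E)%E by rewrite lee_fin sqr_ge0.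
rewrite (integral_upper h c0 mF (f0 F)) (integral_upper h c0 mF2 (f0 F2)).
have m1 : measurable_fun setT (fun s : mR => (F (s, 0%R) ^+ 2)%:E).
  by apply: measurable_line; apply: contX; exact: (@cont_hline R F 0 cF).
have m2 := measurable_vint h c0 mF2 (f0 F2).
have p0 s : (0 <= \int[leb]_(t in `]0%R, h[) (F2 (s, t) ^+ 2)%:E)%E by apply: integral_ge0 => t _; exact: f0.
have k1 : (0 <= (2 * h)%:E)%E by rewrite lee_fin mulr_ge0// ltW.
have k2 : (0 <= (2 * h ^+ 2)%:E)%E by rewrite lee_fin mulr_ge0// sqr_ge0.
rewrite -(ge0_integralZl leb measurableT m1 (fun s _ => f0 (fun s => F (s.1, 0%R)) (s, 0%R)) k1).
rewrite -(ge0_integralZl leb measurableT m2 (fun s _ => p0 s) k2).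
rewrite -(ge0_integralD leb measurableT); last 4 first.
- by move=> s _; apply: mule_ge0 => //; rewrite lee_fin sqr_ge0.
- exact: emeasurable_funM.
- by move=> s _; apply: mule_ge0.
- exact: emeasurable_funM.
apply: ge0_le_integral => //.
- by move=> s _; apply: integral_ge0 => t _; exact: f0.
- exact: (measurable_vint h c0 mF (f0 F)).
- by apply: emeasurable_funD; exact: emeasurable_funM.
move=> s _; set Y := (\int[leb]_(t in _) (F2 _ ^+ 2)%:E)%E.
have Y0 : (0 <= Y)%E by exact: p0.
apply: (le_trans (@le_integral_cst 0 h ((2 * F (s, 0%R) ^+ 2)%:E + (2 * h)%:E * Y)%E _ (ltW h0) _ _ _ _)).
- by apply: adde_ge0; [rewrite lee_fin mulr_ge0// sqr_ge0|exact: mule_ge0].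
- by move=> t; exact: f0.
- by apply: measurable_line; apply: contX; exact: cont_vline.
- move=> t /andP[t0 th].
  have := @ftc_sqr R 0 h 0 t (fun t => F (s, t)) (fun t => F2 (s, t)) (dline2 dF s) (@cont_vline R F2 s cF2).
  by rewrite subr0 => H; apply: H; rewrite ?lexx ?ltW//.
rewrite subr0 ge0_muleDl; [|by rewrite lee_fin mulr_ge0// sqr_ge0|exact: mule_ge0].
apply: leeD; first by rewrite -!EFinM lee_fin; lra.
by rewrite muleAC -EFinM; apply: lee_wpmul2r => //; rewrite lee_fin expr2; lra.
Qed.

Lemma shift2E (h : R) (x : R * R) : (x.1, x.2 - h) = x + (0, - h).
Proof. by case: x => s t; transitivity (s + 0, t + - h); [rewrite addr0|]. Qed.

Lemma cont_shift2 (h : R) (F : R * R -> R) : continuous F -> continuous (fun x => F (x.1, x.2 - h)).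
Proof.
move=> cF; under eq_fun do rewrite shift2E.
move=> x; apply: (@continuous_comp _ _ _ (fun x : R * R => x + (0, - h)) F); last exact: cF.
by apply: cvgD; [exact: cvg_id|exact: cvg_cst].
Qed.

(** The increment is an integral of [F2] over a segment of length h, which gives one factor h;
    integrating the segments over all heights gives the other. Since [F2] vanishes below the bottom,
    the parts of segments lying there contribute nothing. *)
Lemma shift_diff_smooth (d h : R) (F F2 : R * R -> R) : 0 < h -> continuous F -> continuous F2 ->
  (forall x, is_derive x (basis ord_max) F (F2 x)) -> (forall x, x.2 <= 0 -> F2 x = 0) ->
  (\int[area]_(x in upper d (fun=> 0%R)) ((F (x.1, x.2 - h) - F x) ^+ 2)%:E <=
   (2 * h ^+ 2)%:E * \int[area]_(x in upper d (fun=> 0%R)) (F2 x ^+ 2)%:E)%E.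
Proof.
move=> h0 cF cF2 dF F20; have c0 : continuous (fun _ : R => 0 : R) by exact: (@cont_cst R _ 0).
have cG : continuous (fun x : R * R => F (x.1, x.2 - h) - F x) by apply: contB => //; exact: cont_shift2.
have mG := sqr_measurable_plane cG; have mF2 := sqr_measurable_plane cF2.
have f0 (f : R * R -> R) (x : mR2) : (0 <= (f x ^+ 2)%:E)%E by rewrite lee_fin sqr_ge0.
rewrite (integral_upper d c0 mG (f0 _)) (integral_upper d c0 mF2 (f0 F2)).
have m2 := measurable_vint d c0 mF2 (f0 F2).
have p0 s : (0 <= \int[leb]_(t in `]0%R, d[) (F2 (s, t) ^+ 2)%:E)%E by apply: integral_ge0 => t _; exact: f0.
have k2 : (0 <= (2 * h ^+ 2)%:E)%E by rewrite lee_fin mulr_ge0// sqr_ge0.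
rewrite -(ge0_integralZl leb measurableT m2 (fun s _ => p0 s) k2).
apply: ge0_le_integral => //.
- by move=> s _; apply: integral_ge0 => t _; rewrite lee_fin sqr_ge0.
- exact: (measurable_vint d c0 mG (f0 _)).
- exact: emeasurable_funM.
move=> s _.
have mId : measurable (`]0, d[%classic : set mR) by exact: measurable_itv.
pose f : mR -> \bar R := (fun t => (F2 (s, t) ^+ 2)%:E) \_ (`]0%R, d[ : set mR).
have mf : measurable_fun setT f.
  apply: measurable_restrictT => //.
  by apply: measurable_line; apply: contX; exact: cont_vline.
have ff t : (0 <= f t)%E by rewrite /f patchE; case: ifP => // _; exact: f0.
pose g t := f (t - h).
have mg : measurable_fun setT (g : mR -> \bar R).
  apply: (@measurableT_comp _ _ _ _ _ _ f) => //.
  by apply: measurable_funB => //; exact: measurable_cst.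
have gg t : (0 <= g t)%E by exact: ff.
have -> : (\int[leb]_(t in `]0%R, d[) (F2 (s, t) ^+ 2)%:E = \int[leb]_t f t)%E by rewrite integral_mkcond.
have E : (\int[leb]_t f t = \int[leb]_t g t)%E.
  rewrite (ge0_integral_shift h mg gg); apply: eq_integral => t _; by rewrite /g addrK.
have -> : ((2 * h ^+ 2)%:E * \int[leb]_t f t = (2 * h)%:E * \int[leb]_t \int[leb]_(a in `]0%R, h[) g ((t : R) + (a : R))%R)%E.
  by rewrite (shift_avg h0 mg gg) E muleA -EFinM; congr (_%:E * _)%E; ring.
have mI2 : measurable_fun setT (fun t : mR => \int[leb]_(a in `]0%R, h[) g ((t : R) + (a : R))%R)%E.
  have mgg : measurable_fun setT (fun x : mR2 => g (x.1 + x.2)).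
    apply: (@measurableT_comp _ _ _ _ _ _ g) => //.
    by apply: measurable_funD; [exact: measurable_fst|exact: measurable_snd].
  exact: (measurable_vint h c0 mgg (fun x => gg _)).
have I20 t : (0 <= \int[leb]_(a in `]0%R, h[) g ((t : R) + (a : R))%R)%E by apply: integral_ge0 => a _; exact: gg.
have k1 : (0 <= (2 * h)%:E)%E by rewrite lee_fin mulr_ge0// ltW.
rewrite -(ge0_integralZl leb measurableT mI2 (fun t _ => I20 t) k1) [leLHS]integral_mkcond.
apply: ge0_le_integral => //.
- by move=> t _; rewrite patchE; case: ifP => // _; rewrite lee_fin sqr_ge0.
- apply: measurable_restrictT => //.
  by apply: measurable_line; apply: contX; exact: (@cont_vline R _ s cG).
- exact: emeasurable_funM.
move=> t _; rewrite patchE; case: ifPn => [|_]; last exact: mule_ge0.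
rewrite inE /= in_itv /= => /andP[t0 td].
have df a : is_derive a (1 : R) (fun a => F (s, a) - F (s, t - h)) (F2 (s, a)).
  by apply: (is_derive_eq (is_deriveB (dline2 dF s a) (is_derive_cst _ _ _))); rewrite subr0.
have := @ftc_sqr R (t - h) t (t - h) t _ _ df (@cont_vline R F2 s cF2).
have th : t - h <= t by rewrite gerBl ltW.
rewrite !lexx th => /(_ isT isT); rewrite subrr expr0n mulr0 add0e (_ : t - (t - h) = h); last by ring.
move=> H; rewrite -sqrrN opprB; apply: (le_trans H); apply: lee_wpmul2l => //.
rewrite [leRHS](_ : _ = \int[leb]_(a in `]0%R, h[) f ((t - h) + a)%R)%E; last first.
  by apply: eq_integral => a _; rewrite /g; congr f; ring.
rewrite (integral_itv_shift (t - h) h mf ff) subrK; apply: ge0_le_integral => //.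
- apply: measurable_funTS.
  by apply: measurable_line; apply: contX; exact: cont_vline.
- exact: measurable_funTS.
move=> a /=; rewrite in_itv /= => /andP[a1 a2]; rewrite /f patchE; case: ifPn => // /negP na.
have [a0|a0] := leP a 0; first by rewrite F20// expr0n.
by exfalso; apply: na; rewrite inE /= in_itv /= a0 (lt_trans a2 td).
Qed.

Lemma part_sqr_cont b w j : csmooth_cpt w -> [/\ continuous (fun x => part b (w x)),
  continuous (fun x => part b (cderiv j w x)) &
  forall x, is_derive x (basis j) (fun x => part b (w x)) (part b (cderiv j w x))].
Proof.
move=> sw; have C := part_smooth b sw.
have E : (fun x => part b (cderiv j w x)) = (fun x => 'D_(basis j) (fun x => part b (w x)) x).
  by apply/funext => x; rewrite part_cderiv.
split; first exact: Cinfty_continuous.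
  by rewrite E; exact/Cinfty_continuous/Cinfty_D.
by move=> x; rewrite part_cderiv; exact: Cinfty_is_derive.
Qed.

Lemma cst0_cont : continuous (fun _ : R => 0 : R). Proof. exact: (@cont_cst R _ 0). Qed.

Local Notation strip h := (upper h (fun=> 0%R)).

Lemma strip_open (h : R) : open (strip h). Proof. exact: upper_open cst0_cont. Qed.

Arguments strip_open : clear implicits.

Lemma strip_meas (h : R) : measurable (strip h : set mR2). Proof. exact: upper_measurable cst0_cont. Qed.

Lemma hline_cmeas w : csmooth_cpt w -> cmeas (setT : set mR) (fun s => w (s, 0)).
Proof.
move=> [/Cinfty_continuous C1 /Cinfty_continuous C2 _]; split; apply: (@continuous_measurable_fun R).
  exact: (@cont_hline R (fun x => complex.Re (w x)) 0 C1).
exact: (@cont_hline R (fun x => complex.Im (w x)) 0 C2).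
Qed.

Lemma layer_zeroC (h : R) w : 0 < h -> csmooth_cpt w ->
  (sqa (strip h) w <= (2 * h)%:E * sqn leb (setT : set mR) (fun s => w (s, 0%R)) +
     (2 * h ^+ 2)%:E * sqa (strip h) (cderiv ord_max w))%E.
Proof.
move=> h0 sw; have k b := let: And3 c1 c2 c3 := part_sqr_cont b ord_max sw in layer_zero h0 c1 c2 c3.
rewrite /sqa (sqn_parts area (strip_meas h) (csmooth_cmeas (strip_open h) sw)).
rewrite (sqn_parts area (strip_meas h) (cderiv_cmeas ord_max (strip_open h) sw)).
rewrite (sqn_parts leb measurableT (hline_cmeas sw)).
apply: (le_trans (leeD (k true) (k false))); rewrite addeACA.
by rewrite -!ge0_muleDr//; exact: int_sqr_ge0.
Qed.

Definition shift_up (h : R) (w : R * R -> R[i]) (x : R * R) : R[i] := w (x.1, x.2 - h).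

Lemma shift_up_smooth h w : csmooth_cpt w -> csmooth_cpt (shift_up h w).
Proof.
move=> [C1 C2 K]; split.
- rewrite /shift_up; under eq_fun do rewrite shift2E; exact: (Cinfty_shift (0, - h) C1).
- rewrite /shift_up; under eq_fun do rewrite shift2E; exact: (Cinfty_shift (0, - h) C2).
have K' : compact ((fun x : R * R => x + (0, h)) @` tsupport w).
  apply: continuous_compact K; apply: continuous_subspaceT => x.
  by apply: cvgD; [exact: cvg_id|exact: cvg_cst].
have cl := plane_compact_closed K'.
apply: subclosed_compact K' _; first exact: closed_closure.
move=> x hx; apply: (cl); apply: closure_subset hx => y /= hy.
exists (y.1, y.2 - h); first exact: tsupport_sub.
by rewrite shift2E -addrA; case: y {hy} => y1 y2; transitivity (y1 + (0 + 0), y2 + (- h + h)); [|rewrite !addr0 addNr addr0].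
Qed.

Lemma shift_up_cderiv h w j x : csmooth_cpt w -> cderiv j (shift_up h w) x = shift_up h (cderiv j w) x.
Proof.
move=> [C1 C2 _]; rewrite /shift_up /cderiv.
have H (f : R * R -> R) : Cinfty f -> 'D_(basis j) (fun x => f (x.1, x.2 - h)) x = 'D_(basis j) f (x.1, x.2 - h).
  move=> Cf; move: j; apply: basis_ind.
    have h1 := (is_derive_basis0 f (x.1, x.2 - h) _).1 (Cinfty_is_derive ord0 (x.1, x.2 - h) Cf).
    by apply: derive_val; apply/is_derive_basis0.
  have h1 := (is_derive_basis1 f (x.1, x.2 - h) _).1 (Cinfty_is_derive ord_max (x.1, x.2 - h) Cf).
  have h2 : is_derive x.2 (1 : R) (fun t => t - h) 1.
    by apply: (is_derive_eq (is_deriveB (is_derive_id _ _) (is_derive_cst _ _ _))); rewrite subr0.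
  apply: derive_val; apply/is_derive_basis1 => /=.
  rewrite /= in h1.
  have h3 := @is_derive1_comp R (fun t : R => f (x.1, t)) (fun t : R => t - h) x.2 _ _ h1 h2.
  by rewrite mulr1 in h3.
by rewrite (H _ C1) (H _ C2).
Qed.

Lemma shift_diffC (d h : R) w : 0 < h -> csmooth_cpt w -> (forall x, x.2 <= 0 -> cderiv ord_max w x = 0) ->
  (sqa (strip d) (fun x => shift_up h w x - w x)%R <= (2 * h ^+ 2)%:E * sqa (strip d) (cderiv ord_max w))%E.
Proof.
move=> h0 sw w0.
have k b : (\int[area]_(x in strip d) (part b (shift_up h w x - w x) ^+ 2)%:E <=
     (2 * h ^+ 2)%:E * \int[area]_(x in strip d) (part b (cderiv ord_max w x) ^+ 2)%:E)%E.
  have [c1 c2 c3] := part_sqr_cont b ord_max sw.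
  have := shift_diff_smooth d h0 c1 c2 c3; under [X in (X <= _)%E]eq_integral do rewrite -partB.
  by apply => x x0; rewrite w0//; case: (b).
have mw := csmooth_cmeas (strip_open d) sw.
rewrite /sqa (sqn_parts area (strip_meas d) (cmeasB (csmooth_cmeas (strip_open d) (shift_up_smooth h sw)) mw)).
rewrite (sqn_parts area (strip_meas d) (cderiv_cmeas ord_max (strip_open d) sw)).
apply: (le_trans (leeD (k true) (k false))).
by rewrite -!ge0_muleDr//; exact: int_sqr_ge0.
Qed.

Lemma strip_sub (h d : R) : h <= d -> strip h `<=` strip d.
Proof. by move=> hd x /andP[x0 xh]; apply/andP; split => //; exact: lt_le_trans hd. Qed.

(** Absolute continuity of the integral, by dominated convergence along the heights d / (n + 1). *)
Lemma small_layer (d e : R) (g : R * R -> R[i]) : 0 < d -> 0 < e -> cL2a (strip d) g ->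
  exists k, [/\ 0 < k, k <= d & (sqa (strip k) g <= e%:E)%E].
Proof.
move=> d0 e0 hg; have mD := strip_meas d; have [mg _] := hg.
pose k n : R := d / n.+1%:R.
have k0 n : 0 < k n by rewrite divr_gt0.
have kd n : k n <= d by rewrite ler_pdivrMr//; apply: ler_peMr; [exact: ltW|rewrite ler1n].
pose f := fun x : mR2 => (modulus (g x) ^+ 2)%:E.
pose f_ n := f \_ (strip (k n) : set mR2).
have sub n : (strip d `&` strip (k n)) = strip (k n).
  by rewrite setIC; apply/setIidPl; exact: strip_sub (kd n).
have mf := msqrE mg.
have mf_ n : measurable_fun (strip d : set mR2) (f_ n).
  apply/(measurable_restrict _ (strip_meas (k n)) mD); rewrite sub.
  by apply: (measurable_funS mD _ mf); rewrite -(sub n); exact: subIsetl.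
have hA : {ae area, forall x, strip d x -> f_ ^~ x @ \oo --> (cst 0%E : mR2 -> \bar R) x}.
  apply: aeW => x /andP[x0 xd]; apply: cvg_near_cst.
    have xd0 : 0 < x.2 / d by rewrite divr_gt0.
    near=> n; rewrite /f_ patchE; case: ifPn => //; rewrite inE /= => /andP[_]; rewrite ltNge => /negP[].
    have xn : n.+1%:R^-1 < x.2 / d by near: n; exact: (near_infty_natSinv_lt (PosNum xd0)).
    by have := ler_wpM2l (ltW d0) (ltW xn); rewrite mulrCA divff ?gt_eqF// mulr1.
have hB : {ae area, forall x n, strip d x -> (`|f_ n x| <= f x)%E}.
  apply: aeW => x n _; rewrite /f_ patchE; case: ifP => _; last by rewrite abse0 lee_fin sqr_ge0.
  by rewrite gee0_abs// lee_fin sqr_ge0.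
have [_ _] := dominated_convergence mD mf_ (measurable_cst 0%E) hA (sqr_integrable hg) hB.
rewrite integral0.
move=> /vanishesP H; have {}H : vanishes (fun n => \int[area]_(x in strip d) f_ n x)%E.
  by apply: H => n; apply: integral_ge0 => x _; rewrite /f_ patchE; case: ifP => // _; rewrite lee_fin sqr_ge0.
have [n _ /(_ n (leqnn n)) Hn] := H e e0; exists (k n); split => //.
by move: Hn; rewrite -integral_mkcondr sub.
Unshelve. all: by end_near. Qed.

Lemma step'_le0 (t : R) : t <= 0 -> step' t = 0.
Proof. by move=> t0; rewrite /step' !(flat_le0 _ t0) !(mul0r, mulr0, addr0). Qed.

Lemma step'_ge1 (t : R) : 1 <= t -> step' t = 0.
Proof.
move=> t1; have t0 : 1 - t <= 0 by rewrite subr_le0.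
by rewrite /step' !(flat_le0 _ t0) !(mul0r, mulr0, addr0).
Qed.

Definition vstep (l c : R) (x : R * R) : R := step (l * x.2 + c).

Lemma vstep_smooth l c : Cinfty (vstep l c).
Proof. exact: (Cinfty_step l c ord_max). Qed.

Lemma vstep_D0 l c x : 'D_(basis ord0) (vstep l c) x = 0.
Proof.
apply: derive_val; apply/is_derive_basis0; rewrite /vstep /=; exact: is_derive_cst.
Qed.

Lemma vstep_D1 l c x : 'D_(basis ord_max) (vstep l c) x = l * step' (l * x.2 + c).
Proof.
apply: derive_val; apply/is_derive_basis1.
have h := @is_derive1_comp R (@step R) (fun t : R => l * t + c) x.2 _ _ (step_derive _) (is_derive_affine l c x.2).
by rewrite mulrC.
Qed.

Lemma sqa_supp (D E : set (R * R)) (K : R) v u : measurable (D : set mR2) -> measurable (E : set mR2) -> E `<=` D -> 0 <= K ->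
  cmeasurable D v -> cmeasurable E u ->
  (forall x, D x -> ~ E x -> v x = 0) -> (forall x, E x -> modulus (v x) <= K * modulus (u x)) ->
  (sqa D v <= (K ^+ 2)%:E * sqa E u)%E.
Proof.
move=> mD mE ED K0 mv mu v0 vu; have -> : sqa D v = sqa E v.
  have E1 : E = D `&` E by rewrite setIC; apply/esym/setIidPl.
  rewrite /sqa /sqn [in RHS]E1 integral_mkcondr; apply: eq_integral => x; rewrite inE => Dx.
  rewrite patchE; case: ifPn => // /negP nE; rewrite v0 ?modulus0 ?expr0n// => Ex; apply: nE; exact/mem_set.
by apply: sqa_le => //; exact: (cmeas_sub mD ED).
Qed.

(** An approximant with small trace is multiplied by a cut-off vanishing below height k. Its slope
    is of order 1/k, but by [layer_zeroC] the squared norm of the approximant below 2 k is of order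
    k^2 times a small quantity, so the product with the slope is small. *)
Lemma zero_approx1 (d : R) u g (w : nat -> R * R -> R[i]) (e : R) : 0 < d -> jet (strip d) u g w ->
  vanishes (fun n => sqn leb (setT : set mR) (fun s => w n (s, 0))) -> 0 < e ->
  exists z, [/\ csmooth_cpt z, exists2 k : R, 0 < k & forall x, x.2 <= k -> z x = 0,
    (sqa (strip d) (fun x => z x - u x)%R <= e%:E)%E &
    forall j, (sqa (strip d) (fun x => cderiv j z x - g j x)%R <= e%:E)%E].
Proof.
move=> d0 [sw hu hg c1 c2] ct e0; have [C C0 HC] := @step'_bounded R.
have mD := strip_meas d; have oD := strip_open d; have [mu _] := hu; have mg j : cmeasurable (strip d) (g j) by case: (hg j).
(* The total of the gradient error: 2 * 4 r from the terms without derivative of the cut-off, 2 * 36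
   C^2 r from the term with it. *)
pose N := 8 + 72 * C ^+ 2; have N0 : 8 <= N by rewrite /N lerDl mulr_ge0// sqr_ge0.
pose r := e / N; have r0 : 0 < r by rewrite divr_gt0//; lra.
have [k1 [k10 k1d l1]] := small_layer d0 r0 hu.
have [k2 [k20 k2d l2]] := small_layer d0 r0 (hg ord0).
have [k3 [k30 k3d l3]] := small_layer d0 r0 (hg ord_max).
pose kk := Num.min k1 (Num.min k2 k3).
have kk0 : 0 < kk by rewrite !lt_min k10 k20 k30.
have kkd : kk <= d by rewrite ge_min k1d.
have lu : (sqa (strip kk) u <= r%:E)%E.
  apply: le_trans l1; apply: sqa_sub => //; [exact: strip_meas|exact: strip_meas|by apply: strip_sub; rewrite ge_min lexx|].
  exact: (cmeas_sub mD (strip_sub k1d)).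
have lg j : (sqa (strip kk) (g j) <= r%:E)%E.
  move: j; apply: basis_ind.
    apply: le_trans l2; apply: sqa_sub => //; [exact: strip_meas|exact: strip_meas|by apply: strip_sub; rewrite !ge_min lexx orbT|].
    exact: (cmeas_sub mD (strip_sub k2d)).
  apply: le_trans l3; apply: sqa_sub => //; [exact: strip_meas|exact: strip_meas|by apply: strip_sub; rewrite !ge_min lexx !orbT|].
  exact: (cmeas_sub mD (strip_sub k3d)).
pose k := kk / 2; have k0 : 0 < k by rewrite divr_gt0.
(* The height k is fixed first; only then is the approximant chosen, with a trace error r * k that
   is small compared with the height. *)
have [n []] : exists n, [/\ (sqa (strip d) (fun x => w n x - u x)%R <= r%:E)%E,
   forall j, (sqa (strip d) (fun x => cderiv j (w n) x - g j x)%R <= r%:E)%E &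
   (sqn leb (setT : set mR) (fun s => w n (s, 0%R)) <= (r * k)%:E)%E].
  have rk : 0 < r * k by exact: mulr_gt0.
  have F : \forall n \near \oo, forall j, (sqa (strip d) (fun x => cderiv j (w n) x - g j x)%R <= r%:E)%E.
    pose P n j := (sqa (strip d) (fun x => cderiv j (w n) x - g j x)%R <= r%:E)%E.
    by apply: filterS2 (c2 ord0 r r0) (c2 ord_max r r0) => n h0 h1; exact: (@basis_ind (P n) h0 h1).
  have [n [h1 [h2 h3]]] := filter_ex (filterI (c1 r r0) (filterI F (ct _ rk))).
  by exists n.
set W := w n => a1 a2 a3; have sW : csmooth_cpt W by exact: sw.
pose chi := vstep k^-1 (- 1); have Cchi : Cinfty chi by exact: vstep_smooth.
have mchi := cmeas_smooth (strip d) Cchi.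
have mW := csmooth_cmeas oD sW; have mdW j := cderiv_cmeas j oD sW.
have chi01 x : 0 <= chi x <= 1 by rewrite step_ge0 step_le1.
have chi1 x : kk <= x.2 -> chi x = 1.
  move=> xk; apply: step_ge1; rewrite lerBrDr -(ler_pM2l k0) mulrA divff ?gt_eqF// mul1r /k; lra.
have chi' j x : `|'D_(basis j) chi x| <= k^-1 * C.
  move: j; apply: basis_ind; first by rewrite vstep_D0 normr0 mulr_ge0 ?invr_ge0// ltW.
  by rewrite vstep_D1 normrM gtr0_norm ?invr_gt0//; apply: ler_wpM2l; rewrite ?HC// invr_ge0 ltW.
have chi'0 j x : kk <= x.2 -> 'D_(basis j) chi x = 0.
  move=> xk; move: j; apply: basis_ind; first by rewrite vstep_D0.
  rewrite vstep_D1 step'_ge1 ?mulr0//.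
  rewrite lerBrDr -(ler_pM2l k0) mulrA divff ?gt_eqF// mul1r /k; lra.
exists (fun x => (chi x)%:C%C * W x).
have ekk : (strip kk) `<=` strip d by exact: strip_sub.
have nkk x : (strip d) x -> ~ (strip kk) x -> kk <= x.2.
  by move=> /andP[x0 _] nE; rewrite leNgt; apply/negP => xk; apply: nE; exact/andP.
have mul1 v : cmeasurable (strip d) v -> (sqa (strip d) (fun x => (chi x)%:C%C * v x)%R <= sqa (strip d) v)%E.
  move=> mv; have := @sqa_le R (strip d) 1 (fun x => (chi x)%:C%C * v x) v mD ler01 (cmeasM mchi mv) mv.
  rewrite expr1n mul1e; apply => x _; rewrite mul1r modulusM modulus_real.
  have /andP[h1 h2] := chi01 x; rewrite ger0_norm//; apply: ler_piMl => //; exact: modulus_ge0.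
have m1 : cmeasurable (strip d) (fun x => (chi x - 1)%:C%C).
  apply: cmeas_real; apply: measurable_funB => //; exact: (proj1 mchi).
have mul2 v : cmeasurable (strip d) v -> (sqa (strip d) (fun x => (chi x - 1)%:C%C * v x)%R <= sqa (strip kk) v)%E.
  move=> mv; have := @sqa_supp (strip d) (strip kk) 1 (fun x => (chi x - 1)%:C%C * v x) v mD (strip_meas _) ekk ler01 (cmeasM m1 mv) (cmeas_sub mD ekk mv).
  rewrite expr1n mul1e; apply => x; first by move=> Dx nE; rewrite chi1 ?subrr ?mul0r//; exact: nkk.
  move=> _; rewrite mul1r modulusM modulus_real; apply: ler_piMl; first exact: modulus_ge0.
  have /andP[h1 h2] := chi01 x; rewrite ler0_norm ?subr_le0//; lra.
have m3 j : cmeasurable (strip d) (fun x => ('D_(basis j) chi x)%:C%C) by exact: cmeas_smooth (Cinfty_D j Cchi).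
have mul3 j : (sqa (strip d) (fun x => ('D_(basis j) chi x)%:C%C * W x)%R <= ((k^-1 * C) ^+ 2)%:E * sqa (strip kk) W)%E.
  have KC : 0 <= k^-1 * C by rewrite mulr_ge0 ?invr_ge0 ?(ltW k0) ?(ltW C0).
  apply: (sqa_supp mD (strip_meas _) ekk KC (cmeasM (m3 j) mW) (cmeas_sub mD ekk mW)).
    by move=> x Dx nE; rewrite chi'0 ?mul0r//; exact: nkk.
  by move=> x _; rewrite modulusM modulus_real; apply: ler_wpM2r; [exact: modulus_ge0|exact: chi'].
split.
- exact: csmoothM.
- exists k => // x xk; rewrite /chi /vstep step_le0 ?mul0r// subr_le0 -(ler_pM2l k0) mulrA divff ?gt_eqF// mul1r mulr1//.
- have -> : (fun x => (chi x)%:C%C * W x - u x) = (fun x => (chi x)%:C%C * (W x - u x) + (chi x - 1)%:C%C * u x).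
    by apply/funext => x; rewrite rmorphB /=; ring.
  have mWu := cmeasB mW mu.
  apply: (le_trans (sqnD area mD (cmeasM mchi mWu) (cmeasM m1 mu))).
  apply: (@le_trans _ _ (2%:E * r%:E + 2%:E * r%:E)%E).
    apply: leeD; apply: lee_wpmul2l; rewrite ?lee_fin//.
      exact: (le_trans (mul1 _ mWu)).
    exact: (le_trans (mul2 _ mu)).
  rewrite -!EFinM -EFinD lee_fin (_ : e = N * r); last by rewrite /r mulrC divfK// gt_eqF//; lra.
  by have := ler_wpM2r (ltW r0) N0; lra.
- move=> j; have mWg := cmeasB (mdW j) (mg j).
  have -> : (fun x => cderiv j (fun x => (chi x)%:C%C * W x) x - g j x) = (fun x =>
     ((chi x)%:C%C * (cderiv j W x - g j x) + (chi x - 1)%:C%C * g j x) + ('D_(basis j) chi x)%:C%C * W x).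
    by apply/funext => x; rewrite cderivM// rmorphB /=; ring.
  have mA := cmeasM mchi mWg; have mB := cmeasM m1 (mg j); have mC := cmeasM (m3 j) mW.
  apply: (le_trans (sqnD area mD (cmeasD mA mB) mC)).
  have lW : (sqa (strip kk) W <= (r * (4 * k ^+ 2 * 9))%:E)%E.
    apply: (le_trans (layer_zeroC kk0 sW)).
    have ldW : (sqa (strip kk) (cderiv ord_max W) <= (4 * r)%:E)%E.
      have E : sqa (strip kk) (cderiv ord_max W) = sqa (strip kk) (fun x => (cderiv ord_max W x - g ord_max x) + g ord_max x).
        by congr sqa; apply/funext => x; rewrite subrK.
      have mx := cmeas_sub mD ekk (cmeasB (mdW ord_max) (mg ord_max)).
      rewrite E; apply: (le_trans (sqnD area (strip_meas kk) mx (cmeas_sub mD ekk (mg ord_max)))).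
      apply: (@le_trans _ _ (2%:E * r%:E + 2%:E * r%:E)%E); last by rewrite -!EFinM -EFinD lee_fin; lra.
      apply: leeD; apply: lee_wpmul2l; rewrite ?lee_fin//; last exact: lg.
      exact: (le_trans (sqa_sub mD (strip_meas kk) ekk (cmeasB (mdW ord_max) (mg ord_max))) (a2 ord_max)).
    apply: (@le_trans _ _ ((2 * kk)%:E * (r * k)%:E + (2 * kk ^+ 2)%:E * (4 * r)%:E)%E).
      apply: leeD; apply: lee_wpmul2l => //; rewrite lee_fin.
        by rewrite mulr_ge0// ltW.
      by rewrite mulr_ge0// sqr_ge0.
    rewrite -!EFinM -EFinD lee_fin (_ : kk = 2 * k); last by rewrite /k; field.
    by rewrite !expr2; have := mulr_ge0 (ltW r0) (mulr_ge0 (ltW k0) (ltW k0)); lra.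
  apply: (@le_trans _ _ (2%:E * (4 * r)%:E + 2%:E * (((k^-1 * C) ^+ 2)%:E * (r * (4 * k ^+ 2 * 9))%:E))%E).
    apply: leeD; apply: lee_wpmul2l; rewrite ?lee_fin//.
      apply: (le_trans (sqnD area mD mA mB)).
      apply: (@le_trans _ _ (2%:E * r%:E + 2%:E * r%:E)%E); last by rewrite -!EFinM -EFinD lee_fin; lra.
      apply: leeD; apply: lee_wpmul2l; rewrite ?lee_fin//.
        exact: (le_trans (mul1 _ mWg)).
      exact: (le_trans (mul2 _ (mg j))).
    apply: (le_trans (mul3 j)); apply: lee_wpmul2l => //; by rewrite lee_fin sqr_ge0.
  rewrite -!EFinM -EFinD lee_fin (_ : e = N * r); last by rewrite /r mulrC divfK// gt_eqF//; lra.
  rewrite (_ : (k^-1 * C) ^+ 2 * (r * (4 * k ^+ 2 * 9)) = 36 * C ^+ 2 * r); last by field; rewrite gt_eqF.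
  by rewrite /N; lra.
Qed.

Lemma zero_approx (d : R) u g (w : nat -> R * R -> R[i]) : 0 < d -> jet (strip d) u g w ->
  vanishes (fun n => sqn leb (setT : set mR) (fun s => w n (s, 0))) ->
  exists2 z, jet (strip d) u g z & forall n, exists2 k : R, 0 < k & forall x, x.2 <= k -> z n x = 0.
Proof.
move=> d0 J ct; have [sw hu hg c1 c2] := J.
have H n : exists z, [/\ csmooth_cpt z, exists2 k : R, 0 < k & forall x, x.2 <= k -> z x = 0,
    (sqa (strip d) (fun x => z x - u x)%R <= (n.+1%:R^-1)%:E)%E &
    forall j, (sqa (strip d) (fun x => cderiv j z x - g j x)%R <= (n.+1%:R^-1)%:E)%E].
  by apply: (zero_approx1 d0 J ct); rewrite invr_gt0.
have [z Hz] := choice H; exists z; last by move=> n; have [] := Hz n.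
have vn (f : nat -> \bar R) : (forall n, (f n <= (n.+1%:R^-1)%:E)%E) -> vanishes f.
  move=> fn e e0; near=> n; apply: (le_trans (fn n)); rewrite lee_fin; apply: ltW.
  by near: n; exact: (near_infty_natSinv_lt (PosNum e0)).
split.
- by move=> n; have [h _ _ _] := Hz n; exact: h.
- exact: hu.
- exact: hg.
- by apply: vn => n; have [_ _ h _] := Hz n; exact: h.
- by move=> j; apply: vn => n; have [_ _ _ h] := Hz n; exact: h.
Unshelve. all: by end_near. Qed.

End strips.

(** * Vertical translations and the quadratic form *)

Section shift.
Context {R : realType}.
Local Notation mR := (measurableTypeR R).
Local Notation mR2 := (measurableTypeR R * measurableTypeR R)%type.
Local Notation leb := (@lebesgue_measure R).
Local Notation strip h := (upper h (fun=> 0%R)).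
Variable d : R.
Hypothesis d0 : 0 < d.
Local Notation D := (strip d).
Implicit Types u v p q a : R * R -> R[i].

Let mD : measurable (D : set mR2) := strip_meas d.
Let oD : open D := @strip_open R d.

Lemma shift_le (f : mR2 -> \bar R) (t : R) : 0 <= t -> measurable_fun setT f -> (forall x, (0 <= f x)%E) ->
  (forall x, x.2 <= 0 -> f x = 0%E) ->
  (\int[area]_(x in D) f (x.1, ((x.2 : R) - t)%R) <= \int[area]_(x in D) f x)%E.
Proof.
move=> t0 mf f0 fz; have mF : measurable_fun setT (f \_ (D : set mR2)) by exact: measurable_restrictT.
have F0 x : (0 <= (f \_ (D : set mR2)) x)%E by rewrite patchE; case: ifP.
rewrite [leRHS]integral_mkcond (ge0_integral_shift2 (- t) mF F0).
rewrite [leLHS](_ : _ = \int[area]_(x in D) (f \_ (D : set mR2)) (x.1, ((x.2 : R) - t)%R))%E; last first.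
  apply: eq_integral => x; rewrite inE => /andP[x0 xd]; rewrite patchE; case: ifPn => // /negP nD.
  rewrite fz//= leNgt; apply/negP => xt; apply: nD; apply/mem_set; apply/andP; split => //=.
  by apply: le_lt_trans xd; rewrite gerBl.
apply: ge0_subset_integral => //.
by apply: (@measurableT_comp _ _ _ _ _ _ (f \_ (D : set mR2))) => //; exact: measurable_shift2.
Qed.

(** Values below the bottom are irrelevant for elements of L_2 of the strip, so the translate is set
    to zero there explicitly. For functions vanishing near and below the bottom it is the plain
    translate ([tsh_smooth]). *)
Definition tsh (h : R) v (x : R * R) : R[i] := if h < x.2 then shift_up h v x else 0.

Lemma tsh_cmeas h v : 0 < h -> cmeasurable D v -> cmeasurable D (tsh h v).
Proof.
move=> h0 mv.
have key b : measurable_fun (D : set mR2) (fun x => part b (tsh h v x)).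
  pose F : mR2 -> R := (fun x => part b (v x)) \_ (D : set mR2).
  have mF : measurable_fun setT F.
    by apply/(measurable_restrict _ mD measurableT); rewrite setTI; exact: part_measurable.
  have mG : measurable_fun (D : set mR2) (fun x : mR2 => F (x.1, x.2 + (- h))).
    by apply: measurable_funTS; apply: (@measurableT_comp _ _ _ _ _ _ F) => //; exact: measurable_shift2.
  apply: eq_measurable_fun mG => x; rewrite inE => /andP[x0 xd]; rewrite /F patchE /tsh /shift_up; case: ifPn.
    by rewrite inE => /andP[/= h1 _]; rewrite -subr_gt0 h1.
  move=> /negP nD; case: ifPn => hx; last by case: (b).
  exfalso; apply: nD; apply/mem_set; apply/andP; split => /=; first by rewrite subr_gt0.
  by apply: le_lt_trans xd; rewrite gerBl ltW.
by split; [exact: (key true)|exact: (key false)].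
Qed.

Lemma sqa_tsh h v : 0 < h -> cmeasurable D v -> (sqa D (tsh h v) <= sqa D v)%E.
Proof.
move=> h0 mv; pose f : mR2 -> \bar R := (fun x => (modulus (v x) ^+ 2)%:E) \_ (D : set mR2).
have mf : measurable_fun setT f.
  by apply/(measurable_restrict _ mD measurableT); rewrite setTI; exact: msqrE.
have f0 x : (0 <= f x)%E by rewrite /f patchE; case: ifP => // _; rewrite lee_fin sqr_ge0.
have fz x : x.2 <= 0 -> f x = 0%E.
  by move=> x0; rewrite /f patchE; case: ifPn => //; rewrite inE => /andP[]; rewrite ltNge x0.
have := shift_le (ltW h0) mf f0 fz; rewrite [X in (_ <= X)%E](_ : _ = sqa D v); last first.
  by apply: eq_integral => x xD; rewrite /f patchE xD.
apply: le_trans; rewrite le_eqVlt; apply/orP; left; apply/eqP; apply: eq_integral => x.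
rewrite inE => /andP[x0 xd]; rewrite /f patchE /tsh /shift_up; case: ifPn => hx.
  rewrite ifT//; apply/mem_set; apply/andP; split => /=; first by rewrite subr_gt0.
  by apply: le_lt_trans xd; rewrite gerBl ltW.
rewrite modulus0 expr0n /= ifN//; apply/negP; rewrite inE => /andP[/=].
by rewrite subr_gt0 (negbTE hx).
Qed.

Lemma tshB h v v' x : tsh h v x - tsh h v' x = tsh h (fun x => v x - v' x) x.
Proof. by rewrite /tsh /shift_up; case: ifP => // _; rewrite subrr. Qed.

Lemma tsh_cL2 h v : 0 < h -> cL2a D v -> cL2a D (tsh h v).
Proof.
move=> h0 [mv fv]; split; first exact: tsh_cmeas.
exact: (le_lt_trans (sqa_tsh h0 mv)).
Qed.

Lemma tsh_smooth (h k : R) v : 0 < k -> (forall x, x.2 <= k -> v x = 0) -> tsh h v = shift_up h v.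
Proof.
move=> k0 vz; apply/funext => x; rewrite /tsh; case: ltP => // xh; rewrite /shift_up vz//=.
by rewrite (le_trans _ (ltW k0))// subr_le0.
Qed.

Lemma cderiv_zero (k : R) j v x : 0 < k -> (forall x, x.2 <= k -> v x = 0) -> x.2 <= 0 -> cderiv j v x = 0.
Proof.
move=> k0 vz x0; pose C : set (R * R) := [set y | k <= y.2].
have cC : closed C.
  rewrite (_ : C = snd @^-1` [set t | k <= t])//; apply: closed_comp; last exact: closed_ge.
  by move=> y _; exact: cvg_snd.
have nC : ~ C x by rewrite /C /= => h; have := le_trans h x0; rewrite leNgt k0.
have H (f : R * R -> R) : (forall y, v y = 0 -> f y = 0) -> 'D_(basis j) f x = 0.
  move=> fv; apply/eqP/negPn/negP => n0; apply: nC; apply: (derive_off_closed cC _ n0) => y ny.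
  by rewrite /C /= leNgt; apply/negP => yk; move: ny; rewrite fv ?eqxx// vz// ltW.
by rewrite /cderiv !H// => y ->.
Qed.

(** The approximants vanish near and below the bottom, so cutting their translates at height h
    changes nothing and smoothness survives. *)
Lemma jet_shift h u g z : 0 < h -> jet D u g z ->
  (forall n, exists2 k : R, 0 < k & forall x, x.2 <= k -> z n x = 0) ->
  jet D (tsh h u) (fun j => tsh h (g j)) (fun n => shift_up h (z n)).
Proof.
move=> h0 [sw hu hg c1 c2] Hz; have [mu _] := hu; have mg j : cmeasurable D (g j) by case: (hg j).
have E n : tsh h (z n) = shift_up h (z n) by have [k k0 kz] := Hz n; exact: tsh_smooth kz.
have E' n j : tsh h (cderiv j (z n)) = shift_up h (cderiv j (z n)).
  have [k k0 kz] := Hz n; apply/funext => x; rewrite /tsh; case: ltP => // xh.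
  by rewrite /shift_up (cderiv_zero j k0 kz)//= subr_le0.
split.
- by move=> n; exact: shift_up_smooth.
- exact: tsh_cL2.
- by move=> j; exact: (tsh_cL2 h0 (hg j)).
- apply: (vanishes_le c1 ler01) => n; rewrite mul1e -E.
  have -> : (fun x => tsh h (z n) x - tsh h u x) = tsh h (fun x => z n x - u x) by apply/funext => x; rewrite tshB.
  by apply: sqa_tsh => //; exact: (cmeasB (csmooth_cmeas oD (sw n)) mu).
- move=> j; apply: (vanishes_le (c2 j) ler01) => n; rewrite mul1e.
  have -> : (fun x => cderiv j (shift_up h (z n)) x - tsh h (g j) x) = tsh h (fun x => cderiv j (z n) x - g j x).
    by apply/funext => x; rewrite (shift_up_cderiv _ _ _ (sw n)) -E' tshB.
  by apply: sqa_tsh => //; exact: (cmeasB (cderiv_cmeas j oD (sw n)) (mg j)).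
Qed.

(** Localises near the bottom: an upward translate need not vanish on the upper boundary, so the
    test function needs a factor that is zero there. It is 1 below d / 3 and 0 above 2 d / 3. *)
Definition theta (x : R * R) : R := 1 - vstep (3 / d) (- 1) x.

Lemma theta_smooth : Cinfty theta.
Proof. by apply: CinftyB; [exact: Cinfty_cst|exact: vstep_smooth]. Qed.

Lemma theta01 x : 0 <= theta x <= 1.
Proof.
have := step_ge0 (3 / d * x.2 + - 1); have := step_le1 (3 / d * x.2 + - 1).
by rewrite /theta /vstep; move: (step _) => y; lra.
Qed.

Lemma theta_low x : x.2 <= d / 3 -> theta x = 1.
Proof.
move=> xd; rewrite /theta /vstep step_le0 ?subr0// subr_le0.
by rewrite mulrAC ler_pdivrMr// mul1r mulrC -ler_pdivlMr.
Qed.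

Lemma theta_high x : d * (2 / 3) <= x.2 -> theta x = 0.
Proof.
move=> xd; rewrite /theta /vstep step_ge1 ?subrr// lerBrDr.
by rewrite mulrAC ler_pdivlMr//; lra.
Qed.

Lemma theta_D0 x : 'D_(basis ord0) theta x = 0.
Proof.
apply: derive_val; apply: (is_derive_eq (is_deriveB (is_derive_cst _ _ _) (Cinfty_is_derive ord0 x (vstep_smooth (3 / d) (- 1))))).
by rewrite vstep_D0 subr0.
Qed.

Lemma theta_bound : exists2 Ct : R, 0 < Ct & forall j x, `|'D_(basis j) theta x| <= Ct.
Proof.
have [C C0 HC] := @step'_bounded R; have l0 : 0 < 3 / d by rewrite divr_gt0.
exists (3 / d * C); first exact: mulr_gt0.
move=> j x; move: j; apply: basis_ind; first by rewrite theta_D0 normr0 mulr_ge0 ?ltW.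
have -> : 'D_(basis ord_max) theta x = 0 - 3 / d * step' (3 / d * x.2 + - 1).
  apply: derive_val; apply: (is_derive_eq (is_deriveB (is_derive_cst _ _ _) (Cinfty_is_derive ord_max x (vstep_smooth (3 / d) (- 1))))).
  by rewrite vstep_D1.
by rewrite sub0r normrN normrM (gtr0_norm l0); apply: ler_wpM2l; [exact: ltW|exact: HC].
Qed.

(** Differentiate in the translation parameter under the integral. The derivative falling on [Psi]
    is moved by the weak derivative [beta] onto alpha theta, so no derivative of [Psi] remains, and
    the mean value theorem gives h times the L_1 norm of [Psi]. *)
Lemma shift_form_real (alpha beta : mR2 -> R) (M Ct : R) : 0 <= M -> 0 < Ct ->
  (forall x, `|'D_(basis ord_max) theta x| <= Ct) ->
  measurable_fun (D : set mR2) alpha -> {ae area, forall x, D x -> `|alpha x| <= M} ->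
  measurable_fun (D : set mR2) beta -> {ae area, forall x, D x -> `|beta x| <= M} ->
  (forall phi, testfun D phi -> \int[area]_(x in D) (alpha x * 'D_(basis ord_max) phi x) =
     - \int[area]_(x in D) (beta x * phi x)) ->
  forall (Psi : R * R -> R) (h k : R), Cinfty Psi -> compact (tsupport Psi) -> 0 < k ->
  (forall x, x.2 <= k -> Psi x = 0) -> 0 < h ->
  [/\ area.-integrable D (EFin \o (fun x => alpha x * theta x * Psi (x.1, x.2 - h))),
      area.-integrable D (EFin \o (fun x => alpha x * theta x * Psi x)) &
  `|\int[area]_(x in D) (alpha x * theta x * Psi (x.1, x.2 - h)) - \int[area]_(x in D) (alpha x * theta x * Psi x)| <=
    h * (M * (1 + Ct)) * \int[area]_(x in D) `|Psi x|].
Proof.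
move=> M0 Ct0 hCt ma aM mb bM wab Psi h k CP KP k0 Pz h0.
have [N N0 KN] := compact_in_crect KP.
have tP : testfun setT Psi by split.
have tdP := testfun_D ord_max tP; pose dP x := 'D_(basis ord_max) Psi x.
have [S S0 HS] := testfun_bounded tP; have [S' S'0 HS'] := testfun_bounded tdP.
(* Large enough to contain the supports of all translates with -1 <= t <= h + 1. *)
pose Q := N + h + 2; pose CR := crect (- Q) Q (- Q) Q.
have mCR : measurable (CR : set mR2) := measurable_crect _ _ _ _.
have inCR (t : R) (x : R * R) : - 1 <= t <= h + 1 -> crect (- N) N (- N) N (x.1, x.2 - t) -> CR x.
  move=> /andP[t1 t2]; rewrite /CR /crect /= !in_itv /= => -[/andP[a1 a2] /andP[b1 b2]].
  by rewrite /Q; split; apply/andP; split; lra.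
have inN x : Psi x != 0 -> crect (- N) N (- N) N x by move=> n0; apply: KN; exact: tsupport_sub.
have inN' x : dP x != 0 -> crect (- N) N (- N) N x by exact: (derive_off_closed (@crect_closed _ _ _ _ _) inN).
have bd (f : R * R -> R) (B t : R) x : 0 <= B -> (forall x, `|f x| <= B) -> (forall x, f x != 0 -> crect (- N) N (- N) N x) ->
    - 1 <= t <= h + 1 -> `|f (x.1, x.2 - t)| <= B * \1_CR x.
  move=> B0 fB fN tt; rewrite indicE; have [z|nz] := eqVneq (f (x.1, x.2 - t)) 0.
    by rewrite z normr0 mulr_ge0.
  by rewrite mem_set ?mulr1//; apply: (inCR t) => //; exact: fN.
have i01 x : 0 <= (\1_CR x : R) by rewrite indicE.
have i01' x : (\1_CR x : R) = 0 \/ (\1_CR x : R) = 1 by rewrite indicE; case: (_ \in _); [right|left].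
have p2 (x z A C : R) : `|x| <= A -> `|z| <= C -> `|x * z| <= A * C.
  by move=> h1 h2; rewrite normrM; apply: ler_pM.
have p3 (x y z A C : R) : `|x| <= A -> `|y| <= 1 -> `|z| <= C -> `|x * y * z| <= A * C.
  by move=> h1 h2 h3; apply: (p2) => //; rewrite -[leRHS]mulr1; exact: p2.
have mI : measurable_fun (D : set mR2) (\1_CR : mR2 -> R) by apply: measurable_funTS; exact: measurable_indic.
have hI : cL2 area (D : set mR2) (fun x => (\1_CR x : R)%:C%C).
  split; first exact: cmeas_real.
  apply: le_lt_trans (area_crect_fin (- Q) Q (- Q) Q).
  have aE : (\int[area]_x (\1_CR x)%:E = area (CR : set mR2))%E by rewrite integral_indic// ?setTI ?setIT.
  rewrite -/CR -aE /sqn.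
  apply: (@le_trans _ _ (\int[area]_(x in D) (\1_CR x)%:E)%E).
    apply: ge0_le_integral => //.
    - by move=> x _; rewrite lee_fin sqr_ge0.
    - by apply: msqrE; exact: cmeas_real.
    - exact/measurable_EFinP.
    - by move=> x _; rewrite lee_fin; case: (i01' x) => ->; rewrite modulus_real ?normr0 ?normr1 ?expr0n ?expr1n.
  by apply: ge0_subset_integral => //; exact/measurable_EFinP/measurable_indic.
have domI (F : mR2 -> R) (K : R) : 0 <= K -> measurable_fun (D : set mR2) F ->
    {ae area, forall x, D x -> `|F x| <= K * \1_CR x} -> area.-integrable D (EFin \o F).
  move=> K0 mF FK; apply: (dom_integrable mD (K := K) hI hI mF).
  apply: ae_imp FK => x H Dx; apply: (le_trans (H Dx)); apply: ler_wpM2l => //.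
  by case: (i01' x) => ->; rewrite modulus_real ?normr0 ?normr1 ?expr0n ?expr1n /=; lra.
have mth : measurable_fun (D : set mR2) (theta : mR2 -> R).
  by apply: measurable_funTS; apply: continuous_measurable_plane; exact/Cinfty_continuous/theta_smooth.
have mdth : measurable_fun (D : set mR2) (fun x : mR2 => 'D_(basis ord_max) theta x).
  by apply: measurable_funTS; apply: continuous_measurable_plane; exact/Cinfty_continuous/Cinfty_D/theta_smooth.
have mP t : measurable_fun (D : set mR2) (fun x : mR2 => Psi (x.1, x.2 - t)).
  by apply: measurable_funTS; apply: continuous_measurable_plane; exact/cont_shift2/Cinfty_continuous.
have cdP : continuous dP by exact/Cinfty_continuous/Cinfty_D.
have mdP t : measurable_fun (D : set mR2) (fun x : mR2 => dP (x.1, x.2 - t)).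
  by apply: measurable_funTS; apply: continuous_measurable_plane; exact: cont_shift2.
have th1 x : `|theta x| <= 1 by have /andP[t0 t1] := theta01 x; rewrite ger0_norm.
pose f t x := alpha x * theta x * Psi (x.1, x.2 - t).
have mf t : measurable_fun (D : set mR2) (f t) by do 2 apply: measurable_funM => //.
have fi t : - 1 <= t <= h + 1 -> area.-integrable D (EFin \o f t).
  move=> tt; apply: (domI _ (M * S)) => //; first exact: mulr_ge0.
  by apply: ae_imp aM => x H Dx; rewrite -mulrA; apply: p3 (H Dx) (th1 x) _; exact: bd.
pose f' t x := - (alpha x * theta x * dP (x.1, x.2 - t)).
have df t x : is_derive t (1 : R) (f ^~ x) (f' t x).
  have h1 := (is_derive_basis1 Psi (x.1, x.2 - t) _).1 (Cinfty_is_derive ord_max (x.1, x.2 - t) CP).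
  rewrite /= in h1.
  have h2 : is_derive t (1 : R) (fun t => x.2 - t) (- 1).
    by apply: (is_derive_eq (is_deriveB (is_derive_cst _ _ _) (is_derive_id _ _))); rewrite sub0r.
  have h3 := @is_derive1_comp R (fun s : R => Psi (x.1, s)) (fun t : R => x.2 - t) t _ _ h1 h2.
  have h4 := is_deriveZ (alpha x * theta x) h3.
  by apply: (is_derive_eq h4); rewrite /f' /dP /GRing.scale /= mulrN1 mulrN.
pose G x := `|alpha x| * (S' * \1_CR x).
have G0 x : 0 <= G x by rewrite mulr_ge0// mulr_ge0.
have iG : area.-integrable D (EFin \o G).
  apply: (domI _ (M * S')); first exact: mulr_ge0.
    by apply: measurable_funM; [exact: measurableT_comp|exact: measurable_funM].
  by apply: ae_imp aM => x H Dx; rewrite ger0_norm// /G -mulrA; apply: ler_wpM2r; [exact: mulr_ge0|exact: H].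
pose m t := \int[area]_(x in D) f t x.
(* The parameter runs over an open interval around [0, h], so that the derivative, and with it
   continuity, is available at both ends. *)
have dm t : - 1 < t < h + 1 -> is_derive t (1 : R) m (\int[area]_(x in D) f' t x).
  move=> tt; have tI : `]- 1, (h + 1)[%classic t by rewrite /= in_itv.
  have c1 s : `]- 1, (h + 1)[%classic s -> area.-integrable D (EFin \o f s).
    by rewrite /= in_itv /= => /andP[s1 s2]; apply: fi; rewrite !ltW.
  have c2 s y : `]- 1, (h + 1)[%classic s -> D y -> derivable (f ^~ y) s 1 by move=> _ _; have [] := df s y.
  have E s y : partial1of2 f s y = f' s y by rewrite partial1of2E; have [_] := df s y.
  have c3 s y : `]- 1, (h + 1)[%classic s -> D y -> `|partial1of2 f s y| <= G y.
    rewrite /= in_itv /= => /andP[s1 s2] _; rewrite E /f' normrN; apply: p3 => //.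
    by apply: bd => //; rewrite !ltW.
  have e1 := derivable_under_integral mD tI c1 c2 G0 iG c3.
  have e2 := differentiation_under_integral mD tI c1 c2 G0 iG c3.
  apply: DeriveDef => //; rewrite -derive1E e2; apply: eq_Rintegral => x _; exact: E.
have t0 : (- 1 : R) <= 0 <= h + 1 by rewrite lerN10 /= addr_ge0// ltW.
have th : (- 1 : R) <= h <= h + 1 by lra.
have fi0 := fi 0 t0.
have f0E x : f 0 x = alpha x * theta x * Psi x by rewrite /f subr0; case: x.
split; [exact: (fi h th)|by move: fi0; apply: eq_integrable => // x _; rewrite /= f0E|].
have dm' t : t \in `]0, h[ -> is_derive t (1 : R) m (\int[area]_(x in D) f' t x).
  by rewrite in_itv /= => /andP[t1 t2]; apply: dm; lra.
have cm : {within `[0, h], continuous m}.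
  apply: continuous_in_subspaceT => t; rewrite inE /= in_itv /= => /andP[t1 t2].
  apply/differentiable_continuous/derivable1_diffP.
  by have [] := dm t; rewrite ?(lt_le_trans _ t1)//; lra.
have [t tI] := MVT h0 dm' cm; rewrite subr0.
have -> : m 0 = \int[area]_(x in D) (alpha x * theta x * Psi x) by apply: eq_Rintegral => x _; exact: f0E.
rewrite /m /f => ->; rewrite normrM (gtr0_norm h0) mulrC -mulrA; apply: ler_wpM2l; first exact: ltW.
move: tI; rewrite in_itv /= => /andP[tt0 tth].
have tt : - 1 <= t <= h + 1 by rewrite !ltW//; lra.
pose Pt x := Psi (x.1, x.2 - t).
have CPt : Cinfty Pt by rewrite /Pt; under eq_fun do rewrite shift2E; exact: (Cinfty_shift (0, - t) CP).
(* An admissible test function in the strip: the translate vanishes below height k, and [theta]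
   above 2 d / 3. *)
pose phi x := theta x * Pt x.
have Cphi : Cinfty phi by apply: CinftyM => //; exact: theta_smooth.
have supp x : phi x != 0 -> CR x /\ k <= x.2 <= d * (2 / 3).
  rewrite /phi mulf_eq0 negb_or => /andP[n1 n2]; split; first by apply: (inCR t) => //; exact: inN.
  apply/andP; split.
    rewrite leNgt; apply/negP => xk; move: n2; rewrite /Pt Pz ?eqxx//=.
    by rewrite (le_trans _ (ltW xk))// gerBl ltW.
  by rewrite leNgt; apply/negP => xd; move: n1; rewrite theta_high ?eqxx// ltW.
have tphi : testfun D phi.
  pose C2 : set (R * R) := CR `&` [set x : R * R | k <= x.2 <= d * (2 / 3)].
  have cC2 : closed C2.
    apply: closedI; first exact: crect_closed.
    rewrite (_ : [set x : R * R | _] = snd @^-1` `[k, (d * (2 / 3))]%classic).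
      by apply: closed_comp; [move=> y _; exact: cvg_snd|exact: itv_closed].
    by apply/seteqP; split => x /=; rewrite in_itv.
  have sC2 : tsupport phi `<=` C2.
    by move=> x hx; apply: (cC2); apply: closure_subset hx => y; exact: supp.
  split => //.
    apply: (subclosed_compact _ (@crect_compact _ (- Q) Q (- Q) Q)); first exact: closed_closure.
    by move=> x /sC2[].
  move=> x /sC2[_ /= /andP[x1 x2]]; apply/andP; split; first exact: lt_le_trans x1.
  by apply: (le_lt_trans x2); lra.
have Dphi x : 'D_(basis ord_max) phi x = theta x * dP (x.1, x.2 - t) + 'D_(basis ord_max) theta x * Pt x.
  have hPt : is_derive x (basis ord_max) Pt (dP (x.1, x.2 - t)).
    apply/is_derive_basis1.
    have h1 := (is_derive_basis1 Psi (x.1, x.2 - t) _).1 (Cinfty_is_derive ord_max (x.1, x.2 - t) CP).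
    rewrite /= in h1.
    have h2 : is_derive x.2 (1 : R) (fun s => s - t) 1.
      by apply: (is_derive_eq (is_deriveB (is_derive_id _ _) (is_derive_cst _ _ _))); rewrite subr0.
    have h3 := @is_derive1_comp R (fun s : R => Psi (x.1, s)) (fun s : R => s - t) x.2 _ _ h1 h2.
    by rewrite mulr1 in h3.
  apply: derive_val; apply: (is_derive_eq (is_deriveM (Cinfty_is_derive ord_max x theta_smooth) hPt)).
  by rewrite /GRing.scale /=; ring.
have Pt1 x : `|Pt x| <= S * \1_CR x by exact: bd.
have phiB x : `|phi x| <= S * \1_CR x by rewrite -[leRHS]mul1r; exact: p2.
have MC : 0 <= M * (1 + Ct) by rewrite mulr_ge0// addr_ge0// ltW.
have iPt : area.-integrable D (EFin \o (fun x => `|Pt x|)).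
  apply: (domI _ S) => //; first by apply: measurableT_comp => //; exact: mP.
  by apply: aeW => x _; rewrite normr_id.
have iP : area.-integrable D (EFin \o (fun x => `|Psi x|)).
  apply: (domI _ S) => //.
    by apply: measurable_funTS; apply: measurableT_comp => //; apply: continuous_measurable_plane; exact: Cinfty_continuous.
  by apply: aeW => x _; rewrite normr_id; have := @bd Psi S 0 x S0 HS inN t0; rewrite subr0; case: x.
have leP : \int[area]_(x in D) `|Pt x| <= \int[area]_(x in D) `|Psi x|.
  rewrite -lee_fin /Rintegral !fineK; last 2 first.
  - exact: integrable_fin_num.
  - exact: integrable_fin_num.
  apply: (@shift_le (fun x => `|Psi x|%:E)); [exact: ltW| |by move=> x; rewrite lee_fin|].
    apply/measurable_EFinP; apply: measurableT_comp => //; apply: continuous_measurable_plane; exact: Cinfty_continuous.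
  by move=> x x0; rewrite Pz ?normr0// (le_trans x0)// ltW.
pose F x := beta x * phi x + alpha x * ('D_(basis ord_max) theta x * Pt x).
have mphi : measurable_fun (D : set mR2) (phi : mR2 -> R) by apply: measurable_funM => //; exact: mP.
have i1 : area.-integrable D (EFin \o (fun x => beta x * phi x)).
  apply: (domI _ (M * S)); [exact: mulr_ge0|exact: measurable_funM|].
  by apply: ae_imp bM => x H Dx; rewrite -mulrA; exact: p2 (H Dx) (phiB x).
have i2 : area.-integrable D (EFin \o (fun x => alpha x * ('D_(basis ord_max) theta x * Pt x))).
  apply: (domI _ (M * (Ct * S))); [by rewrite !mulr_ge0// ltW|by do 2 apply: measurable_funM => //; exact: mP|].
  by apply: ae_imp aM => x H Dx; rewrite -!mulrA; exact: p2 (H Dx) (p2 _ _ _ _ (hCt x) (Pt1 x)).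
have i3 : area.-integrable D (EFin \o (fun x => alpha x * 'D_(basis ord_max) phi x)).
  have e : EFin \o (fun x => alpha x * 'D_(basis ord_max) phi x)%R =
      (fun x => ((EFin \o (fun x => (alpha x * ('D_(basis ord_max) theta x * Pt x))%R)) x - (EFin \o f' t) x)%E).
    by apply/funext => x /=; rewrite -EFinB Dphi /f'; congr EFin; ring.
  rewrite e; apply: integrableB => //.
  apply: (domI _ (M * S')); [exact: mulr_ge0|by apply: measurableT_comp => //; do 2 apply: measurable_funM => //|].
  by apply: ae_imp aM => x H Dx; rewrite /f' normrN -[leRHS]mulrA; apply: p3 (H Dx) (th1 x) _; exact: bd.
have -> : \int[area]_(x in D) f' t x = \int[area]_(x in D) F x.
  rewrite /F (RintegralD mD i1 i2) -[X in X + _]opprK -(wab _ tphi) addrC -(RintegralB mD i2 i3).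
  by apply: eq_Rintegral => x _; rewrite Dphi /f'; ring.
have iF : area.-integrable D (EFin \o F) by exact: (integrableD mD i1 i2).
have FB : {ae area, forall x, D x -> `|F x| <= M * (1 + Ct) * `|Pt x|}.
  apply: ae_imp2 aM bM => x Ha Hb Dx; apply: (le_trans (ler_normD _ _)).
  rewrite (_ : M * (1 + Ct) * `|Pt x| = M * `|Pt x| + M * (Ct * `|Pt x|)); last by ring.
  apply: lerD; last exact: p2 (Ha Dx) (p2 _ _ _ _ (hCt x) (lexx _)).
  by apply: p2 (Hb Dx) _; rewrite /phi normrM; apply: ler_piMl.
have iB := integrableZl mD (M * (1 + Ct)) iPt.
apply: (@le_trans _ _ (M * (1 + Ct) * \int[area]_(x in D) `|Pt x|)); last exact: ler_wpM2l.
rewrite ler_norml; apply/andP; split.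
  rewrite -mulNr -(RintegralZl (- (M * (1 + Ct))) mD iPt); apply: ae_le_Rintegral => //; first exact: (integrableZl mD _ iPt).
  by apply: ae_imp FB => x H Dx; have := H Dx; rewrite ler_norml mulNr => /andP[].
rewrite -(RintegralZl (M * (1 + Ct)) mD iPt); apply: ae_le_Rintegral => //.
by apply: ae_imp FB => x H Dx; have := H Dx; rewrite ler_norml => /andP[].
Qed.

Lemma weak_part b j u g phi : is_weak_deriv D j u g -> testfun D phi ->
  \int[area]_(x in D) (part b (u x) * 'D_(basis j) phi x) = - \int[area]_(x in D) (part b (g x) * phi x).
Proof.
move=> [_ _ H] tphi; have := congr1 (part b) (H _ tphi); rewrite partN !cint_part.
have E (f : R * R -> R[i]) (r : R * R -> R) : \int[area]_(x in D) part b (f x * (r x)%:C%C) =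
    \int[area]_(x in D) (part b (f x) * r x).
  by apply: eq_Rintegral => x _; case: b {H}; rewrite /= ?Re_real ?Im_real.
by rewrite !E.
Qed.

(** The derivative recorded is the vertical one, because the translations are vertical. *)
Definition lipcoef (M : R) a : Prop := bounded_coef area (D : set mR2) M a /\
  exists2 g, bounded_coef area (D : set mR2) M g & is_weak_deriv D ord_max a g.

Lemma bounded_coef_le (M M' : R) a : M <= M' -> bounded_coef area (D : set mR2) M a ->
  bounded_coef area (D : set mR2) M' a.
Proof. by move=> MM [ma H]; split => //; apply: ae_imp H => x H Dx; exact: le_trans (H Dx) MM. Qed.

Lemma lipcoef_le (M M' : R) a : M <= M' -> lipcoef M a -> lipcoef M' a.
Proof.
by move=> MM [h1 [g h2 h3]]; split; [exact: bounded_coef_le h1|exists g => //; exact: bounded_coef_le h2].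
Qed.

Lemma Linfty_bounded a : Linfty D a -> exists2 M, 0 <= M & bounded_coef area (D : set mR2) M a.
Proof.
move=> [ma [M HM]]; exists (Num.max M 0); first by rewrite le_max lexx orbT.
by split => //; apply: ae_imp HM => x H Dx; rewrite le_max H.
Qed.

Lemma Winfty_lipcoef a : Winfty 1 D a -> exists2 M, 0 <= M & lipcoef M a.
Proof.
move=> [/Linfty_bounded[M M0 h1] H]; have [g [wg /Linfty_bounded[M' M'0 h2]]] := H ord_max.
exists (M + M'); first exact: addr_ge0.
split; first by apply: bounded_coef_le h1; rewrite lerDl.
by exists g => //; apply: bounded_coef_le h2; rewrite lerDr.
Qed.

Lemma Winfty2_lipcoef a : Winfty 2 D a -> exists2 M, 0 <= M & lipcoef M a.
Proof.
move=> [h H]; apply: Winfty_lipcoef; split => // j; have [g [wg [hg _]]] := H j.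
by exists g.
Qed.

Lemma rsqnR u : cL2a D u -> rsqn area (D : set mR2) u = \int[area]_(x in D) (modulus (u x) ^+ 2).
Proof. by move=> hu; rewrite /rsqn (sqn_fin mD hu). Qed.

Local Notation ns := (rsqn area (D : set mR2)).

Definition vanishing (z : R * R -> R[i]) : Prop := exists2 k : R, 0 < k & forall x, x.2 <= k -> z x = 0.

(** [Psi] is taken to be the real and the imaginary part of z times the conjugate of z', so that Re
    (a z conj z') becomes a difference of two integrals treated by [shift_form_real]. *)
Lemma shift_form_cplx (M Ct : R) a z z' h : 0 <= M -> 0 < Ct ->
  (forall x, `|'D_(basis ord_max) theta x| <= Ct) -> lipcoef M a ->
  csmooth_cpt z -> csmooth_cpt z' -> vanishing z -> vanishing z' -> 0 < h ->
  `|pint area (D : set mR2) true (fun x => (theta x)%:C%C * a x) (tsh h z) (tsh h z') -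
    pint area (D : set mR2) true (fun x => (theta x)%:C%C * a x) z z'| <=
  h * (M * (1 + Ct)) * (2 * (ns z + ns z')).
Proof.
move=> M0 Ct0 hCt [[ma aM] [g [mg gM] wg]] sz sz' [k k0 vz] [k' k'0 vz'] h0.
pose Psi b x := part b (z x * conjc (z' x)).
have [C1 C2 Kz] := sz; have [C1' C2' _] := sz'.
have CP b : Cinfty (Psi b).
  rewrite /Psi; case: b => /=.
    under eq_fun do rewrite ReM Re_conj Im_conj; by apply: CinftyB; apply: CinftyM => //; exact: CinftyN.
  under eq_fun do rewrite ImM Re_conj Im_conj; by apply: CinftyD; apply: CinftyM => //; exact: CinftyN.
have KP b : compact (tsupport (Psi b)).
  apply: subclosed_compact Kz _; first exact: closed_closure.
  by apply: closure_subset => x /=; apply: contra_neq => zx; rewrite /Psi zx mul0r; case: (b).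
have Pz b x : x.2 <= k -> Psi b x = 0 by move=> xk; rewrite /Psi vz// mul0r; case: (b).
have paM b (c : R * R -> R[i]) : {ae area, forall x, D x -> modulus (c x) <= M} ->
    {ae area, forall x, D x -> `|part b (c x)| <= M}.
  by apply: ae_imp => x H Dx; exact: le_trans (part_le _ _) (H Dx).
have wP b phi : testfun D phi -> \int[area]_(x in D) (part b (a x) * 'D_(basis ord_max) phi x) =
    - \int[area]_(x in D) (part b (g x) * phi x) by move=> tphi; exact: (weak_part b wg tphi).
have H b := shift_form_real M0 Ct0 hCt (part_measurable b ma) (paM b a aM) (part_measurable b mg) (paM b g gM)
  (wP b) (CP b) (KP b) k0 (Pz b) h0.
have [i1 j1 b1] := H true; have [i2 j2 b2] := H false.
rewrite (tsh_smooth h k0 vz) (tsh_smooth h k'0 vz').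
have -> : pint area (D : set mR2) true (fun x => (theta x)%:C%C * a x) (shift_up h z) (shift_up h z') =
   \int[area]_(x in D) (part true (a x) * theta x * Psi true (x.1, x.2 - h)) -
   \int[area]_(x in D) (part false (a x) * theta x * Psi false (x.1, x.2 - h)).
  rewrite -(RintegralB mD i1 i2); apply: eq_Rintegral => x _.
  by rewrite /Psi /shift_up -mulrA /= ReM [_ * a x]mulrC Re_real Im_real; ring.
have -> : pint area (D : set mR2) true (fun x => (theta x)%:C%C * a x) z z' =
   \int[area]_(x in D) (part true (a x) * theta x * Psi true x) -
   \int[area]_(x in D) (part false (a x) * theta x * Psi false x).
  rewrite -(RintegralB mD j1 j2); apply: eq_Rintegral => x _.
  by rewrite /Psi -mulrA /= ReM [_ * a x]mulrC Re_real Im_real; ring.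
have hz := cL2_smooth oD sz; have hz' := cL2_smooth oD sz'.
have iz := sqr_integrable hz; have iz' := sqr_integrable hz'.
have PL b : \int[area]_(x in D) `|Psi b x| <= ns z + ns z'.
  rewrite !rsqnR// -(RintegralD mD iz iz').
  have pw x : `|Psi b x| <= modulus (z x) ^+ 2 + modulus (z' x) ^+ 2.
    apply: (le_trans (part_le _ _)); rewrite modulusM modulus_conj.
    have := sqr_ge0 (modulus (z x) - modulus (z' x)).
    by have := sqr_ge0 (modulus (z x)); have := sqr_ge0 (modulus (z' x)); rewrite !expr2; lra.
  apply: ae_le_Rintegral => //; last by apply: aeW => x _; exact: pw.
    apply: (dom_integrable mD (K := 1) hz hz').
      apply: measurable_funTS; apply: measurableT_comp => //; apply: continuous_measurable_plane.
      exact: Cinfty_continuous.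
    by apply: aeW => x _; rewrite normr_id mul1r.
  exact: (integrableD mD iz iz').
have h1 : 0 <= h * (M * (1 + Ct)) by apply: mulr_ge0; [exact: ltW|apply: mulr_ge0 => //; apply: addr_ge0 => //; exact: ltW].
have q1 := le_trans b1 (ler_wpM2l h1 (PL true)); have q2 := le_trans b2 (ler_wpM2l h1 (PL false)).
rewrite mulrCA mulr_natl mulr2n; apply: le_trans (lerD q1 q2).
have sb (r1 r2 r3 r4 : R) : `|r1 - r2 - (r3 - r4)| <= `|r1 - r3| + `|r2 - r4|.
  by rewrite (_ : r1 - r2 - (r3 - r4) = (r1 - r3) - (r2 - r4)); [exact: ler_normB|ring].
exact: sb.
Qed.

Lemma ns_lim p (p_ : nat -> R * R -> R[i]) n : cL2a D p -> cL2a D (p_ n) ->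
  ns (p_ n) <= 2 * ns p + 2 * ns (fun x => p_ n x - p x).
Proof.
move=> hp hn; have hB := cL2B mD hn hp.
have := sqnD area mD (proj1 hB) (proj1 hp).
rewrite (_ : (fun x => _ + _) = p_ n); last by apply/funext => x; rewrite subrK.
by rewrite !rsqnE// -!EFinM -EFinD lee_fin; lra.
Qed.

(** The bound involves only L_2 norms, so it survives the passage to the limit; bounding the norms
    of the approximants turns the 2 into 4. *)
Lemma shift_form (M Ct : R) a p q (p_ q_ : nat -> R * R -> R[i]) h : 0 <= M -> 0 < Ct ->
  (forall x, `|'D_(basis ord_max) theta x| <= Ct) -> lipcoef M a ->
  cL2a D p -> cL2a D q -> (forall n, csmooth_cpt (p_ n)) -> (forall n, csmooth_cpt (q_ n)) ->
  (forall n, vanishing (p_ n)) -> (forall n, vanishing (q_ n)) ->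
  vanishes (fun n => sqa D (fun x => p_ n x - p x)) -> vanishes (fun n => sqa D (fun x => q_ n x - q x)) -> 0 < h ->
  `|pint area (D : set mR2) true (fun x => (theta x)%:C%C * a x) (tsh h p) (tsh h q) -
    pint area (D : set mR2) true (fun x => (theta x)%:C%C * a x) p q| <=
  h * (M * (1 + Ct)) * (4 * (ns p + ns q)).
Proof.
move=> M0 Ct0 hCt la hp hq sp sq vp vq cp cq h0; have [[ma aM] _] := la.
have bt : bounded_coef area (D : set mR2) M (fun x => (theta x)%:C%C * a x).
  split; first by apply: cmeasM => //; exact: (cmeas_smooth D theta_smooth).
  apply: ae_imp aM => x H Dx; rewrite modulusM modulus_real; have /andP[t0 t1] := theta01 x.
  by rewrite ger0_norm//; apply: le_trans (H Dx); apply: ler_piMl => //; exact: modulus_ge0.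
have hp_ n := cL2_smooth oD (sp n); have hq_ n := cL2_smooth oD (sq n).
have shc (r : R * R -> R[i]) (r_ : nat -> R * R -> R[i]) : cL2a D r -> (forall n, cL2a D (r_ n)) ->
    vanishes (fun n => sqa D (fun x => r_ n x - r x)) -> vanishes (fun n => sqa D (fun x => tsh h (r_ n) x - tsh h r x)).
  move=> [mr _] hr_ vr; apply: (vanishes_le vr ler01) => n; rewrite mul1e.
  have -> : (fun x => tsh h (r_ n) x - tsh h r x) = tsh h (fun x => r_ n x - r x) by apply/funext => x; rewrite tshB.
  by apply: sqa_tsh => //; apply: cmeasB => //; case: (hr_ n).
have c1 := pint_cvg mD true M0 bt hp hq hp_ hq_ cp cq.
have c2 := pint_cvg mD true M0 bt (tsh_cL2 h0 hp) (tsh_cL2 h0 hq) (fun n => tsh_cL2 h0 (hp_ n)) (fun n => tsh_cL2 h0 (hq_ n))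
  (shc _ _ hp hp_ cp) (shc _ _ hq hq_ cq).
have ep := vanishes_sqn_fin mD hp_ hp cp; have eq := vanishes_sqn_fin mD hq_ hq cq.
pose X := pint area (D : set mR2) true (fun x => (theta x)%:C%C * a x) (tsh h p) (tsh h q).
pose Y := pint area (D : set mR2) true (fun x => (theta x)%:C%C * a x) p q.
pose X' n := pint area (D : set mR2) true (fun x => (theta x)%:C%C * a x) (tsh h (p_ n)) (tsh h (q_ n)).
pose Y' n := pint area (D : set mR2) true (fun x => (theta x)%:C%C * a x) (p_ n) (q_ n).
set K := h * (M * (1 + Ct)); have K0 : 0 <= K by apply: mulr_ge0; [exact: ltW|apply: mulr_ge0 => //; apply: addr_ge0 => //; exact: ltW].
change (`|X - Y| <= K * (4 * (ns p + ns q))); apply/ler_addgt0Pr => e e0.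
pose r := e / (2 + 8 * K); have r0 : 0 < r by rewrite divr_gt0// ltr_pwDl// mulr_ge0.
have r2 : 0 < r ^+ 2 by rewrite exprn_gt0.
have [n [[n1 n2] [n3 n4]]] := filter_ex (filterI (filterI (c1 _ r2) (c2 _ r2)) (filterI (ep _ r0) (eq _ r0))).
lazy beta in n1, n2, n3, n4; rewrite !lee_fin in n1 n2 n3 n4.
have {}n1 : `|Y' n - Y| <= r.
  by rewrite -(ler_pXn2r (n := 2)) ?nnegrE ?normr_ge0 ?(ltW r0)// real_normK ?num_real.
have {}n2 : `|X' n - X| <= r.
  by rewrite -(ler_pXn2r (n := 2)) ?nnegrE ?normr_ge0 ?(ltW r0)// real_normK ?num_real.
have l1 := ns_lim hp (hp_ n); have l2 := ns_lim hq (hq_ n).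
have l3 : `|X' n - Y' n| <= K * (2 * (ns (p_ n) + ns (q_ n))) by exact: shift_form_cplx.
have l4 : K * (2 * (ns (p_ n) + ns (q_ n))) <= K * (4 * (ns p + ns q) + 8 * r) by apply: ler_wpM2l => //; lra.
have E : e = (2 + 8 * K) * r by rewrite /r mulrC divfK// gt_eqF// ltr_pwDl// mulr_ge0.
have -> : X - Y = (X' n - Y' n) + ((Y' n - Y) - (X' n - X)) by ring.
apply: (le_trans (ler_normD _ _)); apply: (@le_trans _ _ (K * (4 * (ns p + ns q) + 8 * r) + (r + r))).
  apply: lerD; first exact: le_trans l3 l4.
  by apply: (le_trans (ler_normB _ _)); exact: lerD.
by rewrite E mulrDr mulrDl; lra.
Qed.

End shift.

(** * Bookkeeping of integrals *)

Section hasint.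
Context {R : realType} {d : measure_display} {T : measurableType d}.
Variables (mu : {measure set T -> \bar R}) (D : set T).
Hypothesis mD : measurable D.

(** Integrability and value are carried together, so that a long combination of terms is assembled
    once and a pointwise inequality is integrated directly between known values. *)
Definition hasint (F : T -> R) (r : R) : Prop :=
  mu.-integrable D (EFin \o F) /\ \int[mu]_(x in D) F x = r.

Lemma hasintD F G r s : hasint F r -> hasint G s -> hasint (fun x => F x + G x) (r + s).
Proof.
by move=> [iF <-] [iG <-]; split; [exact: (integrableD mD iF iG)|rewrite (RintegralD mD iF iG)].
Qed.

Lemma hasintB F G r s : hasint F r -> hasint G s -> hasint (fun x => F x - G x) (r - s).
Proof.
by move=> [iF <-] [iG <-]; split; [exact: (integrableB mD iF iG)|rewrite (RintegralB mD iF iG)].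
Qed.

Lemma hasintZ (k : R) F r : hasint F r -> hasint (fun x => k * F x) (k * r).
Proof.
by move=> [iF <-]; split; [exact: (integrableZl mD k iF)|rewrite (RintegralZl k mD iF)].
Qed.

Lemma hasint_le F G r s : hasint F r -> hasint G s -> {ae mu, forall x, D x -> F x <= G x} -> r <= s.
Proof. by move=> [iF <-] [iG <-]; exact: ae_le_Rintegral. Qed.

Lemma hasint_sqr u : cL2 mu D u -> hasint (fun x => modulus (u x) ^+ 2) (rsqn mu D u).
Proof. by move=> hu; split; [exact: sqr_integrable|rewrite /rsqn (sqn_fin mD hu)]. Qed.

Lemma hasint_pint b M (a p q : T -> R[i]) : 0 <= M -> bounded_coef mu D M a -> cL2 mu D p -> cL2 mu D q ->
  hasint (fun x => part b (a x * p x * conjc (q x))) (pint mu D b a p q).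
Proof. by move=> M0 ba hp hq; split => //; exact: (pint_integrable mD b M0 ba hp hq). Qed.

Lemma pint_ae b (a p p' q q' : T -> R[i]) : cmeas D a -> cmeas D p -> cmeas D p' -> cmeas D q -> cmeas D q' ->
  {ae mu, forall x, D x -> p x = p' x} -> {ae mu, forall x, D x -> q x = q' x} ->
  pint mu D b a p q = pint mu D b a p' q'.
Proof.
move=> ma mp mp' mq mq' hp hq; rewrite /pint /Rintegral; congr fine; apply: ae_eq_integral => //.
- by apply/measurable_EFinP; exact: pint_measurable.
- by apply/measurable_EFinP; exact: pint_measurable.
- by apply: ae_imp2 hp hq => x E1 E2 Dx; rewrite (E1 Dx) (E2 Dx).
Qed.

End hasint.

(** * Pointwise algebra for the increment under translation *)

Section forms.
Context {R : realType}.
Implicit Types (p q a : R[i]).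

Definition cE := (@ReM R, @ImM R, @ReD R, @ImD R, @ReN R, @ImN R, @Re_conj R, @Im_conj R).

(** The factor 1/2 of the classical inequality is given up to keep the constants simple. *)
Lemma young b (L t : R) a p q : modulus a <= L -> 0 < t ->
  `|part b (a * p * conjc q)| <= L * (t * modulus p ^+ 2 + modulus q ^+ 2 / t).
Proof.
move=> aL t0; apply: (le_trans (part_le _ _)); rewrite !modulusM modulus_conj -mulrA.
have pq0 : 0 <= modulus p * modulus q by apply: mulr_ge0; exact: modulus_ge0.
apply: ler_pM => //; first exact: modulus_ge0.
have := sqr_ge0 (t * modulus p - modulus q); have p2 := sqr_ge0 (modulus p); have q2 := sqr_ge0 (modulus q).
have -> : t * modulus p ^+ 2 + modulus q ^+ 2 / t = (t ^+ 2 * modulus p ^+ 2 + modulus q ^+ 2) / t.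
  by field; rewrite gt_eqF.
rewrite ler_pdivlMr// => h; move: h pq0; move: (modulus p) (modulus q) => x y h pq0.
by have : 0 <= t * (x * y) by [exact: mulr_ge0 (ltW t0) pq0]; move: h; rewrite !expr2; nra.
Qed.

Lemma RealC (r : R) : complex.Re (r%:C)%C = r. Proof. by []. Qed.
Lemma ImagC (r : R) : complex.Im (r%:C)%C = 0. Proof. by []. Qed.

(* [g], [G] are the gradients of [u] and of its vertical translate [U]; the left-hand side of the
   conclusion is the elliptic part of the increment, and [P] is the tested equation. *)
Lemma increment_point (c0 L h th a0 : R) (r0 r1 : R) (a01 b0 b1 g0 g1 G0 G1 u U f : R[i]) (t0 t1 : R) :
  0 < h -> 0 <= L -> 0 <= th <= 1 ->
  (forall z0 z1 : R[i], c0 * (modulus z0 ^+ 2 + modulus z1 ^+ 2) <=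
     complex.Re (r0%:C%C * z0 * conjc z0 + a01 * z1 * conjc z0 + conjc a01 * z0 * conjc z1 + r1%:C%C * z1 * conjc z1)) ->
  [/\ modulus (r0 * t0)%:C%C <= L, modulus (a01 * t0%:C%C) <= L, modulus (conjc a01 * t1%:C%C) <= L & modulus (r1 * t1)%:C%C <= L] ->
  [/\ modulus (b0 * th%:C%C) <= L, modulus (b1 * th%:C%C) <= L, modulus (conjc b0 * t0%:C%C) <= L & modulus (conjc b1 * t1%:C%C) <= L] ->
  modulus (a0 * th)%:C%C <= L -> modulus (th%:C%C : R[i]) <= L -> modulus ('i%C * th%:C%C : R[i]) <= L ->
  let e := U - u in
  let P0 := th%:C%C * (G0 - g0) + t0%:C%C * e in let P1 := th%:C%C * (G1 - g1) + t1%:C%C * e in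
  let ph := th%:C%C * e in
  let P := complex.Re (r0%:C%C * g0 * conjc P0) + complex.Re (a01 * g1 * conjc P0) +
     complex.Re (conjc a01 * g0 * conjc P1) + complex.Re (r1%:C%C * g1 * conjc P1) +
     complex.Re (b0 * g0 * conjc ph) + complex.Re (b1 * g1 * conjc ph) +
     complex.Re (b0 * P0 * conjc u) + complex.Re (b1 * P1 * conjc u) +
     complex.Re (a0%:C%C * u * conjc ph) - complex.Re (1 * (f + 'i%C * u) * conjc ph) in
  let Q (a p q : R[i]) := complex.Re (th%:C%C * a * p * conjc q) in
  let S := Q r0%:C%C G0 G0 - Q r0%:C%C g0 g0 + (Q a01 G1 G0 - Q a01 g1 g0) +
     (Q (conjc a01) G0 G1 - Q (conjc a01) g0 g1) + (Q r1%:C%C G1 G1 - Q r1%:C%C g1 g1) +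
     2 * (Q b0 G0 U - Q b0 g0 u) + 2 * (Q b1 G1 U - Q b1 g1 u) in
  is_true (c0 * (th * (modulus (G0 - g0) ^+ 2 + modulus (G1 - g1) ^+ 2)) <=
  S - 2 * P + 26 * L * (h * (modulus g0 ^+ 2 + modulus g1 ^+ 2 + modulus G0 ^+ 2 + modulus G1 ^+ 2 +
     modulus u ^+ 2 + modulus f ^+ 2) + modulus e ^+ 2 / h)).
Proof.
move=> h0 L0 /andP[th0 th1] ell [m1 m2 m3 m4] [m5 m6 m7 m8] m9 m10 m11 e P0 P1 ph P Q S.
have cr (c p : R[i]) : modulus c <= L -> - (L * (h * modulus p ^+ 2 + modulus e ^+ 2 / h)) <= complex.Re (c * p * conjc e)
    /\ complex.Re (c * p * conjc e) <= L * (h * modulus p ^+ 2 + modulus e ^+ 2 / h).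
  by move=> cL; have := young true p e cL h0; rewrite ler_norml => /andP[].
have [_ k1] := cr _ g0 m1; have [_ k2] := cr _ g1 m2; have [_ k3] := cr _ g0 m3; have [_ k4] := cr _ g1 m4.
have [k5 _] := cr _ G0 m5; have [k6 _] := cr _ G1 m6.
have [_ k5'] := cr _ g0 m5; have [_ k6'] := cr _ g1 m6.
have [_ k7] := cr _ u m7; have [_ k8] := cr _ u m8; have [_ k9] := cr _ u m9.
have [k10 _] := cr _ f m10; have [k11 _] := cr _ u m11.
have {}ell := ler_wpM2l th0 (ell (G0 - g0) (G1 - g1)).
(* Polarisation: the form at the translate, minus the form at u, minus twice the form at u and the
   increment, is the form at the increment. What remains are thirteen products containing the
   increment undifferentiated, each with factor 2, whence 26 L. *)
have key : S - 2 * P = th * complex.Re (r0%:C%C * (G0 - g0) * conjc (G0 - g0) + a01 * (G1 - g1) * conjc (G0 - g0) +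
      conjc a01 * (G0 - g0) * conjc (G1 - g1) + r1%:C%C * (G1 - g1) * conjc (G1 - g1)) +
   2 * (complex.Re (b0 * th%:C%C * G0 * conjc e) + complex.Re (b1 * th%:C%C * G1 * conjc e)
    - complex.Re ((r0 * t0)%:C%C * g0 * conjc e) - complex.Re (a01 * t0%:C%C * g1 * conjc e)
    - complex.Re (conjc a01 * t1%:C%C * g0 * conjc e) - complex.Re ((r1 * t1)%:C%C * g1 * conjc e)
    - complex.Re (b0 * th%:C%C * g0 * conjc e) - complex.Re (b1 * th%:C%C * g1 * conjc e)
    - complex.Re (conjc b0 * t0%:C%C * u * conjc e) - complex.Re (conjc b1 * t1%:C%C * u * conjc e)
    - complex.Re ((a0 * th)%:C%C * u * conjc e) + complex.Re (th%:C%C * f * conjc e)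
    + complex.Re ('i%C * th%:C%C * u * conjc e)).
  have K1 (r t : R) (g G : R[i]) : Q r%:C%C G G - Q r%:C%C g g - 2 * complex.Re (r%:C%C * g * conjc (th%:C%C * (G - g) + t%:C%C * e)) =
     th * complex.Re (r%:C%C * (G - g) * conjc (G - g)) - 2 * complex.Re ((r * t)%:C%C * g * conjc e).
    by rewrite /Q; move: (e) => ee; rewrite !cE !RealC !ImagC; ring.
  have K2 : (Q a01 G1 G0 - Q a01 g1 g0) + (Q (conjc a01) G0 G1 - Q (conjc a01) g0 g1) -
      2 * complex.Re (a01 * g1 * conjc P0) - 2 * complex.Re (conjc a01 * g0 * conjc P1) =
      th * complex.Re (a01 * (G1 - g1) * conjc (G0 - g0)) + th * complex.Re (conjc a01 * (G0 - g0) * conjc (G1 - g1)) -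
      2 * complex.Re (a01 * t0%:C%C * g1 * conjc e) - 2 * complex.Re (conjc a01 * t1%:C%C * g0 * conjc e).
    by rewrite /Q /P0 /P1; move: (e) => ee; rewrite !cE !RealC !ImagC; ring.
  have K3 (b g G : R[i]) (t : R) : 2 * (Q b G U - Q b g u) - 2 * complex.Re (b * g * conjc ph) -
      2 * complex.Re (b * (th%:C%C * (G - g) + t%:C%C * e) * conjc u) =
      2 * (complex.Re (b * th%:C%C * G * conjc e) - complex.Re (b * th%:C%C * g * conjc e) - complex.Re (conjc b * t%:C%C * u * conjc e)).
    by rewrite /Q /ph /e; rewrite !cE !RealC !ImagC; ring.
  have K4 : complex.Re (a0%:C%C * u * conjc ph) = complex.Re ((a0 * th)%:C%C * u * conjc e).
    by rewrite /ph; move: (e) => ee; rewrite !cE !RealC !ImagC; ring.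
  have K5 : complex.Re (1 * (f + 'i%C * u) * conjc ph) = complex.Re (th%:C%C * f * conjc e) + complex.Re ('i%C * th%:C%C * u * conjc e).
    by rewrite /ph mul1r; move: (e) => ee; rewrite !cE !RealC !ImagC; ring.
  have := K1 r0 t0 g0 G0; have := K1 r1 t1 g1 G1; have := K3 b0 g0 G0 t0; have := K3 b1 g1 G1 t1.
  rewrite -/P0 -/P1 /S /P K4 K5 !ReD; move: K2; clear; lra.
rewrite key mulrCA; move: ell k1 k2 k3 k4 k5 k6 k5' k6' k7 k8 k9 k10 k11.
have p0 (z : R[i]) : 0 <= L * (h * modulus z ^+ 2) by apply: mulr_ge0 => //; apply: mulr_ge0; [exact: ltW|exact: sqr_ge0].
have := p0 g0; have := p0 g1; have := p0 G0; have := p0 G1; have := p0 u; have := p0 f.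
have : 0 <= L * (modulus e ^+ 2 / h) by apply: mulr_ge0 => //; apply: divr_ge0; [exact: sqr_ge0|exact: ltW].
move: (modulus g0 ^+ 2) (modulus g1 ^+ 2) (modulus G0 ^+ 2) (modulus G1 ^+ 2) (modulus u ^+ 2) (modulus f ^+ 2) (modulus e ^+ 2 / h).
clear; move=> x1 x2 x3 x4 x5 x6 x7; lra.
Qed.

End forms.

(** * The Dirichlet problem *)

Section coefficients.
Context {R : realType}.
Local Notation mR2 := (measurableTypeR R * measurableTypeR R)%type.
Local Notation strip h := (upper h (fun=> 0%R)).
Variables (A : 'I_2 -> 'I_2 -> R * R -> R[i]) (A1 : 'I_2 -> R * R -> R[i]) (A0 : R * R -> R).
Implicit Types u v f : R * R -> R[i].

(** The term (u, A_j d_j v) is the conjugate of the pairing with A_j d_j v on the left, and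
    conjugation changes the sign of the imaginary part. *)
Definition sg (b : bool) : R := if b then 1 else - 1.

Lemma hform_part D (M : R) b u v : measurable (D : set mR2) -> 0 <= M ->
  (forall j, bounded_coef area (D : set mR2) M (A1 j)) -> cL2a D u -> (forall j, cL2a D (wderiv D j v)) ->
  part b (hform A A1 A0 D u v) =
  pint area (D : set mR2) b (A ord0 ord0) (wderiv D ord0 u) (wderiv D ord0 v) +
  pint area (D : set mR2) b (A ord0 ord_max) (wderiv D ord_max u) (wderiv D ord0 v) +
  pint area (D : set mR2) b (A ord_max ord0) (wderiv D ord0 u) (wderiv D ord_max v) +
  pint area (D : set mR2) b (A ord_max ord_max) (wderiv D ord_max u) (wderiv D ord_max v) +
  pint area (D : set mR2) b (A1 ord0) (wderiv D ord0 u) v + pint area (D : set mR2) b (A1 ord_max) (wderiv D ord_max u) v +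
  sg b * pint area (D : set mR2) b (A1 ord0) (wderiv D ord0 v) u + sg b * pint area (D : set mR2) b (A1 ord_max) (wderiv D ord_max v) u +
  pint area (D : set mR2) b (fun x => (A0 x)%:C%C) u v.
Proof.
move=> mD M0 bA hu hg.
have E (w1 w2 : R * R -> R[i]) c : part b (ipL2 D (fun x => c x * w1 x) w2) = pint area (D : set mR2) b c w1 w2.
  by rewrite cint_part.
have E2 j : part b (ipL2 D u (fun x => A1 j x * wderiv D j v x)) = sg b * pint area (D : set mR2) b (A1 j) (wderiv D j v) u.
  rewrite cint_part -(RintegralZl (sg b) mD (pint_integrable mD b M0 (bA j) (hg j) hu)).
  by apply: eq_Rintegral => x _; rewrite /sg /part; case: b {E}; rewrite !cE; ring.
have S1 i j := E (wderiv D j u) (wderiv D i v) (A i j).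
have S2 j := E (wderiv D j u) v (A1 j).
have S3 := E u v (fun x => (A0 x)%:C%C).
have gen (p : 'I_2 -> 'I_2 -> R[i]) (q r : 'I_2 -> R[i]) (s : R[i]) :
    part b (\sum_(i < 2) \sum_(j < 2) p i j + \sum_(j < 2) q j + \sum_(j < 2) r j + s) =
    part b (p ord0 ord0) + part b (p ord0 ord_max) + part b (p ord_max ord0) + part b (p ord_max ord_max) +
    part b (q ord0) + part b (q ord_max) + part b (r ord0) + part b (r ord_max) + part b s.
  by clear; rewrite !sum2E !partD; ring.
apply: (etrans (gen (fun i j => ipL2 D (fun x => A i j x * wderiv D j u x) (wderiv D i v)) (fun j => ipL2 D (fun x => A1 j x * wderiv D j u x) v)
  (fun j => ipL2 D u (fun x => A1 j x * wderiv D j v x)) (ipL2 D (fun x => (A0 x)%:C%C * u x) v))).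
by congr (_ + _ + _ + _ + _ + _ + _ + _ + _); [exact: S1|exact: S1|exact: S1|exact: S1|exact: S2|exact: S2|exact: E2|exact: E2|exact: S3].
Qed.

Variables (d c0 : R).
Hypotheses (d0 : 0 < d) (c00 : 0 < c0) (hA : admissible_coefficients d A A1 A0 c0).
Local Notation D0 := (strip d).
Let mD0 : measurable (D0 : set mR2) := strip_meas d.
Let oD0 : open D0 := @strip_open R d.

Lemma coefs_bound : exists M, [/\ 0 <= M, forall i j, lipcoef d M (A i j), forall j, lipcoef d M (A1 j) &
  bounded_coef area (D0 : set mR2) M (fun x => (A0 x)%:C%C)].
Proof.
have [hAij hAj /Linfty_bounded[M4 p4 h4] _ _] := hA.
have w i j := Winfty2_lipcoef (hAij i j); have w1 j := Winfty_lipcoef (hAj j).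
have [a p_a ha] := w ord0 ord0; have [b p_b hb] := w ord0 ord_max.
have [c p_c hc] := w ord_max ord0; have [e p_e he] := w ord_max ord_max.
have [k pk hk] := w1 ord0; have [l pl hl] := w1 ord_max.
exists (a + b + c + e + k + l + M4); split.
- by rewrite !addr_ge0.
- apply: basis_ind; apply: basis_ind; [apply: lipcoef_le ha|apply: lipcoef_le hb|apply: lipcoef_le hc|apply: lipcoef_le he]; lra.
- by apply: basis_ind; [apply: lipcoef_le hk|apply: lipcoef_le hl]; lra.
- by apply: bounded_coef_le h4; lra.
Qed.

Lemma coefs_herm : {ae area, forall x, D0 x -> [/\ A ord0 ord0 x = (complex.Re (A ord0 ord0 x))%:C%C,
  A ord_max ord_max x = (complex.Re (A ord_max ord_max x))%:C%C, A ord_max ord0 x = conjc (A ord0 ord_max x) &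
  forall z0 z1 : R[i], c0 * (modulus z0 ^+ 2 + modulus z1 ^+ 2) <=
     complex.Re (A ord0 ord0 x * z0 * conjc z0 + A ord0 ord_max x * z1 * conjc z0 +
       A ord_max ord0 x * z0 * conjc z1 + A ord_max ord_max x * z1 * conjc z1)]}.
Proof.
have [_ _ _ hh he] := hA; apply: ae_imp2 hh he => x hx ex Dx.
have r (z : R[i]) : z = conjc z -> z = (complex.Re z)%:C%C.
  by case: z => z1 z2 [] h; apply: complex_eq => //=; lra.
split; [exact/r/hx|exact/r/hx|exact: hx|move=> z0 z1].
(* The ellipticity condition pairs A_ij with z_i and the conjugate of z_j, the form with z_j and the
   conjugate of z_i; conjugating the vector matches the two. *)
have := ex Dx (fun i => if i == ord0 then conjc z0 else conjc z1).
rewrite !sum2E /= lecE /= => /andP[_]; rewrite !modulus_conj !conjcK.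
by move=> h; apply: (le_trans h); rewrite !cE; lra.
Qed.

(** The first-order terms are split by [young] with a weight t so small that half of the ellipticity
    constant survives; the price is a large multiple K of |v|^2. *)
Lemma coercive_point (M t K a0 : R) (r0 r1 : R) (a01 b0 b1 g0 g1 v : R[i]) : 0 <= M ->
  (forall z0 z1 : R[i], c0 * (modulus z0 ^+ 2 + modulus z1 ^+ 2) <=
     complex.Re (r0%:C%C * z0 * conjc z0 + a01 * z1 * conjc z0 + conjc a01 * z0 * conjc z1 + r1%:C%C * z1 * conjc z1)) ->
  modulus b0 <= M -> modulus b1 <= M -> `|a0| <= M -> 0 < t -> 2 * M * t <= c0 / 2 -> 4 * M / t + M + 1 <= K ->
  c0 / 2 * (modulus g0 ^+ 2 + modulus g1 ^+ 2) + modulus v ^+ 2 <=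
  complex.Re (r0%:C%C * g0 * conjc g0 + a01 * g1 * conjc g0 + conjc a01 * g0 * conjc g1 + r1%:C%C * g1 * conjc g1) +
  2 * complex.Re (b0 * g0 * conjc v) + 2 * complex.Re (b1 * g1 * conjc v) + a0 * modulus v ^+ 2 + K * modulus v ^+ 2.
Proof.
move=> M0 ell m0 m1 ma t0 Mt KM; have := ell g0 g1; set X := complex.Re _ => lX.
have := young true g0 v m0 t0; rewrite ler_norml => /andP[y0 _].
have := young true g1 v m1 t0; rewrite ler_norml => /andP[y1 _].
rewrite /part in y0 y1; move: y0 y1; set Y0 := complex.Re _; set Y1 := complex.Re _ => y0 y1.
have v2 := sqr_ge0 (modulus v); have p0 := sqr_ge0 (modulus g0); have p1 := sqr_ge0 (modulus g1).
have e1 := ler_wpM2r v2 KM; have e2 := ler_wpM2r p0 Mt; have e3 := ler_wpM2r p1 Mt.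
have e4 : - M * modulus v ^+ 2 <= a0 * modulus v ^+ 2.
  by apply: ler_wpM2r => //; move: ma; rewrite ler_norml => /andP[].
move: lX y0 y1 e1 e2 e3 e4; move: (t^-1) => ti.
move: (modulus v ^+ 2) (modulus g0 ^+ 2) (modulus g1 ^+ 2) => V P Q; clear; lra.
Qed.

(** In the imaginary part the second-order terms cancel by hermitian symmetry and the two groups of
    first-order terms cancel each other, while the spectral parameter i leaves -|v|^2. Subtracting K
    times it supplies the mass required by [coercive_point]. *)
Lemma energy_point (M t K a0 : R) (r0 r1 c1 : R) (a01 b0 b1 g0 g1 v f : R[i]) : 0 <= M ->
  (forall z0 z1 : R[i], c0 * (modulus z0 ^+ 2 + modulus z1 ^+ 2) <=
     complex.Re (r0%:C%C * z0 * conjc z0 + a01 * z1 * conjc z0 + conjc a01 * z0 * conjc z1 + r1%:C%C * z1 * conjc z1)) ->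
  modulus b0 <= M -> modulus b1 <= M -> `|a0| <= M -> 0 < t -> 2 * M * t <= c0 / 2 -> 4 * M / t + M + 1 <= K -> 0 <= K ->
  c1 <= c0 / 2 -> c1 <= 1 / 2 ->
  let T b := part b (r0%:C%C * g0 * conjc g0) + part b (a01 * g1 * conjc g0) + part b (conjc a01 * g0 * conjc g1) +
     part b (r1%:C%C * g1 * conjc g1) + part b (b0 * g0 * conjc v) + part b (b1 * g1 * conjc v) +
     sg b * part b (b0 * g0 * conjc v) + sg b * part b (b1 * g1 * conjc v) + part b (a0%:C%C * v * conjc v) -
     part b (1 * (f + 'i%C * v) * conjc v) in
  is_true (c1 * (modulus v ^+ 2 + (modulus g0 ^+ 2 + modulus g1 ^+ 2)) <= T true - K * T false + 4 * (1 + K) ^+ 2 * modulus f ^+ 2).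
Proof.
move=> M0 ell m0 m1 ma t0 Mt KM K0 c1a c1b T.
have cp := coercive_point g0 g1 v M0 ell m0 m1 ma t0 Mt KM.
have n1 : modulus (1 : R[i]) <= 1 by rewrite (modulus_real (1 : R)) normr1.
have k1 : 0 < 2 * (1 + K) by lra.
have := young true f v n1 k1; have := young false f v n1 k1; rewrite !ler_norml => /andP[y1 _] /andP[_ y2].
have hv := modulus_sqr v.
have ET : T true = complex.Re (r0%:C%C * g0 * conjc g0 + a01 * g1 * conjc g0 + conjc a01 * g0 * conjc g1 + r1%:C%C * g1 * conjc g1) +
  2 * complex.Re (b0 * g0 * conjc v) + 2 * complex.Re (b1 * g1 * conjc v) + a0 * modulus v ^+ 2 - part true (1 * f * conjc v).
  have D1 : part true (1 * (f + 'i%C * v) * conjc v) = part true (1 * f * conjc v).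
    by rewrite !(@mul1r R[i]) /part !cE /=; ring.
  have D2 : part true (a0%:C%C * v * conjc v) = a0 * modulus v ^+ 2.
    by rewrite /part hv !cE !RealC !ImagC; ring.
  rewrite /T D1 D2 /sg; move: (part true (1 * f * conjc v)) => F1; rewrite /part !ReD; ring.
have EF : T false = - modulus v ^+ 2 - part false (1 * f * conjc v).
  by rewrite /T /sg /part hv !mul1r; rewrite !cE !RealC !ImagC /=; ring.
rewrite ET EF; move: cp y1 y2.
move: (complex.Re _) (complex.Re (b0 * _ * _)) (complex.Re (b1 * _ * _)) (part true _) (part false _) => X Y0 Y1 p q.
have p0 := sqr_ge0 (modulus g0); have p1 := sqr_ge0 (modulus g1); have p2 := sqr_ge0 (modulus v).
have q0 := ler_wpM2r p0 c1a; have q1 := ler_wpM2r p1 c1a; have q2 := ler_wpM2r p2 c1b.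
have E : (1 + K) * (2 * (1 + K) * modulus f ^+ 2 + modulus v ^+ 2 / (2 * (1 + K))) = 2 * (1 + K) ^+ 2 * modulus f ^+ 2 + 1 / 2 * modulus v ^+ 2.
  by field; apply: lt0r_neq0; lra.
have f0 : 0 <= (1 + K) ^+ 2 * modulus f ^+ 2 by apply: mulr_ge0; exact: sqr_ge0.
rewrite !mul1r; move: E; set Y := _ + _ / _ => E cp y1 y2.
have y3 := ler_wpM2l K0 y1.
clearbody Y; move: cp q0 q1 q2 E y2 y3 f0; clear.
move: (modulus v ^+ 2) (modulus g0 ^+ 2) (modulus g1 ^+ 2) (modulus f ^+ 2) => V G0 G1 F; rewrite !expr2; lra.
Qed.

Lemma energy_arith (c1 E Z F : R) : 0 < c1 -> 0 <= F -> c1 * Z <= E * F -> Z <= (E + 1) / c1 * F.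
Proof. by move=> c10 F0 H; rewrite mulrAC ler_pdivlMr// mulrC; lra. Qed.

Lemma half_bound (M : R) : 0 <= M -> 2 * M * (c0 / (4 * (M + 1))) <= c0 / 2.
Proof.
move=> M0; have M1 : 0 < M + 1 by rewrite ltr_wpDl.
rewrite (_ : 2 * M * _ = c0 / 2 * (M / (M + 1))); last by field; rewrite gt_eqF.
have h1 : M / (M + 1) <= 1 by rewrite ler_pdivrMr ?mul1r// lerDl.
by have c2 : 0 <= c0 / 2 by [apply: divr_ge0 => //; exact: ltW]; have := ler_wpM2l c2 h1; rewrite mulr1.
Qed.

Definition dsolve f u : Prop := is_resolvent (HDirichlet0 d A A1 A0) 'i%C f u.
Local Notation ns := (rsqn area (D0 : set mR2)).
Local Notation pI := (pint area (D0 : set mR2)).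

(** The chosen derivatives of the test function are replaced by an explicit gradient [G], to which
    pointwise algebra can be applied. *)
Lemma dsolve_eq b f u v (G : 'I_2 -> R * R -> R[i]) (M : R) : 0 <= M -> (forall i j, lipcoef d M (A i j)) -> (forall j, lipcoef d M (A1 j)) ->
  dsolve f u -> (forall j, cmeasurable D0 (G j)) -> (forall j, {ae area, forall x, D0 x -> wderiv D0 j v x = G j x}) ->
  [/\ W2 1 D0 v, zero_trace D0 (fun=> d) v & zero_trace D0 (fun=> 0) v] ->
  pI b (A ord0 ord0) (wderiv D0 ord0 u) (G ord0) + pI b (A ord0 ord_max) (wderiv D0 ord_max u) (G ord0) +
  pI b (A ord_max ord0) (wderiv D0 ord0 u) (G ord_max) + pI b (A ord_max ord_max) (wderiv D0 ord_max u) (G ord_max) +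
  pI b (A1 ord0) (wderiv D0 ord0 u) v + pI b (A1 ord_max) (wderiv D0 ord_max u) v +
  sg b * pI b (A1 ord0) (G ord0) u + sg b * pI b (A1 ord_max) (G ord_max) u +
  pI b (fun x => (A0 x)%:C%C) u v - pI b (fun=> 1) (fun x => f x + 'i%C * u x) v = 0.
Proof.
move=> M0 lA lA1 [[Wu _ _] _ H] mG aeG Vv; have [Wv _ _] := Vv.
have [hu hg] := W2_wderiv oD0 Wu; have [hv hgv] := W2_wderiv oD0 Wv.
have Hv : part b (hform A A1 A0 D0 u v) = part b (ipL2 D0 (fun x => f x + 'i%C * u x) v) := congr1 (part b) (H v Vv).
have {Hv}Hv := etrans (esym (hform_part b mD0 M0 (fun j => (lA1 j).1) hu (fun j => (hgv j).2))) Hv.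
have mA i j : cmeas (D0 : set mR2) (A i j) by case: (lA i j) => -[].
have mA1 j : cmeas (D0 : set mR2) (A1 j) by case: (lA1 j) => -[].
have mu : cmeas (D0 : set mR2) u by case: hu.
have mgu j : cmeas (D0 : set mR2) (wderiv D0 j u) by case: (hg j) => _ [].
have mgv j : cmeas (D0 : set mR2) (wderiv D0 j v) by case: (hgv j) => _ [].
have rf (w : R * R -> R[i]) : {ae area, forall x, D0 x -> w x = w x} by exact: aeW.
have e1 i j : pI b (A i j) (wderiv D0 j u) (wderiv D0 i v) = pI b (A i j) (wderiv D0 j u) (G i).
  exact: (pint_ae mD0 b (mA i j) (mgu j) (mgu j) (mgv i) (mG i) (rf _) (aeG i)).
have e2 j : pI b (A1 j) (wderiv D0 j v) u = pI b (A1 j) (G j) u.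
  exact: (pint_ae mD0 b (mA1 j) (mgv j) (mG j) mu mu (aeG j) (rf _)).
have Hr : part b (ipL2 D0 (fun x => f x + 'i%C * u x) v) = pI b (fun=> 1) (fun x => f x + 'i%C * u x) v.
  by rewrite cint_part; apply: eq_Rintegral => x _; rewrite mul1r.
have {Hv Hr}Hv := etrans Hv Hr.
rewrite (e1 ord0 ord0) (e1 ord0 ord_max) (e1 ord_max ord0) (e1 ord_max ord_max) (e2 ord0) (e2 ord_max) in Hv.
by rewrite -Hv subrr.
Qed.

(** [energy_point] is integrated with the solution as its own test function; the tested equation
    makes both the real and the imaginary part contribute 0. *)
Lemma dsolve_energy : exists2 C, 0 < C & forall f u, cL2a D0 f -> dsolve f u ->
  ns u + (ns (wderiv D0 ord0 u) + ns (wderiv D0 ord_max u)) <= C * ns f.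
Proof.
have [M [M0 lA lA1 bA0]] := coefs_bound.
pose t := c0 / (4 * (M + 1)); have t0 : 0 < t by rewrite divr_gt0// mulr_gt0// ltr_wpDl.
have Mt : 2 * M * t <= c0 / 2 := half_bound M0.
pose K := 4 * M / t + M + 1; have K0 : 0 <= K.
  by have : 0 <= 4 * M / t by [apply: divr_ge0; [lra|exact: ltW]]; rewrite /K; lra.
pose c1 := Num.min (c0 / 2) (1 / 2); have c10 : 0 < c1 by rewrite lt_min !divr_gt0.
have c1a : c1 <= c0 / 2 by rewrite ge_min lexx.
have c1b : c1 <= 1 / 2 by rewrite ge_min lexx orbT.
pose E := 4 * (1 + K) ^+ 2; have E0 : 0 <= E by rewrite mulr_ge0// sqr_ge0.
exists ((E + 1) / c1); first by rewrite divr_gt0//; lra.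
move=> f u hf S; have [[Wu zd z0] L2fu _] := S; have [hu hg] := W2_wderiv oD0 Wu.
have hgL j : cL2a D0 (wderiv D0 j u) by case: (hg j).
have mgL j : cmeasurable D0 (wderiv D0 j u) by case: (hgL j).
have rfl j : {ae area, forall x, D0 x -> wderiv D0 j u x = wderiv D0 j u x} by exact: aeW.
have eq b := dsolve_eq b M0 lA lA1 S mgL rfl (And3 Wu zd z0).
have hfu : cL2a D0 (fun x => f x + 'i%C * u x) by exact/L2P.
have hp b i j := hasint_pint mD0 b M0 (lA i j).1 (hgL j) (hgL i).
have hq b j := hasint_pint mD0 b M0 (lA1 j).1 (hgL j) hu.
have hr b := hasint_pint mD0 b M0 bA0 hu hu.
have hs b := hasint_pint mD0 b ler01 (bounded_coef1 D0) hfu hu.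
have hP b := hasintB mD0 (hasintD mD0 (hasintD mD0 (hasintD mD0 (hasintD mD0 (hasintD mD0 (hasintD mD0 (hasintD mD0 (hasintD mD0
  (hp b ord0 ord0) (hp b ord0 ord_max)) (hp b ord_max ord0)) (hp b ord_max ord_max)) (hq b ord0)) (hq b ord_max))
  (hasintZ mD0 (sg b) (hq b ord0))) (hasintZ mD0 (sg b) (hq b ord_max))) (hr b)) (hs b).
have hL := hasintZ mD0 c1 (hasintD mD0 (hasint_sqr mD0 hu) (hasintD mD0 (hasint_sqr mD0 (hgL ord0)) (hasint_sqr mD0 (hgL ord_max)))).
have hR := hasintD mD0 (hasintB mD0 (hP true) (hasintZ mD0 K (hP false))) (hasintZ mD0 E (hasint_sqr mD0 hf)).
have := hasint_le mD0 hL hR; rewrite (eq true) (eq false) mulr0 subr0 add0r => H.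
apply: (energy_arith c10 (rsqn_ge0 _ _ _)); apply: H.
apply: ae_imp2 (ae_imp2 (fun x p q => conj p q) (lA1 ord0).1.2 (lA1 ord_max).1.2) (ae_imp2 (fun x p q => conj p q) coefs_herm bA0.2).
move=> x [b0 b1] [hx ha] Dx; have [r0 r1 a10 ell] := hx Dx.
move: ell (ha Dx); rewrite r0 r1 a10 modulus_real => ell ha'.
exact: (energy_point (wderiv D0 ord0 u x) (wderiv D0 ord_max u x) (u x) (f x) M0 ell (b0 Dx) (b1 Dx) ha' t0 Mt (lexx K) K0 c1a c1b).
Qed.

Lemma cderiv_vanishing j v : vanishing v -> vanishing (cderiv j v).
Proof.
move=> [k k0 vz]; exists (k / 2) => [|x xk]; first exact: divr_gt0.
pose C : set (R * R) := [set y | k <= y.2].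
have cC : closed C.
  rewrite (_ : C = snd @^-1` [set t | k <= t])//; apply: closed_comp; last exact: closed_ge.
  by move=> y _; exact: cvg_snd.
have nC : ~ C x by rewrite /C /= => h; lra.
have H (F : R * R -> R) : (forall y, v y = 0 -> F y = 0) -> 'D_(basis j) F x = 0.
  move=> fv; apply/eqP/negPn/negP => n0; apply: nC; apply: (derive_off_closed cC _ n0) => y ny.
  by rewrite /C /= leNgt; apply/negP => yk; move: ny; rewrite fv ?eqxx// vz// ltW.
by rewrite /cderiv !H// => y ->.
Qed.

Lemma jet_zero_trace D (q : R -> R) u g (w : nat -> R * R -> R[i]) : open D -> jet D u g w ->
  (forall n s, w n (s, q s) = 0) -> zero_trace D q u.
Proof.
move=> oD J wz; split; [exact: measurable_cst|exact: measurable_cst|exists w; split].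
- by case: J.
- exact: jet_normW21 J.
- rewrite (_ : (fun n => _) = fun=> 0%E); first exact: cvg_cst.
  by apply/funext => n; apply: integral0_eq => s _; rewrite wz subrr modulus0 expr0n mul0r.
Qed.

Lemma dsolve_jet f u : dsolve f u -> exists2 z, jet D0 u (fun j => wderiv D0 j u) z & forall n, vanishing (z n).
Proof.
move=> [[Wu _ [_ _ [w [sw cw ct]]]] _ _]; apply: (zero_approx d0 (jetP oD0 Wu sw cw)).
have E n : sqn lebesgue_measure (setT : set (measurableTypeR R)) (fun s => w n (s, 0)) =
   (\int[lebesgue_measure]_(s in setT) (modulus (w n (s, 0%R) - 0) ^+ 2 * arclen (fun=> 0%R) s)%:E)%E.
  apply: eq_integral => s _; rewrite subr0 /arclen derive1_cst expr0n /= addr0 sqrtr1 mulr1//.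
have := (vanishesP _).1 ct; rewrite (_ : (fun n => sqn _ _ _) = fun n => (\int[lebesgue_measure]_(s in setT) (modulus (w n (s, 0%R) - 0) ^+ 2 * arclen (fun=> 0%R) s)%:E)%E).
  apply => n; apply: integral_ge0 => s _; rewrite lee_fin; apply: mulr_ge0; [exact: sqr_ge0|exact: sqrtr_ge0].
by apply/funext => n; rewrite E.
Qed.

(** The approximants vanish at the bottom, so the trace term of [layer_zeroC] drops out. The 8 is
    its factor 2 times two factors 2 from the passage to the limit. *)
Lemma dsolve_layer f u h : cL2a D0 f -> dsolve f u -> 0 < h <= d ->
  (sqa (strip h) u <= (8 * h ^+ 2)%:E * sqa (strip h) (wderiv D0 ord_max u))%E.
Proof.
move=> hf S /andP[h0 hd]; have [z J Hz] := dsolve_jet S; have [sw hu hg c1 c2] := J.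
have [mu _] := hu; have [mg _] := hg ord_max.
have sub := strip_sub hd; have mS := strip_meas h.
have mu' := cmeas_sub mD0 sub mu; have mg' := cmeas_sub mD0 sub mg.
apply: (vanishes_le_const (a := fun n => (2%:E * sqa D0 (fun x => z n x - u x)%R +
   (8 * h ^+ 2)%:E * sqa D0 (fun x => cderiv ord_max (z n) x - wderiv D0 ord_max u x)%R)%E)).
- apply: vanishesD; [by apply: (vanishes_le c1 (ler0n _ 2))|apply: (vanishes_le (c2 ord_max) (K := 8 * h ^+ 2)) => //].
  by rewrite mulr_ge0// sqr_ge0.
- by apply: mule_ge0; [rewrite lee_fin mulr_ge0// sqr_ge0|exact: sqa_ge0].
move=> n; have mz := csmooth_cmeas (@strip_open R h) (sw n); have mdz := cderiv_cmeas ord_max (@strip_open R h) (sw n).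
have hd0 : (0 <= (2 * h ^+ 2)%:E)%E by rewrite lee_fin mulr_ge0// sqr_ge0.
have q1 : (sqa (strip h) u <= 2%:E * sqa (strip h) (z n) + 2%:E * sqa D0 (fun x => z n x - u x)%R)%E.
  have -> : sqa (strip h) u = sqa (strip h) (fun x => z n x + (u x - z n x)).
    by congr sqa; apply/funext => x; rewrite addrC subrK.
  apply: (le_trans (sqnD area mS mz (cmeasB mu' mz))); apply: leeD => //; apply: lee_wpmul2l => //.
  rewrite sqn_sym; apply: sqa_sub => //; exact: (cmeasB (csmooth_cmeas oD0 (sw n)) mu).
have q2 : (sqa (strip h) (z n) <= (2 * h ^+ 2)%:E * sqa (strip h) (cderiv ord_max (z n)))%E.
  apply: (le_trans (layer_zeroC h0 (sw n))); rewrite (_ : sqn _ _ _ = 0%E) ?mule0 ?add0e//.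
  have [k k0 kz] := Hz n; apply: integral0_eq => s _; rewrite kz ?modulus0 ?expr0n//=; exact: ltW.
have q3 : (sqa (strip h) (cderiv ord_max (z n)) <= 2%:E * sqa D0 (fun x => cderiv ord_max (z n) x - wderiv D0 ord_max u x)%R +
    2%:E * sqa (strip h) (wderiv D0 ord_max u))%E.
  have -> : sqa (strip h) (cderiv ord_max (z n)) = sqa (strip h) (fun x => (cderiv ord_max (z n) x - wderiv D0 ord_max u x) + wderiv D0 ord_max u x).
    by congr sqa; apply/funext => x; rewrite subrK.
  apply: (le_trans (sqnD area mS (cmeasB mdz mg') mg')); apply: leeD => //; apply: lee_wpmul2l => //.
  apply: sqa_sub => //; exact: (cmeasB (cderiv_cmeas ord_max oD0 (sw n)) mg).
have p2 : (0 <= 2%:E :> \bar R)%E by [].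
have q4 := le_trans q2 (lee_wpmul2l hd0 q3).
apply: (le_trans q1); apply: (le_trans (leeD2r _ (lee_wpmul2l p2 q4))).
rewrite [in leLHS]ge0_muleDr; [|by apply: mule_ge0 => //; exact: sqa_ge0|by apply: mule_ge0 => //; exact: sqa_ge0].
rewrite [in leLHS]ge0_muleDr; [|by apply: mule_ge0 => //; apply: mule_ge0 => //; exact: sqa_ge0|by apply: mule_ge0 => //; apply: mule_ge0 => //; exact: sqa_ge0].
rewrite !muleA -!EFinM (_ : 2 * (2 * h ^+ 2) * 2 = 8 * h ^+ 2); last by ring.
by rewrite -addeA addeCA; apply: leeD2l; rewrite addeC.
Qed.

(** All translation errors are of order h, and the energy estimate turns the remaining norms into
    that of f; the numbers 100 and 300 are generous. *)
Lemma savare_arith (K L C1 h u g0 g1 G0 G1 e f a00 a01 a10 a11 b0 b1 : R) :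
  a00 <= h * K * (4 * (g0 + g0)) -> a01 <= h * K * (4 * (g1 + g0)) -> a10 <= h * K * (4 * (g0 + g1)) -> a11 <= h * K * (4 * (g1 + g1)) ->
  b0 <= h * K * (4 * (g0 + u)) -> b1 <= h * K * (4 * (g1 + u)) -> e <= 26 * L * h * (8 * g1) -> G0 <= g0 -> G1 <= g1 ->
  0 <= u -> 0 <= g0 -> 0 <= g1 -> 0 <= f -> u + (g0 + g1) <= C1 * f -> 0 <= h * K -> 0 <= L * h ->
  a00 + a01 + a10 + a11 + 2 * b0 + 2 * b1 + (26 * L * h * (g0 + g1 + G0 + G1 + u + f) + e) <= h * (((100 * K + 300 * L) * C1 + 300 * L) * f).
Proof.
move=> l1 l2 l3 l4 l5 l6 l7 m1 m2 p1 p2 p3 p4 EN hK hL.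
have b1' := ler_wpM2l hK EN; have b2' := ler_wpM2l hL EN.
have q1 := ler_wpM2l hL m1; have q2 := ler_wpM2l hL m2.
have r1 := mulr_ge0 hK p1; have r2 := mulr_ge0 hK p2; have r3 := mulr_ge0 hK p3.
have s1 := mulr_ge0 hL p1; have s2 := mulr_ge0 hL p2; have s3 := mulr_ge0 hL p3; have s4 := mulr_ge0 hL p4.
move: l1 l2 l3 l4 l5 l6 l7 b1' b2' q1 q2 r1 r2 r3 s1 s2 s3 s4; clear -A A1 A0 d0 c00 hA mD0 oD0.
lra.
Qed.

Lemma incr_arith (cA cB S P S' P' L h n e : R) : h != 0 -> cB <= S - 2 * P + 26 * L * (h * n + e / h) ->
  cA = cB -> S' = S -> P' = P -> cA <= S' - 2 * P' + (26 * L * h * n + 26 * L / h * e).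
Proof.
move=> h0 H -> -> ->; apply: (le_trans H); rewrite le_eqVlt; apply/orP; left; apply/eqP.
by clear -A A1 A0 d0 c00 hA mD0 oD0 h0; field.
Qed.

(* The form of [u] is compared with that of its translate; the difference is O(h) because the
   coefficients are Lipschitz in [x_2], and below height [h] the translate is zero. *)
Lemma savare : exists2 C, 0 < C & forall f u (h : R), cL2a D0 f -> dsolve f u -> 0 < h <= d / 3 ->
  (sqa (strip h) (wderiv D0 ord0 u) + sqa (strip h) (wderiv D0 ord_max u) <= (C * h * ns f)%:E)%E.
Proof.
have [M [M0 lA lA1 bA0]] := coefs_bound; have [Ct Ct0 hCt] := theta_bound d0.
have [C1 C10 HC1] := dsolve_energy.
(* One constant that dominates 1, the coefficients, and the coefficients times derivatives of
   [theta], as [increment_point] asks. *)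
pose L := (M + 1) * (Ct + 1).
have MCt := mulr_ge0 M0 (ltW Ct0).
have [L1 LM LC L0] : [/\ 1 <= L, M <= L, M * Ct <= L & 0 <= L] by clear -MCt M0 Ct0 A A1 A0 d0 c00 hA mD0 oD0; rewrite /L mulrDl mulrDr; split; lra.
pose K := M * (1 + Ct); have K0 : 0 <= K by rewrite mulr_ge0// addr_ge0// ltW.
exists ((100 * K + 300 * L) * C1 / c0 + 300 * L / c0 + 1).
  have e1 : 0 <= (100 * K + 300 * L) * C1 / c0.
    by apply: divr_ge0; [apply: mulr_ge0; [clear -K0 L0 A A1 A0 d0 c00 hA mD0 oD0; lra|exact: ltW]|exact: ltW].
  have e2 : 0 <= 300 * L / c0 by apply: divr_ge0; [clear -L0 A A1 A0 d0 c00 hA mD0 oD0; lra|exact: ltW].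
  by clear -e1 e2 A A1 A0 d0 c00 hA mD0 oD0; lra.
move=> f u h hf S /andP[h0 hd3]; have [z J Hz] := dsolve_jet S.
have [[Wu zd z0] L2fu _] := S; have hfu : cL2a D0 (fun x => f x + 'i%C * u x) by exact/L2P.
have [sw hu hg c1 c2] := J; have EN := HC1 f u hf S.
pose g j := wderiv D0 j u; pose G j := tsh h (g j); pose U := tsh h u; pose e x := U x - u x.
have JT : jet D0 U G (fun n => shift_up h (z n)) := jet_shift h0 J Hz.
have Je := jetB oD0 JT J; rewrite -/e in Je.
have [swT hU hG _ _] := JT; have [swe he hDe ce1 ce2] := Je.
have tb x : D0 x -> `|theta d x| <= 1 + Ct.
  move=> _; have /andP[t0 t1] := theta01 d x; rewrite (ger0_norm t0); clear -t1 Ct0 A A1 A0 d0 c00 hA mD0 oD0; lra.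
have tb' j x : D0 x -> `|'D_(basis j) (theta d) x| <= 1 + Ct by move=> _; apply: (le_trans (hCt j x)); clear -A A1 A0 d0 c00 hA mD0 oD0; lra.
have Ct1 : 0 <= 1 + Ct by clear -Ct0 A A1 A0 d0 c00 hA mD0 oD0; lra.
have Jp := jetM oD0 (theta_smooth d) Ct1 tb tb' Je.
have zz n s : z n (s, 0) = 0 by have [k k0 kz] := Hz n; apply: kz; exact: ltW.
have zh n s : shift_up h (z n) (s, 0) = 0.
  by have [k k0 kz] := Hz n; apply: kz; rewrite /= sub0r; clear -k0 h0 A A1 A0 d0 c00 hA mD0 oD0; lra.
(* The solution and its translate vanish at the bottom and [theta] at the top, so the localised
   increment is an admissible test function. *)
have V : [/\ W2 1 D0 (fun x => (theta d x)%:C%C * e x), zero_trace D0 (fun=> d) (fun x => (theta d x)%:C%C * e x) &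
    zero_trace D0 (fun=> 0) (fun x => (theta d x)%:C%C * e x)].
  split; first exact: (jet_W2 oD0 Jp).
    apply: (jet_zero_trace oD0 Jp) => n s; rewrite theta_high; first by rewrite mul0r.
    exact: d0.
    have h23 : 2 / 3 <= 1 :> R by rewrite ler_pdivrMr ?ltr0n// mul1r ler_nat.
    exact: (ler_piMr (ltW d0) h23).
  by apply: (jet_zero_trace oD0 Jp) => n s; rewrite zz zh subrr mulr0.
pose P j x := (theta d x)%:C%C * (G j x - g j x) + ('D_(basis j) (theta d) x)%:C%C * e x.
have hP j : cL2a D0 (P j) by exact: (jet_g Jp j).
have mP j : cmeasurable D0 (P j) by case: (hP j).
have aeP j : {ae area, forall x, D0 x -> wderiv D0 j (fun x => (theta d x)%:C%C * e x) x = P j x} by exact: jet_wderiv Jp.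
have eq0 := dsolve_eq true M0 lA lA1 S mP aeP V.
have hph : cL2a D0 (fun x => (theta d x)%:C%C * e x) := jet_u Jp.
have thb : bounded_coef area (D0 : set mR2) 1 (fun x => (theta d x)%:C%C).
  split; first exact: (cmeas_smooth D0 (theta_smooth d)).
  by apply: aeW => x _; rewrite modulus_real; have /andP[t0 t1] := theta01 d x; rewrite ger0_norm.
have thA a : bounded_coef area (D0 : set mR2) M a -> bounded_coef area (D0 : set mR2) M (fun x => (theta d x)%:C%C * a x).
  move=> [ma Ha]; split; first by apply: cmeasM => //; case: thb.
  apply: ae_imp2 thb.2 Ha => x h1 h2 Dx; rewrite modulusM -[leRHS]mul1r; apply: ler_pM; rewrite ?modulus_ge0//; [exact: h1|exact: h2].
have iP i j := hasint_pint mD0 true M0 (lA i j).1 (hg j) (hP i).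
have iQ j := hasint_pint mD0 true M0 (lA1 j).1 (hg j) hph.
have iR j := hasint_pint mD0 true M0 (lA1 j).1 (hP j) hu.
have i9 := hasint_pint mD0 true M0 bA0 hu hph.
have i10 := hasint_pint mD0 true ler01 (bounded_coef1 D0) hfu hph.
have IP := hasintB mD0 (hasintD mD0 (hasintD mD0 (hasintD mD0 (hasintD mD0 (hasintD mD0 (hasintD mD0 (hasintD mD0 (hasintD mD0
  (iP ord0 ord0) (iP ord0 ord_max)) (iP ord_max ord0)) (iP ord_max ord_max)) (iQ ord0)) (iQ ord_max)) (hasintZ mD0 (sg true) (iR ord0))) (hasintZ mD0 (sg true) (iR ord_max))) i9) i10.
rewrite eq0 in IP.
have iD i j := hasintB mD0 (hasint_pint mD0 true M0 (thA _ (lA i j).1) (hG j) (hG i)) (hasint_pint mD0 true M0 (thA _ (lA i j).1) (hg j) (hg i)).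
have iE j := hasintB mD0 (hasint_pint mD0 true M0 (thA _ (lA1 j).1) (hG j) hU) (hasint_pint mD0 true M0 (thA _ (lA1 j).1) (hg j) hu).
have IS := hasintD mD0 (hasintD mD0 (hasintD mD0 (hasintD mD0 (hasintD mD0 (iD ord0 ord0) (iD ord0 ord_max)) (iD ord_max ord0)) (iD ord_max ord_max))
  (hasintZ mD0 2 (iE ord0))) (hasintZ mD0 2 (iE ord_max)).
have IN := hasintD mD0 (hasintZ mD0 (26 * L * h) (hasintD mD0 (hasintD mD0 (hasintD mD0 (hasintD mD0 (hasintD mD0 (hasint_sqr mD0 (hg ord0)) (hasint_sqr mD0 (hg ord_max)))
  (hasint_sqr mD0 (hG ord0))) (hasint_sqr mD0 (hG ord_max))) (hasint_sqr mD0 hu)) (hasint_sqr mD0 hf))) (hasintZ mD0 (26 * L / h) (hasint_sqr mD0 he)).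
have IR := hasintD mD0 (hasintB mD0 IS (hasintZ mD0 2 IP)) IN; rewrite mulr0 subr0 in IR.
pose DD j x := G j x - g j x.
have hDD j : cL2a D0 (DD j) := hDe j.
have IL := hasintZ mD0 c0 (hasintD mD0 (hasint_pint mD0 true ler01 thb (hDD ord0) (hDD ord0)) (hasint_pint mD0 true ler01 thb (hDD ord_max) (hDD ord_max))).
have ReSq (t : R) (w : R[i]) : part true (t%:C%C * w * conjc w) = t * modulus w ^+ 2.
  by rewrite /part modulus_sqr !cE !RealC !ImagC; ring.
have main := hasint_le mD0 IL IR.
have sfA i j := shift_form d0 M0 Ct0 (hCt ord_max) (lA i j) (hg j) (hg i) (fun n => cderiv_smooth j (sw n)) (fun n => cderiv_smooth i (sw n))
   (fun n => cderiv_vanishing j (Hz n)) (fun n => cderiv_vanishing i (Hz n)) (c2 j) (c2 i) h0.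
have sfB j := shift_form d0 M0 Ct0 (hCt ord_max) (lA1 j) (hg j) hu (fun n => cderiv_smooth j (sw n)) sw
   (fun n => cderiv_vanishing j (Hz n)) Hz (c2 j) c1 h0.
have nsT v : cL2a D0 v -> ns (tsh h v) <= ns v.
  by move=> hv; rewrite -lee_fin -!rsqnE//; [apply: (sqa_tsh h0); case: hv|exact: tsh_cL2].
(* The increment is of order h in L_2. Its square enters divided by h, so its contribution is again
   of order h. *)
have ne : ns e <= 8 * h ^+ 2 * ns (g ord_max).
  rewrite -lee_fin (EFinM (8 * h ^+ 2)) -!rsqnE//; last exact: hg.
  apply: (vanishes_le_const (a := fun n => (2%:E * sqa D0 (fun x => (shift_up h (z n) x - z n x) - e x)%R +
     (8 * h ^+ 2)%:E * sqa D0 (fun x => cderiv ord_max (z n) x - g ord_max x)%R)%E)).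
  - apply: vanishesD; [by apply: (vanishes_le ce1 (ler0n _ 2))|apply: (vanishes_le (c2 ord_max) (K := 8 * h ^+ 2)) => //].
    by rewrite mulr_ge0// sqr_ge0.
  - by apply: mule_ge0; [rewrite lee_fin mulr_ge0// sqr_ge0|exact: sqa_ge0].
  move=> n; have me : cmeasurable D0 e by case: he.
  have mn := csmooth_cmeas oD0 (swe n); have mdz := cderiv_cmeas ord_max oD0 (sw n).
  have mg : cmeasurable D0 (g ord_max) by case: (hg ord_max).
  have [k k0 kz] := cderiv_vanishing ord_max (Hz n).
  have q1 := shift_diffC d h0 (sw n) (fun x xk => kz x (le_trans xk (ltW k0))).
  have q2 : (sqa D0 e <= 2%:E * sqa D0 (fun x => (shift_up h (z n) x - z n x) - e x)%R + 2%:E * sqa D0 (fun x => shift_up h (z n) x - z n x)%R)%E.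
    have -> : sqa D0 e = sqa D0 (fun x => (e x - (shift_up h (z n) x - z n x)) + (shift_up h (z n) x - z n x)).
      by congr sqa; apply/funext => x; rewrite subrK.
    apply: (le_trans (sqnD area mD0 (cmeasB me mn) mn)); apply: leeD => //; apply: lee_wpmul2l => //.
    by rewrite sqn_sym.
  have q3 : (sqa D0 (cderiv ord_max (z n)) <= 2%:E * sqa D0 (fun x => cderiv ord_max (z n) x - g ord_max x)%R + 2%:E * sqa D0 (g ord_max))%E.
    have -> : sqa D0 (cderiv ord_max (z n)) = sqa D0 (fun x => (cderiv ord_max (z n) x - g ord_max x) + g ord_max x).
      by congr sqa; apply/funext => x; rewrite subrK.
    exact: (sqnD area mD0 (cmeasB mdz mg) mg).
  have hd0 : (0 <= (2 * h ^+ 2)%:E)%E by rewrite lee_fin mulr_ge0// sqr_ge0.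
  have p2 : (0 <= 2%:E :> \bar R)%E by [].
  have q4 := le_trans q1 (lee_wpmul2l hd0 q3).
  apply: (le_trans q2); apply: (le_trans (leeD2l _ (lee_wpmul2l p2 q4))).
  rewrite [X in (_ + 2%:E * X <= _)%E]ge0_muleDr; [|by apply: mule_ge0 => //; exact: sqa_ge0|by apply: mule_ge0 => //; exact: sqa_ge0].
  rewrite [X in (_ + X <= _)%E]ge0_muleDr; [|by apply: mule_ge0 => //; apply: mule_ge0 => //; exact: sqa_ge0|by apply: mule_ge0 => //; apply: mule_ge0 => //; exact: sqa_ge0].
  rewrite !muleA -!EFinM (_ : 2 * (2 * h ^+ 2) * 2 = 8 * h ^+ 2); last by ring.
  by rewrite addeA [leRHS]addeC.
(* Below height h the translate is zero and [theta] is 1, so the increment of the gradient is minus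
   the gradient itself. *)
have strip_le j : (sqa (strip h) (g j) <= (pI true (fun x => (theta d x)%:C%C) (DD j) (DD j))%:E)%E.
  have [iI EI] := hasint_pint mD0 true ler01 thb (hDD j) (hDD j); rewrite -EI /Rintegral fineK; last exact: (integrable_fin_num mD0 iI).
  have hd : h <= d by rewrite (le_trans hd3)// ler_pdivrMr ?ltr0n// ler_peMr ?ler1n// ltW.
  have sub := strip_sub hd; have mS := strip_meas h.
  have t0 x : (0 <= ((EFin \o (fun x => part true ((theta d x)%:C%C * DD j x * conjc (DD j x))%R)) x))%E.
    by rewrite /comp lee_fin ReSq; apply: mulr_ge0; [by have /andP[] := theta01 d x|exact: sqr_ge0].
  have mF := measurable_int _ iI.
  apply: (@le_trans _ _ (\int[area]_(x in strip h) (EFin \o (fun x => part true ((theta d x)%:C%C * DD j x * conjc (DD j x))%R)) x)%E); last first.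
    by apply: ge0_subset_integral => // x _; exact: t0.
  rewrite le_eqVlt; apply/orP; left; apply/eqP; apply: eq_integral => x; rewrite inE => /andP[x0 xh].
  rewrite /comp ReSq theta_low ?mul1r//; last by rewrite (le_trans (ltW xh)).
  by rewrite /DD /G /tsh ltNge (ltW xh) /= sub0r modulusN.
have nsf := rsqn_ge0 area (D0 : set mR2) f.
have sl0 := strip_le ord0; have sl1 := strip_le ord_max.
apply: (le_trans (leeD sl0 sl1)); rewrite -EFinD lee_fin.
have fin : c0 * (pI true (fun x => (theta d x)%:C%C) (DD ord0) (DD ord0) + pI true (fun x => (theta d x)%:C%C) (DD ord_max) (DD ord_max)) <=
   h * (((100 * K + 300 * L) * C1 + 300 * L) * ns f).
  apply: (le_trans (main _)); last first.
    clear main.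
    have gN j : ns (G j) <= ns (g j) := nsT _ (hg j).
    have n0 (v : R * R -> R[i]) : 0 <= ns v := rsqn_ge0 area (D0 : set mR2) v.
    have sA i j : pI true (fun x => (theta d x)%:C%C * A i j x) (G j) (G i) - pI true (fun x => (theta d x)%:C%C * A i j x) (g j) (g i) <= h * K * (4 * (ns (g j) + ns (g i))).
      by have := sfA i j; rewrite ler_norml => /andP[].
    have sB j : pI true (fun x => (theta d x)%:C%C * A1 j x) (G j) U - pI true (fun x => (theta d x)%:C%C * A1 j x) (g j) u <= h * K * (4 * (ns (g j) + ns u)).
      by have := sfB j; rewrite ler_norml => /andP[].
    have l1 := sA ord0 ord0; have l2 := sA ord0 ord_max; have l3 := sA ord_max ord0; have l4 := sA ord_max ord_max.
    have l5 := sB ord0; have l6 := sB ord_max; have m1 := gN ord0; have m2 := gN ord_max.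
    have e2 : 26 * L / h * ns e <= 26 * L * h * (8 * ns (g ord_max)).
      have Lh : 0 <= 26 * L / h by apply: divr_ge0; [clear -L0 A A1 A0 d0 c00 hA mD0 oD0; lra|exact: ltW].
      apply: (le_trans (ler_wpM2l Lh ne)); rewrite le_eqVlt; apply/orP; left; apply/eqP; field; exact: lt0r_neq0.
    have p1 := n0 u; have p2 := n0 (g ord0); have p3 := n0 (g ord_max).
    have EN' : ns u + (ns (g ord0) + ns (g ord_max)) <= C1 * ns f by exact: EN.
    have hK : 0 <= h * K by apply: mulr_ge0 => //; exact: ltW.
    have hL : 0 <= L * h by apply: mulr_ge0 => //; exact: ltW.
    exact: (savare_arith l1 l2 l3 l4 l5 l6 e2 m1 m2 p1 p2 p3 nsf EN' hK hL).
  apply: ae_imp2 (ae_imp2 (fun x p q => conj p q) (ae_imp2 (fun x p q => conj p q) (lA1 ord0).1.2 (lA1 ord_max).1.2) (ae_imp2 (fun x p q => conj p q) (lA ord0 ord0).1.2 (lA ord_max ord_max).1.2))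
    (ae_imp2 (fun x p q => conj p q) (lA ord0 ord_max).1.2 (ae_imp2 (fun x p q => conj p q) coefs_herm bA0.2)).
  move=> x [[b0 b1] [aa0 aa1]] [a01 [hx ha0]] Dx; have [r0 r1 a10 ell] := hx Dx.
  move: {b0}(b0 Dx) {b1}(b1 Dx) {aa0}(aa0 Dx) {aa1}(aa1 Dx) {a01}(a01 Dx) {ha0}(ha0 Dx) => b0 b1 aa0 aa1 a01 ha0.
  move: ell aa0 aa1; rewrite r0 r1 a10 !modulus_real => ell aa0 aa1; rewrite modulus_real in ha0.
  have th := theta01 d x; have /andP[th0 th1] := th.
  have mt (c : R[i]) (t : R) : modulus c <= M -> `|t| <= Ct -> modulus (c * t%:C%C) <= L.
    move=> cM tC; rewrite modulusM modulus_real; apply: le_trans LC; apply: ler_pM => //; exact: modulus_ge0.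
  have mt1 (c : R[i]) : modulus c <= M -> modulus (c * (theta d x)%:C%C) <= L.
    move=> cM; rewrite modulusM modulus_real ger0_norm//; apply: le_trans LM; apply: (le_trans _ cM); apply: ler_piMr => //; exact: modulus_ge0.
  have mtr (r t : R) : `|r| <= M -> `|t| <= Ct -> modulus (r * t)%:C%C <= L :> R.
    by move=> rM tC; rewrite modulus_real normrM; apply: le_trans LC; apply: ler_pM.
  have mth : modulus ((theta d x)%:C%C : R[i]) <= L by rewrite modulus_real (ger0_norm th0); clear -th1 L1 A A1 A0 d0 c00 hA mD0 oD0; lra.
  have mith : modulus ('i%C * (theta d x)%:C%C : R[i]) <= L.
    rewrite modulusM modulus_real (ger0_norm th0) /modulus /= expr0n add0r expr1n sqrtr1 mul1r; clear -th1 L1 A A1 A0 d0 c00 hA mD0 oD0; lra.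
  have mat : modulus (A0 x * theta d x)%:C%C <= L :> R.
    rewrite modulus_real normrM; apply: le_trans LM; rewrite -[leRHS]mulr1; apply: ler_pM => //; by rewrite ger0_norm.
  have := increment_point (g ord0 x) (g ord_max x) (G ord0 x) (G ord_max x) (u x) (U x) (f x) h0 L0 th ell
    (And4 (mtr _ _ aa0 (hCt ord0 x)) (mt _ _ a01 (hCt ord0 x)) (mt _ _ (_ : modulus (conjc (A ord0 ord_max x)) <= M) (hCt ord_max x)) (mtr _ _ aa1 (hCt ord_max x)))
    (And4 (mt1 _ b0) (mt1 _ b1) (mt _ _ (_ : modulus (conjc (A1 ord0 x)) <= M) (hCt ord0 x)) (mt _ _ (_ : modulus (conjc (A1 ord_max x)) <= M) (hCt ord_max x))) mat mth mith.
  rewrite !modulus_conj => /(_ a01 b0 b1) ip.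
  cbv zeta beta in ip; cbv beta.
  apply: (incr_arith (lt0r_neq0 h0) ip).
  - apply: (congr1 (fun z : R => c0 * z)).
    have q0 := ReSq (theta d x) (DD ord0 x); have q1 := ReSq (theta d x) (DD ord_max x).
    exact: (etrans (congr2 (fun y z : R => y + z) q0 q1) (esym (mulrDr _ _ _))).
  - exact: erefl.
  - by congr (_ + _ + _ + _ + _ + _ + _ + _ + _ - _); exact: mul1r.
have hns : 0 <= h * ns f by apply: mulr_ge0 => //; exact: ltW.
rewrite -(ler_pM2l c00); apply: (le_trans fin).
rewrite [leRHS](_ : _ = h * (((100 * K + 300 * L) * C1 + 300 * L) * ns f) + c0 * (h * ns f)).
  by rewrite lerDl; apply: mulr_ge0 => //; exact: ltW.
clear -c00 A A1 A0 d0 c00 hA mD0 oD0; field; exact: lt0r_neq0.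
Qed.

End coefficients.

(** * Geometry of the oscillating boundary and of the bad intervals *)

Section oscillation.
Context {R : realType}.
Local Notation mR := (measurableTypeR R).
Local Notation leb := (@lebesgue_measure R).
Implicit Types (b g : R -> R).

Lemma periodic_int g : (forall t, g (t + 1) = g t) -> forall (k : int) t, g (t + k%:~R) = g t.
Proof.
move=> per; have pn (n : nat) t : g (t + n%:R) = g t.
  by elim: n t => [|n IH] t; rewrite ?addr0// -natr1 addrA per.
case=> n t; first exact: (pn n).
have -> : (Negz n)%:~R = - (n.+1%:R) :> R by [].
by rewrite -[LHS](pn n.+1) subrK.
Qed.

Lemma periodic_max g : continuous g -> (forall t, g (t + 1) = g t) ->
  exists2 c, 0 <= c <= 1 & forall t, g t <= g c.
Proof.
move=> cg per; have [c ci hc] := @EVT_max R g 0 1 ler01 (continuous_subspaceT cg).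
exists c; first by rewrite in_itv /= in ci.
move=> t; rewrite -(periodic_int per (- Num.floor t) t); apply: hc.
have /andP[h1 h2] := floor_itv t.
rewrite in_itv /= mulrNz subr_ge0 h1 /= lerBlDl; move: h2; rewrite intrD => /ltW; exact.
Qed.

Lemma max01_ge b : continuous b -> (forall t, b (t + 1) = b t) -> forall t, b t <= max01 b.
Proof.
move=> cb per t; have [c c01 hc] := periodic_max cb per; apply: (le_trans (hc t)).
by apply: ub_le_sup; [exists (b c) => _ [x _ <-]; exact: hc|exists c].
Qed.

Lemma derive1_periodic b : (forall t, b (t + 1) = b t) -> forall t, derive1 b (t + 1) = derive1 b t.
Proof.
move=> per t; rewrite /derive1.
by rewrite (_ : (fun h : R => h^-1 *: (b (h + (t + 1)) - b (t + 1))) = (fun h : R => h^-1 *: (b (h + t) - b t)))//; apply/funext => h; rewrite addrA !per.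
Qed.

Lemma C2_derive b : C2_fun b -> forall t, is_derive t (1 : R) b (derive1 b t).
Proof. by move=> [db _ _] t; rewrite derive1E; exact/derivableP. Qed.

Lemma C2_cont b : C2_fun b -> continuous b /\ continuous (derive1 b).
Proof.
move=> [db d2b _]; split => t; apply: differentiable_continuous; apply/derivable1_diffP.
  exact: db.
exact: d2b.
Qed.

Lemma continuous_div (e : R) : continuous (fun s : R => s / e).
Proof. by apply: contM; [move=> ?; exact: cvg_id|exact: cont_cst]. Qed.

Lemma indic_itv_ge (al k e : R) (A : set mR) : 0 < k -> 0 <= al -> al + k <= e -> measurable A ->
  `]al, (al + k)[%classic `<=` A -> (k%:E <= \int[leb]_(t in `]0%R, e[) (\1_A t)%:E)%E.
Proof.
move=> k0 a0 ake mA sA; have mI (x y : R) : measurable (`]x, y[%classic : set mR) by exact: measurable_itv.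
rewrite (integral_indic leb (mI 0 e) mA).
apply: (@le_trans _ _ (leb (`]al, (al + k)[%classic : set mR))).
  by rewrite /= lebesgue_measure_itv /= lte_fin ltrDl k0 -EFinB addrAC subrr add0r.
apply: le_measure; rewrite ?inE; [exact: mI|by apply: measurableI|].
move=> t /= ti; split; first exact: sA.
move: ti; rewrite /= !in_itv /= => /andP[t1 t2]; apply/andP; split; lra.
Qed.

(** As b is not constant, b' is non-zero somewhere and |b'| > c1 in a neighbourhood of radius r. By
    periodicity a copy of it, scaled by e, is met by every window of length e. *)
Lemma oscillation_set b : C2_fun b -> (forall t, b (t + 1) = b t) -> ~ (exists k, forall t, b t = k) ->
  exists c1 j : R, [/\ 0 < c1, 0 < j & forall e : R, 0 < e ->
    measurable ([set s | c1 < `|derive1 b (s / e)|] : set mR) /\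
    forall s : R, ((j * e)%:E <= \int[leb]_(t in `]0%R, e[)
      (\1_([set s | c1 < `|derive1 b (s / e)|] : set mR) (s + t)%R)%:E)%E].
Proof.
move=> C2 per nc; have pb' := derive1_periodic per; have [cb cb'] := C2_cont C2; have isd := C2_derive C2.
have [t0 n0] : exists t0, derive1 b t0 != 0.
  apply: contrapT => /forallNP h; apply: nc; exists (b 0) => t; have [c _ E] := mean_value 0 t isd.
  by have := h c => /negP/negPn/eqP z; move: E; rewrite z mul0r => /eqP; rewrite subr_eq0 => /eqP.
pose c1 := `|derive1 b t0| / 2; have c10 : 0 < c1 by rewrite divr_gt0// normr_gt0.
have /cvgrPdist_lt/(_ c1 c10)/nbhs_ballP[r0 r00 hr] := cb' t0.
(* At most 1/2, so that one half of the scaled neighbourhood always fits into the window. *)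
pose r := Num.min r0 (1 / 2); have rp : 0 < r by rewrite lt_min r00 divr_gt0.
have r1 : r <= r0 by rewrite ge_min lexx.
have r2 : r <= 1 / 2 by rewrite ge_min lexx orbT.
have big (z : R) : `|t0 - z| < r -> c1 < `|derive1 b z|.
  move=> h; have hz : `|derive1 b t0 - derive1 b z| < c1 by apply: hr; rewrite -ball_normE /=; exact: lt_le_trans h r1.
  have := ler_distD 0 (derive1 b t0) (derive1 b z); have := lerB_dist (derive1 b t0) (derive1 b z).
  move: hz; rewrite /c1; move: (`|_ - _|) (`|derive1 b t0|) (`|derive1 b z|) => x y w; lra.
exists c1, r; split => // e e0; set J := [set s | _].
have cJ : continuous (fun s : R => `|derive1 b (s / e)|).
  have cd : continuous (fun s : R => derive1 b (s / e)).
    by move=> y; apply: (@continuous_comp _ _ _ (fun s : R => s / e) (derive1 b)); [exact: continuous_div|exact: cb'].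
  by move=> y; exact: (cvg_norm (cd y)).
have mJ : measurable (J : set mR).
  apply: open_measurable; rewrite (_ : J = (fun s => `|derive1 b (s / e)|) @^-1` [set x | c1 < x])//.
  by apply: open_comp; [move=> y _; exact: cJ|exact: open_gt].
(* Selects the copy y of e * t0 with s < y <= s + e. *)
split => // s; pose k := Num.floor (s / e - t0); have /andP[k1 k2] := floor_itv (s / e - t0).
pose y := e * (t0 + (k + 1)%:~R); have re0 : 0 < r * e by exact: mulr_gt0.
have ne : e != 0 by exact: lt0r_neq0.
have ys : s < y.
  have : s / e < t0 + (k + 1)%:~R by move: k2; rewrite ltrBlDl.
  by rewrite ltr_pdivrMr// mulrC.
have ye : y <= s + e.
  have : t0 + (k + 1)%:~R <= s / e + 1 by move: k1; rewrite intrD lerBrDl addrA => h; rewrite lerD2r.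
  by move=> /(ler_wpM2l (ltW e0)); rewrite -/y mulrDr mulr1 mulrCA divff// mulr1.
have near (t : R) : `|y - (s + t)| < r * e -> J (s + t).
  move=> h; rewrite /J /= -(periodic_int pb' (- (k + 1))); apply: big.
  rewrite mulrNz (_ : t0 - _ = (y - (s + t)) / e); last by rewrite /y; field.
  by rewrite normrM normfV (gtr0_norm e0) ltr_pdivrMr.
have mJs : measurable ([set t | J (s + t)] : set mR).
  rewrite (_ : [set t | J (s + t)] = (fun t : mR => (t + s : mR)) @^-1` J); last by apply/seteqP; split => t /=; rewrite addrC.
  by rewrite -[_ @^-1` _]setTI; exact: (measurable_add s measurableT mJ).
have EI : (\int[leb]_(t in `]0%R, e[) (\1_J (s + t)%R)%:E = \int[leb]_(t in `]0%R, e[) (\1_([set t | J (s + t)] : set mR) t)%:E)%E.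
  by apply: eq_integral => t _; rewrite !indicE !mem_setE.
rewrite EI; have rr : r * e <= e / 2 by have := ler_wpM2r (ltW e0) r2; move: (r * e) => z; clear; lra.
clearbody y; have yz (t : R) : y - s < t < y - s + r * e \/ y - s - r * e < t < y - s -> `|y - (s + t)| < r * e.
  move: re0; move: (r * e) => re re0; clear; move=> h; rewrite ltr_norml; apply/andP.
  by case: h => /andP[h1 h2]; split; lra.
(* Only one side of y is used, the one with room: the right side if y lies in the first half of the
   window, the left side otherwise. *)
case: (lerP y (s + e / 2)) => hy.
  have q1 : 0 <= y - s by rewrite subr_ge0 ltW.
  have q2 : y - s + r * e <= e by move: hy rr; move: (r * e) => re; clear; lra.
  apply: (indic_itv_ge re0 q1 q2 mJs) => t /=; rewrite in_itv /= => h; apply: near; apply: yz; by left.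
have q1 : 0 <= y - s - r * e by move: hy rr; move: (r * e) => re; clear; lra.
have q2 : y - s - r * e + r * e <= e by move: ye; move: (r * e) => re; clear; lra.
apply: (indic_itv_ge re0 q1 q2 mJs) => t /=; rewrite in_itv /= subrK => h; apply: near; apply: yz; by right.
Qed.

(** If a <= 2 m the bound is at least 1. Otherwise the points y - th * a sweep a segment of length a
    < c, too short to meet two of the separated intervals; they lie in a single one for a set of th
    of length 2 m / a, which is at most 3 m / (a + m) because 2 m < a. *)
Lemma bad_thin (I : set int) (X : int -> R) (sp c m : R) :
  (forall n k, I n -> I k -> n != k -> sp <= `|X n - X k|) -> 0 < m -> c + 2 * m <= sp ->
  let Bad : set mR := \bigcup_(n in I) `]X n - m, X n + m[%classic in
  measurable Bad /\ forall y a : R, 0 < a < c ->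
    (\int[leb]_(th in `]0%R, 1%R[) (\1_Bad (y - th * a)%R)%:E <= (3 * m / (a + m))%:E)%E.
Proof.
move=> sep m0 cm Bad; have mBad : measurable Bad.
  by apply: open_measurable; apply: bigcup_open => n _; exact: interval_open.
split => // y a /andP[a0 ac]; have am : 0 < a + m by exact: addr_gt0.
have mI (x z : R) : measurable (`]x, z[%classic : set mR) by exact: measurable_itv.
have ml : measurable_fun setT (fun th : mR => (y - (th : R) * a : mR)).
  by apply: measurable_funB => //; exact: measurable_funM.
have mf : measurable_fun setT (fun th : mR => (\1_Bad (y - (th : R) * a)%R)%:E : \bar R).
  by apply/measurable_EFinP; exact: (measurableT_comp (measurable_indic mBad) ml).
have f0 (th : mR) : (0 <= (\1_Bad (y - (th : R) * a)%R : R)%:E)%E by rewrite lee_fin.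
have f1 (th : R) : 0 < th < 1 -> ((\1_Bad (y - th * a)%R : R)%:E <= 1)%E.
  by move=> _; rewrite lee_fin indicE; case: (_ \in _).
case: (lerP a (2 * m)) => ha.
  apply: (le_trans (le_integral_cst ler01 lee01 f0 mf f1)); rewrite subr0 mule1 lee_fin ler_pdivlMr// mul1r; lra.
have [[th0 [n In th0I]]|no] := pselect (exists th0 : R, exists2 n, I n & 0 < th0 < 1 /\ `|y - th0 * a - X n| < m); last first.
  rewrite integral0_eq; first by rewrite lee_fin divr_ge0 ?mulr_ge0 ?ltW.
  move=> th /=; rewrite in_itv /= => th01; rewrite indicE memNset//= => -[n In]; rewrite /= in_itv /= => /andP[h1 h2].
  apply: no; exists th, n => //; split => //; rewrite ltr_norml; apply/andP; split; lra.
have [/andP[p0 p1] p2] := th0I.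
pose K := `](y - X n - m) / a, (y - X n + m) / a[%classic : set mR.
apply: (@le_trans _ _ (\int[leb]_(th in `]0%R, 1%R[) (\1_K th)%:E)%E).
  apply: ge0_le_integral; [exact: mI|by move=> th _; exact: f0|exact: measurable_funTS|by apply: measurable_funTS; apply/measurable_EFinP; apply: measurable_indic; exact: mI|].
  move=> th /=; rewrite in_itv /= => /andP[q0 q1]; rewrite lee_fin !indicE ler_nat.
  case: (boolP (y - th * a \in Bad)) => // /set_mem[k Ik]; rewrite /= in_itv /= => /andP[h1 h2].
  (* Two different intervals met by the same segment would have centres at distance less than c + 2
     m. *)
  have kn : k = n.
    apply/eqP/negPn/negP => kn; have := sep _ _ Ik In kn; apply/negP; rewrite -ltNge.
    move: p2; rewrite !ltr_norml => /andP[z1 z2]; have := mulr_gt0 p0 a0; have := mulr_gt0 q0 a0.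
    have : th0 * a < a by rewrite gtr_pMl.
    have : th * a < a by rewrite gtr_pMl.
    move=> *; apply/andP; split; lra.
  rewrite kn in h1 h2; have Kth : K th by rewrite /K /= in_itv /= ltr_pdivrMr// ltr_pdivlMr//; apply/andP; split; lra.
  by rewrite (mem_set Kth).
rewrite (integral_indic leb (mI 0 1) (mI _ _)).
apply: (@le_trans _ _ (leb K)); first by apply: le_measure; rewrite ?inE; [by apply: measurableI|exact: mI|move=> ? []].
have KE : (y - X n + m) / a - (y - X n - m) / a = 2 * m / a by field; exact: lt0r_neq0.
have K0 : 0 < 2 * m / a by rewrite divr_gt0// mulr_gt0.
rewrite /K /= lebesgue_measure_itv /= lte_fin -subr_gt0 KE K0 -EFinB KE lee_fin ler_pdivrMr// mulrAC ler_pdivlMr//.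
have := mulr_gt0 m0 a0; nra.
Qed.

Lemma lower_derive b (h e : R) : (forall t, is_derive t (1 : R) b (derive1 b t)) ->
  forall s, is_derive s (1 : R) (fun s => h * b (s / e)) (h / e * derive1 b (s / e)).
Proof.
move=> isd s; have dl := is_derive_affine e^-1 0 s.
have dc := @is_derive1_comp _ b (fun s => e^-1 * s + 0) s _ _ (isd _) dl.
rewrite (_ : (fun s => h * b (s / e)) = (fun s => h * (b \o (fun s => e^-1 * s + 0)) s)); last first.
  by apply/funext => r /=; rewrite addr0 (mulrC r).
apply: (is_derive_eq (is_deriveM (is_derive_cst h s 1) dc)).
by rewrite /GRing.scale /= mulr0 !addr0 (mulrC e^-1 s); ring.
Qed.

Lemma robin_graph (a : R * R -> R) d0 (p : R -> R) : admissible_robin a d0 -> continuous p ->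
  (forall s, 0 <= p s <= d0) -> continuous (fun s => a (s, p s)).
Proof.
move=> [_ /pinfty_ex_gt0[L L0 hL]] cp pd s; apply/cvgrPdist_lt => e e0.
have eL : 0 < e / L by exact: divr_gt0.
have /cvgrPdist_lt/(_ _ eL) h1 := cp s.
have /cvgrPdist_lt/(_ _ eL) h2 : t @[t --> s] --> s by exact: cvg_id.
near=> t; apply: (le_lt_trans (hL ((s, p s), (t, p t)) (conj (pd s) (pd t)))).
rewrite /= prod_normE /= mulrC -ltr_pdivlMr// gt_max; apply/andP; split; near: t; [exact: h2|exact: h1].
Unshelve. all: by end_near. Qed.

(** The essential bound holds almost everywhere only. A rectangle of positive area near x contains a
    point where it holds, and the Lipschitz condition carries it to x over a distance of at most 1 +
    d0. *)
Lemma robin_bounded (a : R * R -> R) d0 : 0 < d0 -> admissible_robin a d0 ->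
  exists2 M, 0 <= M & forall x, 0 <= x.2 <= d0 -> `|a x| <= M.
Proof.
move=> d00 [[/= [_ [M HM]] _] /pinfty_ex_gt0[L L0 hL]].
exists (`|M| + L * (1 + d0)); first by rewrite addr_ge0// mulr_ge0 ?ltW// addr_gt0.
move=> x xd; pose Bx : set (R * R) := `]x.1, (x.1 + 1)[%classic `*` `]0, d0[%classic.
have [y [By ay]] : exists y, Bx y /\ modulus (a y)%:C%C <= M.
  apply: contrapT => /forallNP no; have [N [mN N0 sN]] := HM.
  have sub : Bx `<=` N.
    move=> y By; apply: sN => /= h; apply: (no y); split => //; apply: h.
    by case: By => _ /=; rewrite in_itv.
  have mB : measurable (Bx : set (mR * mR)) by apply: measurableX; exact: measurable_itv.
  have aB : (area Bx <= 0)%E by rewrite -N0; apply: le_measure; rewrite ?inE.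
  have aE : area Bx = d0%:E.
    apply: (etrans (product_measure1E (@lebesgue_measure R) (@lebesgue_measure R) (measurable_itv `]x.1, (x.1 + 1)[) (measurable_itv `]0, d0[))).
    by rewrite /= !lebesgue_measure_itv /= !lte_fin ltrDl ltr01 d00 -!EFinB addrAC subrr add0r subr0 mul1e.
  by move: aB; rewrite aE lee_fin leNgt d00.
rewrite modulus_real in ay; have [/= y1 y2] := By; rewrite !in_itv /= in y1 y2.
have yd : 0 <= y.2 <= d0 by case/andP: y2 => u1 u2; rewrite !ltW.
have := hL (x, y) (conj xd yd) => /= h.
have n1 : `|x - y| <= 1 + d0.
  rewrite prod_normE /= ge_max !ler_norml; case/andP: xd => ? ?; case/andP: y1 => ? ?; case/andP: y2 => ? ?.
  apply/andP; split; apply/andP; split; lra.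
have h3 := ler_wpM2l (ltW L0) n1; have h4 := ler_norm M; have := ler_distD 0 (a x) (a y).
have := ler_normD (a x - a y) (a y); rewrite subrK; move: h h3; lra.
Qed.

End oscillation.

(** * The layer estimate for functions of W_2^1 *)

Section layer.
Context {R : realType}.
Local Notation mR := (measurableTypeR R).
Local Notation mR2 := (measurableTypeR R * measurableTypeR R)%type.
Local Notation leb := (@lebesgue_measure R).

Lemma ereal_sum2 (a al k : R) (X1 X2 Q1 Q2 N1 N2 : \bar R) : 0 <= a -> 0 <= al -> 0 <= k ->
  (0 <= X1 -> 0 <= X2 -> 0 <= Q1 -> 0 <= Q2 -> 0 <= N1 -> 0 <= N2 ->
   a%:E * X1 <= al%:E * Q1 + k%:E * N1 -> a%:E * X2 <= al%:E * Q2 + k%:E * N2 ->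
   a%:E * (X1 + X2) <= al%:E * (Q1 + Q2) + k%:E * (N1 + N2))%E.
Proof.
move=> a0 al0 k0 x1 x2 q1 q2 n1 n2 h1 h2; rewrite !ge0_muleDr//.
by apply: (le_trans (leeD h1 h2)); rewrite addeACA.
Qed.

Lemma ereal_sum6 (a al k : R) (X1 X2 Q1 Q2 P1 S1 Y1 P2 S2 Y2 : \bar R) : 0 <= a -> 0 <= al -> 0 <= k ->
  (0 <= X1 -> 0 <= X2 -> 0 <= Q1 -> 0 <= Q2 -> 0 <= P1 + S1 + Y1 -> 0 <= P2 + S2 + Y2 ->
   a%:E * X1 <= al%:E * Q1 + k%:E * (P1 + S1 + Y1) -> a%:E * X2 <= al%:E * Q2 + k%:E * (P2 + S2 + Y2) ->
   a%:E * (X1 + X2) <= al%:E * (Q1 + Q2) + k%:E * ((P1 + P2) + (S1 + S2) + (Y1 + Y2)))%E.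
Proof.
move=> a0 al0 k0 x1 x2 q1 q2 n1 n2 h1 h2.
have -> : ((P1 + P2) + (S1 + S2) + (Y1 + Y2) = (P1 + S1 + Y1) + (P2 + S2 + Y2))%E.
  by rewrite [RHS]addeACA; congr (_ + _)%E; rewrite addeACA.
exact: ereal_sum2.
Qed.

(** [r], [q] and [n] are the approximation errors of the layer norm, the boundary norm and the
    energy; replacing on both sides of the inequality costs 2 each time, hence the 4. *)
Lemma ereal_limit (a al k : R) (Xv Xw r Qw QT q Nw Nv n : \bar R) : 0 <= a -> 0 <= al -> 0 <= k ->
  (0 <= Xw -> 0 <= r -> 0 <= QT -> 0 <= q -> 0 <= Nv -> 0 <= n ->
   Xv <= 2%:E * (Xw + r) -> Qw <= 2%:E * (QT + q) -> Nw <= 2%:E * (Nv + n) ->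
   a%:E * Xw <= al%:E * Qw + k%:E * Nw ->
   a%:E * Xv <= 4%:E * (al%:E * QT + k%:E * Nv) + 4%:E * ((al%:E * q + k%:E * n) + a%:E * r))%E.
Proof.
move=> a0 al0 k0 x0 r0 Q0 q0 N0 n0 h1 h2 h3 h4.
have m (c : R) (x : \bar R) : 0 <= c -> (0 <= x)%E -> (0 <= c%:E * x)%E by move=> c0 ?; apply: mule_ge0 => //; rewrite lee_fin.
have c2 : (0 <= 2%:E :> \bar R)%E by [].
have e1 (c : R) (x y : \bar R) : (0 <= x)%E -> (0 <= y)%E -> (c%:E * (2%:E * (x + y)) = 2%:E * (c%:E * x + c%:E * y))%E.
  by move=> ? ?; rewrite muleCA ge0_muleDr.
have g1 : (a%:E * Xv <= 2%:E * (a%:E * Xw + a%:E * r))%E by rewrite -e1//; apply: lee_wpmul2l => //; rewrite lee_fin.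
have g2 : (al%:E * Qw <= 2%:E * (al%:E * QT + al%:E * q))%E by rewrite -e1//; apply: lee_wpmul2l => //; rewrite lee_fin.
have g3 : (k%:E * Nw <= 2%:E * (k%:E * Nv + k%:E * n))%E by rewrite -e1//; apply: lee_wpmul2l => //; rewrite lee_fin.
have g4 := le_trans h4 (leeD g2 g3).
have ar := m _ _ a0 r0; have Aq := m _ _ al0 q0; have AQ := m _ _ al0 Q0; have KN := m _ _ k0 N0; have Kn := m _ _ k0 n0.
apply: (le_trans g1).
apply: (@le_trans _ _ (2%:E * (2%:E * ((al%:E * QT + k%:E * Nv) + (al%:E * q + k%:E * n)) + 2%:E * (a%:E * r)))%E).
  apply: lee_wpmul2l => //; apply: leeD.
    apply: (le_trans g4); rewrite -ge0_muleDr ?adde_ge0//; apply: lee_wpmul2l => //.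
    by rewrite addeACA.
  by rewrite -[leLHS]mul1e; apply: lee_wpmul2r => //; rewrite lee_fin ler1n.
have s1 := adde_ge0 AQ KN; have s2 := adde_ge0 Aq Kn.
rewrite -ge0_muleDr ?adde_ge0// muleA -EFinM (_ : 2 * 2 = 4); last by ring.
by rewrite -addeA ge0_muleDr ?adde_ge0.
Qed.

Variables (p : R -> R) (B T d : R).
Hypotheses (cp : continuous p) (p0 : forall s, 0 <= p s) (pB : forall s, p s <= B) (BT : B < T) (Td : T <= d).
Variables (e j kap : R) (J Bad : set mR).
Hypotheses (e0 : 0 < e) (j0 : 0 < j) (kap0 : 0 <= kap) (mJ : measurable J) (mBad : measurable Bad).
Hypothesis HJ : forall s : R, ((j * e)%:E <= \int[leb]_(t in `]0%R, e[) (\1_J (s + t)%R)%:E)%E.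
(** Assumed for all smooth functions at once, since it is applied to the real and imaginary parts of
    every approximant. *)
Hypothesis Hbad : forall F F1 F2 : R * R -> R, continuous F -> continuous F1 -> continuous F2 ->
  (forall x, is_derive x (basis ord0) F (F1 x)) -> (forall x, is_derive x (basis ord_max) F (F2 x)) ->
  forall t, B < t < T -> (\int[leb]_(s in Bad) (F (s, t) ^+ 2)%:E <=
    kap%:E * \int[area]_(x in upper d p) (F1 x ^+ 2 + F2 x ^+ 2 + F x ^+ 2)%:E)%E.

Local Notation D := (upper d p).
Local Notation U := (upper T p).
Let oD : open D := upper_open cp.
Let oU : open U := upper_open cp.
Let mD : measurable (D : set mR2) := upper_measurable d cp.
Let mU : measurable (U : set mR2) := upper_measurable T cp.
Let mJB : measurable (J `\` Bad) := measurableD mJ mBad.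
Let sUD : U `<=` D. Proof. by move=> x /andP[x1 x2]; apply/andP; split => //; exact: lt_le_trans Td. Qed.
Let al : R := 2 * T * (4 * (T - B)).
Let kk : R := 2 * T * ((T - B) * (4 * T + 2 * kap) + 2 * e ^+ 2) + 2 * T ^+ 2 * (T - B) * j.
Let a : R := j * (T - B).
Let T0 : 0 < T. Proof. exact: le_lt_trans (le_trans (p0 0) (pB 0)) BT. Qed.
Let H0 : 0 < T - B. Proof. by rewrite subr_gt0. Qed.
Let al0 : 0 <= al. Proof. by rewrite !mulr_ge0 ?ltW. Qed.
Let kk0 : 0 <= kk.
Proof.
have t0 := ltW T0; have h0 := ltW H0; have jj := ltW j0; have e2 := sqr_ge0 e; have t2 := sqr_ge0 T.
have s1 : 0 <= 4 * T + 2 * kap by apply: addr_ge0; apply: mulr_ge0.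
have s2 : 0 <= (T - B) * (4 * T + 2 * kap) + 2 * e ^+ 2 by apply: addr_ge0; apply: mulr_ge0.
by rewrite /kk; apply: addr_ge0; apply: mulr_ge0 => //; apply: mulr_ge0 => //; apply: mulr_ge0.
Qed.
Let a0 : 0 <= a. Proof. by rewrite mulr_ge0 ?ltW. Qed.
Local Notation NN u g := (sqa D (g ord0) + sqa D (g ord_max) + sqa D u)%E.

Lemma layer_smoothC w : csmooth_cpt w ->
  (a%:E * sqa U w <= al%:E * sqn leb (J `\` Bad) (fun s => w (s, p s)) + kk%:E * NN w (fun j => cderiv j w))%E.
Proof.
move=> sw; have C b := part_smooth b sw.
have E b i : (fun x => part b (cderiv i w x)) = (fun x => 'D_(basis i) (fun x => part b (w x)) x).
  by apply/funext => x; rewrite part_cderiv.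
have c0 b : continuous (fun x => part b (w x)) by exact: Cinfty_continuous.
have c1 b i : continuous (fun x => part b (cderiv i w x)) by rewrite E; exact/Cinfty_continuous/Cinfty_D.
have dd b i x : is_derive x (basis i) (fun x => part b (w x)) (part b (cderiv i w x)).
  by rewrite part_cderiv; exact: Cinfty_is_derive.
have LS b := layer_smooth (c0 b) (c1 b ord0) (c1 b ord_max) (dd b ord0) (dd b ord_max) cp p0 pB BT Td e0 j0 kap0 mJ mBad HJ
  (Hbad (c0 b) (c1 b ord0) (c1 b ord_max) (dd b ord0) (dd b ord_max)).
have ms (f : R * R -> R) : continuous f -> measurable_fun (D : set mR2) (fun x : mR2 => (f x ^+ 2)%:E).
  by move=> cf; apply: measurable_funTS; exact: sqr_measurable_plane.
have EN b : (\int[area]_(x in D) (part b (cderiv ord0 w x) ^+ 2 + part b (cderiv ord_max w x) ^+ 2 + part b (w x) ^+ 2)%:E =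
   \int[area]_(x in D) (part b (cderiv ord0 w x) ^+ 2)%:E + \int[area]_(x in D) (part b (cderiv ord_max w x) ^+ 2)%:E +
   \int[area]_(x in D) (part b (w x) ^+ 2)%:E)%E.
  have q (f : R * R -> R) (x : mR2) : D x -> (0 <= (f x ^+ 2)%:E)%E by move=> _; rewrite lee_fin sqr_ge0.
  have m0 := ms _ (c1 b ord0); have m1 := ms _ (c1 b ord_max); have m2 := ms _ (c0 b).
  rewrite -(ge0_integralD area mD (q _) m0 (q _) m1) -(ge0_integralD area mD _ _ (q _) m2)//.
    by move=> x _; rewrite adde_ge0// lee_fin sqr_ge0.
  exact: (emeasurable_funD m0 m1).
have mw := csmooth_cmeas oD sw; have mwU := csmooth_cmeas oU sw; have md i := cderiv_cmeas i oD sw.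
have mg : cmeas (J `\` Bad) (fun s => w (s, p s)).
  by have [g1 g2] := graph_cmeas cp sw; split; exact: measurable_funTS.
rewrite /sqa (sqn_parts area mU mwU) (sqn_parts leb mJB mg) (sqn_parts area mD mw) (sqn_parts area mD (md ord0)) (sqn_parts area mD (md ord_max)).
have L1 := LS true; have L2 := LS false; rewrite !EN in L1 L2.
have i0 (f : R * R -> R) E' : (0 <= \int[area]_(x in E') (f x ^+ 2)%:E)%E by exact: int_sqr_ge0.
have i1 (f : mR -> R) E' : (0 <= \int[leb]_(x in E') (f x ^+ 2)%:E)%E by exact: int_sqr_ge0.
exact: (ereal_sum6 a0 al0 kk0 (i0 _ _) (i0 _ _) (i1 _ _) (i1 _ _)
   (adde_ge0 (adde_ge0 (i0 _ _) (i0 _ _)) (i0 _ _)) (adde_ge0 (adde_ge0 (i0 _ _) (i0 _ _)) (i0 _ _)) L1 L2).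
Qed.

(** [S] is any limit of the boundary values of the approximants; it will be the trace of the Robin
    solution while u here is the difference v. *)
Lemma layer_jet u g w (S : R -> R[i]) : jet D u g w -> cmeas (setT : set mR) S ->
  vanishes (fun n => sqn leb (setT : set mR) (fun s => w n (s, p s) - S s)) ->
  (a%:E * sqa U u <= 4%:E * (al%:E * sqn leb (J `\` Bad) S + kk%:E * NN u g))%E.
Proof.
move=> [sw hu hg c1 c2] mS cS; have [mu _] := hu; have mg i : cmeasurable D (g i) by case: (hg i).
pose q n := sqn leb (setT : set mR) (fun s => w n (s, p s) - S s)%R.
pose r n := sqa D (fun x => w n x - u x)%R.
pose nn n := (sqa D (fun x => cderiv ord0 (w n) x - g ord0 x)%R + sqa D (fun x => cderiv ord_max (w n) x - g ord_max x)%R + r n)%E.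
have m (c : R) (x : \bar R) : 0 <= c -> (0 <= x)%E -> (0 <= c%:E * x)%E by move=> ? ?; apply: mule_ge0 => //; rewrite lee_fin.
have s0 (E : set (R * R)) (v : R * R -> R[i]) : (0 <= sqa E v)%E by exact: sqa_ge0.
have nn0 n : (0 <= nn n)%E by rewrite /nn /r; apply: adde_ge0; [apply: adde_ge0|]; exact: s0.
have sub2 (dd : measure_display) (X : measurableType dd) (mu' : {measure set X -> \bar R}) (E : set X) (f h : X -> R[i]) :
    measurable E -> cmeas E f -> cmeas E h -> (sqn mu' E f <= 2%:E * (sqn mu' E h + sqn mu' E (fun x => f x - h x)%R))%E.
  move=> mE mf mh; rewrite ge0_muleDr ?sqn_ge0// (_ : sqn mu' E f = sqn mu' E (fun x => h x + (f x - h x))%R).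
    by apply: sqnD => //; exact: cmeasB.
  by congr sqn; apply/funext => x; rewrite addrC subrK.
apply: (vanishes_le_const (a := fun n => (4%:E * ((al%:E * q n + kk%:E * nn n) + a%:E * r n))%E)).
- apply: (@vanishes_le _ 4 _ (fun n => (al%:E * q n + kk%:E * nn n) + a%:E * r n)%E) => //.
  apply: vanishesD; last exact: (@vanishes_le _ a _ r).
  apply: vanishesD; first exact: (@vanishes_le _ al _ q).
  have vn : vanishes nn := vanishesD (vanishesD (c2 ord0) (c2 ord_max)) c1.
  exact: (@vanishes_le _ kk _ nn).
- apply: (m _ _ (ler0n _ 4)); apply: adde_ge0; [apply: (m _ _ al0); exact: sqn_ge0|apply: (m _ _ kk0); apply: adde_ge0; [apply: adde_ge0|]; exact: s0].
move=> n; have sn := sw n; have mw := csmooth_cmeas oD sn; have md i := cderiv_cmeas i oD sn.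
have mwU := csmooth_cmeas oU sn; have muU := cmeas_sub mD sUD mu.
have gT := graph_cmeas cp sn.
have re (f : mR -> R[i]) : cmeas (setT : set mR) f -> cmeas (J `\` Bad) f by move=> [f1 f2]; split; exact: measurable_funTS.
have mono (f : mR -> R[i]) : cmeas (setT : set mR) f -> (sqn leb (J `\` Bad) f <= sqn leb (setT : set mR) f)%E.
  move=> mf; apply: ge0_subset_integral => //; first exact: msqrE.
  by move=> x _; rewrite lee_fin sqr_ge0.
apply: (ereal_limit a0 al0 kk0 _ _ _ _ _ _ _ _ _ (layer_smoothC sn)) => //.
- exact: sqn_ge0.
- exact: sqn_ge0.
- exact: sqn_ge0.
- by apply: adde_ge0; [apply: adde_ge0|]; exact: s0.
- apply: (le_trans (sub2 _ _ area U u (w n) mU muU mwU)); apply: lee_wpmul2l => //; apply: leeD2l.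
  by rewrite sqn_sym; apply: sqa_sub => //; exact: cmeasB.
- apply: (le_trans (sub2 _ _ leb _ _ S mJB (re _ gT) (re _ mS))); apply: lee_wpmul2l => //; apply: leeD2l.
  by apply: mono; exact: cmeasB.
have i0 := sub2 _ _ area D _ _ mD mw mu; have i1 i := sub2 _ _ area D _ _ mD (md i) (mg i).
apply: (le_trans (leeD (leeD (i1 ord0) (i1 ord_max)) i0)).
have F (x y z : \bar R) : (0 <= x)%E -> (0 <= y)%E -> (0 <= z)%E -> (2%:E * x + 2%:E * y + 2%:E * z = 2%:E * (x + y + z))%E.
  by move=> x0 y0 z0; rewrite -(ge0_muleDr _ x0 y0) -(ge0_muleDr _ (adde_ge0 x0 y0) z0).
have pos E (v v' : R * R -> R[i]) : (0 <= sqn area E v + sqn area E v')%E by apply: adde_ge0; exact: sqn_ge0.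
rewrite (F _ _ _ (pos _ _ _) (pos _ _ _) (pos _ _ _)); apply: lee_wpmul2l => //.
rewrite le_eqVlt; apply/orP; left; apply/eqP; rewrite /nn /r /sqa.
have G (x1 y1 x2 y2 x3 y3 : \bar R) : ((x1 + y1) + (x2 + y2) + (x3 + y3) = (x1 + x2 + x3) + (y1 + y2 + y3))%E.
  by rewrite (addeACA x1 y1 x2 y2) (addeACA (x1 + x2)%E (y1 + y2)%E x3 y3).
exact: G.
Qed.

End layer.

(** * Extension by zero, and approximants adapted to the trace *)

Section extension.
Context {R : realType}.
Local Notation mR := (measurableTypeR R).
Local Notation mR2 := (measurableTypeR R * measurableTypeR R)%type.
Local Notation leb := (@lebesgue_measure R).
Implicit Types (D E : set (R * R)) (u v h : R * R -> R[i]).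

Lemma cmeas_ext D E h : measurable (E : set mR2) -> measurable (D : set mR2) -> cmeasurable E h ->
  (forall x, D x -> ~ E x -> h x = 0) -> cmeasurable D h.
Proof.
move=> mE mD [h1 h2] z; have key (F : R * R -> R) : measurable_fun (E : set mR2) (F : mR2 -> R) ->
    (forall x, D x -> ~ E x -> F x = 0) -> measurable_fun (D : set mR2) (F : mR2 -> R).
  move=> mF zF; have mr : measurable_fun setT ((F : mR2 -> R) \_ (E : set mR2)) by apply/(measurable_restrict _ mE measurableT); apply: (measurable_funS mE _ mF); first [exact: subIsetl | exact: subIsetr].
  apply: (eq_measurable_fun ((F : mR2 -> R) \_ (E : set mR2))); last exact: measurable_funTS.
  move=> x; rewrite inE => Dx; rewrite patchE; case: ifPn => // /negP xE; rewrite zF// => Ex; exact/xE/mem_set.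
by split; apply: key => // x Dx nE; rewrite z.
Qed.

Lemma sqa_ext D E h : measurable (E : set mR2) -> measurable (D : set mR2) -> E `<=` D -> cmeasurable E h ->
  (forall x, D x -> ~ E x -> h x = 0) -> (sqa D h <= sqa E h)%E.
Proof.
move=> mE mD sED mh z; have := @sqa_supp R D E 1 h h mD mE sED ler01 (cmeas_ext mE mD mh z) mh z.
by rewrite expr1n mul1e; apply => x _; rewrite mul1r.
Qed.

(** No derivative appears on the interface, because the approximants and their derivatives are
    themselves zero off the smaller set. *)
Lemma jet_zero_ext D E u g (w : nat -> R * R -> R[i]) : open D -> open E -> E `<=` D -> jet E u g w ->
  (forall x, D x -> ~ E x -> [/\ u x = 0, forall j, g j x = 0, forall n, w n x = 0 & forall n j, cderiv j (w n) x = 0]) ->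
  jet D u g w.
Proof.
move=> oD oE sED [sw [mu lu] hg c1 c2] z; have mD := open_measurable_plane oD; have mE := open_measurable_plane oE.
have zu x : D x -> ~ E x -> u x = 0 by move=> Dx nE; have [] := z x Dx nE.
have zg j x : D x -> ~ E x -> g j x = 0 by move=> Dx nE; have [] := z x Dx nE.
have ext h : cmeasurable E h -> (forall x, D x -> ~ E x -> h x = 0) -> (sqa D h <= 1%:E * sqa E h)%E.
  by move=> mh zh; rewrite mul1e; exact: sqa_ext.
split=> //.
- by split; [exact: cmeas_ext mu zu|apply: le_lt_trans lu; exact: sqa_ext].
- move=> j; have [mg lg] := hg j; split; first exact: cmeas_ext mg (zg j).
  by apply: le_lt_trans lg; exact: (sqa_ext mE mD sED mg (zg j)).
- apply: (vanishes_le c1 ler01) => n; apply: ext; first exact: cmeasB (csmooth_cmeas oE (sw n)) mu.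
  by move=> x Dx nE; have [-> _ -> _] := z x Dx nE; rewrite subr0.
- move=> j; apply: (vanishes_le (c2 j) ler01) => n; apply: ext.
    by apply: cmeasB (cderiv_cmeas j oE (sw n)) _; case: (hg j).
  by move=> x Dx nE; have [_ -> _ ->] := z x Dx nE; rewrite subr0.
Qed.

Lemma flat_trace_sqn (c : R) (w : R * R -> R[i]) :
  (\int[leb]_(s in setT) (modulus (w (s, c) - 0) ^+ 2 * arclen (fun=> c) s)%:E)%E = sqn leb (setT : set mR) (fun s => w (s, c)).
Proof. by apply: eq_integral => s _; rewrite subr0 /arclen derive1_cst expr0n /= addr0 sqrtr1 mulr1. Qed.

Lemma jet_flat_trace D c u g (w : nat -> R * R -> R[i]) : open D -> jet D u g w ->
  vanishes (fun n => sqn leb (setT : set mR) (fun s => w n (s, c))) -> zero_trace D (fun=> c) u.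
Proof.
move=> oD J v; split; [exact: measurable_cst|exact: measurable_cst|exists w; split].
- by case: J.
- exact: jet_normW21 J.
- apply: (vanishesP _).2; first by move=> n; rewrite flat_trace_sqn sqn_ge0.
  by under [X in vanishes X]eq_fun do rewrite flat_trace_sqn.
Qed.

Lemma zero_trace_jet D c u : open D -> W2 1 D u -> zero_trace D (fun=> c) u ->
  exists2 w, jet D u (fun j => wderiv D j u) w & vanishes (fun n => sqn leb (setT : set mR) (fun s => w n (s, c))).
Proof.
move=> oD Wu [_ _ [w [sw cw ct]]]; exists w; first exact: jetP.
have := (vanishesP _).1 ct; under [X in vanishes X]eq_fun do rewrite flat_trace_sqn.
by apply => n; rewrite flat_trace_sqn sqn_ge0.
Qed.

(** The approximants from the definition of the trace converge in W_2^1 and on the graph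
    simultaneously. By the last clause, a function with approximants of the same boundary values has
    the same trace; it is meant for u minus a function cut off near the graph. *)
Lemma trace_jet d B (p : R -> R) u : B < d -> (forall s, 0 <= p s <= B) -> continuous p -> continuous (derive1 p) ->
  (exists L, forall s, arclen p s <= L) -> forall w0, jet (upper d p) u (fun j => wderiv (upper d p) j u) w0 ->
  let T := trace (upper d p) p u in
  exists2 w, jet (upper d p) u (fun j => wderiv (upper d p) j u) w &
   [/\ cmeas (setT : set mR) T, (sqn leb (setT : set mR) T < +oo)%E,
    vanishes (fun n => sqn leb (setT : set mR) (fun s => w n (s, p s) - T s)) &
    forall v g z, jet (upper d p) v g z -> (forall n s, z n (s, p s) = w n (s, p s)) ->
      is_trace (upper d p) p v (trace (upper d p) p v) /\ {ae leb, forall s, trace (upper d p) p v s = T s}].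
Proof.
move=> Bd pB cp cp' [L pL] w0 J0 T; have oD : open (upper d p) := upper_open cp.
have Wu := jet_W2 oD J0.
have L0 : 0 <= L by apply: le_trans (le_trans _ (pL 0)); [exact: ler01|exact: arclen_ge1].
have hT0 := jet_is_trace Bd pB cp L0 cp' pL J0.
have [hT _] := trace_ae Bd pB cp cp' Wu hT0; have aT := is_trace_ae Bd pB cp cp' Wu hT.
have [mT1 mT2 [w [sw cw ct]]] := hT; have mT : cmeas (setT : set mR) T by split.
have J := jetP oD Wu sw cw; have [_ hu hg _ _] := J.
have mw n : cmeas (setT : set mR) (fun s => w n (s, p s) - T s) by exact: cmeasB (graph_cmeas cp (sw n)) mT.
have gv : vanishes (fun n => gsqn p (fun s => w n (s, p s) - T s)) by apply: (vanishesP _).1 ct => n; exact: gsqn_ge0.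
have vT : vanishes (fun n => sqn leb (setT : set mR) (fun s => w n (s, p s) - T s)).
  by apply: (vanishes_le gv ler01) => n; rewrite mul1e; exact: gsqn_ge.
have trT v g z : jet (upper d p) v g z -> (forall n s, z n (s, p s) = w n (s, p s)) ->
      is_trace (upper d p) p v (trace (upper d p) p v) /\ {ae leb, forall s, trace (upper d p) p v s = T s}.
  move=> Jv E; have Wv := jet_W2 oD Jv; apply: (trace_ae Bd pB cp cp' Wv).
  split=> //; exists z; split; [by case: Jv|exact: jet_normW21 Jv|].
  by rewrite (_ : (fun n => _) = (fun n => \int[leb]_(s in setT) (modulus (w n (s, p s) - T s) ^+ 2 * arclen p s)%:E)%E)//; apply/funext => n; apply: eq_integral => s _; rewrite E.
exists w; first exact: J.
split; [exact: mT| |exact: vT|exact: trT].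
have [K K0 HK] := ctrace_close Bd pB cp.
have [mu lu] := hu; have [mg lg] := hg ord_max.
(* Comparing with the approximant 0 in [ctrace_close] bounds the norm of the trace itself. *)
have s0 : csmooth_cpt (fun=> 0 : R[i]).
  have := csmoothB (sw 0%N) (sw 0%N); rewrite (_ : (fun x => _) = fun=> 0)//; by apply/funext => x; rewrite subrr.
have cz x : cderiv ord_max (fun=> 0 : R[i]) x = 0.
  have := cderivB ord_max x (sw 0%N) (sw 0%N); rewrite subrr (_ : (fun x => _) = fun=> 0)//; by apply/funext => y; rewrite subrr.
have N E h : sqa E (fun x => 0 - h x)%R = sqa E h by apply: eq_integral => x _; rewrite sub0r modulusN.
have := HK u (wderiv (upper d p) ord_max u) _ mu mg s0.
rewrite N (_ : sqa _ (fun x => cderiv _ _ x - _)%R = sqa (upper d p) (wderiv (upper d p) ord_max u)); last first.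
  by apply: eq_integral => x _; rewrite cz sub0r modulusN.
move=> h; have cT : cmeas (setT : set mR) (ctrace d B p u (wderiv (upper d p) ord_max u)) by first [exact: (ctrace_cmeas cp mu mg)|exact: (ctrace_cmeas Bd cp mu mg)|exact: (ctrace_cmeas Bd cp pB mu mg)|exact: (ctrace_cmeas pB cp mu mg)|exact: ctrace_cmeas].
apply: (@le_lt_trans _ _ (sqn leb (setT : set mR) (fun s => 0 - ctrace d B p u (wderiv (upper d p) ord_max u) s)%R)).
  apply: ae_ge0_le_integral => //.
  - by move=> s _; rewrite lee_fin sqr_ge0.
  - exact: msqrE.
  - by move=> s _; rewrite lee_fin sqr_ge0.
  - apply: msqrE; exact: (cmeasB (graph_cmeas cp s0) cT).
  by apply: ae_imp aT => s h' _; rewrite /T h' sub0r modulusN.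
apply: (le_lt_trans h); apply: lte_mul_pinfty; rewrite ?lee_fin//.
exact: lte_add_pinfty.
Qed.

End extension.

(** * Pointwise inequality for the difference of the two tested problems *)

Section pointwise.
Context {R : realType}.
Variable c0 : R.

(** [RD] and [DD] are the integrands of the Robin equation tested with v and of the Dirichlet
    equation tested with chi v; [l] tells whether the point lies in the layer. Up to commutators the
    difference is the form at v, treated as in [coercive_point]. [S] is tied to the ellipticity
    constant, while [sg] and [s] stay free for the final absorption. *)
Lemma robin_point (M t K S sg s : R) (l : bool) (a0 r0 r1 chi tt : R) (a01 b0 b1 g0 g1 h0 h1 U V f : R[i]) : 0 <= M ->
  (forall z0 z1 : R[i], c0 * (modulus z0 ^+ 2 + modulus z1 ^+ 2) <=
     complex.Re (r0%:C%C * z0 * conjc z0 + a01 * z1 * conjc z0 + conjc a01 * z0 * conjc z1 + r1%:C%C * z1 * conjc z1)) ->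
  modulus a01 <= M -> modulus (r1%:C%C : R[i]) <= M -> modulus b0 <= M -> modulus b1 <= M -> `|a0| <= M ->
  0 < t -> 2 * M * t <= c0 / 2 -> 4 * M / t + M + 1 <= K -> 0 <= K ->
  0 < S -> (1 + K) * (M / S) <= c0 / 4 -> 0 < sg -> 0 < s -> 0 <= chi <= 1 -> (l = false -> chi = 1 /\ tt = 0) ->
  let v := U - chi%:C%C * V in
  let G0 := g0 - chi%:C%C * h0 in let G1 := g1 - (chi%:C%C * h1 + tt%:C%C * V) in
  let P0 := chi%:C%C * G0 in let P1 := chi%:C%C * G1 + tt%:C%C * v in
  let RD b := part b (r0%:C%C * g0 * conjc G0) + part b (a01 * g1 * conjc G0) + part b (conjc a01 * g0 * conjc G1) +
     part b (r1%:C%C * g1 * conjc G1) + part b (b0 * g0 * conjc v) + part b (b1 * g1 * conjc v) +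
     (if b then 1 else -1) * part b (b0 * G0 * conjc U) + (if b then 1 else -1) * part b (b1 * G1 * conjc U) +
     part b (a0%:C%C * U * conjc v) - part b (1 * (f + 'i%C * U) * conjc v) in
  let DD b := part b (r0%:C%C * h0 * conjc P0) + part b (a01 * h1 * conjc P0) + part b (conjc a01 * h0 * conjc P1) +
     part b (r1%:C%C * h1 * conjc P1) + part b (b0 * h0 * conjc (chi%:C%C * v)) + part b (b1 * h1 * conjc (chi%:C%C * v)) +
     (if b then 1 else -1) * part b (b0 * P0 * conjc V) + (if b then 1 else -1) * part b (b1 * P1 * conjc V) +
     part b (a0%:C%C * V * conjc (chi%:C%C * v)) - part b (1 * (f + 'i%C * V) * conjc (chi%:C%C * v)) in
  let lr : R := l%:R in
  is_true (c0 / 4 * (modulus G0 ^+ 2 + modulus G1 ^+ 2) + modulus v ^+ 2 <=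
    (RD true - DD true) - K * (RD false - DD false) +
    (1 + K) * (2 * M * S * modulus (tt%:C%C * V) ^+ 2 +
      lr * (M * s * (modulus h0 ^+ 2 + modulus h1 ^+ 2) + 2 * M * (modulus (tt%:C%C * v) ^+ 2 / s) +
        2 * M * sg * modulus (tt%:C%C * V) ^+ 2 + sg * modulus f ^+ 2 + (2 * M + 1) * (modulus v ^+ 2 / sg)))).
Proof.
move=> M0 ell ma01 mr1 mb0 mb1 ma0 t0 Mt KM K0 S0 SM sg0 s0 /andP[x0 x1] lx v G0 G1 P0 P1 RD DD lr.
have cp := coercive_point G0 G1 v M0 ell mb0 mb1 ma0 t0 Mt KM.
pose W := tt%:C%C * V; pose w := tt%:C%C * v.
pose sb (b : bool) : R := if b then 1 else -1.
(* The commutators: every term has a factor 1 - chi or the slope of chi, and so vanishes off the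
   layer. *)
pose er b := part b (a01 * W * conjc G0) + part b (r1%:C%C * W * conjc G1) - part b (conjc a01 * h0 * conjc w) - part b (r1%:C%C * h1 * conjc w)
   + part b (b1 * W * conjc v) - part b (conjc b1 * W * conjc v) - part b ((1 - chi)%:C%C * f * conjc v).
have T1 b (a g q G : R[i]) : part b (a * g * conjc G) - part b (a * q * conjc (chi%:C%C * G)) = part b (a * (g - chi%:C%C * q) * conjc G).
  by clear; rewrite /part; case: b; rewrite !cE !RealC !ImagC; ring.
have T2 b (a g q G z : R[i]) : part b (a * g * conjc G) - part b (a * q * conjc (chi%:C%C * G + z)) = part b (a * (g - chi%:C%C * q) * conjc G) - part b (a * q * conjc z).
  by clear; rewrite /part; case: b; rewrite !cE !RealC !ImagC; ring.
have T3 b (a G : R[i]) : part b (a * G * conjc U) - part b (a * (chi%:C%C * G) * conjc V) = part b (a * G * conjc v).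
  by rewrite /v; clear; rewrite /part; case: b; rewrite !cE !RealC !ImagC; ring.
have T4 b (a G : R[i]) : sb b * part b (a * G * conjc U) - sb b * part b (a * (chi%:C%C * G + w) * conjc V) = sb b * part b (a * G * conjc v) - part b (conjc a * W * conjc v).
  by rewrite /w /W /v; clear; rewrite /part /sb; case: b; rewrite !cE !RealC !ImagC; ring.
have T6 b (y : R[i]) : part b (1 * (f + 'i%C * U) * conjc y) - part b (1 * (f + 'i%C * V) * conjc (chi%:C%C * y)) = part b ((1 - chi)%:C%C * f * conjc y) + part b ('i%C * v * conjc y).
  by rewrite /v; clear; rewrite !mul1r /part; case: b; rewrite !cE !RealC !ImagC /=; ring.
have TA b (a y z q : R[i]) : part b (a * (y + z) * conjc q) = part b (a * y * conjc q) + part b (a * z * conjc q).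
  by clear; rewrite /part; case: b; rewrite !cE; ring.
have GW : g1 - chi%:C%C * h1 = G1 + W by rewrite /G1 /W; ring.
have hv := modulus_sqr v.
have main b : RD b - DD b = part b (r0%:C%C * G0 * conjc G0) + part b (a01 * G1 * conjc G0) + part b (conjc a01 * G0 * conjc G1) + part b (r1%:C%C * G1 * conjc G1) +
    (part b (b0 * G0 * conjc v) + sb b * part b (b0 * G0 * conjc v)) + (part b (b1 * G1 * conjc v) + sb b * part b (b1 * G1 * conjc v)) +
    part b (a0%:C%C * v * conjc v) - part b ('i%C * v * conjc v) + er b.
  have e1 := T1 b r0%:C%C g0 h0 G0; have e2 := T1 b a01 g1 h1 G0; have e3 := T2 b (conjc a01) g0 h0 G1 w; have e4 := T2 b r1%:C%C g1 h1 G1 w.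
  have e5 := T1 b b0 g0 h0 v; have e6 := T1 b b1 g1 h1 v; have e7 := congr1 (fun z => sb b * z) (T3 b b0 G0); have e8 := T4 b b1 G1.
  have e9 := T1 b a0%:C%C U V v; have e10 := T6 b v.
  rewrite mulrBr in e7; rewrite GW TA in e2; rewrite GW TA in e4; rewrite GW TA in e6.
  rewrite -/G0 in e1 e3 e5; rewrite -/v in e9.
  rewrite /RD /DD -/(sb b) /P0 /P1 -/w /er.
  move: e1 e2 e3 e4 e5 e6 e7 e8 e9 e10.
  do 40 ?[move: (part b _) => ?]; move: (sb b) => q; clear.
  by move=> *; lra.
have KT : RD true - DD true = complex.Re (r0%:C%C * G0 * conjc G0 + a01 * G1 * conjc G0 + conjc a01 * G0 * conjc G1 + r1%:C%C * G1 * conjc G1) +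
  2 * complex.Re (b0 * G0 * conjc v) + 2 * complex.Re (b1 * G1 * conjc v) + a0 * modulus v ^+ 2 + er true.
  rewrite main (_ : part true (a0%:C%C * v * conjc v) = a0 * modulus v ^+ 2); last by rewrite /part hv !cE !RealC !ImagC; ring.
  rewrite (_ : part true ('i%C * v * conjc v) = 0); last by rewrite /part !cE /=; ring.
  by move: (er true) => ee; rewrite /part /sb !ReD; ring.
have KF : RD false - DD false = - modulus v ^+ 2 + er false.
  rewrite main (_ : part false (a0%:C%C * v * conjc v) = 0); last by rewrite /part !cE !RealC !ImagC; ring.
  rewrite (_ : part false ('i%C * v * conjc v) = modulus v ^+ 2); last by rewrite /part hv !cE /=; ring.
  rewrite (_ : part false (r0%:C%C * G0 * conjc G0) = 0); last by rewrite /part !cE !RealC !ImagC; ring.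
  rewrite (_ : part false (r1%:C%C * G1 * conjc G1) = 0); last by rewrite /part !cE !RealC !ImagC; ring.
  rewrite (_ : part false (a01 * G1 * conjc G0) = - part false (conjc a01 * G0 * conjc G1)); last by rewrite /part !cE; ring.
  by rewrite /sb; ring.
rewrite KT KF -/W -/w.
pose Z := 2 * M * S * modulus W ^+ 2 + lr * (M * s * (modulus h0 ^+ 2 + modulus h1 ^+ 2) + 2 * M * (modulus w ^+ 2 / s) +
        2 * M * sg * modulus W ^+ 2 + sg * modulus f ^+ 2 + (2 * M + 1) * (modulus v ^+ 2 / sg)).
have MS0 : 0 <= M / S by apply: divr_ge0 => //; exact: ltW.
have GG0 : 0 <= modulus G0 ^+ 2 + modulus G1 ^+ 2 by apply: addr_ge0; exact: sqr_ge0.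
(* Only the two terms pairing W with the gradient of v are charged to that gradient, with weight 1 /
   S; the others are charged to layer norms of v and of the Dirichlet solution, and to f. *)
have eb b : `|er b| <= Z + M / S * (modulus G0 ^+ 2 + modulus G1 ^+ 2).
  rewrite /Z /lr; clear Z lr; case: l lx => [_|/(_ erefl)[chi1 tt0]]; last first.
    rewrite /er /W /w chi1 tt0 subrr !mul0r conjc0 ?mulr0 ?mul0r; rewrite !modulus0 expr0n /=.
    have p0 b' : part b' (0 : R[i]) = 0 by case: b'.
    rewrite !(mulr0, mul0r, p0, subr0, addr0, normr0, add0r, oppr0); exact: mulr_ge0.
  have m1 : modulus ((1 - chi)%:C%C : R[i]) <= 1 by rewrite modulus_real ger0_norm ?subr_ge0//; lra.
  have mc : modulus (conjc a01) <= M by rewrite modulus_conj.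
  have mc1 : modulus (conjc b1) <= M by rewrite modulus_conj.
  have := young b W G0 ma01 S0; have := young b W G1 mr1 S0; have := young b h0 w mc s0; have := young b h1 w mr1 s0.
  have := young b W v mb1 sg0; have := young b W v mc1 sg0; have := young b f v m1 sg0.
  rewrite /er !mul1r; rewrite !ler_norml.
  do 7 ?[move: (part b _) => ?]; move: (modulus W ^+ 2) (modulus w ^+ 2 / s) (modulus v ^+ 2 / sg) (modulus f ^+ 2) (modulus h0 ^+ 2) (modulus h1 ^+ 2) => A1 A2 A3 A4 A5 A6.
  rewrite (_ : M / S * (modulus G0 ^+ 2 + modulus G1 ^+ 2) = M * (modulus G0 ^+ 2 / S) + M * (modulus G1 ^+ 2 / S)); last by ring.
  move: (modulus G0 ^+ 2 / S) (modulus G1 ^+ 2 / S) => A7 A8; clear.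
  move=> /andP[? ?] /andP[? ?] /andP[? ?] /andP[? ?] /andP[? ?] /andP[? ?] /andP[? ?]; apply/andP; split; lra.
have := eb true; have := eb false; rewrite !ler_norml => /andP[_ ef] /andP[et _].
have kf := ler_wpM2l K0 ef; have sm := ler_wpM2r GG0 SM.
rewrite -/Z; clear eb ef; clearbody Z; move: cp et kf sm; rewrite -addrA.
move: (complex.Re _) (complex.Re (b0 * _ * _)) (complex.Re (b1 * _ * _)) (er true) (er false) (modulus v ^+ 2) (modulus G0 ^+ 2) (modulus G1 ^+ 2) Z (M / S).
clear; move=> X Y0 Y1 et ef Vv A7 A8 Z ms; lra.
Qed.

End pointwise.

(** * The Robin problem tested with v *)

Section robin.
Context {R : realType}.
Local Notation mR := (measurableTypeR R).
Local Notation mR2 := (measurableTypeR R * measurableTypeR R)%type.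
Local Notation leb := (@lebesgue_measure R).
Local Notation strip h := (upper h (fun=> 0%R)).
Implicit Types u v f h : R * R -> R[i].

Lemma Rint_ext (D E : set (R * R)) (F : R * R -> R) : E `<=` D -> (forall x, D x -> ~ E x -> F x = 0) ->
  Rintegral area (D : set mR2) F = Rintegral area (E : set mR2) F.
Proof.
move=> sED z; rewrite /Rintegral integral_mkcond [in RHS]integral_mkcond; congr (fine (integral _ _ _)).
apply/funext => x; rewrite !patchE; case: ifPn => [/set_mem Dx|/negP nD].
  by case: ifPn => // /negP nE; rewrite (z x Dx)// => Ex; exact/nE/mem_set.
by case: ifPn => // /set_mem Ex; exfalso; apply: nD; apply/mem_set; exact: sED.
Qed.

Lemma bounded_coef_sub (D E : set (R * R)) (M : R) (c : R * R -> R[i]) : measurable (D : set mR2) -> E `<=` D ->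
  bounded_coef area (D : set mR2) M c -> bounded_coef area (E : set mR2) M c.
Proof.
move=> mD sED [mc hc]; split; first exact: (cmeas_sub mD sED mc).
by apply: ae_imp hc => x H /sED; exact: H.
Qed.

Lemma cL2_sub (D E : set (R * R)) h : measurable (D : set mR2) -> measurable (E : set mR2) -> E `<=` D -> cL2a D h -> cL2a E h.
Proof.
move=> mD mE sED [mh lh]; split; first exact: (cmeas_sub mD sED mh).
by apply: le_lt_trans lh; apply: sqa_sub.
Qed.

(** An indicator factor instead of a smaller domain of integration, so that layer terms can be added
    to the other integrands over [D]. *)
Definition lay (T : R) h (x : R * R) : R[i] := ((x.2 < T)%R%:R)%:C%C * h x.

Lemma lay_modulus T h x : modulus (lay T h x) ^+ 2 = (x.2 < T)%R%:R * modulus (h x) ^+ 2.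
Proof. by rewrite /lay modulusM modulus_real; case: (x.2 < T) => /=; rewrite ?normr1 ?normr0 ?mul1r ?mul0r ?expr0n. Qed.

Lemma lay_cmeas D T h : cmeasurable D h -> cmeasurable D (lay T h).
Proof.
move=> mh; apply: cmeasM => //; apply: cmeas_real; apply: measurable_funTS.
have oT : open [set x : R * R | x.2 < T].
  rewrite (_ : [set x : R * R | x.2 < T] = snd @^-1` [set t | t < T])//.
  by apply: open_comp; [move=> y _; exact: cvg_snd|exact: open_lt].
rewrite (_ : (fun x : R * R => (x.2 < T)%R%:R : R) = \1_[set x : R * R | x.2 < T]).
  exact: (measurable_indic (open_measurable_plane oT)).
apply/funext => x; rewrite indicE.
by have -> : (x \in [set x : R * R | x.2 < T]) = (x.2 < T)%R by apply/idP/idP; rewrite inE.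
Qed.

Lemma lay_cL2 D T h : measurable (D : set mR2) -> cL2a D h -> cL2a D (lay T h).
Proof.
move=> mD [mh lh]; split; first exact: lay_cmeas.
have := @sqa_le R D 1 (lay T h) h mD ler01 (lay_cmeas T mh) mh; rewrite expr1n mul1e => H.
apply: le_lt_trans lh; apply: H => x _; rewrite mul1r /lay modulusM modulus_real.
by apply: ler_piMl; [exact: modulus_ge0|case: (x.2 < T); rewrite /= ?normr1 ?normr0].
Qed.

Lemma hasint_lay D T h : measurable (D : set mR2) -> cL2a D h ->
  hasint area (D : set mR2) (fun x => (x.2 < T)%R%:R * modulus (h x) ^+ 2) (rsqn area (D : set mR2) (lay T h)).
Proof.
move=> mD hh; have := hasint_sqr mD (lay_cL2 T mD hh).
by rewrite (_ : (fun x => modulus (lay T h x) ^+ 2) = (fun x : R * R => (x.2 < T)%R%:R * modulus (h x) ^+ 2))//; apply/funext => x; exact: lay_modulus.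
Qed.

Lemma lay_sqa D E T h : measurable (D : set mR2) -> measurable (E : set mR2) -> E `<=` D -> cmeasurable D h ->
  (forall x, D x -> x.2 < T -> E x) -> (sqa D (lay T h) <= sqa E h)%E.
Proof.
move=> mD mE sED mh H.
have := @sqa_supp R D E 1 (lay T h) h mD mE sED ler01 (lay_cmeas T mh) (cmeas_sub mD sED mh); rewrite expr1n mul1e; apply.
  move=> x Dx nE; rewrite /lay; case: (boolP (x.2 < T)) => xT; last by rewrite mul0r.
  by exfalso; apply: nE; exact: H.
move=> x _; rewrite mul1r /lay modulusM modulus_real.
by apply: ler_piMl; [exact: modulus_ge0|case: (x.2 < T); rewrite /= ?normr1 ?normr0].
Qed.

Lemma poweR_bound (a1 a2 a3 X F : R) : 0 <= a1 -> 0 <= a2 -> 0 <= a3 -> 0 <= X -> 0 <= F -> a1 + a2 + a3 <= X * F ->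
  ((a1%:E + (a2%:E + a3%:E)) `^ 2^-1 <= (Num.sqrt X)%:E * (F%:E `^ 2^-1))%E.
Proof.
move=> p1 p2 p3 pX pF H; have p4 : 0 <= a1 + (a2 + a3) by rewrite !addr_ge0.
rewrite -!EFinD !poweR_EFin (powR12_sqrt p4) (powR12_sqrt pF) -EFinM lee_fin -sqrtrM//.
by apply: ler_wsqrtr; rewrite addrA.
Qed.

Lemma fin_arith (K X Y Z : R) : X <= - Y - 0 - K * (- 0 - 0) + Z -> X + Y <= Z.
Proof. by move=> *; lra. Qed.

Lemma modulus_sqrD (y z : R[i]) : modulus (y + z) ^+ 2 <= 2 * modulus y ^+ 2 + 2 * modulus z ^+ 2.
Proof.
rewrite !modulus_sqr ReD ImD.
have := sqr_ge0 (complex.Re y - complex.Re z); have := sqr_ge0 (complex.Im y - complex.Im z).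
by move: (complex.Re y) (complex.Re z) (complex.Im y) (complex.Im z) => y1 z1 y2 z2; rewrite !sqrrB !sqrrD; clear; lra.
Qed.

(** The difference of the solutions is v plus (chi - 1) times the Dirichlet solution, and the latter
    with its gradient lives in the layer. *)
Lemma total_point (l : bool) (chi t k : R) (U V g0 g1 h0 h1 : R[i]) : 0 <= chi <= 1 -> `|t| <= k -> (l = false -> chi = 1 /\ t = 0) ->
  modulus (U - V) ^+ 2 + modulus (g0 - h0) ^+ 2 + modulus (g1 - h1) ^+ 2 <=
  2 * (modulus (g0 - chi%:C%C * h0) ^+ 2 + modulus (g1 - (chi%:C%C * h1 + t%:C%C * V)) ^+ 2 + modulus (U - chi%:C%C * V) ^+ 2) +
  4 * (l%:R * modulus h0 ^+ 2 + l%:R * modulus h1 ^+ 2) + (2 + 4 * k ^+ 2) * (l%:R * modulus V ^+ 2).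
Proof.
move=> /andP[x0 x1] tk lx; have q (y : R[i]) : 0 <= modulus y ^+ 2 by exact: sqr_ge0.
have mm (c : R) (y : R[i]) : modulus (c%:C%C * y) ^+ 2 = c ^+ 2 * modulus y ^+ 2 by rewrite modulusM modulus_real exprMn real_normK ?num_real.
have E1 : U - V = (U - chi%:C%C * V) + (chi - 1)%:C%C * V by rewrite rmorphB /=; ring.
have E2 : g0 - h0 = (g0 - chi%:C%C * h0) + (chi - 1)%:C%C * h0 by rewrite rmorphB /=; ring.
have E3 : g1 - h1 = (g1 - (chi%:C%C * h1 + t%:C%C * V)) + ((chi - 1)%:C%C * h1 + t%:C%C * V) by rewrite rmorphB /=; ring.
have i1 := modulus_sqrD (U - chi%:C%C * V) ((chi - 1)%:C%C * V); rewrite -E1 mm in i1.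
have i2 := modulus_sqrD (g0 - chi%:C%C * h0) ((chi - 1)%:C%C * h0); rewrite -E2 mm in i2.
have i3 := modulus_sqrD (g1 - (chi%:C%C * h1 + t%:C%C * V)) ((chi - 1)%:C%C * h1 + t%:C%C * V); rewrite -E3 in i3.
have i4 := modulus_sqrD ((chi - 1)%:C%C * h1) (t%:C%C * V); rewrite !mm in i4.
have c1 : (chi - 1) ^+ 2 <= l%:R.
  case: l lx => [_|/(_ erefl)[-> _]]; last by rewrite subrr expr0n.
  by rewrite -sqrrN opprB; apply: exprn_ile1; [rewrite subr_ge0|rewrite lerBlDr lerDl].
have t1 : t ^+ 2 <= k ^+ 2 * l%:R.
  case: l lx {c1} => [_|/(_ erefl)[_ ->]]; last by rewrite expr0n mulr0.
  by rewrite mulr1 -(real_normK (num_real t)) lerXn2r// nnegrE; exact: le_trans tk.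
have j1 := ler_wpM2r (q V) c1; have j2 := ler_wpM2r (q h0) c1; have j3 := ler_wpM2r (q h1) c1; have j4 := ler_wpM2r (q V) t1.
have lr0 : 0 <= l%:R :> R by []. have k1 := mulr_ge0 lr0 (q h0).
have j5 : t ^+ 2 * modulus V ^+ 2 <= k ^+ 2 * (l%:R * modulus V ^+ 2) by rewrite mulrA.
have -> : (2 + 4 * k ^+ 2) * (l%:R * modulus V ^+ 2) = 2 * (l%:R * modulus V ^+ 2) + 4 * (k ^+ 2 * (l%:R * modulus V ^+ 2)) by ring.
have ar (a1 a2 a3 b1 b2 b3 W p1 p2 p3 p4 L1 L2 L3 kL : R) : a1 <= 2 * b1 + 2 * p3 -> a2 <= 2 * b2 + 2 * p2 -> a3 <= 2 * b3 + 2 * W ->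
   W <= 2 * p1 + 2 * p4 -> p3 <= L3 -> p2 <= L1 -> p1 <= L2 -> p4 <= kL -> 0 <= L1 ->
   a1 + a2 + a3 <= 2 * (b2 + b3 + b1) + 4 * (L1 + L2) + (2 * L3 + 4 * kL) by clear; move=> *; lra.
exact: (ar _ _ _ _ _ _ _ _ _ _ _ _ _ _ _ i1 i2 i3 i4 j1 j2 j3 j5 k1).
Qed.

Lemma lay_arith (M SS sg s k t V0 H1 H2 F v K : R) (l : bool) : 0 <= M -> 0 < SS -> 0 < sg -> 0 < s -> 0 <= k -> 0 <= K ->
  (l = false -> t = 0) -> `|t| <= k -> 0 <= V0 -> 0 <= F -> 0 <= v ->
  (1 + K) * (2 * M * SS * (t ^+ 2 * V0) + l%:R * (M * s * (H1 + H2) + 2 * M * (t ^+ 2 * v / s) + 2 * M * sg * (t ^+ 2 * V0) + sg * F + (2 * M + 1) * (v / sg))) <=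
  (1 + K) * (2 * M * SS * k ^+ 2 * (l%:R * V0) + M * s * (l%:R * H1 + l%:R * H2) + 2 * M * k ^+ 2 / s * (l%:R * v) + 2 * M * sg * k ^+ 2 * (l%:R * V0) + sg * F + (2 * M + 1) / sg * (l%:R * v)).
Proof.
move=> M0 SS0 sg0 s0 k0 K0 lt tk V00 F0 v0; apply: ler_wpM2l; first exact: addr_ge0.
case: l lt => [_|/(_ erefl)->].
  have t2 : t ^+ 2 <= k ^+ 2 by rewrite -(real_normK (num_real t)) lerXn2r// nnegrE.
  have p1 : 0 <= 2 * M * SS by apply: mulr_ge0; [exact: mulr_ge0|exact: ltW].
  have p2 : 0 <= 2 * M / s by apply: divr_ge0; [exact: mulr_ge0|exact: ltW].
  have p3 : 0 <= 2 * M * sg by apply: mulr_ge0; [exact: mulr_ge0|exact: ltW].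
  have f1 := ler_wpM2l p1 (ler_wpM2r V00 t2); have f2 := ler_wpM2l p2 (ler_wpM2r v0 t2); have f3 := ler_wpM2l p3 (ler_wpM2r V00 t2).
  rewrite !mul1r (_ : 2 * M * SS * k ^+ 2 * V0 = 2 * M * SS * (k ^+ 2 * V0)); last by ring.
  rewrite (_ : 2 * M * k ^+ 2 / s * v = 2 * M / s * (k ^+ 2 * v)); last by ring.
  rewrite (_ : 2 * M * (t ^+ 2 * v / s) = 2 * M / s * (t ^+ 2 * v)); last by ring.
  rewrite (_ : 2 * M * sg * k ^+ 2 * V0 = 2 * M * sg * (k ^+ 2 * V0)); last by ring.
  rewrite (_ : (2 * M + 1) / sg * v = (2 * M + 1) * (v / sg)); last by ring.
  move: f1 f2 f3; move: (2 * M * SS * _) (2 * M * SS * _) (2 * M / s * _) (2 * M / s * _) (2 * M * sg * _) (2 * M * sg * _) (M * s * _) (sg * F) ((2 * M + 1) * _).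
  by clear; move=> *; lra.
by rewrite expr0n /= !(mul0r, mulr0, add0r, addr0) mulr_ge0// ltW.
Qed.

Variables (A : 'I_2 -> 'I_2 -> R * R -> R[i]) (A1 : 'I_2 -> R * R -> R[i]) (A0 : R * R -> R) (a : R * R -> R) (d c0 : R).
Hypotheses (d0 : 0 < d) (c00 : 0 < c0) (hA : admissible_coefficients d A A1 A0 c0).
Variables (p : R -> R) (B T : R).
Hypotheses (cp : continuous p) (cp' : continuous (derive1 p)) (pB : forall s, 0 <= p s <= B) (BT : B < T) (Td : T <= d).
Variable L : R.
Hypothesis pL : forall s, arclen p s <= L.
Variable Ma : R.
Hypotheses (ca : continuous (fun s => a (s, p s))) (a0 : forall s, 0 <= a (s, p s)) (aM : forall s, a (s, p s) <= Ma).
Local Notation D := (upper d p).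
Local Notation D0 := (strip d).
Let Bd : B < d. Proof. exact: lt_le_trans Td. Qed.
Let oD : open D. Proof. exact: upper_open. Qed.
Let mD : measurable (D : set mR2). Proof. exact: upper_measurable. Qed.
Let oD0 : open D0 := @strip_open R d.
Let mD0 : measurable (D0 : set mR2) := strip_meas d.
Let sD : D `<=` D0.
Proof. by move=> x /andP[x1 x2]; apply/andP; split => //; apply: le_lt_trans x1; have /andP[] := pB x.1. Qed.
(** The slope for which [chi] passes from 0 to 1 in the middle half of B < x_2 < T; [chi] is thus
    zero in a whole neighbourhood of the crest level. *)
Let ll : R := 2 / (T - B).
Let chi : R * R -> R := vstep ll (- (ll * (B + (T - B) / 4))).
Let tt (x : R * R) : R := 'D_(basis ord_max) chi x.
Let H0 : 0 < T - B. Proof. by rewrite subr_gt0. Qed.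
Let ll0 : 0 < ll. Proof. exact: divr_gt0. Qed.
Let Cchi : Cinfty chi. Proof. exact: vstep_smooth. Qed.

Let arg (x : R * R) : R := ll * x.2 - ll * (B + (T - B) / 4).
Let arg_low x : x.2 <= B -> arg x <= 0.
Proof. by move=> h; rewrite /arg -mulrBr; apply: mulr_ge0_le0; [exact: ltW|move: H0; lra]. Qed.
Let arg_high x : T <= x.2 -> 1 <= arg x.
Proof.
move=> h; rewrite /arg -mulrBr; apply: (@le_trans _ _ (ll * (3 / 4 * (T - B)))).
  have -> : ll * (3 / 4 * (T - B)) = 3 / 2 by rewrite /ll; field; exact: lt0r_neq0.
  by rewrite ler_pdivlMr// mul1r ler_nat.
by apply: ler_wpM2l; [exact: ltW|move: H0; lra].
Qed.
Let ttE x : tt x = ll * step' (arg x). Proof. exact: vstep_D1. Qed.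
Let chi_low x : x.2 <= B -> chi x = 0 /\ tt x = 0.
Proof. by move=> h; rewrite ttE /chi /vstep step_le0 ?step'_le0 ?mulr0//; exact: arg_low. Qed.
Let chi_high x : T <= x.2 -> chi x = 1 /\ tt x = 0.
Proof. by move=> h; rewrite ttE /chi /vstep step_ge1 ?step'_ge1 ?mulr0//; exact: arg_high. Qed.
Let chi01 x : 0 <= chi x <= 1. Proof. by rewrite /chi /vstep step_ge0 step_le1. Qed.
Let dchi0 x : 'D_(basis ord0) chi x = 0. Proof. exact: vstep_D0. Qed.

(** The bound for [step'] is a parameter, so that the final constant can be chosen before the
    boundary. *)
Variable Cs : R.
Hypotheses (Cs0 : 0 < Cs) (hCs : forall t : R, `|step' t| <= Cs).
Let kk : R := ll * Cs.
Let kk0 : 0 <= kk. Proof. by apply: mulr_ge0; exact: ltW. Qed.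
Let tt_le x : `|tt x| <= kk.
Proof. by rewrite ttE normrM (gtr0_norm ll0); apply: ler_wpM2l; [exact: ltW|exact: hCs]. Qed.
Let dchi_le j x : `|'D_(basis j) chi x| <= kk + 1.
Proof.
move: j; apply: basis_ind; first by rewrite dchi0 normr0 addr_ge0.
by apply: (le_trans (tt_le x)); rewrite lerDl.
Qed.
Let chi_le x : `|chi x| <= kk + 1.
Proof. by have /andP[h1 h2] := chi01 x; rewrite ger0_norm// (le_trans h2)// lerDr. Qed.
Let kk1 : 0 <= kk + 1. Proof. exact: addr_ge0. Qed.
Let offD x : D0 x -> ~ D x -> x.2 <= B.
Proof.
move=> /andP[x0 xd] nD; rewrite leNgt; apply/negP => h; apply: nD; apply/andP; split => //.
by apply: le_lt_trans h; have /andP[] := pB x.1.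
Qed.

Variables (f u u0 : R * R -> R[i]).
Hypotheses (hf : cL2a D0 f) (hu : is_resolvent (HRobin d A A1 A0 a p) 'i%C f u) (S : dsolve A A1 A0 d f u0).
Let g j := wderiv D j u.
Let g0 j := wderiv D0 j u0.
Let v x := u x - (chi x)%:C%C * u0 x.
Let V0 x := g ord0 x - (chi x)%:C%C * g0 ord0 x.
Let V1 x := g ord_max x - ((chi x)%:C%C * g0 ord_max x + (tt x)%:C%C * u0 x).
Let V (j : 'I_2) := if j == ord0 then V0 else V1.
Let P0 x := (chi x)%:C%C * V0 x.
Let P1 x := (chi x)%:C%C * V1 x + (tt x)%:C%C * v x.
Let P (j : 'I_2) := if j == ord0 then P0 else P1.
Let ps x := (chi x)%:C%C * v x.

(** As [chi] vanishes below the crests, chi v extends by zero to the flat strip, and v has the trace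
    of u on the graph; at the top [chi] is 1 and both solutions vanish. Two sequences are needed:
    [z] is controlled at the top, [w] on the graph. *)
Lemma robin_core : exists z, [/\ jet D v V z,
  jet D0 ps P (fun n x => (chi x)%:C%C * z n x),
  zero_trace D (fun=> d) v /\ zero_trace D0 (fun=> d) ps, zero_trace D0 (fun=> 0) ps &
  exists w, [/\ jet D v V w, cmeas (setT : set mR) (trace D p u), (sqn leb (setT : set mR) (trace D p u) < +oo)%E,
    vanishes (fun n => sqn leb (setT : set mR) (fun s => w n (s, p s) - trace D p u s)) &
    is_trace D p v (trace D p v) /\ {ae leb, forall s, trace D p v s = trace D p u s}]].
Proof.
have [[Wu zu] _ _] := hu; have [[Wu0 z0d _] _ _] := S.
have [wu Ju cu] := zero_trace_jet oD Wu zu; have [w0 J0 cw0] := zero_trace_jet oD0 Wu0 z0d.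
have [w Jw [mT lT vT trT]] := trace_jet Bd pB cp cp' (ex_intro _ L pL) Ju.
have Jc := jetM oD Cchi kk1 (fun x _ => chi_le x) (fun j x _ => dchi_le j x) (jet_sub oD0 oD sD J0).
have EV : (fun (j : 'I_2) x => g j x - ((chi x)%:C%C * g0 j x + ('D_(basis j) chi x)%:C%C * u0 x)) = V.
  apply/funext; apply: basis_ind; apply/funext => x; rewrite /V //=.
  by rewrite dchi0 mul0r addr0.
have J1 := jetB oD Ju Jc; rewrite -/g EV in J1; have J2 := jetB oD Jw Jc; rewrite -/g EV in J2.
have zl x : D0 x -> ~ D x -> chi x = 0 /\ tt x = 0 by move=> Dx nD; apply: chi_low; exact: offD.
pose z n x := wu n x - (chi x)%:C%C * w0 n x; have sz n : csmooth_cpt (z n) := jet_smooth J1 n.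
have JE := jetM oD Cchi kk1 (fun x _ => chi_le x) (fun j x _ => dchi_le j x) J1.
have EP : (fun (j : 'I_2) x => (chi x)%:C%C * V j x + ('D_(basis j) chi x)%:C%C * v x) = P.
  apply/funext; apply: basis_ind; apply/funext => x; rewrite /V /P //=.
  by rewrite dchi0 mul0r addr0.
rewrite EP in JE.
have Jp : jet D0 ps P (fun n x => (chi x)%:C%C * z n x).
  apply: (jet_zero_ext oD0 oD sD JE) => x Dx nD; have [c1 c2] := zl x Dx nD; split.
  - by rewrite /ps c1 mul0r.
  - by apply: basis_ind; rewrite /P //= /P0 /P1 c1 ?c2 !mul0r ?addr0.
  - by move=> n; rewrite c1 mul0r.
  - move=> n j; rewrite (cderivM _ _ Cchi (sz n)) c1 mul0r add0r; move: j; apply: basis_ind; first by rewrite dchi0 mul0r.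
    by rewrite -/(tt x) c2 mul0r.
have cd s : chi (s, d) = 1 by have [] := @chi_high (s, d) Td.
have vz : vanishes (fun n => sqn leb (setT : set mR) (fun s => z n (s, d))).
  have gs (y : nat -> R * R -> R[i]) : (forall n, csmooth_cpt (y n)) -> forall n, cmeas (setT : set mR) (fun s => y n (s, d)).
    by move=> sy n; exact: (graph_cmeas (p := fun=> d) (@cont_cst R R d) (sy n)).
  have s1 : forall n, csmooth_cpt (wu n) by case: Ju.
  have s2 : forall n, csmooth_cpt (w0 n) by case: J0.
  have vs := vanishesD cu cw0; apply: (vanishes_le vs (K := 2)) => // n.
  rewrite ge0_muleDr ?sqn_ge0// (_ : sqn leb _ (fun s => z n (s, d)) = sqn leb (setT : set mR) (fun s => wu n (s, d) + - w0 n (s, d))%R).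
    have := sqnD leb measurableT (gs _ s1 n) (cmeasN (gs _ s2 n)); rewrite (_ : sqn leb (setT : set mR) (fun x => - w0 n (x, d))%R = sqn leb (setT : set mR) (fun s => w0 n (s, d)))//.
    by apply: eq_integral => s _; rewrite modulusN.
  by congr sqn; apply/funext => s; rewrite /z cd mul1r.
have q1 : zero_trace D (fun=> d) v := jet_flat_trace oD J1 vz.
have q2 : zero_trace D0 (fun=> d) ps.
  apply: (jet_flat_trace oD0 Jp); apply: (vanishes_le vz ler01) => n; rewrite mul1e le_eqVlt; apply/orP; left; apply/eqP.
  by congr sqn; apply/funext => s; rewrite cd mul1r.
have q3 : zero_trace D0 (fun=> 0) ps.
  apply: (jet_zero_trace oD0 Jp) => n s; have [-> _] := @chi_low (s, 0) (le_trans (proj1 (andP (pB 0))) (proj2 (andP (pB 0)))).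
  by rewrite mul0r.
exists z; split; [exact: J1|exact: Jp|exact: (conj q1 q2)|exact: q3|].
have cg s : chi (s, p s) = 0 by have [] := @chi_low (s, p s) (proj2 (andP (pB s))).
exists (fun n x => w n x - (chi x)%:C%C * w0 n x); split; [exact: J2|exact: mT|exact: lT| |].
  apply: (vanishes_le vT ler01) => n; rewrite mul1e le_eqVlt; apply/orP; left; apply/eqP.
  by congr sqn; apply/funext => s; rewrite cg mul0r subr0.
by apply: trT J2 _ => n s; rewrite cg mul0r subr0.
Qed.

Let al s : R := a (s, p s) * arclen p s.
Definition robin_energy : R := fine (\int[leb]_s (al s * modulus (trace D p u s) ^+ 2)%:E)%E.

Let al0 s : 0 <= al s. Proof. by apply: mulr_ge0 => //; exact: sqrtr_ge0. Qed.
Let mal : measurable_fun setT (al : mR -> R).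
Proof. by apply: measurable_funM; [exact: continuous_measurable_fun|exact: arclen_measurable]. Qed.

Lemma robin_integrable : leb.-integrable setT (fun s : mR => (al s * modulus (trace D p u s) ^+ 2)%:E).
Proof.
have [z [_ _ _ _ [w [_ mT lT _ _]]]] := robin_core.
have mm : measurable_fun setT (fun s : mR => al s * modulus (trace D p u s) ^+ 2).
  by apply: measurable_funM => //; apply/measurable_EFinP; exact: msqrE.
apply/integrableP; split; first exact/measurable_EFinP.
have Ma0 : 0 <= Ma := le_trans (a0 0) (aM 0).
have L0 : 0 <= L := le_trans (sqrtr_ge0 _) (pL 0).
apply: (@le_lt_trans _ _ ((Ma * L)%:E * sqn leb (setT : set mR) (trace D p u))%E); last first.
  by apply: lte_mul_pinfty => //; rewrite lee_fin mulr_ge0.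
have k1 : (0 <= (Ma * L)%:E)%E by rewrite lee_fin mulr_ge0.
have n1 (s : mR) : [set: mR] s -> (0 <= (modulus (trace D p u s) ^+ 2)%:E)%E by move=> _; rewrite lee_fin sqr_ge0.
rewrite /sqn -(ge0_integralZl leb measurableT (msqrE mT) n1 k1).
apply: ge0_le_integral; [exact: measurableT|by move=> s _; exact: abse_ge0|by apply: measurableT_comp => //; exact/measurable_EFinP|by apply: measurable_funeM; exact: msqrE|].
move=> s _; have nn : 0 <= al s * modulus (trace D p u s) ^+ 2 by apply: mulr_ge0; [exact: al0|exact: sqr_ge0].
rewrite gee0_abs; last by rewrite lee_fin.
rewrite -EFinM lee_fin.
by apply: ler_wpM2r; [exact: sqr_ge0|apply: ler_pM => //; exact: sqrtr_ge0].
Qed.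

Lemma robin_energyE : ((robin_energy)%:E = \int[leb]_s (al s * modulus (trace D p u s) ^+ 2)%:E)%E.
Proof. by rewrite /robin_energy fineK//; exact: integrable_fin_num robin_integrable. Qed.

Lemma robin_energy_ge0 : 0 <= robin_energy.
Proof. by rewrite /robin_energy; apply: fine_ge0; apply: integral_ge0 => s _; rewrite lee_fin mulr_ge0// sqr_ge0. Qed.

(** The traces of u and v agree, so the pairing is an integral of a |u|^2 with real weight, hence
    absent from the imaginary part. *)
Lemma robin_energy_part b : part b (ip_graph D p a u v) = if b then robin_energy else 0.
Proof.
have [z [_ _ _ _ [w [_ mT lT _ [[mv1 mv2 _] aT]]]]] := robin_core.
have mv : cmeas (setT : set mR) (trace D p v) by split.
have E : part b (ip_graph D p a u v) = pint leb (setT : set mR) b (fun s => (al s)%:C%C) (trace D p u) (trace D p v).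
  by rewrite /ip_graph; case: b.
have mc : cmeas (setT : set mR) (fun s => (al s)%:C%C) by exact: cmeas_real.
have rf : {ae leb, forall s, [set: mR] s -> trace D p u s = trace D p u s} by exact: aeW.
have aT' : {ae leb, forall s, [set: mR] s -> trace D p v s = trace D p u s} by apply: ae_imp aT => s h _.
apply: (etrans E); apply: (etrans (pint_ae measurableT b mc mT mT mv mT rf aT')).
have X s : part b ((al s)%:C%C * trace D p u s * conjc (trace D p u s)) = if b then al s * modulus (trace D p u s) ^+ 2 else 0.
  by rewrite /part modulus_sqr; case: (b); rewrite !cE !RealC !ImagC; ring.
rewrite /robin_energy /pint /Rintegral; case: b E X => E X.
  by congr fine; apply: eq_integral => s _; rewrite X.
by rewrite integral0_eq// => s _; rewrite X.
Qed.

Lemma robin_energy_set (E : set mR) (q : R) : measurable E -> 0 <= q -> (forall s, E s -> q <= al s) ->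
  (q%:E * sqn leb E (trace D p u) <= robin_energy%:E)%E.
Proof.
move=> mE q0 qE; have [z [_ _ _ _ [w [_ mT lT _ _]]]] := robin_core; rewrite robin_energyE.
have mT' : cmeas E (trace D p u) by case: mT => ? ?; split; exact: measurable_funTS.
have mm : measurable_fun setT (fun s : mR => (al s * modulus (trace D p u s) ^+ 2)%:E).
  by have /integrableP[] := robin_integrable.
have k1 : (0 <= q%:E)%E by rewrite lee_fin.
have n1 (s : mR) : E s -> (0 <= (modulus (trace D p u s) ^+ 2)%:E)%E by move=> _; rewrite lee_fin sqr_ge0.
rewrite /sqn -(ge0_integralZl leb mE (msqrE mT') n1 k1).
apply: (@le_trans _ _ (\int[leb]_(s in E) (al s * modulus (trace D p u s) ^+ 2)%:E)%E).
  apply: ge0_le_integral; [exact: mE|by move=> s _; rewrite -EFinM lee_fin mulr_ge0// sqr_ge0|by apply: measurable_funeM; exact: msqrE|exact: measurable_funTS|].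
  by move=> s Es; rewrite lee_fin; apply: ler_wpM2r; [exact: sqr_ge0|exact: qE].
by apply: ge0_subset_integral => // s _; rewrite lee_fin mulr_ge0// sqr_ge0.
Qed.

Local Notation pD := (pint area (D : set mR2)).
Local Notation nD := (rsqn area (D : set mR2)).

Lemma hform_part_ae b (M : R) y z (G : 'I_2 -> R * R -> R[i]) : 0 <= M -> (forall i j, bounded_coef area (D : set mR2) M (A i j)) ->
  (forall j, bounded_coef area (D : set mR2) M (A1 j)) ->
  W2 1 D y -> W2 1 D z -> (forall j, cmeasurable D (G j)) -> (forall j, {ae area, forall x, D x -> wderiv D j z x = G j x}) ->
  part b (hform A A1 A0 D y z) =
  pD b (A ord0 ord0) (wderiv D ord0 y) (G ord0) + pD b (A ord0 ord_max) (wderiv D ord_max y) (G ord0) +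
  pD b (A ord_max ord0) (wderiv D ord0 y) (G ord_max) + pD b (A ord_max ord_max) (wderiv D ord_max y) (G ord_max) +
  pD b (A1 ord0) (wderiv D ord0 y) z + pD b (A1 ord_max) (wderiv D ord_max y) z +
  sg b * pD b (A1 ord0) (G ord0) y + sg b * pD b (A1 ord_max) (G ord_max) y +
  pD b (fun x => (A0 x)%:C%C) y z.
Proof.
move=> M0 bA bA1 Wy Wz mG aeG.
have [hy hgy] := W2_wderiv oD Wy; have [hz hgz] := W2_wderiv oD Wz.
apply: (etrans (hform_part A A0 b mD M0 bA1 hy (fun j => (hgz j).2))).
have mA i j : cmeas (D : set mR2) (A i j) by case: (bA i j).
have mA1 j : cmeas (D : set mR2) (A1 j) by case: (bA1 j).
have my : cmeas (D : set mR2) y by case: hy.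
have mgy j : cmeas (D : set mR2) (wderiv D j y) by case: (hgy j) => _ [].
have mgz j : cmeas (D : set mR2) (wderiv D j z) by case: (hgz j) => _ [].
have rf (w : R * R -> R[i]) : {ae area, forall x, D x -> w x = w x} by exact: aeW.
have e1 i j : pD b (A i j) (wderiv D j y) (wderiv D i z) = pD b (A i j) (wderiv D j y) (G i).
  exact: (pint_ae mD b (mA i j) (mgy j) (mgy j) (mgz i) (mG i) (rf _) (aeG i)).
have e2 j : pD b (A1 j) (wderiv D j z) y = pD b (A1 j) (G j) y.
  exact: (pint_ae mD b (mA1 j) (mgz j) (mG j) my my (aeG j) (rf _)).
by rewrite (e1 ord0 ord0) (e1 ord0 ord_max) (e1 ord_max ord0) (e1 ord_max ord_max) (e2 ord0) (e2 ord_max).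
Qed.

Lemma pint_ext b (c y z : R * R -> R[i]) : (forall x, D0 x -> ~ D x -> y x = 0 \/ z x = 0) ->
  pint area (D0 : set mR2) b c y z = pD b c y z.
Proof.
move=> H; apply: (Rint_ext (F := fun x => part b (c x * y x * conjc (z x))) sD) => x Dx nD.
by case: (H x Dx nD) => ->; rewrite ?mulr0 ?mul0r ?conjc0 ?mulr0; case: b.
Qed.

(** [robin_point] integrated over the curved domain. The Dirichlet equation lives on the flat strip,
    but its test function and gradient vanish outside the curved domain, so all its integrals
    restrict to it. *)
Lemma robin_inequality (M t K SS sgm s : R) : 0 <= M -> (forall i j, lipcoef d M (A i j)) -> (forall j, lipcoef d M (A1 j)) ->
  bounded_coef area (D0 : set mR2) M (fun x => (A0 x)%:C%C) ->
  0 < t -> 2 * M * t <= c0 / 2 -> 4 * M / t + M + 1 <= K -> 0 <= K -> 0 < SS -> (1 + K) * (M / SS) <= c0 / 4 -> 0 < sgm -> 0 < s ->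
  c0 / 4 * (nD V0 + nD V1) + nD v + robin_energy <=
  (1 + K) * (2 * M * SS * kk ^+ 2 * nD (lay T u0) + M * s * (nD (lay T (g0 ord0)) + nD (lay T (g0 ord_max))) +
    2 * M * kk ^+ 2 / s * nD (lay T v) + 2 * M * sgm * kk ^+ 2 * nD (lay T u0) + sgm * nD f + (2 * M + 1) / sgm * nD (lay T v)).
Proof.
move=> M0 lA lA1 bA0 t0 Mt KM K0 SS0 SSM sg0 s0.
have [[Wu zu] L2r Hr] := hu; have [[Wu0 _ _] _ _] := S.
have [z [Jv Jp [zv zps] zps0 _]] := robin_core.
have [_ hv hV _ _] := Jv; have [_ hps hP _ _] := Jp.
have [hu' hg'] := W2_wderiv oD Wu; have hg j : cL2a D (g j) by case: (hg' j).
have [hu0' hg0'] := W2_wderiv oD0 Wu0.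
have hu0 : cL2a D u0 := cL2_sub mD0 mD sD hu0'.
have hg0 j : cL2a D (g0 j) by apply: (cL2_sub mD0 mD sD); case: (hg0' j).
have hPD j : cL2a D (P j) := cL2_sub mD0 mD sD (hP j).
have hpsD : cL2a D ps := cL2_sub mD0 mD sD hps.
have hfD : cL2a D f := cL2_sub mD0 mD sD hf.
have bA i j : bounded_coef area (D : set mR2) M (A i j) := bounded_coef_sub mD0 sD (lA i j).1.
have bA1 j : bounded_coef area (D : set mR2) M (A1 j) := bounded_coef_sub mD0 sD (lA1 j).1.
have bA0D := bounded_coef_sub mD0 sD bA0.
have hfu : cL2a D (fun x => f x + 'i%C * u x) by exact/L2P.
have hfu0 : cL2a D (fun x => f x + 'i%C * u0 x) by apply: (cL2_sub mD0 mD sD); case: S => _ /L2P.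
have Wv := jet_W2 oD Jv.
have mV j : cmeasurable D (V j) by case: (hV j).
have aeV j : {ae area, forall x, D x -> wderiv D j v x = V j x} := jet_wderiv j oD Jv.
have mP j : cmeasurable D0 (P j) by case: (hP j).
have aeP j : {ae area, forall x, D0 x -> wderiv D0 j ps x = P j x} := jet_wderiv j oD0 Jp.
have eqR b := hform_part_ae b M0 bA bA1 Wu Wv mV aeV.
have eqH b : part b (hform A A1 A0 D u v) + part b (ip_graph D p a u v) = pD b (fun=> 1) (fun x => f x + 'i%C * u x) v.
  rewrite -partD (Hr v (conj Wv zv)) cint_part; apply: eq_Rintegral => x _; by rewrite mul1r.
have eqD b := dsolve_eq b M0 lA lA1 S mP aeP (And3 (jet_W2 oD0 Jp) zps zps0).
have zl x : D0 x -> ~ D x -> chi x = 0 /\ tt x = 0 by move=> Dx nD; apply: chi_low; exact: offD.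
have zps' x : D0 x -> ~ D x -> ps x = 0 by move=> Dx nD; rewrite /ps (zl x Dx nD).1 mul0r.
have zP j x : D0 x -> ~ D x -> P j x = 0.
  move=> Dx nD; have [c1 c2] := zl x Dx nD; move: j; apply: basis_ind; rewrite /P //= /P0 /P1 c1 ?c2 !mul0r ?addr0//.
have x1 b i j : pint area (D0 : set mR2) b (A i j) (g0 j) (P i) = pD b (A i j) (g0 j) (P i).
  by apply: pint_ext => x Dx nD; right; exact: zP.
have x2 b j : pint area (D0 : set mR2) b (A1 j) (g0 j) ps = pD b (A1 j) (g0 j) ps.
  by apply: pint_ext => x Dx nD; right; exact: zps'.
have x3 b j : pint area (D0 : set mR2) b (A1 j) (P j) u0 = pD b (A1 j) (P j) u0.
  by apply: pint_ext => x Dx nD; left; exact: zP.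
have x4 b c y : pint area (D0 : set mR2) b c y ps = pD b c y ps.
  by apply: pint_ext => x Dx nD; right; exact: zps'.
have {}eqD b := eqD b.
have hv1 (r r1 : R) (F : R * R -> R) : hasint area (D : set mR2) F r -> r = r1 -> hasint area (D : set mR2) F r1 by move=> h <-.
have iP b i j := hasint_pint mD b M0 (bA i j) (hg j) (hV i).
have iQ b j := hasint_pint mD b M0 (bA1 j) (hg j) hv.
have iR b j := hasint_pint mD b M0 (bA1 j) (hV j) hu'.
have i9 b := hasint_pint mD b M0 bA0D hu' hv.
have i10 b := hasint_pint mD b ler01 (bounded_coef1 D) hfu hv.
have IR b := hasintB mD (hasintD mD (hasintD mD (hasintD mD (hasintD mD (hasintD mD (hasintD mD (hasintD mD (hasintD mD
  (iP b ord0 ord0) (iP b ord0 ord_max)) (iP b ord_max ord0)) (iP b ord_max ord_max)) (iQ b ord0)) (iQ b ord_max)) (hasintZ mD (sg b) (iR b ord0))) (hasintZ mD (sg b) (iR b ord_max))) (i9 b)) (i10 b).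
have jP b i j := hasint_pint mD b M0 (bA i j) (hg0 j) (hPD i).
have jQ b j := hasint_pint mD b M0 (bA1 j) (hg0 j) hpsD.
have jR b j := hasint_pint mD b M0 (bA1 j) (hPD j) hu0.
have j9 b := hasint_pint mD b M0 bA0D hu0 hpsD.
have j10 b := hasint_pint mD b ler01 (bounded_coef1 D) hfu0 hpsD.
have ID b := hasintB mD (hasintD mD (hasintD mD (hasintD mD (hasintD mD (hasintD mD (hasintD mD (hasintD mD (hasintD mD
  (jP b ord0 ord0) (jP b ord0 ord_max)) (jP b ord_max ord0)) (jP b ord_max ord_max)) (jQ b ord0)) (jQ b ord_max)) (hasintZ mD (sg b) (jR b ord0))) (hasintZ mD (sg b) (jR b ord_max))) (j9 b)) (j10 b).
have ar1 (Sm h ip r q : R) : h = Sm -> h + ip = q -> ip = r -> Sm - q = - r by move=> <- <- <-; rewrite opprD addrA subrr add0r.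
(* The equation gives the value of the integral: minus the boundary energy in the real part, 0 in
   the imaginary part. *)
have vR b := hv1 _ (- (if b then robin_energy else 0)) _ (IR b) (ar1 _ _ _ _ _ (eqR b) (eqH b) (robin_energy_part b)).
have ar2 (k z1 z2 z3 z4 z5 z6 z7 z8 z9 z10 y1 y2 y3 y4 y5 y6 y7 y8 y9 y10 : R) : z1 = y1 -> z2 = y2 -> z3 = y3 -> z4 = y4 -> z5 = y5 -> z6 = y6 -> z7 = y7 ->
    z8 = y8 -> z9 = y9 -> z10 = y10 -> z1 + z2 + z3 + z4 + z5 + z6 + k * z7 + k * z8 + z9 - z10 = 0 ->
    y1 + y2 + y3 + y4 + y5 + y6 + k * y7 + k * y8 + y9 - y10 = 0.
  by move=> -> -> -> -> -> -> -> -> -> ->.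
have vD b := hv1 _ 0 _ (ID b) (ar2 _ _ _ _ _ _ _ _ _ _ _ _ _ _ _ _ _ _ _ _ _ (x1 b ord0 ord0) (x1 b ord0 ord_max) (x1 b ord_max ord0) (x1 b ord_max ord_max)
  (x2 b ord0) (x2 b ord_max) (x3 b ord0) (x3 b ord_max) (x4 b _ _) (x4 b _ _) (eqD b)).
have l0 := hasint_lay T mD hu0; have l1 := hasint_lay T mD (hg0 ord0); have l2 := hasint_lay T mD (hg0 ord_max).
have l3 := hasint_lay T mD hv.
have IZ := hasintZ mD (1 + K) (hasintD mD (hasintD mD (hasintD mD (hasintD mD (hasintD mD (hasintZ mD (2 * M * SS * kk ^+ 2) l0) (hasintZ mD (M * s) (hasintD mD l1 l2)))
   (hasintZ mD (2 * M * kk ^+ 2 / s) l3)) (hasintZ mD (2 * M * sgm * kk ^+ 2) l0)) (hasintZ mD sgm (hasint_sqr mD hfD))) (hasintZ mD ((2 * M + 1) / sgm) l3)).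
have IRR := hasintD mD (hasintB mD (hasintB mD (vR true) (vD true)) (hasintZ mD K (hasintB mD (vR false) (vD false)))) IZ.
have IL := hasintD mD (hasintZ mD (c0 / 4) (hasintD mD (hasint_sqr mD (hV ord0)) (hasint_sqr mD (hV ord_max)))) (hasint_sqr mD hv).
have main := hasint_le mD IL IRR.
apply: (@fin_arith K); apply: main.
apply: ae_imp2 (ae_imp2 (fun x p q => conj p q) (ae_imp2 (fun x p q => conj p q) (lA1 ord0).1.2 (lA1 ord_max).1.2) (lA ord_max ord_max).1.2)
    (ae_imp2 (fun x p q => conj p q) (lA ord0 ord_max).1.2 (ae_imp2 (fun x p q => conj p q) (coefs_herm hA) bA0.2)).
move=> x [[b0 b1] aa1] [a01 [hx ha0]] Dx'; have Dx := sD Dx'; have [r0 r1 a10 ell] := hx Dx.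
move: {b0}(b0 Dx) {b1}(b1 Dx) {aa1}(aa1 Dx) {a01}(a01 Dx) {ha0}(ha0 Dx) => b0 b1 aa1 a01 ha0.
rewrite modulus_real in ha0; move: ell aa1; rewrite r0 r1 a10 => ell aa1.
have lx : (x.2 < T) = false -> chi x = 1 /\ tt x = 0 by move=> /negbT; rewrite -leNgt; exact: chi_high.
have rp := @robin_point R c0 M t K SS sgm s (x.2 < T) (A0 x) _ _ (chi x) (tt x) _ _ _ (g ord0 x) (g ord_max x) (g0 ord0 x) (g0 ord_max x) (u x) (u0 x) (f x)
  M0 ell a01 aa1 b0 b1 ha0 t0 Mt KM K0 SS0 SSM sg0 s0 (chi01 x) lx.
cbv zeta in rp; rewrite !(@modulusM R (tt x)%:C%C) !modulus_real !exprMn !(real_normK (num_real (tt x))) in rp.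
have q (y : R[i]) : 0 <= modulus y ^+ 2 by exact: sqr_ge0.
have la := lay_arith (modulus (g0 ord0 x) ^+ 2) (modulus (g0 ord_max x) ^+ 2) M0 SS0 sg0 s0 kk0 K0 (fun e => (lx e).2) (tt_le x) (q (u0 x)) (q (f x)) (q (v x)).
exact: (le_trans rp (lerD (lexx _) la)).
Qed.

Local Notation nF := (rsqn area (D0 : set mR2) f).
Local Notation U := (upper T p).

Lemma robin_total :
  nD (fun x => u x - u0 x) + nD (fun x => g ord0 x - g0 ord0 x) + nD (fun x => g ord_max x - g0 ord_max x) <=
  2 * (nD V0 + nD V1 + nD v) + 4 * (nD (lay T (g0 ord0)) + nD (lay T (g0 ord_max))) + (2 + 4 * kk ^+ 2) * nD (lay T u0).
Proof.
have [[Wu zu] _ _] := hu; have [[Wu0 _ _] _ _] := S.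
have [z [[_ hv hV _ _] _ _ _ _]] := robin_core.
have [hu' hg'] := W2_wderiv oD Wu; have hg j : cL2a D (g j) by case: (hg' j).
have [hu0' hg0'] := W2_wderiv oD0 Wu0.
have hu0 : cL2a D u0 := cL2_sub mD0 mD sD hu0'.
have hg0 j : cL2a D (g0 j) by apply: (cL2_sub mD0 mD sD); case: (hg0' j).
have IL := hasintD mD (hasintD mD (hasint_sqr mD (cL2B mD hu' hu0)) (hasint_sqr mD (cL2B mD (hg ord0) (hg0 ord0)))) (hasint_sqr mD (cL2B mD (hg ord_max) (hg0 ord_max))).
have IR := hasintD mD (hasintD mD (hasintZ mD 2 (hasintD mD (hasintD mD (hasint_sqr mD (hV ord0)) (hasint_sqr mD (hV ord_max))) (hasint_sqr mD hv)))
  (hasintZ mD 4 (hasintD mD (hasint_lay T mD (hg0 ord0)) (hasint_lay T mD (hg0 ord_max))))) (hasintZ mD (2 + 4 * kk ^+ 2) (hasint_lay T mD hu0)).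
apply: (hasint_le mD IL IR); apply: aeW => x Dx.
have lx : (x.2 < T) = false -> chi x = 1 /\ tt x = 0 by move=> /negbT; rewrite -leNgt; exact: chi_high.
exact: (total_point (u x) (u0 x) (g ord0 x) (g ord_max x) (g0 ord0 x) (g0 ord_max x) (chi01 x) (tt_le x) lx).
Qed.

Lemma robin_norm X : 0 <= X ->
  2 * (nD V0 + nD V1 + nD v) + 4 * (nD (lay T (g0 ord0)) + nD (lay T (g0 ord_max))) + (2 + 4 * kk ^+ 2) * nD (lay T u0) <= X * nF ->
  (normW21 D (fun x => u x - u0 x)%R <= (Num.sqrt X)%:E * normL2 D0 f)%E.
Proof.
move=> X0 H; have [[Wu zu] _ _] := hu; have [[Wu0 _ _] _ _] := S.
have [hu' hg'] := W2_wderiv oD Wu; have [hu0' hg0'] := W2_wderiv oD0 Wu0.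
have [z0 J0 _] := dsolve_jet d0 S; have J0D := jet_sub oD0 oD sD J0.
have [_ hu0 hg0 _ _] := J0D.
have wd j : is_weak_deriv D j (fun x => u x - u0 x) (fun x => g j x - g0 j x).
  exact: (weak_derivB oD (hg' j).1 (jet_weak j oD J0D) hu' hu0 (hg' j).2 (hg0 j)).
have fE (h : R * R -> R[i]) : cL2a D h -> sqa D h = (nD h)%:E by exact: rsqnE.
have fF : sqa D0 f = nF%:E by exact: rsqnE.
have sum2 (F : 'I_2 -> \bar R) : (\sum_(j < 2) F j = F ord0 + F ord_max)%E.
  by rewrite 2!big_ord_recl big_ord0 adde0; congr (_ + F _)%E; exact/val_inj.
have q0 := fE _ (cL2B mD hu' hu0); have q1 := fE _ (cL2B mD (hg' ord0).2 (hg0 ord0)); have q2 := fE _ (cL2B mD (hg' ord_max).2 (hg0 ord_max)).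
have E1 := etrans (normW21E oD wd) (congr1 (fun x : \bar R => (x `^ 2^-1)%E)
   (congr2 (fun x y : \bar R => (x + y)%E) q0 (etrans (sum2 _) (congr2 (fun x y : \bar R => (x + y)%E) q1 q2)))).
rewrite E1 normL2E fF.
have nn (h : R * R -> R[i]) : 0 <= nD h := rsqn_ge0 area (D : set mR2) h.
have nf : 0 <= nF := rsqn_ge0 area (D0 : set mR2) f.
exact: (poweR_bound (nn _) (nn _) (nn _) X0 nf (le_trans robin_total H)).
Qed.

(** The layer of the curved domain lies in the flat strip of height T, where the gradient bound
    holds; [dsolve_layer] then gives the extra T^2 for the function. *)
Lemma robin_layers Cv : 0 < T ->
  (sqa (strip T) (g0 ord0) + sqa (strip T) (g0 ord_max) <= (Cv * T * nF)%:E)%E ->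
  nD (lay T (g0 ord0)) + nD (lay T (g0 ord_max)) <= Cv * T * nF /\ nD (lay T u0) <= 8 * T ^+ 2 * (Cv * T * nF).
Proof.
move=> T0 H; have [[Wu0 _ _] _ _] := S; have [hu0' hg0'] := W2_wderiv oD0 Wu0.
have hg0 j : cL2a D0 (g0 j) by case: (hg0' j).
have mT := strip_meas T; have sT := strip_sub Td.
have ll' (h : R * R -> R[i]) : cL2a D0 h -> ((nD (lay T h))%:E <= sqa (strip T) h)%E.
  move=> hh; have [mh _] := hh; rewrite -rsqnE; last exact: (lay_cL2 T mD (cL2_sub mD0 mD sD hh)).
  apply: (@le_trans _ _ (sqa D0 (lay T h))); first by apply: sqa_sub => //; exact: lay_cmeas.
  by apply: (lay_sqa mD0 mT sT mh) => x /andP[x0 _] xT; apply/andP.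
have b1 := le_trans (leeD (ll' _ (hg0 ord0)) (ll' _ (hg0 ord_max))) H.
split; first by rewrite -lee_fin EFinD.
have Tp : 0 < T <= d by rewrite T0.
have T2 : 0 <= 8 * T ^+ 2 by rewrite mulr_ge0// sqr_ge0.
rewrite -lee_fin (EFinM (8 * T ^+ 2)); apply: (le_trans (ll' _ hu0')); apply: (le_trans (dsolve_layer d0 hf S Tp)).
apply: lee_wpmul2l; first by rewrite lee_fin.
by apply: le_trans H; rewrite leeDr//; exact: sqa_ge0.
Qed.

(** On the good part of the boundary the density of the boundary energy is at least q, so the energy
    divided by q bounds the trace there. *)
Lemma robin_layer (e j kap q : R) (J Bad : set mR) : 0 < e -> 0 < j -> 0 <= kap -> measurable J -> measurable Bad ->
  (forall s : R, ((j * e)%:E <= \int[leb]_(t in `]0%R, e[) (\1_J (s + t)%R)%:E)%E) ->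
  (forall F F1 F2 : R * R -> R, continuous F -> continuous F1 -> continuous F2 ->
  (forall x, is_derive x (basis ord0) F (F1 x)) -> (forall x, is_derive x (basis ord_max) F (F2 x)) ->
  forall t, B < t < T -> (\int[leb]_(s in Bad) (F (s, t) ^+ 2)%:E <=
    kap%:E * \int[area]_(x in upper d p) (F1 x ^+ 2 + F2 x ^+ 2 + F x ^+ 2)%:E)%E) ->
  0 < q -> (forall s, (J `\` Bad) s -> q <= a (s, p s) * arclen p s) ->
  j * (T - B) * nD (lay T v) <= 4 * (8 * T * (T - B) * (robin_energy / q) +
    (2 * T * ((T - B) * (4 * T + 2 * kap) + 2 * e ^+ 2) + 2 * T ^+ 2 * (T - B) * j) * (nD V0 + nD V1 + nD v)).
Proof.
move=> e0 j0 kap0 mJ mBad HJ Hbad q0 qE; have [z [_ _ _ _ [w [Jw mT lT vT _]]]] := robin_core.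
have [_ hv hV _ _] := Jw; have mJB := measurableD mJ mBad.
have LJ := layer_jet cp (fun s => proj1 (andP (pB s))) (fun s => proj2 (andP (pB s))) BT Td e0 j0 kap0 mJ mBad HJ Hbad Jw mT vT.
have mU : measurable (U : set mR2) by exact: upper_measurable.
have sU : U `<=` D by move=> x /andP[x1 x2]; apply/andP; split => //; exact: lt_le_trans Td.
have hTJ : cL2 leb (J `\` Bad) (trace D p u).
  split; first by case: mT => ? ?; split; exact: measurable_funTS.
  apply: le_lt_trans lT; apply: ge0_subset_integral => //; first exact: msqrE.
  by move=> x _; rewrite lee_fin sqr_ge0.
have QE := rsqnE hTJ; have := robin_energy_set mJB (ltW q0) qE; rewrite QE -EFinM lee_fin => Qr.
have fE (h : R * R -> R[i]) : cL2a D h -> sqa D h = (nD h)%:E by exact: rsqnE.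
have UE : sqa U v = (rsqn area (U : set mR2) v)%:E by apply: rsqnE; exact: (cL2_sub mD mU sU hv).
rewrite QE UE (fE _ (hV ord0)) (fE _ (hV ord_max)) (fE _ hv) in LJ.
have {}LJ : j * (T - B) * rsqn area (U : set mR2) v <= 4 * (2 * T * (4 * (T - B)) * rsqn leb (J `\` Bad) (trace D p u) +
    (2 * T * ((T - B) * (4 * T + 2 * kap) + 2 * e ^+ 2) + 2 * T ^+ 2 * (T - B) * j) * (nD V0 + nD V1 + nD v)).
  by rewrite -lee_fin; exact: LJ.
have H1 := ltW H0; have T0 : 0 < T by apply: le_lt_trans BT; have /andP[h1 h2] := pB 0; exact: le_trans h2.
have lv : nD (lay T v) <= rsqn area (U : set mR2) v.
  rewrite -lee_fin -UE -rsqnE; last exact: lay_cL2.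
  by apply: lay_sqa => //; [case: hv|move=> x /andP[x1 _] xT; apply/andP].
have jH : 0 <= j * (T - B) by rewrite mulr_ge0// ltW.
apply: (le_trans (ler_wpM2l jH lv)); apply: (le_trans LJ); apply: ler_wpM2l => //; apply: lerD => //.
have -> : 2 * T * (4 * (T - B)) = 8 * T * (T - B) by ring.
apply: ler_wpM2l; first by rewrite !mulr_ge0// ltW.
by rewrite ler_pdivlMr// mulrC.
Qed.

End robin.

(** * Absorption of the layer terms *)

Section absorption.
Context {R : realType}.

(** [E2] stands for the squared rate. The layer norm [lv] is of order eta E2 times the energies, and
    occurs with weights kk^2 / s, of order 1 / (eta^2 s), and 1 / sg. With s = Lam E2 / eta and sg =
    Lam eta E2 both products are of order 1 / Lam, while the terms with s and sg themselves remain
    of order Lam E2 F. *)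
Lemma absorb (M K SS Cs Cv tau j cE c : R) : 0 <= M -> 0 <= K -> 0 < SS -> 0 < Cs -> 0 < Cv -> 0 < tau -> 0 < j -> 0 < cE -> 0 < c ->
  exists2 C : R, 0 < C & forall eta E2 F kk n0 n1 nv rob lu lg lv kap e q T : R,
   0 < eta <= 1 -> eta <= E2 -> eta + kap <= cE * E2 -> q^-1 <= cE * E2 -> 0 < e <= eta -> 0 <= kap ->
   T = tau * eta -> kk = 2 / eta * Cs -> 0 <= F -> 0 <= n0 -> 0 <= n1 -> 0 <= nv -> 0 <= rob -> 0 <= lu -> 0 <= lg -> 0 <= lv ->
   (forall sg s, 0 < sg -> 0 < s -> c * (n0 + n1) + nv + rob <=
     (1 + K) * (2 * M * SS * kk ^+ 2 * lu + M * s * lg + 2 * M * kk ^+ 2 / s * lv + 2 * M * sg * kk ^+ 2 * lu + sg * F + (2 * M + 1) / sg * lv)) ->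
   lg <= Cv * T * F -> lu <= 8 * T ^+ 2 * (Cv * T * F) ->
   j * eta * lv <= 4 * (8 * T * eta * (rob / q) + (2 * T * (eta * (4 * T + 2 * kap) + 2 * e ^+ 2) + 2 * T ^+ 2 * eta * j) * (n0 + n1 + nv)) ->
   2 * (n0 + n1 + nv) + 4 * lg + (2 + 4 * kk ^+ 2) * lu <= C * E2 * F.
Proof.
move=> M0 K0 SS0 Cs0 Cv0 tau0 j0 cE0 c0.
(* Bounds from below the coefficients of the gradient of v, of v, and of the boundary energy. *)
pose c' := Num.min c 1; have c'0 : 0 < c' by rewrite lt_min c0 ltr01.
have c'c : c' <= c by rewrite ge_min lexx. have c'1 : c' <= 1 by rewrite ge_min lexx orbT.
have Cs2 : 0 < Cs ^+ 2 by exact: exprn_gt0. have tau3 : 0 < tau ^+ 3 by exact: exprn_gt0. have tau2 : 0 < tau ^+ 2 by exact: exprn_gt0.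
pose C1 := 32 * Cs ^+ 2 * tau ^+ 3 * Cv; have C10 : 0 < C1 by rewrite !mulr_gt0.
pose C3 := 8 * M * Cs ^+ 2 + 2 * M + 1; have C30 : 0 < C3 by rewrite ltr_wpDl// addr_ge0// !mulr_ge0// ltW.
pose C4 := 8 * tau ^+ 2 + 4 * tau + 2 * tau ^+ 2 * j; have C40 : 0 < C4 by rewrite !addr_gt0// !mulr_gt0.
pose C6 := 4 * cE * (8 * tau + C4) / j; have C60 : 0 < C6 by rewrite divr_gt0// !mulr_gt0// addr_gt0// mulr_gt0.
have K1 : 0 < 1 + K by rewrite ltr_pwDl.
(* Large enough for the layer terms, after multiplication by 1 + K, to be at most c' / 2 times the
   energies (see [t5]). *)
pose Lam := 2 * (1 + K) * C3 * C6 / c'; have Lam0 : 0 < Lam by rewrite /Lam; apply: divr_gt0 => //; apply: mulr_gt0 => //; apply: mulr_gt0 => //; apply: mulr_gt0.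
pose W := 2 * M * SS * C1 + 2 * M * Lam * C1 + M * Lam * Cv * tau + Lam.
have w1 : 0 <= 2 * M * SS * C1 by apply: mulr_ge0; [apply: mulr_ge0; [exact: mulr_ge0|exact: ltW]|exact: ltW].
have w2 : 0 <= 2 * M * Lam * C1 by apply: mulr_ge0; [apply: mulr_ge0; [exact: mulr_ge0|exact: ltW]|exact: ltW].
have w3 : 0 <= M * Lam * Cv * tau := mulr_ge0 (mulr_ge0 (mulr_ge0 M0 (ltW Lam0)) (ltW Cv0)) (ltW tau0).
have W0 : 0 < W by rewrite /W ltr_wpDl//; apply: addr_ge0 => //; exact: addr_ge0.
exists (4 / c' * ((1 + K) * W) + 4 * Cv * tau + 16 * tau ^+ 3 * Cv + 4 * C1).
  have u1 : 0 < 4 / c' * ((1 + K) * W) by apply: mulr_gt0; [exact: divr_gt0|exact: mulr_gt0].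
  have u2 : 0 < 4 * Cv * tau by apply: mulr_gt0 => //; exact: mulr_gt0.
  have u3 : 0 < 16 * tau ^+ 3 * Cv by apply: mulr_gt0 => //; exact: mulr_gt0.
  have u4 : 0 < 4 * C1 by exact: mulr_gt0.
  by apply: addr_gt0 => //; apply: addr_gt0 => //; exact: addr_gt0.
move=> eta E2 F kk n0 n1 nv rob lu lg lv kap e q T /andP[eta0 eta1] etaE kapE qE /andP[e0 ee] kap0 TE kkE F0 n00 n10 nv0 rob0 lu0 lg0 lv0 H lgE luE lvE.
have E20 : 0 < E2 := lt_le_trans eta0 etaE.
pose NN := n0 + n1 + nv; have NN0 : 0 <= NN by rewrite !addr_ge0.
have ne : eta != 0 by exact: lt0r_neq0. have nE : E2 != 0 by exact: lt0r_neq0. have nL : Lam != 0 by exact: lt0r_neq0.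
have EF0 : 0 <= E2 * F by rewrite mulr_ge0// ltW.
have etaF : eta * F <= E2 * F by exact: ler_wpM2r.
have eta3 : eta ^+ 3 <= E2.
  apply: le_trans etaE; rewrite exprS; apply: ler_piMr; [exact: ltW|].
  by apply: exprn_ile1 => //; exact: ltW.
have kklu : kk ^+ 2 * lu <= C1 * (eta * F).
  have := ler_wpM2l (sqr_ge0 kk) luE; rewrite (_ : kk ^+ 2 * (8 * T ^+ 2 * (Cv * T * F)) = C1 * (eta * F))//.
  by rewrite kkE TE /C1; field.
have lg' : lg <= Cv * tau * (eta * F) by move: lgE; rewrite TE (_ : Cv * (tau * eta) * F = Cv * tau * (eta * F))//; ring.
have lu' : lu <= 8 * tau ^+ 3 * Cv * (E2 * F).
  apply: (le_trans luE); rewrite TE (_ : _ * _ = 8 * tau ^+ 3 * Cv * (eta ^+ 3 * F)); last by ring.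
  by apply: ler_wpM2l; [rewrite !mulr_ge0// ltW|exact: ler_wpM2r].
(* The factor [E2] comes from 1 / q in front of the boundary energy and from eta + kap in front of
   the interior energy. *)
have lv' : lv <= eta * E2 * C6 * (rob + NN).
  have e2 : e ^+ 2 <= eta ^+ 2 by rewrite lerXn2r// nnegrE ltW.
  have k1 : 2 * T * (eta * (4 * T + 2 * kap) + 2 * e ^+ 2) + 2 * T ^+ 2 * eta * j <= eta ^+ 2 * (C4 * (cE * E2)).
    apply: (@le_trans _ _ (eta ^+ 2 * (C4 * (eta + kap)))); last first.
      by apply: ler_wpM2l; [exact: sqr_ge0|apply: ler_wpM2l; [exact: ltW|]].
    have T0 : 0 <= 4 * T by rewrite TE !mulr_ge0// ltW.
    have s1 := ler_wpM2l T0 e2.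
    have s2 : 0 <= (8 * tau ^+ 2 + 2 * tau ^+ 2 * j) * (eta ^+ 2 * kap).
      by apply: mulr_ge0; [apply: addr_ge0; rewrite !mulr_ge0// ltW|apply: mulr_ge0 => //; exact: sqr_ge0].
    have s3 : eta ^+ 2 * (C4 * (eta + kap)) = 2 * T * (eta * (4 * T + 2 * kap)) + 4 * T * eta ^+ 2 + 2 * T ^+ 2 * eta * j + (8 * tau ^+ 2 + 2 * tau ^+ 2 * j) * (eta ^+ 2 * kap).
      by rewrite TE /C4; ring.
    rewrite s3; move: s1 s2; rewrite mulrDr; move: (4 * T * _) (eta ^+ 2 * kap) => y1 y2.
    rewrite (_ : 2 * T * (2 * e ^+ 2) = 4 * T * e ^+ 2); last by ring.
    by move=> *; lra.
  have r1 : rob / q <= rob * (cE * E2) by exact: ler_wpM2l.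
  have je : 0 < j * eta by exact: mulr_gt0.
  rewrite -(ler_pM2l je); apply: (le_trans lvE).
  have T8 : 0 <= 8 * T * eta by rewrite TE !mulr_ge0// ltW.
  have s1 := ler_wpM2l T8 r1; have s2 := ler_wpM2r NN0 k1.
  have p1 : 0 <= 4 * cE * (eta ^+ 2 * E2) by rewrite !mulr_ge0// ?ltW// exprn_gt0.
  have p2 : 0 <= 8 * tau * NN + C4 * rob by rewrite addr_ge0// !mulr_ge0// ltW.
  have p3 := mulr_ge0 p1 p2.
  have -> : j * eta * (eta * E2 * C6 * (rob + NN)) = 4 * (8 * T * eta * (rob * (cE * E2)) + eta ^+ 2 * (C4 * (cE * E2)) * NN) + 4 * cE * (eta ^+ 2 * E2) * (8 * tau * NN + C4 * rob).
    by rewrite TE /C6; field; exact: lt0r_neq0.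
  move: s1 s2 p3; rewrite -/NN; move: (8 * T * eta * _) (8 * T * eta * _) (_ * NN) (_ * NN) (4 * cE * _ * _).
  by clear; move=> *; lra.
(* These are the Young weights: one of order eta E2, the other of order E2 / eta. *)
have sg0 : 0 < Lam * eta * E2 := mulr_gt0 (mulr_gt0 Lam0 eta0) E20. have s0 : 0 < Lam * E2 / eta := divr_gt0 (mulr_gt0 Lam0 E20) eta0.
have := H _ _ sg0 s0.
have t1 : 2 * M * SS * kk ^+ 2 * lu <= 2 * M * SS * C1 * (E2 * F).
  rewrite -(mulrA (2 * M * SS)) -(mulrA (2 * M * SS) C1); apply: ler_wpM2l; first by rewrite !mulr_ge0// ltW.
  by apply: (le_trans kklu); apply: ler_wpM2l; [exact: ltW|].
have eE : eta * E2 <= E2 by apply: ler_piMl => //; exact: ltW.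
have t2 : 2 * M * (Lam * eta * E2) * kk ^+ 2 * lu <= 2 * M * Lam * C1 * (E2 * F).
  have p0 : 0 <= 2 * M * Lam := mulr_ge0 (mulr_ge0 (ler0n _ 2) M0) (ltW Lam0).
  have p1 : 0 <= eta * E2 by rewrite mulr_ge0// ltW.
  have -> : 2 * M * (Lam * eta * E2) * kk ^+ 2 * lu = 2 * M * Lam * (eta * E2 * (kk ^+ 2 * lu)) by ring.
  rewrite -(mulrA _ C1); apply: ler_wpM2l => //.
  apply: (le_trans (ler_wpM2l p1 kklu)).
  rewrite (_ : eta * E2 * (C1 * (eta * F)) = C1 * (eta * eta * (E2 * F))); last by ring.
  apply: ler_wpM2l; [exact: ltW|]; apply: ler_piMl => //.
  by apply: mulr_ile1 => //; exact: ltW.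
have t3 : M * (Lam * E2 / eta) * lg <= M * Lam * Cv * tau * (E2 * F).
  have p0 : 0 <= M * (Lam * E2 / eta) by apply: mulr_ge0 => //; exact: ltW.
  apply: (le_trans (ler_wpM2l p0 lg')); rewrite le_eqVlt; apply/orP; left; apply/eqP; by field.
have t4 : Lam * eta * E2 * F <= Lam * (E2 * F).
  have -> : Lam * eta * E2 * F = Lam * (eta * E2 * F) by ring.
  by apply: ler_wpM2l; [exact: ltW|exact: ler_wpM2r].
have t5 : 2 * M * kk ^+ 2 / (Lam * E2 / eta) * lv + (2 * M + 1) / (Lam * eta * E2) * lv <= c' / (2 * (1 + K)) * (rob + NN).
  have -> : 2 * M * kk ^+ 2 / (Lam * E2 / eta) * lv + (2 * M + 1) / (Lam * eta * E2) * lv = C3 / (Lam * eta * E2) * lv.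
    by rewrite kkE /C3; field; rewrite ne nE nL.
  have p0 : 0 <= C3 / (Lam * eta * E2) by apply: divr_ge0; exact: ltW.
  apply: (le_trans (ler_wpM2l p0 lv')); rewrite le_eqVlt; apply/orP; left; apply/eqP.
  have -> : C3 / (Lam * eta * E2) * (eta * E2 * C6 * (rob + NN)) = C3 * C6 / Lam * (rob + NN) by field; rewrite ne nE nL.
  congr (_ * _); rewrite /Lam; field; rewrite !lt0r_neq0//.
move=> HH.
have big : 2 * M * SS * kk ^+ 2 * lu + M * (Lam * E2 / eta) * lg + 2 * M * kk ^+ 2 / (Lam * E2 / eta) * lv + 2 * M * (Lam * eta * E2) * kk ^+ 2 * lu + Lam * eta * E2 * F + (2 * M + 1) / (Lam * eta * E2) * lv
   <= W * (E2 * F) + c' / (2 * (1 + K)) * (rob + NN).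
  have -> : W * (E2 * F) = 2 * M * SS * C1 * (E2 * F) + 2 * M * Lam * C1 * (E2 * F) + M * Lam * Cv * tau * (E2 * F) + Lam * (E2 * F) by rewrite /W; ring.
  have ar (y1 y2 y3 y4 y5 y6 z1 z2 z3 z4 z5 : R) : y1 <= z1 -> y4 <= z2 -> y2 <= z3 -> y5 <= z4 -> y3 + y6 <= z5 ->
    y1 + y2 + y3 + y4 + y5 + y6 <= z1 + z2 + z3 + z4 + z5 by clear; move=> *; lra.
  exact: (ar _ _ _ _ _ _ _ _ _ _ _ t1 t2 t3 t4 t5).
have HH2 : c * (n0 + n1) + nv + rob <= (1 + K) * (W * (E2 * F)) + c' / 2 * (rob + NN).
  apply: (le_trans (le_trans HH (ler_wpM2l (ltW K1) big))); rewrite le_eqVlt; apply/orP; left; apply/eqP.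
  by field; exact: lt0r_neq0.
(* As c' <= 1, the boundary energy on the right is absorbed together with the norms of v. *)
have NNb : NN <= 2 / c' * ((1 + K) * (W * (E2 * F))).
  rewrite (_ : 2 / c' * ((1 + K) * (W * (E2 * F))) = 2 * ((1 + K) * (W * (E2 * F))) / c'); last by ring.
  rewrite ler_pdivlMr//.
  have z1 := ler_wpM2r (addr_ge0 n00 n10) c'c; have z2 := ler_wpM2r nv0 c'1; have z3 := ler_wpM2r rob0 c'1.
  have z6 := mulr_ge0 (ltW c'0) rob0.
  move: HH2 z1 z2 z3 z6; rewrite /NN; move: ((1 + K) * _) => y; clear.
  by move=> *; lra.
have kk4 := le_trans kklu (ler_wpM2l (ltW C10) etaF).
have p0 : 0 <= Cv * tau := mulr_ge0 (ltW Cv0) (ltW tau0).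
have lg4 := le_trans lg' (ler_wpM2l p0 etaF).
have -> : (2 + 4 * kk ^+ 2) * lu = 2 * lu + 4 * (kk ^+ 2 * lu) by ring.
have -> : (4 / c' * ((1 + K) * W) + 4 * Cv * tau + 16 * tau ^+ 3 * Cv + 4 * C1) * E2 * F =
  2 * (2 / c' * ((1 + K) * (W * (E2 * F)))) + 4 * (Cv * tau * (E2 * F)) + 2 * (8 * tau ^+ 3 * Cv * (E2 * F)) + 4 * (C1 * (E2 * F)) by ring.
have ar (y1 y2 y3 y4 z1 z2 z3 z4 : R) : y1 <= z1 -> y2 <= z2 -> y3 <= z3 -> y4 <= z4 ->
  2 * y1 + 4 * y2 + (2 * y3 + 4 * y4) <= 2 * z1 + 4 * z2 + 2 * z3 + 4 * z4 by clear; move=> *; lra.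
exact: (ar _ _ _ _ _ _ _ _ NNb lg4 lu' kk4).
Qed.

End absorption.

(** * The estimate for one boundary, uniform in its parameters *)

Section estimate.
Context {R : realType}.
Local Notation mR := (measurableTypeR R).
Local Notation mR2 := (measurableTypeR R * measurableTypeR R)%type.
Local Notation leb := (@lebesgue_measure R).
Local Notation strip h := (upper h (fun=> 0%R)).
Variables (A : 'I_2 -> 'I_2 -> R * R -> R[i]) (A1 : 'I_2 -> R * R -> R[i]) (A0 : R * R -> R) (a : R * R -> R) (d c0 : R).
Hypotheses (d0 : 0 < d) (c00 : 0 < c0) (hA : admissible_coefficients d A A1 A0 c0).

(** The order of the quantifiers is the point: [C] is fixed before everything that varies with eps.
    The bounds [L] and [Ma] do not enter [C]; they make traces and boundary energies finite, and [L]
    will grow like eta / eps. *)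
Lemma robin_estimate (tau j cE : R) : 0 < tau -> 0 < j -> 0 < cE -> exists2 C, 0 < C & forall (p : R -> R) (B T L Ma E2 kap e q : R) (J Bad : set mR),
  continuous p -> continuous (derive1 p) -> (forall s, 0 <= p s <= B) -> 0 < T - B <= 1 -> T = tau * (T - B) -> T <= d / 3 ->
  (forall s, arclen p s <= L) -> continuous (fun s => a (s, p s)) -> (forall s, 0 <= a (s, p s)) -> (forall s, a (s, p s) <= Ma) ->
  T - B <= E2 -> T - B + kap <= cE * E2 -> 0 < q -> q^-1 <= cE * E2 -> 0 < e <= T - B -> 0 <= kap ->
  measurable J -> measurable Bad ->
  (forall s : R, ((j * e)%:E <= \int[leb]_(t in `]0%R, e[) (\1_J (s + t)%R)%:E)%E) ->
  (forall F F1 F2 : R * R -> R, continuous F -> continuous F1 -> continuous F2 ->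
  (forall x, is_derive x (basis ord0) F (F1 x)) -> (forall x, is_derive x (basis ord_max) F (F2 x)) ->
  forall t, B < t < T -> (\int[leb]_(s in Bad) (F (s, t) ^+ 2)%:E <=
    kap%:E * \int[area]_(x in upper d p) (F1 x ^+ 2 + F2 x ^+ 2 + F x ^+ 2)%:E)%E) ->
  (forall s, (J `\` Bad) s -> q <= a (s, p s) * arclen p s) ->
  forall f u u0, cL2a (strip d) f -> is_resolvent (HRobin d A A1 A0 a p) 'i%C f u -> dsolve A A1 A0 d f u0 ->
  (normW21 (upper d p) (fun x => u x - u0 x)%R <= (Num.sqrt (C * E2))%:E * normL2 (strip d) f)%E.
Proof.
move=> tau0 j0 cE0; have [M [M0 lA lA1 bA0]] := coefs_bound hA.
have [Cs Cs0 hCs] := @step'_bounded R; have [Cv Cv0 hCv] := savare d0 c00 hA.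
have M1 : 0 < M + 1 by rewrite ltr_wpDl.
pose t := c0 / (4 * (M + 1)); have t0 : 0 < t by rewrite divr_gt0// mulr_gt0.
have Mt : 2 * M * t <= c0 / 2 := half_bound c00 M0.
pose K := 4 * M / t + M + 1; have K0 : 0 <= K.
  have h : 0 <= 4 * M / t by apply: divr_ge0; [exact: mulr_ge0|exact: ltW].
  by rewrite /K; apply: addr_ge0 => //; exact: addr_ge0.
have K1 : 0 < 1 + K by rewrite ltr_pwDl.
(* The coercive part keeps c0 / 2 of the ellipticity; this choice spends at most c0 / 4 of it on the
   commutators. *)
pose SS := 4 * (1 + K) * (M + 1) / c0; have SS0 : 0 < SS by apply: divr_gt0 => //; apply: mulr_gt0 => //; exact: mulr_gt0.
have SSM : (1 + K) * (M / SS) <= c0 / 4.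
  have -> : (1 + K) * (M / SS) = c0 / 4 * (M / (M + 1)) by rewrite /SS; field; rewrite !lt0r_neq0.
  by apply: ler_piMr; [apply: divr_ge0 => //; exact: ltW|rewrite ler_pdivrMr// mul1r lerDl].
have c4 : 0 < c0 / 4 by exact: divr_gt0.
have [C C0 HC] := absorb M0 K0 SS0 Cs0 Cv0 tau0 j0 cE0 c4.
exists C => // p B T L Ma E2 kap e q J Bad cp cp' pB etaI TE T3 pL ca a0 aM eE kE q0 qE ee kap0 mJ mBad HJ Hbad HqE f u u0 hf hu S.
have /andP[eta0 eta1] := etaI; have BT : B < T by rewrite -subr_gt0.
have Td : T <= d by rewrite (le_trans T3)// ler_pdivrMr ?ltr0n// ler_peMr ?ler1n// ltW.
have B0 : 0 <= B by have /andP[h1 h2] := pB 0; exact: le_trans h2.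
have T0 : 0 < T := le_lt_trans B0 BT.
have E20 : 0 < E2 := lt_le_trans eta0 eE.
have TI : 0 < T <= d / 3 by rewrite T0.
have [lg lu] := @robin_layers R A A1 A0 d d0 p B T cp pB Td f u0 hf S Cv T0 (hCv f u0 T hf S TI).
have /andP[e0 _] := ee.
have lv := @robin_layer R A A1 A0 a d p B T cp cp' pB BT Td L pL Ma ca a0 aM Cs Cs0 hCs f u u0 hu S e j kap q J Bad e0 j0 kap0 mJ mBad HJ Hbad q0 HqE.
have n0 (h : R * R -> R[i]) : 0 <= rsqn area (upper d p : set mR2) h := rsqn_ge0 area (upper d p : set mR2) h.
have nF0 : 0 <= rsqn area (strip d : set mR2) f := rsqn_ge0 area (strip d : set mR2) f.
have mD : measurable (upper d p : set mR2) by exact: upper_measurable.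
have sD : upper d p `<=` strip d.
  by move=> x /andP[x1 x2]; apply/andP; split => //; apply: le_lt_trans x1; have /andP[] := pB x.1.
have fF : rsqn area (upper d p : set mR2) f <= rsqn area (strip d : set mR2) f.
  rewrite -lee_fin -!rsqnE//; last exact: (cL2_sub (strip_meas d) mD sD hf).
  by apply: sqa_sub => //; [exact: strip_meas|case: hf].
have rob0 := @robin_energy_ge0 R a d p a0 u.
have RI sgm s sg0 s0 := @robin_inequality R A A1 A0 a d c0 hA p B T cp cp' pB BT Td L pL ca Cs Cs0 hCs f u u0 hf hu S M t K SS sgm s M0 lA lA1 bA0 t0 Mt (lexx _) K0 SS0 SSM sg0 s0.
have X0 : 0 <= C * E2 by apply: mulr_ge0; exact: ltW.
apply: (@robin_norm R A A1 A0 a d d0 p B T cp cp' pB BT Td L pL Cs Cs0 hCs f u u0 hf hu S (C * E2) X0).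
apply: (HC (T - B) E2 _ _ _ _ _ (robin_energy a d p u) _ _ _ kap e q T etaI eE kE qE ee kap0 TE erefl nF0 (n0 _) (n0 _) (n0 _) rob0 (n0 _) (addr_ge0 (n0 _) (n0 _)) (n0 _) _ lg lu lv).
move=> sgm s sg0 s0; apply: (le_trans (RI sgm s sg0 s0)); apply: ler_wpM2l; first exact: ltW.
by rewrite lerD2r lerD2l; apply: ler_wpM2l => //; exact: ltW.
Qed.

End estimate.

(** * Choice of the thresholds and conclusion *)

Section main.
Context {R : realType}.
Local Notation mR := (measurableTypeR R).
Local Notation leb := (@lebesgue_measure R).

Lemma right_nbhs (P : R -> Prop) : (\forall e \near 0^'+, P e) -> exists2 e0 : R, 0 < e0 & forall e, 0 < e < e0 -> P e.
Proof.
rewrite near_withinE => /nbhs_ballP[e0 e00 he]; exists e0 => // e /andP[h1 h2]; apply: he => //.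
by rewrite /ball /= sub0r normrN gtr0_norm.
Qed.

Lemma right_small (g : R -> R) (r : R) : g e @[e --> 0^'+] --> 0 -> 0 < r -> exists2 e0 : R, 0 < e0 & forall e, 0 < e < e0 -> `|g e| < r.
Proof. by move=> /cvgr0Pnorm_lt h r0; exact: (right_nbhs (h r r0)). Qed.

(** Since cov + m <= 1, the logarithm of (cov + m) / m is at most |ln m|. The case m = 0 is separate
    because the rays need a positive width; the intervals are then empty. *)
Lemma bad_kap (I : set int) (X : int -> R) (sp cov m d : R) (p : R -> R) (B T : R) :
  (forall n k, I n -> I k -> n != k -> sp <= `|X n - X k|) -> 0 < cov -> 0 <= m -> cov + 2 * m <= sp -> cov + m <= 1 -> T + cov <= d ->
  continuous p -> (forall s, p s <= B) ->
  let Bad : set mR := \bigcup_(n in I) `]X n - m, X n + m[%classic in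
  let kap := 9 * (1 + cov^-1 ^+ 2) * (m * `|ln m|) in
  [/\ measurable Bad, 0 <= kap & forall F F1 F2 : R * R -> R, continuous F -> continuous F1 -> continuous F2 ->
  (forall x, is_derive x (basis ord0) F (F1 x)) -> (forall x, is_derive x (basis ord_max) F (F2 x)) ->
  forall t, B < t < T -> (\int[leb]_(s in Bad) (F (s, t) ^+ 2)%:E <=
    kap%:E * \int[area]_(x in upper d p) (F1 x ^+ 2 + F2 x ^+ 2 + F x ^+ 2)%:E)%E].
Proof.
move=> sep cov0 m0 cm cm1 Tc cp pB Bad kap.
have mBad : measurable Bad by apply: open_measurable; apply: bigcup_open => n _; exact: interval_open.
have k0 : 0 <= 9 * (1 + cov^-1 ^+ 2) by rewrite mulr_ge0// addr_ge0// sqr_ge0.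
have kap0 : 0 <= kap by apply: mulr_ge0 => //; apply: mulr_ge0.
split => // F F1 F2 cF cF1 cF2 dF1 dF2 t Bt.
have N0 : (0 <= \int[area]_(x in upper d p) (F1 x ^+ 2 + F2 x ^+ 2 + F x ^+ 2)%:E)%E.
  by apply: integral_ge0 => x _; rewrite lee_fin !addr_ge0// sqr_ge0.
have [mz|mp] := eqVneq m 0.
  have -> : Bad = set0.
    by apply/seteqP; split => // s [n _]; rewrite mz subr0 addr0 /= in_itv /= => /andP[h1 h2]; have := lt_trans h1 h2; rewrite ltxx.
  by rewrite integral_set0; apply: mule_ge0 => //; rewrite lee_fin.
have mp0 : 0 < m by rewrite lt_def mp.
have [_ thin] := bad_thin sep mp0 cm.
apply: (le_trans (bad_set_upper cF cF1 cF2 dF1 dF2 cp pB cov0 mp0 mBad thin Tc Bt)).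
apply: lee_wpmul2r => //; rewrite lee_fin; apply: ler_wpM2l => //; apply: ler_wpM2l => //.
have cmp : 0 < cov + m by exact: addr_gt0.
rewrite ln_div ?posrE// (ler0_norm (ln_le0 (le_trans _ cm1))); last by rewrite lerDr ltW.
by rewrite lerBlDr addNr; exact: ln_le0.
Qed.

Lemma sqrt_sum3 (x y z : R) : 0 <= x -> 0 <= y -> 0 <= z -> Num.sqrt (x ^+ 2 + y ^+ 2 + z ^+ 2) <= x + y + z.
Proof.
move=> x0 y0 z0; have s0 : 0 <= x + y + z by rewrite !addr_ge0.
rewrite -[leRHS](ger0_norm s0) -sqrtr_sqr; apply: ler_wsqrtr.
have := mulr_ge0 x0 y0; have := mulr_ge0 x0 z0; have := mulr_ge0 y0 z0; rewrite !expr2; clear; move=> *; lra.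
Qed.

(** The covering speaks of points with x_2 > 0, while the graph may touch x_2 = 0. The point is
    raised slightly, and the Lipschitz condition keeps the value of [a] below dl. *)
Lemma covering_ge (a : R * R -> R) (d0 : R) (I : set int) (X : int -> R) (m dl T p s : R) : admissible_robin a d0 ->
  [set x : R * R | a x <= dl /\ 0 < x.2 < T] `<=` \bigcup_(n in I) [set x : R * R | `|x.1 - X n| < m /\ 0 < x.2 < T] ->
  0 <= p -> p < T -> T <= d0 -> ~ (\bigcup_(n in I) `]X n - m, X n + m[%classic) s -> dl <= a (s, p).
Proof.
move=> [_ /pinfty_ex_gt0[L L0 hL]] cov p0 pT Td nb; rewrite leNgt; apply/negP => h; apply: nb.
(* The first bound keeps [a] at most dl at the raised point, the second keeps that point below T. *)
pose y := Num.min ((dl - a (s, p)) / L) ((T - p) / 2).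
have y0 : 0 < y by rewrite lt_min !divr_gt0// subr_gt0.
have y1 : y <= (dl - a (s, p)) / L by rewrite ge_min lexx.
have y2 : y <= (T - p) / 2 by rewrite ge_min lexx orbT.
have yT : p + y < T by move: y2 pT; clear; lra.
have pyd : 0 <= p + y <= d0 by rewrite addr_ge0 ?(ltW y0)//= (le_trans (ltW yT)).
have pd : 0 <= p <= d0 by rewrite p0 /= (le_trans (ltW pT)).
have := hL ((s, p + y), (s, p)) (conj pyd pd); rewrite /= prod_normE /= subrr normr0 addrAC subrr add0r (gtr0_norm y0) => h1.
have my : Num.max 0 y = y by apply/max_idPr; exact: ltW.
rewrite my in h1; have h2 : L * y <= dl - a (s, p) by rewrite mulrC -ler_pdivlMr.
have ay : a (s, p + y) <= dl by move: (le_trans (ler_norm _) (le_trans h1 h2)); clear; lra.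
have [] := cov (s, p + y); first by split => //=; rewrite yT andbT ltr_wpDl.
move=> n In [/= h3 _]; exists n => //=; rewrite in_itv /=; move: h3; rewrite ltr_norml => /andP[h4 h5].
by apply/andP; split; move: h4 h5; clear; lra.
Qed.

End main.

Theorem theorem1p5 (R : realType) (d c0 delta0 : R)
  (A : 'I_2 -> 'I_2 -> R * R -> R[i]) (A1 : 'I_2 -> R * R -> R[i])
  (A0 : R * R -> R) (a : R * R -> R) (b eta mu delta : R -> R)
  (I : set int) (X : int -> R)
  (d_gt0 : 0 < d) (c0_gt0 : 0 < c0) (delta0_gt0 : 0 < delta0)
  (hA : admissible_coefficients d A A1 A0 c0)
  (ha : admissible_robin a delta0)
  (a_ge0 : forall x : R * R, 0 <= x.2 <= delta0 -> 0 <= a x)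
  (b_C2 : C2_fun b)
  (b_ge0 : forall t, 0 <= b t)
  (b_per : forall t, b (t + 1) = b t)
  (b_nonconst : ~ exists k, forall t, b t = k)
  (eta_ge0 : forall eps : R, 0 < eps -> 0 <= eta eps)
  (eta_cvg : eta eps @[eps --> 0^'+] --> 0)
  (eta_fast : eps^-1 * eta eps @[eps --> 0^'+] --> +oo)
  (mu_ge0 : forall t : R, 0 < t -> 0 <= mu t)
  (mu_cvg : mu t @[t --> 0^'+] --> 0)
  (X_sep : well_separated I X)
  (hcov : covering a eta b mu I X)
  (delta_gt0 : forall eps : R, 0 < eps -> 0 < delta eps)
  (delta_cvg : delta eps @[eps --> 0^'+] --> 0) :
  exists eps0 C : R, [/\ 0 < eps0, 0 < C &
    forall eps : R, 0 < eps < eps0 ->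
    forall f, L2 (Omega0 d) f ->
    forall u u0,
      is_resolvent (HRobin d A A1 A0 a (lower_bdry eta b eps)) 'i%C f u ->
      is_resolvent (HDirichlet0 d A A1 A0) 'i%C f u0 ->
      (normW21 (Omega d eta b eps) (fun x => u x - u0 x)%R
       <= (C * (Num.sqrt (eta eps)
                + Num.sqrt eps / (Num.sqrt (eta eps) * Num.sqrt (delta eps))
                + Num.sqrt (mu (delta eps))
                  * Num.sqrt `|ln (mu (delta eps))|))%:E
          * normL2 (Omega0 d) f)%E].

Proof.
have [/= Xs [sp sp0 sep]] := X_sep.
have [c1 [j [c10 j0 HJ]]] := oscillation_set b_C2 b_per b_nonconst.
have [cb cb'] := C2_cont b_C2; have isd := C2_derive b_C2.
have bmax t : b t <= max01 b := max01_ge cb b_per t.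
have bst0 : 0 <= max01 b := le_trans (b_ge0 0) (bmax 0).
(* The layer has height tau * eta, as in the covering, and rises above the crests by exactly eta. *)
pose tau := max01 b + 1; have tau0 : 0 < tau by rewrite /tau ltr_wpDl.
(* Length of the slanted rays: d / 3 leaves room above the layer, sp / 4 keeps a ray from reaching a
   second bad interval, and 1 / 2 gives cov + m <= 1. *)
pose cov := Num.min (1 / 2) (Num.min (sp / 4) (d / 3)).
have cov0 : 0 < cov by rewrite !lt_min !divr_gt0.
have [cov1 cov2 cov3] : [/\ cov <= 1 / 2, cov <= sp / 4 & cov <= d / 3] by split; rewrite /cov !ge_min lexx ?orbT.
pose Ck := 9 * (1 + cov^-1 ^+ 2); have Ck0 : 0 <= Ck by rewrite mulr_ge0// addr_ge0// sqr_ge0.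
(* One constant for the contributions of eta, of the bad intervals, and of the boundary energy. *)
pose cE := 1 + Ck + c1^-1; have ic1 : 0 < c1^-1 by rewrite invr_gt0.
have cE0 : 0 < cE by rewrite /cE ltr_wpDl// addr_ge0.
have [C C0 HC] := robin_estimate a d_gt0 c0_gt0 hA tau0 j0 cE0.
have [Ma Ma0 hMa] := robin_bounded delta0_gt0 ha.
have [Mb _ hMb] : exists2 t0, True & forall t, `|derive1 b t| <= `|derive1 b t0|.
  have cn : continuous (fun t => `|derive1 b t|) by move=> t; exact: (cvg_norm (cb' t)).
  have pn t : `|derive1 b (t + 1)| = `|derive1 b t| by rewrite (derive1_periodic b_per).
  by have [t0 _ ht] := periodic_max cn pn; exists t0.
have [dl1 [ep1 [dl10 ep10 Hcov]]] := hcov.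
(* Below this value of eta the layer fits under d / 3, as the translation argument asks, and under
   delta0, where [a] is controlled. *)
pose rT := Num.min 1 (Num.min (d / 3 / tau) (delta0 / tau)); have rT0 : 0 < rT by rewrite !lt_min ltr01 !divr_gt0.
have [rT1 rT2 rT3] : [/\ rT <= 1, rT <= d / 3 / tau & rT <= delta0 / tau] by split; rewrite /rT !ge_min lexx ?orbT.
have [e1 e10 He1] := right_small eta_cvg rT0.
have /cvgryPgt/(_ 1)/right_nbhs[e2 e20 He2] := eta_fast.
pose rm := Num.min (1 / 2) (sp / 4); have rm0 : 0 < rm by rewrite lt_min !divr_gt0.
have [rm1 rm2] : rm <= 1 / 2 /\ rm <= sp / 4 by split; rewrite /rm ge_min lexx ?orbT.
have [t1 t10 Ht1] := right_small mu_cvg rm0.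
(* Small delta serves twice: it makes mu(delta) small compared with the separation, and it brings
   the covering into force. *)
pose rd := Num.min t1 dl1; have rd0 : 0 < rd by rewrite lt_min t10.
have [e3 e30 He3] := right_small delta_cvg rd0.
exists (Num.min (Num.min e1 e2) (Num.min e3 ep1)), (Num.sqrt C); split; [by rewrite !lt_min e10 e20 e30|by rewrite sqrtr_gt0|].
move=> eps /andP[eps0]; rewrite !lt_min => /andP[/andP[l1 l2] /andP[l3 l4]] f hf u u0 hu hu0.
have := He1 eps; rewrite eps0 l1 => /(_ isT); have := He2 eps; rewrite eps0 l2 => /(_ isT).
have := He3 eps; rewrite eps0 l3 => /(_ isT) hdl hfast hsm.
have dl0 := delta_gt0 _ eps0; set dl := delta eps in dl0 hdl *; rewrite (gtr0_norm dl0) lt_min in hdl.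
have /andP[hdl1 hdl2] := hdl; have := Ht1 dl; rewrite dl0 hdl1 => /(_ isT).
set m := mu dl; have m0 : 0 <= m := mu_ge0 _ dl0; rewrite (ger0_norm m0) => hm.
set h := eta eps in hfast hsm *.
(* A period is shorter than the layer is thick, so averaging over a period costs no more than the
   vertical comparison. *)
have eh : eps < h by move: hfast; rewrite mulrC ltr_pdivlMr// mul1r.
have h0 : 0 < h := lt_trans eps0 eh; rewrite (gtr0_norm h0) in hsm.
pose p := lower_bdry eta b eps; pose B := h * max01 b; pose T := tau * h.
have HT : T - B = h by rewrite /T /B /tau; ring.
have pB s : 0 <= p s <= B.
  by rewrite /p /lower_bdry -/h mulr_ge0 ?(ltW h0)//= /B; apply: ler_wpM2l; [exact: ltW|exact: bmax].
have T3 : T <= d / 3 by rewrite /T mulrC -ler_pdivlMr// (le_trans (ltW hsm)).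
have Td0 : T <= delta0 by rewrite /T mulrC -ler_pdivlMr// (le_trans (ltW hsm)).
have BT : B < T by rewrite -subr_gt0 HT.
have dp s : derive1 p s = h / eps * derive1 b (s / eps).
  by rewrite derive1E; apply: derive_val; exact: (lower_derive h eps isd s).
have cdiv (g : R -> R) : continuous g -> continuous (fun s : R => g (s / eps)).
  by move=> cg y; apply: (@continuous_comp _ _ _ (fun s : R => s / eps) g); [exact: continuous_div|exact: cg].
have cp : continuous p by apply: (contM (f := fun=> h) (g := fun s : R => b (s / eps))); [exact: cont_cst|exact: cdiv].
have cp' : continuous (derive1 p).
  rewrite (_ : derive1 p = (fun s : R => h / eps * derive1 b (s / eps))); last by apply/funext.
  by apply: (contM (f := fun=> h / eps) (g := fun s : R => derive1 b (s / eps))); [exact: cont_cst|exact: cdiv].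
have he0 : 0 < h / eps by exact: divr_gt0.
(* This bound is not uniform in eps; it only has to be finite for each boundary. *)
have pL s : arclen p s <= Num.sqrt (1 + (h / eps * `|derive1 b Mb|) ^+ 2).
  rewrite /arclen; apply: ler_wsqrtr; rewrite lerD2l dp -(real_normK (num_real (_ * _))) normrM (gtr0_norm he0).
  have ib := ler_wpM2l (ltW he0) (hMb (s / eps)).
  by rewrite lerXn2r// nnegrE; apply: mulr_ge0 => //; exact: ltW.
have pd s : 0 <= p s <= delta0.
  by have /andP[h1 h2] := pB s; rewrite h1 /= (le_trans h2)// (le_trans (ltW BT)).
have ca := robin_graph ha cp pd.
have a0 s : 0 <= a (s, p s) by apply: a_ge0; exact: pd.
have aM s : a (s, p s) <= Ma by apply: (le_trans (ler_norm _)); apply: hMa; exact: pd.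
pose Xs1 := Num.sqrt h; pose Y := Num.sqrt eps / (Num.sqrt h * Num.sqrt dl); pose Z := Num.sqrt m * Num.sqrt `|ln m|.
have X2 : Xs1 ^+ 2 = h by rewrite sqr_sqrtr// ltW.
have Y2 : Y ^+ 2 = eps / (h * dl) by rewrite /Y expr_div_n exprMn !sqr_sqrtr// ltW.
have Z2 : Z ^+ 2 = m * `|ln m| by rewrite /Z exprMn !sqr_sqrtr.
(* The sum of the squares of the three terms of the rate; [sqrt_sum3] returns to the rate itself at
   the end. *)
pose E2 := Xs1 ^+ 2 + Y ^+ 2 + Z ^+ 2.
have Y20 := sqr_ge0 Y; have Z20 := sqr_ge0 Z.
have hE : h <= E2 by rewrite /E2 X2 -addrA lerDl addr_ge0.
have YE : Y ^+ 2 <= E2 by rewrite /E2 addrAC lerDr addr_ge0// X2 ltW.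
have ZE : Z ^+ 2 <= E2 by rewrite /E2 lerDr addr_ge0// X2 ltW.
have E20 : 0 <= E2 := le_trans Y20 YE.
pose kap := Ck * (m * `|ln m|).
have m2 : m <= 1 / 2 := le_trans (ltW hm) rm1. have m3 : m <= sp / 4 := le_trans (ltW hm) rm2.
have cm : cov + 2 * m <= sp by move: cov2 m3 sp0; clear; lra.
have cm1 : cov + m <= 1 by move: cov1 m2; clear; lra.
have Tc : T + cov <= d by move: cov3 T3 d_gt0; clear; lra.
have [mBad kap0 Hbad] := bad_kap sep cov0 m0 cm cm1 Tc cp (fun s => proj2 (andP (pB s))).
have [mJ HJs] := HJ eps eps0.
(* On the good part of the boundary a is at least delta and the arc length at least c1 eta / eps, so
   1 / q is the square of the second term of the rate, up to 1 / c1. *)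
pose q := dl * (c1 * (h / eps)); have q0 : 0 < q := mulr_gt0 dl0 (mulr_gt0 c10 he0).
have qE : q^-1 <= cE * E2.
  have -> : q^-1 = c1^-1 * Y ^+ 2 by rewrite Y2 /q; field; rewrite !lt0r_neq0.
  apply: (le_trans (ler_wpM2l (ltW ic1) YE)); apply: ler_wpM2r => //.
  by rewrite /cE lerDr addr_ge0.
have kE : T - B + kap <= cE * E2.
  have k1 : kap <= Ck * E2 by rewrite /kap -Z2; exact: ler_wpM2l.
  rewrite HT; apply: (le_trans (lerD hE k1)).
  have -> : E2 + Ck * E2 = (1 + Ck) * E2 by ring.
  by apply: ler_wpM2r => //; rewrite /cE lerDl; exact: ltW.
have HqE s : ([set s | c1 < `|derive1 b (s / eps)|] `\` \bigcup_(n in I) `]X n - m, X n + m[%classic) s -> q <= a (s, p s) * arclen p s.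
  move=> [js nb]; have /andP[p1 p2] := pB s.
  have hc : [set x : R * R | a x <= dl /\ 0 < x.2 < T] `<=` \bigcup_(n in I) [set x : R * R | `|x.1 - X n| < m /\ 0 < x.2 < T].
    by apply: Hcov; rewrite ?dl0 ?eps0.
  have da : dl <= a (s, p s) := covering_ge ha hc p1 (le_lt_trans p2 BT) Td0 nb.
  have ar : c1 * (h / eps) <= arclen p s.
    apply: (@le_trans _ _ `|derive1 p s|).
      by rewrite dp normrM (gtr0_norm he0) mulrC; apply: ler_wpM2l; [exact: ltW|exact: ltW js].
    by rewrite -sqrtr_sqr /arclen; apply: ler_wsqrtr; rewrite lerDr.
  by apply: ler_pM => //; [exact: ltW|rewrite ltW// mulr_gt0].
have etaI : 0 < T - B <= 1 by rewrite HT h0 (le_trans (ltW hsm)).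
have TE : T = tau * (T - B) by rewrite HT.
have eT : T - B <= E2 by rewrite HT.
have ee : 0 < eps <= T - B by rewrite HT eps0 ltW.
have := HC p B T _ Ma E2 kap eps q _ _ cp cp' pB etaI TE T3 pL ca a0 aM eT kE q0 qE ee kap0 mJ mBad HJs Hbad HqE f u u0 ((L2P _ _).1 hf) hu hu0.
move=> main; apply: (le_trans main); apply: lee_wpmul2r; first exact: poweR_ge0.
rewrite lee_fin sqrtrM ?(ltW C0)//; apply: ler_wpM2l; first exact: sqrtr_ge0.
apply: sqrt_sum3; first exact: sqrtr_ge0.
  by apply: divr_ge0; [exact: sqrtr_ge0|apply: mulr_ge0; exact: sqrtr_ge0].
by apply: mulr_ge0; exact: sqrtr_ge0.
Qed.
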